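(* For any positive integers $t,m$ with $m(t-1)\leq 24$, the sequence $\{c_t^{(m)}(n)\}_{n\geq 0}$ is a UPS sequence. Its least period of sign is $9$, $8$, $25$ for $(t,m)=(3,9)$, $(4,4)$, $(5,5)$, respectively, and is $t$ otherwise.
   Context: For positive integers $t,m$, the integers $c_t^{(m)}(n)$ are defined by $\sum_{n\ge 0}c_t^{(m)}(n)q^n=\frac{(q;q)_\infty^m}{(q^t;q^t)_\infty^m}$, where $(a;q)_\infty=\prod_{n=0}^\infty(1-aq^n)$, $|q|<1$. For real $x$, $\mathrm{sgn}(x)$ is $1$, $0$, $-1$ according as $x>0$, $x=0$, $x<0$. A sequence $\{a(n)\}_{n\ge0}$ of real numbers is a UPS sequence (ultimately periodic in sign) if there is a positive integer $T$ such that $\mathrm{sgn}(a(n))=\mathrm{sgn}(a(n+T))$ for all sufficiently large $n$; such a $T$ is called a period of sign, and the smallest such $T$ is called the least period of sign. *)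

(* Defs.v *)
From HB Require Import structures.
From mathcomp Require Import all_boot all_order all_algebra.
From mathcomp Require Import all_classical all_reals all_analysis.

Set Implicit Arguments.
Unset Strict Implicit.
Unset Printing Implicit Defensive.

Import Order.TTheory GRing.Theory Num.Theory.
Import numFieldNormedType.Exports.

Local Open Scope classical_set_scope.
Local Open Scope ring_scope.

(* The library puts the topology on an abstract numFieldType K; the intended K
   is R[i] with R : realType, where the limit exists whenever `|q| < 1. *)
Definition qpoch (K : numFieldType) (a q : K) : K :=
  lim (\prod_(0 <= k < N) (1 - a * q ^+ k) @[N --> \oo]).

(* c n is the coefficient of q^n in (q; q)_oo^m / (q^t; q^t)_oo^m.  The identity
   on the open unit disc determines c, by uniqueness of power series; for
   0 < t the denominator does not vanish there. *)
Definition is_coef (K : numFieldType) (t m : nat) (c : nat -> int) : Prop :=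
  forall q : K, `|q| < 1 ->
    series (fun n => (c n)%:~R * q ^+ n) N @[N --> \oo] -->
      qpoch q q ^+ m / qpoch (q ^+ t) (q ^+ t) ^+ m.

(* Stated over any realDomainType, so that it applies both to real sequences
   and directly to integer ones. *)
Definition sign_period (D : realDomainType) (a : nat -> D) (T : nat) : Prop :=
  (0 < T)%N /\ \forall n \near \oo, Num.sg (a n) = Num.sg (a (n + T)%N).

Definition UPS (D : realDomainType) (a : nat -> D) : Prop :=
  exists T : nat, sign_period a T.

Definition least_sign_period (D : realDomainType) (a : nat -> D) (T : nat)
    : Prop :=
  sign_period a T /\ forall T' : nat, sign_period a T' -> (T <= T')%N.

(* Main.v *)
Require Import Defs.
From HB Require Import structures.
From mathcomp Require Import all_boot all_order all_algebra.
From mathcomp Require Import complex.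
From mathcomp Require Import boolp classical_sets functions reals topology normedtype sequences exp trigo realfun derive.
From mathcomp Require Import ring lra zify.
Set Implicit Arguments. Unset Strict Implicit. Unset Printing Implicit Defensive.
Import Order.TTheory GRing.Theory Num.Theory.
Import numFieldNormedType.Exports.
Local Open Scope classical_set_scope.
Local Open Scope ring_scope.
Local Notation Re := complex.Re.
Local Notation Im := complex.Im.

(** Write E(q) for the product of the 1 - q^(n+1), so that the numbers c n are
    the coefficients of f(q) = E(q)^m / E(q^t)^m.

    The pentagonal number theorem turns E into a theta series, and Poisson
    summation of Gaussians (proved here through finite Fourier inversion on a
    grid) gives its behaviour near every root of unity.  For q = e(h/t) exp(-Z)
    with h prime to t, the quotient f(q) equals
    lead * Gam(h)^m * exp(- shift Z + rate / Z) up to an exponentially smaller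
    error; on the rest of the circle |q| = exp(- Re Z), including the points
    near h/t with h not prime to t, f is exponentially smaller
    ([major_coprime], [major_noncoprime], [minor_arc], collected in [arcs]).
    Averaging f(q) / q^n over equally spaced points of the circle yields c n.
    All cusps h/t contribute the same saddle integral, which is real and
    positive up to a smaller error, times Gam(h)^m e(- n h / t).  Hence the
    sign of c n for n = r modulo t is eventually that of the finite sum
    [cusp_sum], as soon as this sum has a nonzero real part ([sign_main]).  No
    bound on the size of the exponents is involved in this step: m (t - 1) <= 24
    only makes the list of pairs (t, m) finite.

    For those pairs the cusp sum is an integer polynomial in a root of unity of
    order 12 t.  Reducing it modulo a suitable prime shows that it does not
    vanish, because integer relations between primitive roots of unity of the
    same order transfer to finite fields ([cusp_sum_neq0]).  The finitely many
    classes where it does vanish are listed in [zeros].  In most of them c n is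
    eventually zero on the class: E(q) or E(q)^3 has no exponent there, or only
    those of E(q^25) or E(q^9)^3, by the pentagonal and the Jacobi identities; and
    for (4, 8) the odd part of f is a multiple of q ([eta_4_8_odd]).  The other
    cases are decided by identities: for (3, 9) and (5, 5) the terms of index
    divisible by t are, in order, the coefficients for (3, 3) and (5, 1)
    ([section_3_9], [section_5_5]); for (4, 4) and (8, 2) the even classes are,
    up to sign changes, products with explicit nonnegative coefficients
    ([signs_4_4], [signs_8_2]).  So the signs have period t, except for (4, 4),
    where they have period 8, and for (3, 9) and (5, 5), where the period t of
    the section gives t^2.

    Minimality: the least period divides any period, so only proper divisors g
    of t have to be excluded.  Were g a period, the classes congruent modulo g
    would all carry the same sign, whereas their cusp sums add up to 0
    ([cusp_sum_classes]) without all vanishing. *)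

(** * Limits and absolutely convergent sums in the complex plane *)

Module ComplexLimits.

Section Modulus.
Variable R : realType.
Local Notation C := (R[i]%C).
Implicit Types (x y z w : C) (a b : R).

Definition nrm (z : C) : R := Normc.normc z.

Lemma nrm0 : nrm 0 = 0. Proof. exact: Normc.normc0. Qed.
Lemma nrm1 : nrm 1 = 1. Proof. exact: Normc.normc1. Qed.
Lemma nrmM x y : nrm (x * y) = nrm x * nrm y. Proof. exact: Normc.normcM. Qed.
Lemma nrmD x y : nrm (x + y) <= nrm x + nrm y. Proof. exact: le_normcD. Qed.
Lemma nrmN x : nrm (- x) = nrm x. Proof. exact: normcN. Qed.
Lemma nrmB x y : nrm (x - y) <= nrm x + nrm y.
Proof. by rewrite -(nrmN y); exact: nrmD. Qed.
Lemma nrmBC x y : nrm (x - y) = nrm (y - x).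
Proof. by rewrite -nrmN opprB. Qed.
Lemma nrmV x : nrm x^-1 = (nrm x)^-1. Proof. exact: Normc.normcV. Qed.
Lemma nrm_div x y : nrm (x / y) = nrm x / nrm y. Proof. by rewrite nrmM nrmV. Qed.
Lemma nrm_ge0 x : 0 <= nrm x. Proof. by case: x => a b; exact: sqrtr_ge0. Qed.
Lemma nrm_eq0 x : (nrm x == 0) = (x == 0).
Proof.
by apply/eqP/eqP => [/Normc.eq0_normc//|->]; exact: nrm0.
Qed.
Lemma nrm_gt0 x : (0 < nrm x) = (x != 0).
Proof. by rewrite lt_neqAle nrm_ge0 andbT eq_sym nrm_eq0. Qed.
Lemma nrmX x n : nrm (x ^+ n) = nrm x ^+ n.
Proof. by elim: n => [|n IH]; rewrite ?expr0 ?nrm1// !exprS nrmM IH. Qed.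
Lemma nrm_real a : nrm (a%:C)%C = `|a|.
Proof. by rewrite /nrm /= expr0n /= addr0 sqrtr_sqr. Qed.
Lemma nrm_nat n : nrm n%:R = n%:R.
Proof.
by rewrite -(rmorph_nat (real_complex R)) nrm_real ger0_norm.
Qed.
Lemma nrm_sum (I : Type) (r : seq I) (P : pred I) (F : I -> C) :
  nrm (\sum_(i <- r | P i) F i) <= \sum_(i <- r | P i) nrm (F i).
Proof.
elim/big_ind2: _ => [|x a y b h1 h2|//]; first by rewrite nrm0.
by rewrite (le_trans (nrmD _ _))// lerD.
Qed.
Lemma nrm_prod (I : Type) (r : seq I) (P : pred I) (F : I -> C) :
  nrm (\prod_(i <- r | P i) F i) = \prod_(i <- r | P i) nrm (F i).
Proof. by elim/big_ind2: _ => [|x a y b <- <-|//]; rewrite ?nrm1 ?nrmM. Qed.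
Lemma nrm_sqr x : nrm x ^+ 2 = Re x ^+ 2 + Im x ^+ 2.
Proof. by case: x => a b; rewrite /nrm /= sqr_sqrtr// addr_ge0// sqr_ge0. Qed.
Lemma Re_le_nrm x : `|Re x| <= nrm x.
Proof.
rewrite -(ler_pXn2r (n := 2)) ?nnegrE ?nrm_ge0// nrm_sqr real_normK ?num_real//.
by rewrite lerDl sqr_ge0.
Qed.
Lemma Im_le_nrm x : `|Im x| <= nrm x.
Proof.
rewrite -(ler_pXn2r (n := 2)) ?nnegrE ?nrm_ge0// nrm_sqr real_normK ?num_real//.
by rewrite lerDr sqr_ge0.
Qed.
Lemma nrm_le_ReIm x : nrm x <= `|Re x| + `|Im x|.
Proof.
rewrite -(ler_pXn2r (n := 2)) ?nnegrE ?nrm_ge0 ?addr_ge0// nrm_sqr.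
rewrite sqrrD !real_normK ?num_real// lerD2r lerDl mulrn_wge0//.
by rewrite mulr_ge0.
Qed.
Lemma ler_nrm_dist x y : nrm x - nrm y <= nrm (x - y).
Proof. by rewrite lerBlDr -{1}(subrK y x) nrmD. Qed.

Lemma ReD x y : Re (x + y) = Re x + Re y. Proof. by case: x; case: y. Qed.
Lemma ImD x y : Im (x + y) = Im x + Im y. Proof. by case: x; case: y. Qed.
Lemma ReN x : Re (- x) = - Re x. Proof. by case: x. Qed.
Lemma ImN x : Im (- x) = - Im x. Proof. by case: x. Qed.
Lemma ReM x y : Re (x * y) = Re x * Re y - Im x * Im y. Proof. by case: x; case: y. Qed.
Lemma ImM x y : Im (x * y) = Re x * Im y + Im x * Re y. Proof. by case: x; case: y. Qed.
Lemma Re_realM a x : Re (a%:C%C * x) = a * Re x.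
Proof. by rewrite ReM /= mul0r subr0. Qed.
Lemma Im_realM a x : Im (a%:C%C * x) = a * Im x.
Proof. by rewrite ImM /= mul0r addr0. Qed.
Lemma Re_sum (I : Type) (r : seq I) (P : pred I) (F : I -> C) :
  Re (\sum_(i <- r | P i) F i) = \sum_(i <- r | P i) Re (F i).
Proof. by elim/big_ind2: _ => [//|x a y b <- <-|//]; rewrite ReD. Qed.
Lemma Im_sum (I : Type) (r : seq I) (P : pred I) (F : I -> C) :
  Im (\sum_(i <- r | P i) F i) = \sum_(i <- r | P i) Im (F i).
Proof. by elim/big_ind2: _ => [//|x a y b <- <-|//]; rewrite ImD. Qed.
Lemma eqC x y : Re x = Re y -> Im x = Im y -> x = y.
Proof. by case: x => a b; case: y => c d /= -> ->. Qed.

End Modulus.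

Section Limits.
Variable R : realType.
Local Notation C := (R[i]%C).
Implicit Types (u v : nat -> C) (l : C).

Definition tends u l := forall e : R, 0 < e ->
  exists n0, forall n, (n0 <= n)%N -> nrm (u n - l) <= e.

Lemma invn_le (e : R) : 0 < e -> exists n0, forall n, (n0 <= n)%N -> n.+1%:R^-1 <= e.
Proof.
move=> e0; exists (Num.bound e^-1) => n hn.
rewrite -[leRHS]invrK lef_pV2 ?posrE ?invr_gt0//; apply: ltW.
have ie0 : 0 <= e^-1 by rewrite invr_ge0 ltW.
apply: (lt_le_trans (archi_boundP ie0)).
by rewrite ler_nat (leq_trans hn).
Qed.

Lemma tends_unique u l1 l2 : tends u l1 -> tends u l2 -> l1 = l2.
Proof.
move=> h1 h2; apply/eqP; rewrite -subr_eq0 -nrm_eq0 eq_le nrm_ge0 andbT.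
apply/ler_addgt0Pr => e e0; rewrite add0r.
have e20 : 0 < e / 2 by rewrite divr_gt0.
have [n1 H1] := h1 _ e20; have [n2 H2] := h2 _ e20.
set n := maxn n1 n2.
have -> : l1 - l2 = (u n - l2) - (u n - l1) by ring.
rewrite (le_trans (nrmB _ _))// [leRHS]splitr lerD ?H1 ?H2//.
  exact: leq_maxr.
exact: leq_maxl.
Qed.

Lemma tends_cst l : tends (fun=> l) l.
Proof. by move=> e e0; exists 0%N => n _; rewrite subrr nrm0 ltW. Qed.

Lemma tends_ext u v l : (forall n, u n = v n) -> tends u l -> tends v l.
Proof. by move=> /funext ->. Qed.

Lemma tends_ext_near N u v l : (forall n, (N <= n)%N -> u n = v n) -> tends u l -> tends v l.
Proof.
move=> h hu e e0; have [n0 H] := hu e e0; exists (maxn N n0) => n.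
by rewrite geq_max => /andP[h1 h2]; rewrite -h// H.
Qed.

Lemma tendsD u v l1 l2 : tends u l1 -> tends v l2 ->
  tends (fun n => u n + v n) (l1 + l2).
Proof.
move=> h1 h2 e e0.
have e20 : 0 < e / 2 by rewrite divr_gt0.
have [n1 H1] := h1 _ e20; have [n2 H2] := h2 _ e20.
exists (maxn n1 n2) => n; rewrite geq_max => /andP[k1 k2].
rewrite opprD addrACA (le_trans (nrmD _ _))// [leRHS]splitr lerD ?H1 ?H2//.
Qed.

Lemma tends_mul0 u v l (B : R) : (forall n, nrm (v n) <= B) -> tends u 0 ->
  tends (fun n => u n * v n) 0.
Proof.
move=> hB hu e e0.
have B0 : 0 <= B by rewrite (le_trans (nrm_ge0 _) (hB 0%N)).
have e10 : 0 < e / (B + 1) by rewrite divr_gt0// ltr_wpDl.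
have [n0 H] := hu _ e10; exists n0 => n hn.
rewrite subr0 nrmM -[leRHS](divfK (x := B + 1)) ?gt_eqF ?ltr_wpDl//.
rewrite ler_pM ?nrm_ge0//; first by rewrite -[u n]subr0 H.
by rewrite (le_trans (hB n))// lerDl.
Qed.

Lemma tends_sub0 u l : tends u l <-> tends (fun n => u n - l) 0.
Proof. by split=> h e e0; have [n0 H] := h e e0; exists n0 => n hn; move: (H n hn); rewrite subr0. Qed.

Lemma tends_bound u l : tends u l -> exists B : R, forall n, nrm (u n) <= B.
Proof.
move=> h; have [n0 H] := h 1 ltr01.
exists (\sum_(i < n0) nrm (u i) + (1 + nrm l)) => n.
have [hn|hn] := leqP n0 n.
  rewrite -[u n](subrK l) (le_trans (nrmD _ _))// ler_wpDl ?sumr_ge0// => [i _|].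
    exact: nrm_ge0.
  by rewrite lerD2r H.
rewrite ler_wpDr ?addr_ge0 ?nrm_ge0//.
by rewrite (bigD1 (Ordinal hn))//= lerDl sumr_ge0// => i _; exact: nrm_ge0.
Qed.

Lemma tendsN u l : tends u l -> tends (fun n => - u n) (- l).
Proof.
by move=> h e e0; have [n0 H] := h e e0; exists n0 => n hn; rewrite -opprD nrmN H.
Qed.

Lemma tendsB u v l1 l2 : tends u l1 -> tends v l2 ->
  tends (fun n => u n - v n) (l1 - l2).
Proof. by move=> h1 h2; apply: tendsD => //; exact: tendsN. Qed.

Lemma tendsM u v l1 l2 : tends u l1 -> tends v l2 ->
  tends (fun n => u n * v n) (l1 * l2).
Proof.
move=> h1 h2; apply/tends_sub0.
have [B hB] := tends_bound h2.
have e1 : tends (fun n => (u n - l1) * v n) 0.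
  by apply: (tends_mul0 0 hB); apply/(tends_sub0 u l1).
have e2 : tends (fun n => (v n - l2) * l1) 0.
  by apply: (@tends_mul0 _ (fun=> l1) 0 (nrm l1)) => //; apply/(tends_sub0 v l2).
have := tendsD e1 e2; rewrite addr0; apply: tends_ext => n; ring.
Qed.

Lemma tendsZ (k : C) u l : tends u l -> tends (fun n => k * u n) (k * l).
Proof. by apply: tendsM; exact: tends_cst. Qed.

Lemma tendsX u l k : tends u l -> tends (fun n => u n ^+ k) (l ^+ k).
Proof.
move=> h; elim: k => [|k IH]; first exact: tends_cst.
rewrite exprS; apply: (tends_ext (u := fun n => u n * u n ^+ k)).
  by move=> n; rewrite exprS.
exact: tendsM.
Qed.

Lemma tends_sum (I : Type) (r : seq I) (P : pred I) (F : nat -> I -> C) (L : I -> C) :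
  (forall i, P i -> tends (F ^~ i) (L i)) ->
  tends (fun n => \sum_(i <- r | P i) F n i) (\sum_(i <- r | P i) L i).
Proof.
move=> h; elim: r => [|i r IH].
  rewrite big_nil; apply: tends_ext (tends_cst 0) => n; by rewrite big_nil.
rewrite big_cons; apply: (tends_ext (u := fun n => if P i then F n i + \sum_(j <- r | P j) F n j else \sum_(j <- r | P j) F n j)).
  by move=> n; rewrite big_cons.
by case: ifP => // hP; apply: tendsD => //; exact: h.
Qed.

Lemma tends_prod (I : Type) (r : seq I) (P : pred I) (F : nat -> I -> C) (L : I -> C) :
  (forall i, P i -> tends (F ^~ i) (L i)) ->
  tends (fun n => \prod_(i <- r | P i) F n i) (\prod_(i <- r | P i) L i).
Proof.
move=> h; elim: r => [|i r IH].
  rewrite big_nil; apply: tends_ext (tends_cst 1) => n; by rewrite big_nil.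
rewrite big_cons; apply: (tends_ext (u := fun n => if P i then F n i * \prod_(j <- r | P j) F n j else \prod_(j <- r | P j) F n j)).
  by move=> n; rewrite big_cons.
by case: ifP => // hP; apply: tendsM => //; exact: h.
Qed.

Lemma tends_comp (f : nat -> nat) u l : (forall n, (n <= f n)%N) -> tends u l ->
  tends (fun n => u (f n)) l.
Proof.
move=> hf h e e0; have [n0 H] := h e e0; exists n0 => n hn.
by rewrite H// (leq_trans hn).
Qed.

Lemma tendsS u l : tends (fun n => u n.+1) l -> tends u l.
Proof.
move=> h e e0; have [n0 H] := h e e0; exists n0.+1 => -[//|n] hn.
by rewrite H.
Qed.

Lemma tends_nrm u l (b : R) : tends u l -> (forall n, nrm (u n) <= b) -> nrm l <= b.
Proof.
move=> h hb; apply/ler_addgt0Pr => e e0.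
have [n0 H] := h e e0.
rewrite -[l](subrK (u n0)) (le_trans (nrmD _ _))// addrC lerD//.
by rewrite nrmBC H.
Qed.

Lemma tends_squeeze u l (K : R) : (forall n, nrm (u n - l) <= K / n.+1%:R) -> tends u l.
Proof.
move=> h e e0.
have K0 : 0 <= K by have := le_trans (nrm_ge0 _) (h 0%N); rewrite divr1.
have e10 : 0 < e / (K + 1) by rewrite divr_gt0// ltr_wpDl.
have [n0 H] := invn_le e10; exists n0 => n hn.
rewrite (le_trans (h n))// (le_trans (ler_wpM2l K0 (H n hn)))//.
by rewrite mulrCA ger_pMr// ler_pdivrMr ?ltr_wpDl// mul1r lerDl.
Qed.

Lemma tendsV u l : l != 0 -> tends u l -> tends (fun n => (u n)^-1) l^-1.
Proof.
move=> l0 h e e0.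
have nl0 : 0 < nrm l by rewrite nrm_gt0.
have d0 : 0 < Num.min (nrm l / 2) (e * (nrm l ^+ 2 / 2)).
  by rewrite lt_min divr_gt0//= mulr_gt0// divr_gt0// exprn_gt0.
have [n0 H] := h _ d0; exists n0 => n hn.
have := H n hn; rewrite le_min => /andP[h1 h2].
have un : nrm l / 2 <= nrm (u n).
  have : nrm l - nrm (u n) <= nrm l / 2.
    by rewrite (le_trans (ler_nrm_dist _ _))// nrmBC.
  lra.
have un0 : u n != 0 by rewrite -nrm_gt0 (lt_le_trans _ un)// divr_gt0.
have -> : (u n)^-1 - l^-1 = (l - u n) / (u n * l) by field; rewrite un0 l0.
rewrite nrm_div nrmM nrmBC ler_pdivrMr ?mulr_gt0 ?nrm_gt0//.
rewrite (le_trans h2)// ler_wpM2l ?(ltW e0)// expr2 mulrAC ler_wpM2r// ltW//.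
Qed.

Lemma tends_ReIm u (a b : R) : (fun n => Re (u n)) @ \oo --> a ->
  (fun n => Im (u n)) @ \oo --> b -> tends u (a +i* b)%C.
Proof.
move=> /cvgrPdist_le ha /cvgrPdist_le hb e e0.
have e20 : 0 < e / 2 by rewrite divr_gt0.
have [n1 _ H1] := ha _ e20; have [n2 _ H2] := hb _ e20.
exists (maxn n1 n2) => n; rewrite geq_max => /andP[k1 k2].
rewrite (le_trans (nrm_le_ReIm _))// [leRHS]splitr lerD//.
  by rewrite ReD ReN distrC; exact: H1.
by rewrite ImD ImN distrC; exact: H2.
Qed.

Lemma tends_Re_ge u l (b : R) : tends u l -> (forall n, b <= Re (u n)) -> b <= Re l.
Proof.
move=> h hb; apply/ler_addgt0Pr => e e0.
have [n0 H] := h e e0.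
have := le_trans (Re_le_nrm _) (H n0 (leqnn _)).
rewrite ReD ReN ler_norml => /andP[_]; have := hb n0; lra.
Qed.

(** Absolutely convergent series. *)

Definition sums_bounded (b : nat -> R) := exists B, forall n, \sum_(0 <= k < n) b k <= B.

Lemma sums_bounded_is_cvg b : (forall n, 0 <= b n) -> sums_bounded b -> cvgn (series b).
Proof.
move=> b0 [B hB]; apply: nondecreasing_is_cvgn.
  by apply/nondecreasing_seqP => n; rewrite !seriesEnat /= big_nat_recr//= lerDl.
by exists B => _ [n _ <-]; exact: hB.
Qed.

Lemma abs_series u b : (forall n, nrm (u n) <= b n) -> sums_bounded b ->
  exists l, tends (fun n => \sum_(0 <= k < n) u k) l.
Proof.
move=> hu sb.
have b0 n : 0 <= b n by rewrite (le_trans (nrm_ge0 _) (hu n)).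
have cb := sums_bounded_is_cvg b0 sb.
have aux (f : nat -> R) : (forall n, `|f n| <= b n) -> cvgn (series f).
  move=> hf; apply: normed_cvg.
  apply: (series_le_cvg _ _ _ cb) => // n; exact: normr_ge0.
have cR : cvgn (series (fun n => Re (u n))).
  by apply: aux => n; rewrite (le_trans (Re_le_nrm _)).
have cI : cvgn (series (fun n => Im (u n))).
  by apply: aux => n; rewrite (le_trans (Im_le_nrm _)).
eexists; apply: tends_ReIm.
  have -> : (fun n => Re (\sum_(0 <= k < n) u k)) = series (fun n => Re (u n)).
    by apply/funext => n; rewrite Re_sum.
  exact: cR.
have -> : (fun n => Im (\sum_(0 <= k < n) u k)) = series (fun n => Im (u n)).
  by apply/funext => n; rewrite Im_sum.
exact: cI.
Qed.

Lemma sums_tail b : (forall n, 0 <= b n) -> sums_bounded b ->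
  forall e, 0 < e -> exists N, forall M, \sum_(N <= k < M) b k <= e.
Proof.
move=> b0 sb e e0.
have /cvgrPdist_le/(_ e e0)[N _ H] := sums_bounded_is_cvg b0 sb.
exists N => M; have [hM|hM] := leqP N M; last first.
  by rewrite big_geq ?ltW// ltnW.
have -> : \sum_(N <= k < M) b k = series b M - series b N.
  by rewrite !seriesEnat /= [in RHS](big_cat_nat (leq0n _) hM)//= addrAC subrr add0r.
have := H N (leqnn _); apply: le_trans.
rewrite ler_normr; apply/orP; left; rewrite lerD2r.
apply: nondecreasing_cvgn_le; last exact: sums_bounded_is_cvg.
by apply/nondecreasing_seqP => n; rewrite !seriesEnat /= big_nat_recr//= lerDl.
Qed.

Lemma sums_nneg_mono (b : nat -> R) : (forall n, 0 <= b n) -> forall n m, (n <= m)%N ->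
  \sum_(0 <= k < n) b k <= \sum_(0 <= k < m) b k.
Proof.
by move=> b0 n m nm; rewrite (big_cat_nat (leq0n _) nm)//= lerDl sumr_ge0.
Qed.

(** Dominated convergence for series (Tannery). *)
Lemma tannery (u : nat -> nat -> C) (l : nat -> C) (b : nat -> R) (K : nat -> nat) (L : C) :
  (forall n k, (k < K n)%N -> nrm (u n k) <= b k) -> sums_bounded b -> (forall n, 0 <= b n) ->
  (forall k, tends (u ^~ k) (l k)) -> (forall n, (n <= K n)%N) ->
  tends (fun n => \sum_(0 <= k < n) l k) L ->
  tends (fun n => \sum_(0 <= k < K n) u n k) L.
Proof.
move=> hu sb b0 hl hK hL e e0.
have e30 : 0 < e / 3 by rewrite divr_gt0.
have [N1 H1] := sums_tail b0 sb e30.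
have [N2 H2] := hL _ e30.
pose N := maxn N1 N2.
have [N3 H3] := tends_sum (index_iota 0 N) (P := predT) (fun i _ => hl i) e30.
exists (maxn N N3) => n; rewrite geq_max => /andP[k1 k2].
have hNK : (N <= K n)%N by rewrite (leq_trans k1).
rewrite (big_cat_nat (leq0n _) hNK)//=.
set A := \sum_(0 <= i < N) u n i; set T := \sum_(N <= i < K n) u n i.
set S := \sum_(0 <= i < N) l i.
have -> : A + T - L = (A - S) + T + (S - L) by ring.
have -> : e = e / 3 + e / 3 + e / 3 by field.
rewrite (le_trans (nrmD _ _))// lerD ?H2 ?leq_maxr//.
rewrite (le_trans (nrmD _ _))// lerD ?H3//.
rewrite (le_trans (nrm_sum _ _ _))//.
apply: le_trans (H1 (K n)).
rewrite (big_cat_nat (leq_maxl N1 N2) hNK)//= ler_wpDl ?sumr_ge0//.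
by rewrite big_nat [leRHS]big_nat ler_sum// => i /andP[_ hi]; exact: hu.
Qed.

Lemma geometric_sum_le (r : R) n : 0 <= r < 1 -> \sum_(0 <= k < n) r ^+ k <= (1 - r)^-1.
Proof.
move=> /andP[r0 r1].
have h : (1 - r) * \sum_(0 <= k < n) r ^+ k = 1 - r ^+ n.
  elim: n => [|n IH]; first by rewrite big_nil mulr0 expr0 subrr.
  by rewrite big_nat_recr//= mulrDr IH exprS; ring.
have r10 : 0 < 1 - r by rewrite subr_gt0.
rewrite -(ler_pM2l r10) h mulfV ?gt_eqF// gerBl exprn_ge0//.
Qed.

Lemma geometric_sums_bounded (K r : R) : 0 <= r < 1 -> 0 <= K ->
  sums_bounded (fun k => K * r ^+ k).
Proof.
move=> hr K0; exists (K * (1 - r)^-1) => n.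
by rewrite -mulr_sumr ler_wpM2l// geometric_sum_le.
Qed.

End Limits.

End ComplexLimits.
Import ComplexLimits.

(** * The complex exponential *)

Module ComplexExponential.

Section RealBounds.
Variable R : realType.
Implicit Types x y : R.

Lemma sin_abs_le y : `|sin y| <= `|y|.
Proof.
have main (z : R) : 0 <= z -> `|sin z| <= z.
  move=> z0; have [c _ h] := MVT_segment z0 (fun x _ => is_derive_sin x)
    (continuous_subspaceT (@continuous_sin R)).
  move: h; rewrite sin0 !subr0 => ->; rewrite normrM (ger0_norm z0) ler_piMl//.
  exact: cos_max.
have [h|h] := leP 0 y; first by rewrite (ger0_norm h) main.
have := main (- y); rewrite oppr_ge0 (ltW h) => /(_ isT).
by rewrite sinN normrN => /le_trans-> //; rewrite -normrN ler_norm.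
Qed.

Lemma cos_one_sub y : 1 - cos y = 2 * sin (y / 2) ^+ 2.
Proof.
have {1}-> : y = (y / 2) *+ 2 by rewrite mulr2n -splitr.
by rewrite cos_mulr2n cos2sin2; ring.
Qed.

Lemma cos_quad y : 1 - cos y <= y ^+ 2 / 2.
Proof.
rewrite cos_one_sub.
have := sin_abs_le (y / 2); rewrite -(ler_pXn2r (n := 2)) ?nnegrE//.
by rewrite !real_normK ?num_real//; lra.
Qed.

Lemma cos_lin y : `|cos y - 1| <= `|y|.
Proof.
rewrite distrC cos_one_sub ger0_norm; last by rewrite mulr_ge0// sqr_ge0.
have := sin_abs_le (y / 2); have := sin_max (y / 2).
rewrite [`|y / 2|]normrM (ger0_norm (x := 2^-1)) ?invr_ge0//.
have -> : sin (y / 2) ^+ 2 = `|sin (y / 2)| ^+ 2 by rewrite real_normK ?num_real.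
have := normr_ge0 (sin (y / 2)); set s := `|sin _|.
nra.
Qed.

Lemma sin_quad y : `|sin y - y| <= y ^+ 2.
Proof.
have main (z : R) : 0 <= z -> `|sin z - z| <= z ^+ 2.
  move=> z0; have [c cz h] := MVT_segment z0 (fun x _ => is_derive_sin x)
    (continuous_subspaceT (@continuous_sin R)).
  move: h cz; rewrite sin0 !subr0 in_itv/= => -> /andP[c0 cz].
  rewrite -{2}[z]mul1r -mulrBl normrM (ger0_norm z0) expr2 ler_wpM2r//.
  by rewrite (le_trans (cos_lin c))// ger0_norm.
have [h|h] := leP 0 y; first exact: main.
have := main (- y); rewrite oppr_ge0 (ltW h) => /(_ isT).
by rewrite sinN opprK addrC distrC sqrrN.
Qed.

Lemma expR_sub1_le x : `|expR x - 1| <= `|x| * expR `|x|.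
Proof.
have h1 : expR x - 1 <= x * expR x.
  have := expR_ge1Dx (- x); rewrite -(ler_pM2r (expR_gt0 x)) -expRD addNr expR0.
  nra.
have h2 := expR_ge1Dx x.
have [x0|x0] := leP 0 x; first by rewrite !ger0_norm// ?subr_ge0 -?expR0 ?ler_expR// expR0 (le_trans _ h2)//; lra.
have e1 : 1 <= expR (- x) by rewrite -expR0 ler_expR oppr_ge0 ltW.
have e2 : expR x <= 1 by rewrite -expR0 ler_expR ltW.
rewrite ler0_norm ?subr_le0// ltr0_norm//; nra.
Qed.

Lemma expR_sub1_quad x : `|expR x - 1 - x| <= x ^+ 2 * expR `|x|.
Proof.
have h1 : expR x - 1 <= x * expR x.
  have := expR_ge1Dx (- x); rewrite -(ler_pM2r (expR_gt0 x)) -expRD addNr expR0.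
  nra.
have h2 := expR_ge1Dx x.
rewrite ger0_norm; last by lra.
have := expR_sub1_le x; set E := expR x in h1 h2 *; set a := expR `|x| => h3.
have h4 : E - 1 - x <= x * (E - 1) by lra.
rewrite (le_trans h4)// (le_trans (ler_norm _))// normrM.
by rewrite -real_normK ?num_real// expr2 -mulrA ler_wpM2l.
Qed.

End RealBounds.

Section ComplexExp.
Variable R : realType.
Local Notation C := (R[i]%C).
Implicit Types (z w : C) (x : R).

Definition cexp z : C := (expR (Re z) * cos (Im z) +i* (expR (Re z) * sin (Im z)))%C.

Lemma cexpD z w : cexp (z + w) = cexp z * cexp w.
Proof. by apply: eqC; rewrite ?(ReM, ImM) /= ReD ImD expRD ?cosD ?sinD; ring. Qed.
Lemma cexp0 : cexp 0 = 1.
Proof. by rewrite /cexp /= expR0 cos0 sin0 mulr1 mulr0. Qed.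
Lemma cexpN z : cexp (- z) = (cexp z)^-1.
Proof.
have h : cexp (- z) * cexp z = 1 by rewrite -cexpD addNr cexp0.
have z0 : cexp z != 0 by apply/eqP => e; move: h; rewrite e mulr0 => /eqP; rewrite eq_sym oner_eq0.
by apply: (mulIf z0); rewrite h mulVf.
Qed.
Lemma nrm_cexp z : nrm (cexp z) = expR (Re z).
Proof.
apply/eqP; rewrite -(eqrXn2 (n := 2)) ?nrm_ge0 ?expR_ge0// nrm_sqr /=.
by rewrite !exprMn -mulrDr cos2Dsin2 mulr1.
Qed.
Lemma cexp_neq0 z : cexp z != 0.
Proof. by rewrite -nrm_gt0 nrm_cexp expR_gt0. Qed.
Lemma cexpX z n : cexp z ^+ n = cexp (z *+ n).
Proof. by elim: n => [|n IH]; rewrite ?cexp0// exprS IH -cexpD mulrS. Qed.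
Lemma cexpXR z n : cexp z ^+ n = cexp (n%:R * z).
Proof. by rewrite cexpX mulr_natl. Qed.
Lemma cexp_conj z : (cexp z)^*%C = cexp (z^*%C).
Proof. by case: z => a b; rewrite /cexp /= cosN sinN mulrN. Qed.
Lemma cexp_real x : cexp (x%:C)%C = (expR x)%:C%C.
Proof. by rewrite /cexp /= cos0 sin0 mulr1 mulr0. Qed.
Lemma cexp_sub1_quad w : nrm (cexp w - 1 - w) <= 2 * nrm w ^+ 2 * expR (nrm w).
Proof.
rewrite (le_trans (nrm_le_ReIm _))//.
have hx := expR_sub1_quad (Re w); have hx1 := expR_sub1_le (Re w).
have hc := cos_quad (Im w); have hs := sin_quad (Im w).
have c1 : 0 <= 1 - cos (Im w) by rewrite subr_ge0 cos_le1.
have E1 : expR (Re w) <= expR `|Re w| by rewrite ler_expR ler_norm.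
have E2 : expR `|Re w| <= expR (nrm w) by rewrite ler_expR Re_le_nrm.
have -> : Re (cexp w - 1 - w) = (expR (Re w) - 1 - Re w) - expR (Re w) * (1 - cos (Im w)).
  by rewrite !(ReD, ReN) /=; ring.
have -> : Im (cexp w - 1 - w) = expR (Re w) * (sin (Im w) - Im w) + (expR (Re w) - 1) * Im w.
  by rewrite !(ImD, ImN) /=; ring.
set x := Re w in hx hx1 E1 E2 *; set y := Im w in hc hs c1 *.
have nE : nrm w ^+ 2 = x ^+ 2 + y ^+ 2 by exact: nrm_sqr.
set F := expR (nrm w) in E2 *.
set E := expR `|x| in hx hx1 E1 E2 *.
have E0 : 0 <= expR x by exact: expR_ge0.
have x2 : `|x| ^+ 2 = x ^+ 2 by rewrite real_normK ?num_real.
have y2 : `|y| ^+ 2 = y ^+ 2 by rewrite real_normK ?num_real.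
have b1 : `|expR x * (1 - cos y)| <= F * (y ^+ 2 / 2).
  by rewrite normrM (ger0_norm E0) (ger0_norm c1) ler_pM// (le_trans E1).
have b2 : `|expR x * (sin y - y)| <= F * y ^+ 2.
  by rewrite normrM (ger0_norm E0) ler_pM// (le_trans E1).
have b3 : `|(expR x - 1) * y| <= `|x| * F * `|y|.
  by rewrite normrM ler_wpM2r// (le_trans hx1)// ler_wpM2l.
have b4 : `|expR x - 1 - x| <= x ^+ 2 * F.
  by rewrite (le_trans hx)// ler_wpM2l// sqr_ge0.
have F0 : 0 <= F by exact: expR_ge0.
have k1 := ler_normB (expR x - 1 - x) (expR x * (1 - cos y)).
have k2 := ler_normD (expR x * (sin y - y)) ((expR x - 1) * y).
apply: (le_trans (lerD k1 k2)).
have xy : `|x| * `|y| <= (x ^+ 2 + y ^+ 2) / 2.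
  by rewrite -x2 -y2; have := sqr_ge0 (`|x| - `|y|); lra.
have b5 : `|x| * F * `|y| <= F * ((x ^+ 2 + y ^+ 2) / 2).
  by rewrite mulrAC mulrC ler_wpM2l.
rewrite nE; have : 0 <= F * x ^+ 2 by rewrite mulr_ge0 ?sqr_ge0.
lra.
Qed.

(** The additive character of period one. *)
Definition eu x : C := cexp (0 +i* (2 * pi * x))%C.

Lemma euD x y : eu (x + y) = eu x * eu y.
Proof. by rewrite /eu -cexpD; congr cexp; apply: eqC; rewrite /= ?addr0// mulrDr. Qed.
Lemma eu0 : eu 0 = 1.
Proof. by rewrite /eu mulr0 cexp0. Qed.
Lemma nrm_eu x : nrm (eu x) = 1.
Proof. by rewrite nrm_cexp /= expR0. Qed.
Lemma eu_neq0 x : eu x != 0. Proof. exact: cexp_neq0. Qed.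
Lemma euN x : eu (- x) = (eu x)^-1.
Proof. by rewrite /eu -cexpN; congr cexp; apply: eqC; rewrite /= ?oppr0// mulrN. Qed.
Lemma eu_conj x : (eu x)^*%C = eu (- x).
Proof. by rewrite /eu cexp_conj; congr cexp; apply: eqC; rewrite /= // mulrN. Qed.
Lemma euX x n : eu x ^+ n = eu (n%:R * x).
Proof. by elim: n => [|n IH]; rewrite ?mul0r ?eu0// exprS IH -euD -natr1 mulrDl mul1r addrC. Qed.
Lemma euE x : eu x = (cos (2 * pi * x) +i* sin (2 * pi * x))%C.
Proof. by rewrite /eu /cexp /= expR0 !mul1r. Qed.
Lemma eu1 : eu 1 = 1.
Proof. by rewrite euE mulr1 mulr_natl cos2pi sin2pi. Qed.
Lemma eu_half : eu (1 / 2) = -1.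
Proof.
rewrite euE; have -> : 2 * pi * (1 / 2) = pi :> R by field.
by rewrite cospi sinpi; apply: eqC; rewrite //= oppr0.
Qed.
Lemma eu_nat n : eu n%:R = 1.
Proof. by rewrite -[n%:R]mulr1 -euX eu1 expr1n. Qed.
Lemma eu_int (n : int) : eu n%:~R = 1.
Proof.
case: n => n; first exact: eu_nat.
by rewrite NegzE rmorphN euN eu_nat invr1.
Qed.
Lemma eu_addZ x (n : int) : eu (x + n%:~R) = eu x.
Proof. by rewrite euD eu_int mulr1. Qed.

Lemma nrm_eu_sub1_sqr x : nrm (eu x - 1) ^+ 2 = 2 * (1 - cos (2 * pi * x)).
Proof.
rewrite nrm_sqr euE ReD ImD ReN ImN /= subr0 sin2cos2; ring.
Qed.

(* On [0, pi/2], sine lies above a positive multiple of the identity. *)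
Lemma sin_ge_lin : exists2 k : R, 0 < k & forall y, 0 <= y <= pi / 2 -> k * y <= sin y.
Proof.
have c1 := @cos1_gt0 R.
have s1 (z : R) : 0 <= z <= 1 -> cos 1 * z <= sin z.
  move=> /andP[z0 z1]; have [c cz h] := MVT_segment z0 (fun x _ => is_derive_sin x)
    (continuous_subspaceT (@continuous_sin R)).
  move: h cz; rewrite sin0 !subr0 in_itv/= => -> /andP[c0 cz].
  rewrite ler_wpM2r//.
  have [->|ne] := eqVneq c 1; first by [].
  have cl : c < 1 by rewrite lt_neqAle ne (le_trans cz).
  have pi2 := @pi_ge2 R; apply: ltW.
  rewrite ltr_cos// in_itv/=; lra.
exists (cos 1 / 2); first by rewrite divr_gt0.
move=> y /andP[y0 y1].
have [h|h] := leP y 1; first by rewrite (le_trans _ (s1 y _)) ?y0// ler_wpM2r//; lra.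
have : sin 1 <= sin y.
  rewrite ltW// ltr_sin// in_itv/=; have := @pihalf_ge1 R; lra.
have : cos 1 * 1 <= sin (1 : R) by apply: s1; rewrite ler01 lexx.
have := @pihalf_lt2 R; nra.
Qed.

Lemma one_sub_cos_ge : exists2 k : R, 0 < k & forall y, `|y| <= pi -> k * y ^+ 2 <= 1 - cos y.
Proof.
have [k k0 hk] := sin_ge_lin.
exists (k ^+ 2 / 2); first by rewrite divr_gt0// exprn_gt0.
move=> y hy.
rewrite -cos_norm -[y ^+ 2]real_normK ?num_real//.
move: hy (normr_ge0 y); set a := `|y| => hy a0.
rewrite cos_one_sub.
have : 0 <= k * (a / 2) <= sin (a / 2).
  by rewrite mulr_ge0 ?(ltW k0) ?divr_ge0//= hk// divr_ge0//=; lra.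
move=> /andP[s0 s1].
have : (k * (a / 2)) ^+ 2 <= sin (a / 2) ^+ 2 by rewrite ler_pXn2r// nnegrE// (le_trans s0).
by rewrite !exprMn; lra.
Qed.

Lemma eu_sub1_ge : exists2 k : R, 0 < k & forall x, `|x| <= 1 / 2 -> k * `|x| <= nrm (eu x - 1).
Proof.
have [k k0 hk] := one_sub_cos_ge.
exists (Num.sqrt k); first by rewrite sqrtr_gt0.
move=> x hx; rewrite -(ler_pXn2r (n := 2)) ?nnegrE ?mulr_ge0 ?nrm_ge0 ?sqrtr_ge0//.
rewrite nrm_eu_sub1_sqr exprMn sqr_sqrtr ?(ltW k0)// real_normK ?num_real//.
have pi0 := @pi_gt0 R.
have : k * (2 * pi * x) ^+ 2 <= 1 - cos (2 * pi * x).
  apply: hk; rewrite normrM ger0_norm ?mulr_ge0 ?(ltW pi0)//; nra.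
have := @pi_ge2 R; have := sqr_ge0 x; set X := x ^+ 2; set c := cos _.
rewrite !exprMn -/X => X0 p2 h.
have : k * X <= k * (2 ^+ 2 * pi ^+ 2 * X).
  rewrite ler_pM2l// ler_peMl//; nra.
have : 0 <= k * X by rewrite mulr_ge0 // ltW.
lra.
Qed.

(* Orthogonality of the characters of the cyclic group of order N. *)
Lemma eu_orth (N : nat) (k : int) : (0 < N)%N ->
  \sum_(0 <= j < N) eu (j%:R * (k%:~R / N%:R)) = if (N %| `|k|)%N then N%:R else 0.
Proof.
move=> N0; have Nn : N%:R != 0 :> R by rewrite pnatr_eq0 -lt0n.
case: ifP => hk.
  have [q hq] : exists q : int, k = q * N%:Z.
    by have /dvdzP[q ->] : (N %| k)%Z by []; exists q.
  have -> : k%:~R / N%:R = q%:~R :> R by rewrite hq rmorphM /= -[N%:Z%:~R]/(N%:R) mulfK.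
  under eq_bigr => j _ do rewrite -euX eu_int expr1n.
  by rewrite sumr_const_nat subn0.
set z := eu (k%:~R / N%:R).
have zN : z ^+ N = 1 by rewrite euX mulrC divfK// eu_int.
have z1 : z != 1.
  apply/negP => /eqP zE; move: hk => /negP; apply.
  pose r := (`|k| %% N)%N.
  have [kr hkr] : exists q : int, (`|k|%N)%:Z = q * N%:Z + r%:Z.
    by exists ((`|k| %/ N)%N%:Z); rewrite /r -PoszM -PoszD -divn_eq.
  have ez : eu ((`|k|%N)%:R / N%:R) = 1.
    have [kk|kk] : k = (`|k|%N)%:Z \/ k = - (`|k|%N)%:Z by lia.
      by rewrite -zE /z {2}kk.
    have : z = (eu ((`|k|%N)%:R / N%:R))^-1 by rewrite -euN -mulNr /z {1}kk rmorphN.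
    by rewrite zE => /(congr1 GRing.inv); rewrite invrK invr1.
  have er : eu (r%:R / N%:R) = 1.
    rewrite -ez -[(`|k|%N)%:R]/((`|k|%N)%:Z%:~R) hkr rmorphD rmorphM /= mulrDl mulfK//.
    by rewrite addrC eu_addZ.
  have rN : (r < N)%N by rewrite ltn_mod.
  rewrite /dvdn -/r; apply/negPn/negP => r0.
  have [c c0 hc] := eu_sub1_ge.
  pose x : R := r%:R / N%:R.
  have x0 : 0 < x by rewrite divr_gt0// ltr0n// lt0n.
  have x1 : x < 1 by rewrite ltr_pdivrMr ?ltr0n// mul1r ltr_nat.
  have [hx|hx] := leP x (1 / 2).
    have := hc x; rewrite er subrr nrm0 gtr0_norm// => /(_ hx).
    by rewrite leNgt mulr_gt0.
  have e1 : eu (x - 1) = 1 by rewrite euD er euN eu1 invr1 mulr1.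
  have := hc (x - 1); rewrite e1 subrr nrm0 => /(_ _)/wrap[].
    by rewrite ltr0_norm ?subr_lt0//; lra.
  by rewrite leNgt mulr_gt0// normr_gt0 subr_eq0 lt_eqF.
have : (z - 1) * \sum_(0 <= j < N) z ^+ j = 0.
  suff -> : (z - 1) * \sum_(0 <= j < N) z ^+ j = z ^+ N - 1 by rewrite zN subrr.
  by rewrite big_mkord -subrX1.
move/eqP; rewrite mulf_eq0 subr_eq0 (negPf z1)/= => /eqP h.
by rewrite -[RHS]h; apply: eq_bigr => j _; rewrite euX.
Qed.

End ComplexExp.

End ComplexExponential.
Import ComplexExponential.

(** * Sums over the integers *)

Module BilateralSums.

Section TwoSided.
Variable R : realType.
Local Notation C := (R[i]%C).
Implicit Types (u v : int -> C) (l : C) (b : nat -> R).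

Definition wsum u M := \sum_(0 <= k < M) (u k%:Z + u (- k.+1%:Z)).

Lemma wsumE u M : wsum u M = \sum_(0 <= i < M + M) u (i%:Z - M%:Z).
Proof.
elim: M => [|M IH]; first by rewrite /wsum !big_nil.
rewrite /wsum big_nat_recr//= -/(wsum u M) IH addSn big_nat_recl//= addnS big_nat_recr//=.
rewrite addrA addrC sub0r; congr (_ + _).
congr (_ + u _); last by lia.
by apply: eq_bigr => i _; congr u; lia.
Qed.

Definition zcv u l := tends (wsum u) l.
Definition zsummable u := exists l, zcv u l.
(** The two-sided sum, with a junk value when the symmetric partial sums diverge. *)
Definition zs u : C := xget 0 [set l | zcv u l].

Lemma zsP u : zsummable u -> zcv u (zs u).
Proof. by move=> [l hl]; rewrite /zs; case: xgetP => [y ->//|/(_ l)/(_ hl)]. Qed.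
Lemma zcv_zs u l : zcv u l -> zs u = l.
Proof. by move=> h; apply: (tends_unique _ h); apply: zsP; exists l. Qed.
Lemma eq_zs u v : u =1 v -> zs u = zs v.
Proof. by move=> /funext ->. Qed.

Lemma wsumD u v M : wsum (fun n => u n + v n) M = wsum u M + wsum v M.
Proof. by rewrite /wsum -big_split; apply: eq_bigr => i _ /=; ring. Qed.
Lemma wsumZ k u M : wsum (fun n => k * u n) M = k * wsum u M.
Proof. by rewrite /wsum mulr_sumr; apply: eq_bigr => i _ /=; ring. Qed.

Lemma zcvD u v l1 l2 : zcv u l1 -> zcv v l2 -> zcv (fun n => u n + v n) (l1 + l2).
Proof. by move=> h1 h2; apply: tends_ext (tendsD h1 h2) => M; rewrite wsumD. Qed.
Lemma zcvZ k u l : zcv u l -> zcv (fun n => k * u n) (k * l).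
Proof. by move=> h1; apply: tends_ext (tendsZ k h1) => M; rewrite wsumZ. Qed.

Lemma zsD u v : zsummable u -> zsummable v -> zs (fun n => u n + v n) = zs u + zs v.
Proof. by move=> /zsP h1 /zsP h2; apply: zcv_zs; exact: zcvD. Qed.
Lemma zsZ k u : zsummable u -> zs (fun n => k * u n) = k * zs u.
Proof. by move=> /zsP h1; apply: zcv_zs; exact: zcvZ. Qed.
Lemma zcv0 : zcv (fun=> 0) 0.
Proof. by apply: tends_ext (tends_cst 0) => n; rewrite /wsum big1// => i _; rewrite addr0. Qed.
Lemma zcv_sum (I : Type) (r : seq I) (F : I -> int -> C) (L : I -> C) :
  (forall i, zcv (F i) (L i)) -> zcv (fun n => \sum_(i <- r) F i n) (\sum_(i <- r) L i).
Proof.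
move=> h; elim: r => [|i r IH].
  rewrite big_nil; apply: tends_ext zcv0 => n; congr wsum; apply/funext => k.
  by rewrite big_nil.
rewrite big_cons; apply: tends_ext (zcvD (h i) IH) => n; congr wsum; apply/funext => k.
by rewrite big_cons.
Qed.

Definition zdom u b := [/\ forall n, nrm (u n) <= b `|n|%N, forall n, 0 <= b n & sums_bounded b].

Lemma zdom_summable u b : zdom u b -> zsummable u.
Proof.
move=> [hu b0 [B hB]].
apply: (abs_series (b := fun k => b k + b k.+1)) => [k|].
  by rewrite (le_trans (nrmD _ _))// lerD// ?hu//.
exists (B + B) => n; rewrite big_split/= lerD//.
have := hB n.+1; rewrite big_nat_recl//=; apply: le_trans.
by rewrite lerDr.
Qed.

Lemma zdom_wsum_le u b (B : R) M : (forall n, nrm (u n) <= b `|n|%N) -> (forall n, 0 <= b n) ->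
  (forall n, \sum_(0 <= k < n) b k <= B) -> nrm (wsum u M) <= 2 * B.
Proof.
move=> hu b0 hB; rewrite (le_trans (nrm_sum _ _ _))//.
have : \sum_(0 <= k < M) (b k + b k.+1) <= 2 * B.
  have -> : 2 * B = B + B by ring.
  rewrite big_split/= lerD//.
  by have := hB M.+1; rewrite big_nat_recl//=; apply: le_trans; rewrite lerDr.
apply: le_trans; apply: ler_sum => k _.
by rewrite (le_trans (nrmD _ _))// lerD// ?hu//.
Qed.

Lemma zdom_le u b (B : R) : (forall n, nrm (u n) <= b `|n|%N) -> (forall n, 0 <= b n) ->
  (forall n, \sum_(0 <= k < n) b k <= B) -> nrm (zs u) <= 2 * B.
Proof.
move=> hu b0 hB.
have h : zsummable u by apply: (@zdom_summable _ b); split => //; exists B.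
by apply: (tends_nrm (zsP h)) => M; exact: zdom_wsum_le.
Qed.

Lemma sums_bounded_to0 b : (forall n, 0 <= b n) -> sums_bounded b ->
  forall e, 0 < e -> exists N, forall n, (N <= n)%N -> b n <= e.
Proof.
move=> b0 sb e e0; have [N hN] := sums_tail b0 sb e0; exists N => n hn.
have := hN n.+1; apply: le_trans; rewrite big_nat_recr//= lerDr sumr_ge0//.
Qed.

Lemma wsum_shift u M : wsum (fun n => u (n + 1)) M = wsum u M + u M%:Z - u (- M%:Z).
Proof.
case: M => [|M]; first by rewrite /wsum !big_nil oppr0; ring.
have -> : wsum u M.+1 + u M.+1%:Z - u (- M.+1%:Z) = wsum u M + u M%:Z + u M.+1%:Z.
  by rewrite /wsum big_nat_recr//=; ring.
rewrite !wsumE addSn big_nat_recr//= addnS big_nat_recr//=.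
congr (_ + u _ + u _); try lia.
by apply: eq_bigr => i _; congr u; lia.
Qed.

Lemma zdom_tends0 u b : zdom u b ->
  tends (fun M => u M%:Z) 0 /\ tends (fun M => u (- M%:Z)) 0.
Proof.
move=> [hu b0 sb]; split=> e e0; have [N hN] := sums_bounded_to0 b0 sb e0; exists N => n hn;
 rewrite subr0 (le_trans _ (hN n hn))// (le_trans (hu _))// ?abszN//.
Qed.

Lemma zcv_shift u b l : zdom u b -> zcv u l -> zcv (fun n => u (n + 1)) l.
Proof.
move=> hu hl; have [h1 h2] := zdom_tends0 hu.
have := tendsB (tendsD hl h1) h2; rewrite addr0 subr0; apply: tends_ext => M.
by rewrite wsum_shift.
Qed.

Lemma zs_shift u b : zdom u b -> zs (fun n => u (n + 1)) = zs u.
Proof.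
by move=> hu; apply: zcv_zs; apply: (zcv_shift hu); apply: zsP; exact: zdom_summable hu.
Qed.

Lemma big_nat_mul (V : nmodType) (a k : nat) (f : nat -> V) :
  \sum_(0 <= i < a * k) f i = \sum_(0 <= s < k) \sum_(0 <= j < a) f (j * k + s)%N.
Proof.
elim: a => [|a IH].
  by rewrite mul0n big_nil big1// => s _; rewrite big_nil.
rewrite mulSn addnC (@big_cat_nat _ _ _ (a * k)) ?leq_addr//= IH.
under [RHS]eq_bigr => s _ do rewrite big_nat_recr//=.
rewrite big_split/=; congr (_ + _).
by rewrite -{1}[(a * k)%N]add0n big_addn addKn; apply: eq_bigr => i _; rewrite addnC.
Qed.

Lemma wsum_split u k M : wsum u (k * M) = \sum_(0 <= s < k) wsum (fun j => u (j * k%:Z + s%:Z)) M.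
Proof.
rewrite wsumE -mulnDr mulnC big_nat_mul; apply: eq_bigr => s _; rewrite wsumE.
by apply: eq_bigr => j _; congr u; rewrite PoszD !PoszM; ring.
Qed.

Lemma zcv_split u k (L : nat -> C) l : (0 < k)%N -> zcv u l ->
  (forall s, (s < k)%N -> zcv (fun j => u (j * k%:Z + s%:Z)) (L s)) ->
  l = \sum_(0 <= s < k) L s.
Proof.
move=> k0 hl hL.
have h1 : tends (fun M => wsum u (k * M)) l.
  by apply: (tends_comp (f := fun M => (k * M)%N)) hl => n; exact: leq_pmull.
apply: tends_unique h1 _.
apply: (tends_ext (u := fun M => \sum_(s < k) wsum (fun j => u (j * k%:Z + s%:Z)) M)).
  by move=> M; rewrite wsum_split big_mkord.
by rewrite big_mkord; apply: tends_sum => i _; exact: hL.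
Qed.

End TwoSided.

End BilateralSums.
Import BilateralSums.

Local Notation "x %:c" := (real_complex _ x) (at level 2, format "x %:c").

(** * Gaussian sums and Riemann sums *)

Module GaussianSums.

Section Grid.
Variable R : realType.
Local Notation C := (R[i]%C).
Implicit Types (x y h K : R) (F G : R -> C).

Lemma le_limN (D L K : R) (M0 : nat) :
  (forall M, (M0 <= M)%N -> (0 < M)%N -> D <= L + K / M%:R) -> D <= L.
Proof.
move=> H; apply/ler_addgt0Pr => e e0.
have e1 : 0 < e / (`|K| + 1) by rewrite divr_gt0// ltr_wpDl.
have [n0 hn] := invn_le e1.
pose M := (maxn M0 n0).+1.
have hM : (M0 <= M)%N by rewrite /M ltnW// ltnS leq_maxl.
have := H M hM isT => /le_trans; apply; rewrite lerD2l.
have h1 : M%:R^-1 <= e / (`|K| + 1) by apply: hn; rewrite leq_maxr.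
have h2 : K / M%:R <= `|K| / M%:R by rewrite ler_wpM2r ?invr_ge0// ler_norm.
rewrite (le_trans h2)// (le_trans (ler_wpM2l (normr_ge0 K) h1))//.
by rewrite mulrCA ger_pMr// ler_pdivrMr ?ltr_wpDl// mul1r lerDl.
Qed.

Definition expdom F K := forall x, nrm (F x) <= K * expR (- `|x|).

Definition grid h F : C := h%:c * zs (fun n : int => F (h * n%:~R)).

Lemma grid_zdom h F K : 0 < h -> 0 <= K -> expdom F K ->
  zdom (fun n : int => F (h * n%:~R)) (fun k => K * expR (- h) ^+ k).
Proof.
move=> h0 K0 hF; split=> [n|n|].
- rewrite (le_trans (hF _))// ler_wpM2l// -expRM_natl ler_expR.
  by rewrite normrM (gtr0_norm h0) natr_absz intr_norm mulrN mulrC.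
- by rewrite mulr_ge0// exprn_ge0// expR_ge0.
- by apply: geometric_sums_bounded => //; rewrite expR_ge0 expR_lt1 oppr_lt0.
Qed.

Lemma grid_summable h F K : 0 < h -> 0 <= K -> expdom F K ->
  zsummable (fun n : int => F (h * n%:~R)).
Proof. by move=> h0 K0 hF; apply: zdom_summable (grid_zdom h0 K0 hF). Qed.

Lemma grid_le h F K : 0 < h -> 0 <= K -> expdom F K -> nrm (grid h F) <= 2 * K * (1 + h).
Proof.
move=> h0 K0 hF; have [h1 h2 _] := grid_zdom h0 K0 hF.
have r1 : expR (- h) < 1 by rewrite expR_lt1 oppr_lt0.
have B n : \sum_(0 <= k < n) K * expR (- h) ^+ k <= K * (1 - expR (- h))^-1.
  by rewrite -mulr_sumr ler_wpM2l// geometric_sum_le// expR_ge0.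
have := zdom_le h1 h2 B.
rewrite /grid nrmM nrm_real gtr0_norm// => /(ler_wpM2l (ltW h0))/le_trans; apply.
have e1 : expR (- h) * (1 + h) <= 1.
  have := expR_ge1Dx h; rewrite -(ler_pM2l (expR_gt0 (- h))) -expRD addNr expR0//.
have : h * (1 - expR (- h))^-1 <= 1 + h.
  by rewrite ler_pdivrMr ?subr_gt0//; lra.
by move=> /(ler_wpM2l K0); lra.
Qed.

Lemma expdomD F G K1 K2 : expdom F K1 -> expdom G K2 -> expdom (fun x => F x + G x) (K1 + K2).
Proof. by move=> h1 h2 x; rewrite (le_trans (nrmD _ _))// mulrDl lerD. Qed.
Lemma expdomZ k F K : expdom F K -> expdom (fun x => k * F x) (nrm k * K).
Proof. by move=> h1 x; rewrite nrmM -mulrA ler_wpM2l ?nrm_ge0. Qed.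

Lemma expdomB F G K1 K2 : expdom F K1 -> expdom G K2 -> expdom (fun x => F x - G x) (K1 + K2).
Proof. by move=> h1 h2 x; rewrite (le_trans (nrmB _ _))// mulrDl lerD. Qed.

Lemma gridD h F G K1 K2 : 0 < h -> 0 <= K1 -> 0 <= K2 -> expdom F K1 -> expdom G K2 ->
  grid h (fun x => F x + G x) = grid h F + grid h G.
Proof.
move=> h0 k1 k2 hF hG; rewrite /grid (@zsD _ (fun n : int => F (h * n%:~R))) ?mulrDr//.
  exact: grid_summable hF.
exact: grid_summable hG.
Qed.
Lemma gridZ h k F K : 0 < h -> 0 <= K -> expdom F K ->
  grid h (fun x => k * F x) = k * grid h F.
Proof.
move=> h0 k1 hF; rewrite /grid (@zsZ _ k (fun n : int => F (h * n%:~R))) ?(mulrCA k)//.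
exact: grid_summable hF.
Qed.
Lemma gridB h F G K1 K2 : 0 < h -> 0 <= K1 -> 0 <= K2 -> expdom F K1 -> expdom G K2 ->
  grid h (fun x => F x - G x) = grid h F - grid h G.
Proof.
move=> h0 k1 k2 hF hG; have hG' := expdomZ (-1) hG.
rewrite -mulN1r -(gridZ _ h0 k2 hG) -(gridD h0 k1 _ hF hG') ?mulr_ge0 ?nrm_ge0//.
by congr grid; apply/funext => x; rewrite mulN1r.
Qed.
Lemma grid_shift h F K : 0 < h -> 0 <= K -> expdom F K ->
  grid h (fun x => F (x + h)) = grid h F.
Proof.
move=> h0 K0 hF; rewrite /grid -(zs_shift (grid_zdom h0 K0 hF)).
by congr (_ * _); apply: eq_zs => n; rewrite rmorphD /= mulrDr mulr1.
Qed.
Lemma expdom_shift h F K : 0 <= h -> 0 <= K -> expdom F K ->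
  expdom (fun x => F (x + h)) (K * expR h).
Proof.
move=> h0 K0 hF x; rewrite (le_trans (hF _))// -mulrA ler_wpM2l// -expRD ler_expR.
have := ler_normB (x + h) h; rewrite addrK (ger0_norm h0); lra.
Qed.
End Grid.

Section Gaussian.
Variable R : realType.
Local Notation C := (R[i]%C).
Implicit Types (x y h K B : R) (b d z : C).
Variable A : C.
Hypothesis A0 : 0 < Re A.

Definition gau z : C := cexp (- (A * z ^+ 2)).

Let a := nrm A.
Let a_gt0 : 0 < a.
Proof. by rewrite /a (lt_le_trans A0)// (le_trans (ler_norm _) (Re_le_nrm _)). Qed.

Lemma quad_max (r p y : R) : 0 < r -> p * y - r * y ^+ 2 <= p ^+ 2 / (4 * r).
Proof.
move=> r0; rewrite ler_pdivlMr ?mulr_gt0//.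
have := sqr_ge0 (p - 2 * r * y); lra.
Qed.

Lemma gau_decay B L : 0 <= B -> exists2 K, 0 < K & forall b x, nrm b <= B ->
  nrm (gau (x%:c + b)) <= K * expR (- (L * `|x|)).
Proof.
move=> B0; exists (expR (a * B ^+ 2 + (2 * a * B + L) ^+ 2 / (4 * Re A))); first exact: expR_gt0.
move=> b x hb; rewrite nrm_cexp -expRD ler_expR ReN.
have -> : A * (x%:c + b) ^+ 2 = (x ^+ 2)%:c * A + ((2 * x)%:c * (A * b) + A * b ^+ 2).
  by rewrite rmorphXn rmorphM rmorph_nat /=; ring.
rewrite 2!ReD !Re_realM.
have h1 : `|Re (A * b)| <= a * B by rewrite (le_trans (Re_le_nrm _))// nrmM ler_wpM2l// nrm_ge0.
have h2 : `|Re (A * b ^+ 2)| <= a * B ^+ 2.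
  by rewrite (le_trans (Re_le_nrm _))// nrmM nrmX ler_wpM2l ?nrm_ge0// ler_pXn2r ?nnegrE ?nrm_ge0.
have h3 := quad_max (2 * a * B + L) `|x| A0.
rewrite real_normK ?num_real// in h3.
have h4 : - (2 * x * Re (A * b)) <= 2 * a * B * `|x|.
  rewrite (le_trans (ler_norm _))// normrN !normrM ger0_norm//.
  have := ler_wpM2l (normr_ge0 x) h1; lra.
move: h2; rewrite ler_norml => /andP[h2 _]; lra.
Qed.

Lemma gauD z d : gau (z + d) = gau z * cexp (- (A * (2 * z * d + d ^+ 2))).
Proof. by rewrite /gau -cexpD; congr cexp; ring. Qed.

Lemma oneDx_sqr_le x : (1 + `|x|) ^+ 2 <= expR (2 * `|x|).
Proof.
rewrite -[2]/(2%:R) expRM_natl ler_pXn2r ?nnegrE ?addr_ge0 ?expR_ge0//.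
exact: expR_ge1Dx.
Qed.

Lemma gau_taylor B : 0 <= B -> exists2 K, 0 < K & forall b d x, nrm b <= B -> nrm d <= 1 ->
  nrm (gau (x%:c + b + d) - gau (x%:c + b) * (1 - 2 * A * (x%:c + b) * d))
    <= K * nrm d ^+ 2 * expR (- (2 * `|x|)).
Proof.
move=> B0; pose D := a * (2 * B + 3).
have D0 : 0 < D by rewrite mulr_gt0// ltr_wpDl// mulr_ge0.
have DE : D = a * (2 * B + 3) by []; clearbody D.
have [K K0 hK] := gau_decay (D + 4) B0.
exists (K * (2 * D ^+ 2 * expR D + a)).
  by rewrite mulr_gt0// addr_gt0// mulr_gt0 ?expR_gt0// mulr_gt0// exprn_gt0.
move=> b d x hb hd; rewrite gauD.
set z := x%:c + b; set w := - (A * (2 * z * d + d ^+ 2)).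
have -> : gau z * cexp w - gau z * (1 - 2 * A * z * d) = gau z * ((cexp w - 1 - w) - A * d ^+ 2).
  by rewrite /w; ring.
have nd := nrm_ge0 d.
have hz : nrm z <= `|x| + B by rewrite (le_trans (nrmD _ _))// nrm_real lerD2l.
have hw : nrm w <= D * (1 + `|x|) * nrm d.
  rewrite nrmN nrmM -/a DE -!mulrA ler_wpM2l ?(ltW a_gt0)// (le_trans (nrmD _ _))//.
  rewrite nrmX !nrmM nrm_nat.
  have : nrm d ^+ 2 <= nrm d by rewrite expr2 ler_piMl.
  have : nrm z * nrm d <= (`|x| + B) * nrm d by rewrite ler_wpM2r.
  have := normr_ge0 x; set y := `|x|; set e := nrm d in nd *.
  have := mulr_ge0 B0 nd => ?.
  move=> y0; have := mulr_ge0 (mulr_ge0 B0 y0) nd; have := mulr_ge0 y0 nd; lra.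
have hw2 : nrm w <= D * (1 + `|x|).
  by rewrite (le_trans hw)// ler_piMr// mulr_ge0 ?(ltW D0)// addr_ge0.
have E1 : nrm (cexp w - 1 - w) <= 2 * D ^+ 2 * expR D * nrm d ^+ 2 * expR ((D + 2) * `|x|).
  rewrite (le_trans (cexp_sub1_quad w))//.
  have -> : 2 * D ^+ 2 * expR D * nrm d ^+ 2 * expR ((D + 2) * `|x|) =
    (2 * (D ^+ 2 * expR (2 * `|x|) * nrm d ^+ 2)) * expR (D * (1 + `|x|)).
    have -> : (D + 2) * `|x| = D * `|x| + 2 * `|x| by ring.
    have -> : D * (1 + `|x|) = D + D * `|x| by ring.
    by rewrite !expRD; ring.
  apply: ler_pM; rewrite ?expR_ge0 ?ler_expR//; first by rewrite mulr_ge0// sqr_ge0.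
  rewrite ler_pM2l//.
  apply: (le_trans (y := (D * (1 + `|x|) * nrm d) ^+ 2)).
    by rewrite ler_pXn2r ?nnegrE ?nrm_ge0 ?mulr_ge0 ?(ltW D0) ?addr_ge0.
  by rewrite !exprMn ler_wpM2r ?sqr_ge0// ler_wpM2l ?sqr_ge0// oneDx_sqr_le.
have E2 : nrm (A * d ^+ 2) <= a * nrm d ^+ 2 * expR ((D + 2) * `|x|).
  rewrite nrmM nrmX -/a; apply: ler_peMr.
    by apply: mulr_ge0; [exact: ltW | exact: sqr_ge0].
  by rewrite -[leLHS]expR0 ler_expR mulr_ge0// addr_ge0// ltW.
have := lerD E1 E2 => /(le_trans (nrmB _ _)) E.
rewrite nrmM (le_trans (ler_pM (nrm_ge0 _) (nrm_ge0 _) (hK b x hb) E))//.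
rewrite le_eqVlt; apply/orP; left; apply/eqP.
have -> : - (2 * `|x|) = - ((D + 4) * `|x|) + (D + 2) * `|x| by ring.
rewrite expRD; ring.
Qed.

Lemma gau_expdom B : 0 <= B -> exists2 K, 0 < K & forall b, nrm b <= B ->
  [/\ expdom (fun x => gau (x%:c + b)) K,
      expdom (fun x => (x%:c + b) * gau (x%:c + b)) K &
      expdom (fun x => (x%:c + b) ^+ 2 * gau (x%:c + b)) K].
Proof.
move=> B0; have [K K0 hK] := gau_decay 3 B0.
pose B1 := 1 + B; have B10 : 1 <= B1 by rewrite lerDl.
have B1p : 0 < B1 by rewrite (lt_le_trans ltr01).
exists (K * B1 ^+ 2); first by rewrite mulr_gt0// exprn_gt0.
move=> b hb.
have aux (k : nat) x : (k <= 2)%N ->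
   nrm ((x%:c + b) ^+ k * gau (x%:c + b)) <= K * B1 ^+ 2 * expR (- `|x|).
  move=> k2; rewrite nrmM nrmX.
  have hz : nrm (x%:c + b) <= B1 * (1 + `|x|).
    rewrite (le_trans (nrmD _ _))// nrm_real /B1; have := normr_ge0 x.
    set y := `|x|; move=> y0; have := mulr_ge0 B0 y0; lra.
  have o1 : 1 <= B1 * (1 + `|x|) by rewrite mulr_ege1// lerDl.
  have hz2 : nrm (x%:c + b) ^+ k <= B1 ^+ 2 * expR (2 * `|x|).
    apply: (le_trans (y := (B1 * (1 + `|x|)) ^+ k)).
      by rewrite lerXn2r ?nnegrE ?nrm_ge0// (le_trans ler01).
    apply: (le_trans (y := (B1 * (1 + `|x|)) ^+ 2)); first by rewrite ler_weXn2l.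
    by rewrite exprMn ler_wpM2l ?sqr_ge0// oneDx_sqr_le.
  rewrite (le_trans (ler_pM _ (nrm_ge0 _) hz2 (hK b x hb)))//.
    by rewrite exprn_ge0// nrm_ge0.
  rewrite le_eqVlt; apply/orP; left; apply/eqP.
  have -> : - `|x| = 2 * `|x| - 3 * `|x| by ring.
  by rewrite expRD; ring.
split=> x; have := aux 0%N x isT; have := aux 1%N x isT; have := aux 2%N x isT.
- by move=> _ _; rewrite expr0 mul1r.
- by move=> _; rewrite expr1.
- by [].
Qed.

(** The Riemann sum of step [h] for the Gaussian, on a line displaced by [b]. *)
Definition rsum h b : C := grid h (fun x => gau (x%:c + b)).

Lemma rsum_moment B : 0 <= B -> exists2 K, 0 < K & forall b h, nrm b <= B -> 0 < h <= 1 ->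
  nrm (grid h (fun x => (x%:c + b) * gau (x%:c + b))) <= K * h.
Proof.
move=> B0; have [K K0 hK] := gau_taylor B0.
have [K1 K10 hK1] := gau_expdom B0.
exists (2 * K / a); first by rewrite divr_gt0// mulr_gt0.
move=> b h hb /andP[h0 h1].
have [e0 e1 _] := hK1 b hb.
have eh := expdom_shift (ltW h0) (ltW K10) e0.
pose P x := (x%:c + b) * gau (x%:c + b).
pose r x := gau (x%:c + b + h%:c) - gau (x%:c + b) * (1 - 2 * A * (x%:c + b) * h%:c).
have hr : expdom r (K * h ^+ 2).
  move=> x; have nh : nrm (h%:c : C) = h by rewrite nrm_real gtr0_norm.
  have := hK b h%:c x hb; rewrite nh => /(_ h1)/le_trans; apply.
  rewrite ler_wpM2l ?(mulr_ge0 (ltW K0) (sqr_ge0 _))// ler_expR lerN2.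
  by rewrite ler_peMl// ler1n.
have : grid h (fun x => (2 * A * h%:c) * P x) = grid h r.
  have -> : (fun x => 2 * A * h%:c * P x) =
     (fun x => r x + (gau (x%:c + b) - gau ((x + h)%:c + b))).
    apply/funext => x; rewrite /r /P rmorphD /=.
    have -> : x%:c + h%:c + b = x%:c + b + h%:c by ring.
    ring.
  rewrite (gridD h0 _ _ hr (expdomB e0 eh)).
  - rewrite (gridB h0 _ _ e0 eh) ?mulr_ge0 ?expR_ge0 ?(ltW K10)//.
    by rewrite (grid_shift h0 (ltW K10) e0) subrr addr0.
  - exact: (mulr_ge0 (ltW K0) (sqr_ge0 _)).
  - by rewrite addr_ge0 ?mulr_ge0 ?expR_ge0 ?(ltW K10).
rewrite (gridZ _ h0 (ltW K10) e1) => /(congr1 (@nrm R)); rewrite 3!nrmM nrm_nat nrm_real gtr0_norm// -/a => E.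
have := grid_le h0 _ hr; rewrite -E => /(_ _)/wrap[]; first exact: (mulr_ge0 (ltW K0) (sqr_ge0 _)).
move=> H; rewrite mulrAC ler_pdivlMr// -(ler_pM2l h0).
set G := nrm _ in H *.
have : 2 * (K * h ^+ 2) * (1 + h) <= 2 * (K * h ^+ 2) * 2.
  apply: ler_wpM2l; last lra.
  by apply: mulr_ge0 => //; exact: (mulr_ge0 (ltW K0) (sqr_ge0 _)).
lra.
Qed.

Lemma rsum_displace B : 0 <= B -> exists2 K, 0 < K & forall b h, nrm b <= B -> 0 < h <= 1 ->
  nrm (rsum h b - rsum h 0) <= K * h.
Proof.
move=> B0; have [K K0 hK] := gau_taylor B0.
have [K1 K10 hK1] := gau_expdom B0.
have [K2 K20 hK2] := rsum_moment B0.
exists (2 * a * B * K2 + 1); first by rewrite ltr_wpDl// !mulr_ge0// ?ltW.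
move=> b h hb h01; have /andP[h0 h1] := h01.
suff : nrm (rsum h b - rsum h 0) <= 2 * a * B * K2 * h.
  by move=> /le_trans; apply; lra.
apply: (@le_limN _ _ _ (4 * K * B ^+ 2) (Num.bound B)) => M hM M0.
have MR : 0 < M%:R :> R by rewrite ltr0n.
have BM : B <= M%:R.
  by rewrite (le_trans (ltW (archi_boundP B0)))// ler_nat.
pose d : C := M%:R^-1%:c * b.
have nd : nrm d <= B / M%:R.
  by rewrite nrmM nrm_real ger0_norm ?invr_ge0 ?(ltW MR)// mulrC ler_wpM2r// invr_ge0 (ltW MR).
have nd1 : nrm d <= 1 by rewrite (le_trans nd)// ler_pdivrMr// mul1r.
have step c : nrm c <= B -> nrm (c + d) <= B ->
   nrm (rsum h (c + d) - rsum h c) <= (2 * a * B * K2 * h) / M%:R + 4 * K * B ^+ 2 / M%:R ^+ 2.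
  move=> hc hcd; have [e0 e1 _] := hK1 c hc; have [f0 _ _] := hK1 _ hcd.
  pose r x := gau (x%:c + c + d) - gau (x%:c + c) * (1 - 2 * A * (x%:c + c) * d).
  have hr : expdom r (K * nrm d ^+ 2).
    move=> x; have := hK c d x hc nd1 => /le_trans; apply.
    rewrite ler_wpM2l ?(mulr_ge0 (ltW K0) (sqr_ge0 _))// ler_expR lerN2.
    by rewrite ler_peMl// ler1n.
  have -> : rsum h (c + d) - rsum h c =
     grid h r + (- (2 * A * d)) * grid h (fun x => (x%:c + c) * gau (x%:c + c)).
    rewrite -(gridB h0 _ _ f0 e0) ?(ltW K10)// -(gridZ _ h0 (ltW K10) e1).
    rewrite -(gridD h0 _ _ hr (expdomZ (- (2 * A * d)) e1)) ?(mulr_ge0 (ltW K0) (sqr_ge0 _)) ?mulr_ge0 ?nrm_ge0 ?(ltW K10)//.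
    by congr grid; apply/funext => x; rewrite /r addrA; ring.
  rewrite (le_trans (nrmD _ _))// addrC lerD//.
    rewrite nrmM nrmN 2!nrmM nrm_nat -/a.
    have := ler_pM _ _ nd (hK2 c h hc h01); rewrite !nrm_ge0 => /(_ isT isT).
    move=> /(ler_wpM2l (mulr_ge0 (ler0n R 2) (ltW a_gt0))); lra.
  apply: le_trans (grid_le h0 _ hr) _; first exact: (mulr_ge0 (ltW K0) (sqr_ge0 _)).
  have -> : 4 * K * B ^+ 2 / M%:R ^+ 2 = 2 * (K * (B / M%:R) ^+ 2) * 2.
    by rewrite exprMn exprVn; ring.
  apply: ler_pM; [|lra| |lra].
    by rewrite mulr_ge0// (mulr_ge0 (ltW K0) (sqr_ge0 _)).
  by rewrite ler_pM2l// ler_wpM2l ?(ltW K0)// lerXn2r ?nnegrE ?nrm_ge0// divr_ge0// ltW.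
have path j : (j <= M)%N -> nrm (rsum h (j%:R * d) - rsum h 0) <=
   j%:R * ((2 * a * B * K2 * h) / M%:R + 4 * K * B ^+ 2 / M%:R ^+ 2).
  have hj i : (i <= M)%N -> nrm (i%:R * d) <= B.
    move=> hi; rewrite nrmM nrm_nat (le_trans (ler_wpM2l (ler0n _ i) nd))//.
    by rewrite mulrCA ler_piMr// ler_pdivrMr// mul1r ler_nat.
  elim: j => [|j IH] jM; first by rewrite !mul0r subrr nrm0.
  have e : j.+1%:R * d = j%:R * d + d by rewrite -natr1 mulrDl mul1r.
  have -> : rsum h (j.+1%:R * d) - rsum h 0 =
    (rsum h (j%:R * d + d) - rsum h (j%:R * d)) + (rsum h (j%:R * d) - rsum h 0) by rewrite e; ring.
  rewrite (le_trans (nrmD _ _))// -[j.+1%:R]natr1 mulrDl mul1r addrC lerD ?IH ?(ltnW jM)//.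
  by apply: step; [exact/hj/ltnW|rewrite -e; exact: hj].
have := path M (leqnn _).
have -> : M%:R * d = b.
  by rewrite /d mulrA -(rmorph_nat (real_complex R)) -rmorphM mulfV ?gt_eqF// rmorph1 mul1r.
move=> /le_trans; apply.
rewrite le_eqVlt; apply/orP; left; apply/eqP; field; exact: lt0r_neq0.
Qed.

End Gaussian.

End GaussianSums.
Import GaussianSums.

(** * Gaussian integrals under scaling *)

Module GaussianScaling.

Section Scale.
Variable R : realType.
Local Notation C := (R[i]%C).
Implicit Types (x y h K B : R) (b d z : C).

Lemma tends_squeeze_near (u : nat -> C) (l : C) (K : R) N :
  (forall n, (N <= n)%N -> nrm (u n - l) <= K / n.+1%:R) -> tends u l.
Proof.
move=> h; apply: (tends_ext_near (N := N) (u := fun n => if (N <= n)%N then u n else l)).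
  by move=> n ->.
apply: (@tends_squeeze _ _ _ `|K|) => n; case: ifP => hn.
  by rewrite (le_trans (h n hn))// ler_wpM2r ?invr_ge0// ler_norm.
by rewrite subrr nrm0 divr_ge0.
Qed.

Section FixedA.
Variable A : C.
Hypothesis A0 : 0 < Re A.
Local Notation gau := (gau A).
Local Notation rsum := (rsum A).
Let a := nrm A.
Let a_gt0 : 0 < a.
Proof. by rewrite /a (lt_le_trans A0)// (le_trans (ler_norm _) (Re_le_nrm _)). Qed.

Let nrm00 : nrm (0 : C) <= 0. Proof. by rewrite nrm0. Qed.

Definition scale_density x : C := (1 - 2 * A * (x%:c + 0) ^+ 2) * gau (x%:c + 0).

(** The sum of [d/dx (x gau x)] over a grid is small because it telescopes up to
    second order terms. *)
Lemma rsum_density : exists2 K, 0 < K & (expdom scale_density K /\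
  forall h, 0 < h <= 1 -> nrm (grid h scale_density) <= K * h).
Proof.
have [K K0 hK] := gau_taylor A0 (lexx 0).
have [K1 K10 hK1] := gau_expdom A0 (lexx 0).
have [e0 e1 e2] := hK1 0 nrm00.
have eD : expdom scale_density (K1 + 2 * a * K1).
  have := expdomB e0 (expdomZ (2 * A) e2); rewrite nrmM nrm_nat -/a.
  have -> : (fun x => gau (x%:c + 0) - 2 * A * ((x%:c + 0) ^+ 2 * gau (x%:c + 0))) = scale_density.
    by apply/funext => x; rewrite /scale_density; ring.
  by [].
pose K' := 2 * a * K1 + K.
have K'0 : 0 < K' by rewrite addr_gt0// !mulr_gt0.
exists (K1 + 2 * a * K1 + 4 * K'); first by rewrite !addr_gt0// !mulr_gt0.
split.
  move=> x; rewrite (le_trans (eD x))// ler_wpM2r ?expR_ge0// lerDl mulr_ge0// ltW//.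
move=> h /andP[h0 h1].
pose F x := (x%:c + 0) * gau (x%:c + 0).
have eh := expdom_shift (ltW h0) (ltW K10) e1.
pose r x := gau (x%:c + 0 + h%:c) - gau (x%:c + 0) * (1 - 2 * A * (x%:c + 0) * h%:c).
pose r2 x := (- (2 * A * h%:c ^+ 2)) * F x + (x%:c + 0 + h%:c) * r x.
have nh : nrm (h%:c : C) = h by rewrite nrm_real gtr0_norm.
have hr x : nrm (r x) <= K * h ^+ 2 * expR (- (2 * `|x|)).
  by have := hK 0 h%:c x nrm00; rewrite nh => /(_ h1).
have hr2 : expdom r2 (K' * h ^+ 2).
  move=> x; rewrite (le_trans (nrmD _ _))//.
  have -> : K' * h ^+ 2 * expR (- `|x|) = (2 * a * h ^+ 2) * (K1 * expR (- `|x|)) + K * h ^+ 2 * expR (- `|x|).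
    by rewrite /K'; ring.
  rewrite lerD//.
    have -> : 2 * a * h ^+ 2 = nrm (- (2 * A * h%:c ^+ 2)) by rewrite nrmN nrmM nrmX nh nrmM nrm_nat.
    rewrite nrmM; apply: ler_wpM2l; [exact: nrm_ge0 | exact: e1].
  have -> : - `|x| = `|x| + (- (2 * `|x|)) by ring.
  rewrite expRD nrmM mulrCA; apply: ler_pM; rewrite ?nrm_ge0//.
  rewrite addr0 (le_trans (nrmD _ _))// nh nrm_real (le_trans _ (expR_ge1Dx _))//; lra.
have z1 : grid h (fun x => F (x + h) - F x) = 0.
  rewrite (gridB h0 _ _ eh e1) ?mulr_ge0 ?expR_ge0 ?(ltW K10)//.
  by rewrite (grid_shift h0 (ltW K10) e1) subrr.
have eq : (fun x => F (x + h) - F x) = (fun x => h%:c * scale_density x + r2 x).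
  apply/funext => x; rewrite /F /r2 /r /scale_density /F rmorphD /=.
  have -> : x%:c + h%:c + 0 = x%:c + 0 + h%:c by ring.
  ring.
move: z1; rewrite eq.
have q1 : 0 <= K' * h ^+ 2 by exact: (mulr_ge0 (ltW K'0) (sqr_ge0 _)).
have q2 : 0 <= K1 + 2 * a * K1 by rewrite addr_ge0// ?mulr_ge0// ltW.
have q3 : 0 <= h * (K1 + 2 * a * K1) by rewrite mulr_ge0// ltW.
have eZ := expdomZ h%:c eD; rewrite nh in eZ.
rewrite (gridD h0 q3 q1 eZ hr2) (gridZ _ h0 q2 eD) => /eqP; rewrite addr_eq0 => /eqP /(congr1 (@nrm R)).
rewrite nrmM nh nrmN => E.
have := grid_le h0 q1 hr2; rewrite -E => H.
have : 2 * (K' * h ^+ 2) * (1 + h) <= 2 * (K' * h ^+ 2) * 2.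
  apply: ler_wpM2l; last lra.
  by apply: mulr_ge0.
move=> H2; rewrite -(ler_pM2l h0) (le_trans H)// (le_trans H2)//.
have := mulr_ge0 (sqr_ge0 h) q2; rewrite expr2; lra.
Qed.

Lemma rsum_step : exists e0 K, [/\ 0 < e0, 0 < K & forall e h, 0 <= e <= e0 -> 0 < h <= 1 ->
  nrm (rsum ((1 + e) * h) 0 - rsum h 0) <= K * e * h + K * e ^+ 2].
Proof.
have [K1 K10 [eD hD]] := rsum_density.
have [K0 K00 hK0] := gau_expdom A0 (lexx 0).
have [g0 _ _] := hK0 0 nrm00.
pose rho := Re A.
pose e0 := Num.min 1 (rho / (6 * a)).
have e00 : 0 < e0 by rewrite lt_min ltr01 divr_gt0// mulr_gt0.
pose K2 := (36 * a ^+ 2 + 4 * a) * expR (25 / (2 * rho)).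
have K20 : 0 < K2 by rewrite mulr_gt0 ?expR_gt0// addr_gt0// mulr_gt0// exprn_gt0.
exists e0, (K1 + 4 * K2); split => //; first by rewrite addr_gt0// mulr_gt0.
move=> e h /andP[e_ge0]; rewrite /e0 le_min => /andP[e1 e2] /andP[h0 h1].
pose r x : C := (1 + e%:c) * gau (((1 + e) * x)%:c) - gau (x%:c + 0) - e%:c * scale_density x.
have hr : expdom r (K2 * e ^+ 2).
  move=> x.
  pose w := - (A * (x%:c ^+ 2 * (2 * e%:c + e%:c ^+ 2))).
  have gE : gau (((1 + e) * x)%:c) = gau (x%:c + 0) * cexp w.
    rewrite /gau -cexpD; congr cexp; rewrite /w rmorphM rmorphD rmorph1 /=; ring.
  have -> : r x = gau (x%:c + 0) *
     ((1 + e%:c) * (cexp w - 1 - w) - A * (e%:c ^+ 2 * x%:c ^+ 2) + e%:c * w).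
    rewrite /r gE /scale_density /w; ring.
  have ne : nrm (e%:c : C) = e by rewrite nrm_real ger0_norm.
  have nx2 : nrm (x%:c ^+ 2 : C) = x ^+ 2 by rewrite nrmX nrm_real real_normK ?num_real.
  have e_2 : e ^+ 2 <= e by rewrite expr2 ler_piMl.
  have hw : nrm w <= 3 * a * e * x ^+ 2.
    rewrite nrmN 2!nrmM nx2 -/a.
    have : nrm (2 * e%:c + e%:c ^+ 2 : C) <= 3 * e.
      by rewrite (le_trans (nrmD _ _))// nrmM nrm_nat nrmX ne; lra.
    move=> /(ler_wpM2l (mulr_ge0 (ltW a_gt0) (sqr_ge0 x))); lra.
  have aex : 3 * a * e * x ^+ 2 <= rho / 2 * x ^+ 2.
    rewrite ler_wpM2r ?sqr_ge0//.
    have : e * (6 * a) <= rho by rewrite -ler_pdivlMr ?mulr_gt0.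
    lra.
  have q1 : nrm (cexp w - 1 - w) <= 18 * a ^+ 2 * e ^+ 2 * (x ^+ 2) ^+ 2 * expR (rho / 2 * x ^+ 2).
    rewrite (le_trans (cexp_sub1_quad w))//.
    apply: ler_pM; rewrite ?expR_ge0 ?ler_expR ?(le_trans hw)//.
      by rewrite mulr_ge0// exprn_ge0// nrm_ge0.
    have -> : 18 * a ^+ 2 * e ^+ 2 * (x ^+ 2) ^+ 2 = 2 * (3 * a * e * x ^+ 2) ^+ 2 by ring.
    by rewrite ler_pM2l// lerXn2r ?nnegrE ?nrm_ge0// (le_trans (nrm_ge0 w)).
  have q2 : nrm (A * (e%:c ^+ 2 * x%:c ^+ 2)) <= a * e ^+ 2 * x ^+ 2.
    by rewrite 2!nrmM nx2 nrmX ne -/a mulrA.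
  have q3 : nrm (e%:c * w) <= 3 * a * e ^+ 2 * x ^+ 2.
    rewrite nrmM ne (le_trans (ler_wpM2l e_ge0 hw))// le_eqVlt; apply/orP; left; apply/eqP; ring.
  have q4 : nrm (1 + e%:c : C) <= 2 by rewrite (le_trans (nrmD _ _))// nrm1 ne; lra.
  have X1 : x ^+ 2 <= expR (4 * `|x|).
    rewrite -[x ^+ 2]real_normK ?num_real//.
    apply: (le_trans (y := (1 + `|x|) ^+ 2)); first by rewrite ler_pXn2r ?nnegrE ?addr_ge0// lerDr.
    rewrite (le_trans (oneDx_sqr_le x))// ler_expR ler_wpM2r// ler_nat//.
  have X2 : (x ^+ 2) ^+ 2 <= expR (4 * `|x|).
    have -> : expR (4 * `|x|) = expR (2 * `|x|) ^+ 2.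
      by rewrite -expRM_natl; congr expR; ring.
    rewrite ler_pXn2r ?nnegrE ?sqr_ge0 ?expR_ge0//.
    rewrite -[x ^+ 2]real_normK ?num_real//.
    apply: (le_trans (y := (1 + `|x|) ^+ 2)); first by rewrite ler_pXn2r ?nnegrE ?addr_ge0// lerDr.
    exact: oneDx_sqr_le.
  have E1 : 1 <= expR (rho / 2 * x ^+ 2).
    by rewrite -[leLHS]expR0 ler_expR mulr_ge0 ?sqr_ge0// divr_ge0// ltW.
  set E := expR (rho / 2 * x ^+ 2) in q1 E1 *.
  set X := expR (4 * `|x|) in X1 X2.
  have X0 : 0 <= X by exact: expR_ge0.
  have bound : nrm ((1 + e%:c) * (cexp w - 1 - w) - A * (e%:c ^+ 2 * x%:c ^+ 2) + e%:c * w) <=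
     (36 * a ^+ 2 + 4 * a) * e ^+ 2 * (X * E).
    rewrite (le_trans (nrmD _ _))//.
    have b1 : nrm ((1 + e%:c) * (cexp w - 1 - w)) <= 36 * a ^+ 2 * e ^+ 2 * (X * E).
      rewrite nrmM (le_trans (ler_pM (nrm_ge0 _) (nrm_ge0 _) q4 q1))//.
      have -> : 2 * (18 * a ^+ 2 * e ^+ 2 * (x ^+ 2) ^+ 2 * E) = (36 * a ^+ 2 * e ^+ 2) * ((x ^+ 2) ^+ 2 * E) by ring.
      apply: ler_wpM2l; first by rewrite mulr_ge0 ?sqr_ge0// mulr_ge0 ?sqr_ge0.
      by rewrite ler_wpM2r// (le_trans ler01).
    have b2 : x ^+ 2 <= X * E by rewrite (le_trans X1)// ler_peMr.
    have ae : 0 <= a * e ^+ 2 by rewrite mulr_ge0 ?sqr_ge0// ltW.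
    have b3 := ler_wpM2l ae b2.
    have b4 := nrmB ((1 + e%:c) * (cexp w - 1 - w)) (A * (e%:c ^+ 2 * x%:c ^+ 2)).
    lra.
  rewrite nrmM (le_trans (ler_wpM2l (nrm_ge0 _) bound))//.
  have -> : nrm (gau (x%:c + 0)) = expR (- (rho * x ^+ 2)).
    rewrite nrm_cexp addr0 ReN; congr (expR (- _)).
    by rewrite -rmorphXn mulrC Re_realM mulrC.
  have -> : expR (- (rho * x ^+ 2)) * ((36 * a ^+ 2 + 4 * a) * e ^+ 2 * (X * E)) =
    (36 * a ^+ 2 + 4 * a) * e ^+ 2 * (expR (- (rho * x ^+ 2) + 4 * `|x| + rho / 2 * x ^+ 2)).
    by rewrite !expRD /X /E; ring.
  have -> : K2 * e ^+ 2 * expR (- `|x|) = (36 * a ^+ 2 + 4 * a) * e ^+ 2 * expR (25 / (2 * rho) - `|x|).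
    by rewrite expRD /K2; ring.
  apply: ler_wpM2l.
    by rewrite mulr_ge0 ?sqr_ge0// addr_ge0// ?mulr_ge0 ?(ltW a_gt0).
  rewrite ler_expR.
  have r0 : 0 < rho / 2 by rewrite divr_gt0.
  have := quad_max 5 `|x| r0; rewrite real_normK ?num_real//.
  have -> : 5 ^+ 2 / (4 * (rho / 2)) = 25 / (2 * rho) :> R.
    by field; exact: lt0r_neq0.
  lra.
have q1 : 0 <= K2 * e ^+ 2 by exact: (mulr_ge0 (ltW K20) (sqr_ge0 _)).
have -> : rsum ((1 + e) * h) 0 - rsum h 0 = grid h r + e%:c * grid h scale_density.
  have eZ := expdomZ e%:c eD.
  have q2 : 0 <= nrm (e%:c : C) * K1 by rewrite mulr_ge0 ?nrm_ge0// ltW.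
  rewrite -(gridZ _ h0 (ltW K10) eD) -(gridD h0 q1 q2 hr eZ).
  have -> : rsum ((1 + e) * h) 0 = grid h (fun x => (r x + e%:c * scale_density x) + gau (x%:c + 0)).
    rewrite /rsum /grid.
    have -> : ((1 + e) * h)%:c = h%:c * (1 + e%:c) :> C by rewrite rmorphM rmorphD rmorph1 mulrC.
    rewrite -mulrA; congr (_ * _).
    have e10 : 0 < (1 + e) * h by rewrite mulr_gt0// ltr_wpDr.
    rewrite -(zsZ _ (grid_summable e10 (ltW K00) g0)).
    apply: eq_zs => n; rewrite /r !addr0 mulrA; ring.
  have hs := expdomD hr eZ.
  rewrite (gridD h0 _ (ltW K00) hs g0) ?addr_ge0//.
  by rewrite /rsum addrK.
rewrite (le_trans (nrmD _ _))//.
have k1 := grid_le h0 q1 hr.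
have k2 : nrm (e%:c * grid h scale_density) <= e * (K1 * h).
  by rewrite nrmM nrm_real ger0_norm// ler_wpM2l// hD// h0 h1.
have k3 : 2 * (K2 * e ^+ 2) * (1 + h) <= 2 * (K2 * e ^+ 2) * 2.
  by apply: ler_wpM2l; [apply: mulr_ge0 | lra].
have k4 : 0 <= K2 * e * h by rewrite mulr_ge0 ?(ltW h0)// mulr_ge0// ltW.
have k5 : 0 <= K1 * e ^+ 2 by exact: (mulr_ge0 (ltW K10) (sqr_ge0 _)).
lra.
Qed.

Lemma rsum_scale (L : R) : 1 <= L -> exists2 K, 0 < K & forall l h, 0 < h -> L * h <= 1 -> 1 <= l <= L ->
  nrm (rsum (l * h) 0 - rsum h 0) <= K * h.
Proof.
move=> L1; have L0 : 0 < L by rewrite (lt_le_trans ltr01).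
have [e0 [K [e00 K0 hK]]] := rsum_step.
exists (K * L * L); first by rewrite !mulr_gt0.
move=> l h h0 Lh /andP[l1 lL].
apply: (@le_limN _ _ _ (K * L ^+ 2) (Num.bound (L / e0))) => M hM M0.
have MR : 0 < M%:R :> R by rewrite ltr0n.
have LM : L / M%:R <= e0.
  rewrite ler_pdivrMr// mulrC -ler_pdivrMr//.
  have Le : 0 <= L / e0 by rewrite divr_ge0// ltW.
  by apply: (le_trans (ltW (archi_boundP Le))); rewrite ler_nat.
pose s := (l - 1) / M%:R.
have s0 : 0 <= s by rewrite divr_ge0 ?subr_ge0// ltW.
pose mu j : R := 1 + j%:R * s.
have sM : M%:R * s = l - 1 by rewrite /s mulrC divfK// gt_eqF.
have mu1 j : 1 <= mu j by rewrite lerDl mulr_ge0.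
have muL j : (j <= M)%N -> mu j <= L.
  move=> jM; have : j%:R * s <= M%:R * s by rewrite ler_wpM2r// ler_nat.
  rewrite sM /mu; lra.
pose T := K * L * L * h / M%:R + K * L ^+ 2 / M%:R ^+ 2.
have path j : (j <= M)%N -> nrm (rsum (mu j * h) 0 - rsum h 0) <=
   j%:R * T.
  elim: j => [|j IH] jM; first by rewrite /mu !mul0r addr0 mul1r subrr nrm0.
  have mj0 : 0 < mu j by rewrite (lt_le_trans ltr01).
  pose e := s / mu j.
  have eE : mu j.+1 * h = (1 + e) * (mu j * h).
    by rewrite /mu -natr1 /e /mu; field; exact: lt0r_neq0.
  have he : 0 <= e <= L / M%:R.
    rewrite divr_ge0 ?(ltW mj0)//= /e (le_trans (y := s))//.
      by rewrite ler_pdivrMr// ler_peMr.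
    rewrite /s ler_wpM2r ?invr_ge0 ?(ltW MR)//; lra.
  have /andP[he0 he1] := he.
  have he2 : 0 <= e <= e0 by rewrite he0 (le_trans he1).
  have mjh : 0 < mu j * h <= 1.
    rewrite mulr_gt0//= (le_trans _ Lh)// ler_wpM2r ?(ltW h0)// muL// ltnW//.
  have -> : rsum (mu j.+1 * h) 0 - rsum h 0 =
    (rsum (mu j.+1 * h) 0 - rsum (mu j * h) 0) + (rsum (mu j * h) 0 - rsum h 0) by ring.
  rewrite (le_trans (nrmD _ _))//.
  have -> : j.+1%:R * T = T + j%:R * T by rewrite -natr1; ring.
  rewrite lerD ?IH ?(ltnW jM)// /T.
  rewrite eE (le_trans (hK _ _ he2 mjh))// lerD//.
    have -> : K * L * L * h / M%:R = K * (L / M%:R) * (L * h) by ring.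
    apply: ler_pM.
    - by apply: mulr_ge0 he0; exact: ltW.
    - by apply: mulr_ge0; exact: ltW.
    - by rewrite ler_pM2l.
    - by rewrite ler_wpM2r ?(ltW h0)// muL// ltnW.
  have -> : K * L ^+ 2 / M%:R ^+ 2 = K * (L / M%:R) ^+ 2 by rewrite exprMn exprVn; ring.
  by rewrite ler_pM2l// lerXn2r ?nnegrE// (le_trans he0).
have := path M (leqnn _).
have -> : mu M = l by rewrite /mu sM; ring.
move=> /le_trans; apply.
rewrite le_eqVlt; apply/orP; left; apply/eqP; rewrite /T; field; exact: lt0r_neq0.
Qed.

(** The Gaussian integral, as the limit of the Riemann sums over dyadic steps. *)
Definition kap : C := xget 0 [set l | tends (fun i => rsum (2 ^- i) 0) l].

Lemma halfX_le (i : nat) : (2 ^- i : R) <= i.+1%:R^-1.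
Proof.
by rewrite lef_pV2 ?posrE ?exprn_gt0// -natrX ler_nat ltn_expl.
Qed.

Lemma kap_dyadic : tends (fun i => rsum (2 ^- i) 0) kap.
Proof.
suff [l hl] : exists l, tends (fun i => rsum (2 ^- i) 0) l.
  by rewrite /kap; case: xgetP => [y _|/(_ l)/(_ hl)].
have [K K0 hK] := @rsum_scale 2 (ler1n _ 2).
pose u i := rsum (2 ^- i.+1) 0 - rsum (2 ^- i) 0.
have hu i : nrm (u i) <= K * (2^-1) ^+ i.
  rewrite /u nrmBC.
  have e : 2 ^- i = 2 * 2 ^- i.+1 :> R by rewrite [in RHS]exprS invfM mulrA mulfV ?mul1r ?pnatr_eq0.
  have p : 0 < 2 ^- i.+1 :> R by rewrite invr_gt0 exprn_gt0.
  have p1 : 2 * 2 ^- i.+1 <= 1 :> R by rewrite -e invf_le1 ?exprn_gt0// exprn_ege1// ler1n.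
  rewrite {1}e (le_trans (hK 2 _ p p1 _)) ?lexx ?ler1n// ler_pM2l// exprVn e.
  by rewrite ler_peMl ?(ltW p)// ler1n.
have [] := abs_series hu (geometric_sums_bounded _ (ltW K0)).
  by rewrite invr_ge0 ler0n/= invf_lt1// ltr1n.
move=> l hl; exists (rsum 1 0 + l).
have := tendsD (tends_cst (rsum 1 0)) hl; apply: tends_ext => n.
elim: n => [|n IH]; first by rewrite big_nil addr0 expr0 invr1.
by rewrite big_nat_recr//= addrA IH /u; ring.
Qed.

Lemma kapP (c : R) b : 0 < c -> tends (fun i => rsum (c * 2 ^- i) b) kap.
Proof.
move=> c0.
pose L := Num.max c c^-1.
have L1 : 1 <= L.
  rewrite le_max; have [h|h] := leP 1 c; first by [].
  by rewrite invf_ge1// ltW.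
have cL : c <= L by rewrite le_max lexx.
have ciL : c^-1 <= L by rewrite le_max lexx orbT.
have L0 : 0 < L by rewrite (lt_le_trans ltr01).
have [K K0 hK] := rsum_scale L1.
have [K2 K20 hK2] := rsum_displace A0 (nrm_ge0 b).
have main : tends (fun i => rsum (c * 2 ^- i) b - rsum (2 ^- i) 0) 0.
  apply: (@tends_squeeze_near _ _ (K2 * L + K * L) (Num.bound (L * L))) => n hn.
  have p : 0 < 2 ^- n :> R by rewrite invr_gt0 exprn_gt0.
  have LL : L * L * 2 ^- n <= 1.
    have LL0 : 0 <= L * L by rewrite mulr_ge0// ltW.
    rewrite ler_pdivrMr ?exprn_gt0// mul1r; apply: (le_trans (ltW (archi_boundP LL0))).
    by rewrite -natrX ler_nat (leq_trans hn)// ltnW// ltn_expl.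
  have Ln : L * 2 ^- n <= 1.
    by rewrite (le_trans _ LL)// ler_wpM2r ?(ltW p)// ler_peMl// ltW.
  have cn1 : c * 2 ^- n <= 1 by rewrite (le_trans _ Ln)// ler_wpM2r// ltW.
  have cn0 : 0 < c * 2 ^- n by rewrite mulr_gt0.
  rewrite subr0.
  have -> : rsum (c * 2 ^- n) b - rsum (2 ^- n) 0 =
    (rsum (c * 2 ^- n) b - rsum (c * 2 ^- n) 0) + (rsum (c * 2 ^- n) 0 - rsum (2 ^- n) 0) by ring.
  rewrite (le_trans (nrmD _ _))// (le_trans (y := (K2 * L + K * L) * 2 ^- n))//; last first.
    by rewrite ler_wpM2l ?halfX_le// addr_ge0// mulr_ge0// ltW.
  rewrite mulrDl lerD//.
    rewrite (le_trans (hK2 b _ (lexx _) _)) ?cn0 ?cn1//.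
    by rewrite -mulrA ler_pM2l// ler_wpM2r// ltW.
  have [h1|h1] := leP 1 c.
    rewrite (le_trans (hK c _ p Ln _)) ?h1 ?cL// -mulrA ler_pM2l//.
    by rewrite ler_peMl// ltW.
  rewrite nrmBC.
  have {1}-> : 2 ^- n = c^-1 * (c * 2 ^- n) :> R by rewrite mulrA mulVf ?mul1r// gt_eqF.
  rewrite (le_trans (hK c^-1 _ cn0 _ _))//.
  - by rewrite (le_trans _ LL)// -[leRHS]mulrA ler_pM2l// ler_wpM2r// ltW.
  - by rewrite ciL andbT invf_ge1// ltW.
  - by rewrite -mulrA ler_pM2l// ler_wpM2r// ltW.
have := tendsD main kap_dyadic; rewrite add0r; apply: tends_ext => n; ring.
Qed.

End FixedA.

Lemma kap_scale A (l : R) : 0 < Re A -> 0 < l -> kap ((l ^+ 2)%:c * A) = (l^-1)%:c * kap A.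
Proof.
move=> A0 l0.
have A1 : 0 < Re ((l ^+ 2)%:c * A) by rewrite Re_realM mulr_gt0// exprn_gt0.
apply: tends_unique (kap_dyadic A1) _.
have := tendsZ (l^-1)%:c (kapP A0 0 l0); apply: tends_ext => i.
rewrite /rsum /grid mulrA -rmorphM mulrA mulVf ?gt_eqF// mul1r; congr (_ * _).
apply: eq_zs => n; rewrite /gau; congr (cexp (- _)).
rewrite !addr0 rmorphXn !rmorphM /=; ring.
Qed.

End Scale.

End GaussianScaling.
Import GaussianScaling.

(** * Poisson summation for Gaussians *)

Module PoissonSummation.

Lemma eq_leq_R (R : realType) (x y : R) : x = y -> x <= y.
Proof. by move=> ->. Qed.

Section PoissonGaussian.
Variable R : realType.
Local Notation C := (R[i]%C).
Implicit Types (x y h B : R) (b d z : C).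

Lemma Re_inv_gt0 (A : C) : 0 < Re A -> 0 < Re A^-1.
Proof.
move=> A0; have An0 : A != 0 by apply/eqP => e; rewrite e ltxx in A0.
have h : Re A^-1 = Re A / nrm A ^+ 2.
  by rewrite nrm_sqr; case: A A0 An0 => p q.
by rewrite h divr_gt0// exprn_gt0// nrm_gt0.
Qed.

Lemma invsq_sums_bounded (K : R) : 0 <= K -> sums_bounded (fun k => K / k.+1%:R ^+ 2).
Proof.
move=> K0; exists (K * 2) => n; rewrite -mulr_sumr ler_wpM2l//.
suff H m : \sum_(0 <= k < m.+1) (k.+1%:R ^+ 2)^-1 <= 2 - m.+1%:R^-1 :> R.
  case: n => [|n]; first by rewrite big_nil.
  by rewrite (le_trans (H n))// gerBl invr_ge0.
elim: m => [|m IH]; first by rewrite big_nat1 expr1n invr1; lra.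
rewrite big_nat_recr//= (le_trans (lerD IH (lexx _)))//.
have a0 : 0 < m.+1%:R :> R by rewrite ltr0n.
have e : m.+2%:R = m.+1%:R + 1 :> R by rewrite natr1.
rewrite e; set a := m.+1%:R in a0 *.
have -> : 2 - (a + 1)^-1 = 2 - a^-1 + (a * (a + 1))^-1 by field; lra.
by rewrite lerD2l lef_pV2 ?posrE; nra.
Qed.

Section FixedA.
Variable A : C.
Hypothesis A0 : 0 < Re A.
Local Notation gau := (gau A).
Local Notation rsum := (rsum A).
Let An0 : A != 0. Proof. by move: A0; apply: contraTneq => ->; rewrite ltxx. Qed.

Definition dgau (k : int) : C := cexp (- ((pi ^+ 2 * k%:~R ^+ 2)%:c / A)).
Definition dual_shift (k : int) : C := (0 +i* (pi * k%:~R))%C / A.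

Lemma gau_eu (k : int) x : gau x%:c * eu (- (k%:~R * x)) = dgau k * gau (x%:c + dual_shift k).
Proof.
rewrite /gau /eu /dgau -!cexpD; congr cexp.
pose I : C := (0 +i* 1)%C.
have I2 : I ^+ 2 = -1 by exact: sqr_i.
have e1 y : (0 +i* y)%C = I * y%:c :> C by apply: eqC; rewrite ?ReM ?ImM /=; ring.
rewrite /dual_shift !e1 !(rmorphM, rmorphN, rmorphXn, rmorph_nat) /=.
set p := (pi : R)%:c; set q := (k%:~R : R)%:c; set X := x%:c.
have -> : - (A * (X + I * (p * q) / A) ^+ 2) =
   - (A * X ^+ 2) - 2 * I * p * q * X - I ^+ 2 * (p * q) ^+ 2 / A by field.
rewrite I2; field; exact: An0.
Qed.

Definition fcoef h (k : int) : C := grid h (fun x => gau x%:c * eu (- (k%:~R * x))).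

Let gau0 : exists2 K, 0 < K & forall k : int, expdom (fun x => gau x%:c * eu (- (k%:~R * x))) K.
Proof.
have [K K0 hK] := gau_expdom A0 (lexx 0); exists K => // k x.
have n00 : nrm (0 : C) <= 0 by rewrite nrm0.
have [e _ _] := hK 0 n00.
by have := e x; rewrite addr0 nrmM nrm_eu mulr1.
Qed.

Lemma fcoefE h (k : int) : 0 < h -> fcoef h k = dgau k * rsum h (dual_shift k).
Proof.
move=> h0; have [K K0 hK] := gau_expdom A0 (nrm_ge0 (dual_shift k)).
have [e _ _] := hK _ (lexx _).
rewrite /rsum -(gridZ _ h0 (ltW K0) e) /fcoef; congr grid; apply/funext => x.
exact: gau_eu.
Qed.

(** Two summations by parts: the discrete Fourier coefficients decay quadratically,
    uniformly in the step. *)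
Lemma fcoef_decay : exists2 K, 0 < K & forall h (k : int), 0 < h <= 1 -> `|k%:~R * h| <= 1 / 2 ->
  nrm (fcoef h k) <= K /\ nrm (fcoef h k) * k%:~R ^+ 2 <= K.
Proof.
have [K1 K10 hK1] := gau0.
have [K K0 hK] := gau_taylor A0 (lexx 0).
have [c c0 hc] := @eu_sub1_ge R.
exists (4 * K1 + 8 * K / c ^+ 2); first by rewrite addr_gt0 ?divr_gt0 ?mulr_gt0.
move=> h k /andP[h0 h1] hk.
have P1 : nrm (fcoef h k) <= 4 * K1.
  rewrite (le_trans (grid_le h0 (ltW K10) (hK1 k)))//.
  have : K1 * h <= K1 by rewrite ler_piMr// ltW.
  lra.
have P0 : 0 < 8 * K / c ^+ 2 by rewrite divr_gt0 ?mulr_gt0.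
split; first lra.
pose F x := gau x%:c.
pose E x := eu (- (k%:~R * x)) : C.
pose D x := (F (x + h) + F (x - h) - 2 * F x) * E x.
have nh : nrm (h%:c : C) = h by rewrite nrm_real gtr0_norm.
have nmh : nrm (- h%:c : C) = h by rewrite nrmN.
have hD : expdom D (2 * K * h ^+ 2).
  move=> x; rewrite nrmM nrm_eu mulr1.
  have n00 : nrm (0 : C) <= 0 by rewrite nrm0.
  have := hK 0 h%:c x n00; rewrite nh => /(_ h1).
  have := hK 0 (- h%:c) x n00; rewrite nmh => /(_ h1).
  rewrite addr0 => d1 d2.
  have -> : F (x + h) + F (x - h) - 2 * F x =
    (gau (x%:c + h%:c) - gau x%:c * (1 - 2 * A * x%:c * h%:c)) +
    (gau (x%:c - h%:c) - gau x%:c * (1 - 2 * A * x%:c * - h%:c)).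
    by rewrite /F rmorphB rmorphD /=; ring.
  rewrite (le_trans (nrmD _ _))// (le_trans (lerD d2 d1))//.
  have -> : K * h ^+ 2 * expR (- (2 * `|x|)) + K * h ^+ 2 * expR (- (2 * `|x|)) = 2 * K * h ^+ 2 * expR (- (2 * `|x|)) by ring.
  apply: ler_wpM2l.
    by apply: mulr_ge0 (sqr_ge0 _); apply: mulr_ge0 => //; exact: ltW.
  by rewrite ler_expR lerN2 ler_peMl// ler1n.
have q0 : 0 <= 2 * K * h ^+ 2.
  by apply: mulr_ge0 (sqr_ge0 _); apply: mulr_ge0 => //; exact: ltW.
pose G x := F x * E x.
have eG : expdom G K1 by exact: hK1.
have eGp := expdom_shift (ltW h0) (ltW K10) eG.
have eGm : expdom (fun x => G (x - h)) (K1 * expR h).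
  move=> x; rewrite (le_trans (eG _))// -mulrA ler_wpM2l ?(ltW K10)// -expRD ler_expR.
  have := ler_normD (x - h) h; rewrite subrK (ger0_norm (ltW h0)); lra.
have K1h : 0 <= K1 * expR h by rewrite mulr_ge0 ?expR_ge0 ?(ltW K10).
have Gm : grid h (fun x => G (x - h)) = grid h G.
  rewrite -(grid_shift h0 K1h eGm); congr grid; apply/funext => x; by rewrite addrK.
have DE : grid h D = (eu (k%:~R * h) + eu (- (k%:~R * h)) - 2) * grid h G.
  have -> : D = (fun x => (eu (k%:~R * h) * G (x + h) + eu (- (k%:~R * h)) * G (x - h)) - 2 * G x).
    apply/funext => x; rewrite /D /G /E.
    have -> : - (k%:~R * (x + h)) = - (k%:~R * x) + - (k%:~R * h) by ring.
    have -> : - (k%:~R * (x - h)) = - (k%:~R * x) + (k%:~R * h) by ring.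
    rewrite !euD (euN (k%:~R * h)).
    have := eu_neq0 (k%:~R * h); set u := eu (k%:~R * h) => u0.
    by field.
  have z1 (z : C) : 0 <= nrm z * (K1 * expR h) by rewrite mulr_ge0 ?nrm_ge0.
  have z2 (z : C) : 0 <= nrm z * K1 by rewrite mulr_ge0 ?nrm_ge0// ltW.
  have ep := expdomZ (eu (k%:~R * h)) eGp; have em := expdomZ (eu (- (k%:~R * h))) eGm.
  rewrite (gridB h0 (addr_ge0 (z1 _) (z1 _)) (z2 _) (expdomD ep em) (expdomZ 2 eG)).
  rewrite (gridD h0 (z1 _) (z1 _) ep em).
  rewrite (gridZ _ h0 K1h eGp) (gridZ _ h0 K1h eGm) (gridZ _ h0 (ltW K10) eG).
  by rewrite Gm (grid_shift h0 (ltW K10) eG); ring.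
have := grid_le h0 q0 hD; rewrite DE.
have -> : eu (k%:~R * h) + eu (- (k%:~R * h)) - 2 = (eu (k%:~R * h) - 1) ^+ 2 * eu (- (k%:~R * h)).
  by rewrite euN; have := eu_neq0 (k%:~R * h); set u := eu (k%:~R * h) => u0; field.
rewrite nrmM nrmM nrm_eu mulr1 nrmX -/(fcoef h k).
set f := nrm (fcoef h k) in P1 *.
have f0 : 0 <= f by exact: nrm_ge0.
have H1 : 2 * (2 * K * h ^+ 2) * (1 + h) <= 8 * K * h ^+ 2.
  have : 2 * (2 * K * h ^+ 2) * (1 + h) <= 2 * (2 * K * h ^+ 2) * 2.
    by apply: ler_wpM2l; [apply: mulr_ge0 | lra].
  lra.
move=> /le_trans/(_ H1).
have H2 : (c * `|k%:~R * h|) ^+ 2 <= nrm (eu (k%:~R * h) - 1) ^+ 2.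
  by rewrite lerXn2r ?nnegrE ?nrm_ge0 ?mulr_ge0 ?(ltW c0)// hc.
move=> H3; have := le_trans (ler_wpM2r f0 H2) H3.
rewrite exprMn real_normK ?num_real// exprMn => H4.
have h2 : 0 < h ^+ 2 by rewrite exprn_gt0.
have : c ^+ 2 * (f * k%:~R ^+ 2) <= 8 * K by rewrite -(ler_pM2r h2); lra.
rewrite mulrC -ler_pdivlMr ?exprn_gt0//; lra.
Qed.

(** The finite Poisson formula, i.e. discrete Fourier inversion on the grid of step [1/N]. *)
Lemma finite_poisson (P j : nat) : (0 < P)%N -> (j < P + P)%N ->
  zs (fun n : int => gau (n%:~R + j%:R / (P + P)%:R)%:c) =
  wsum (fun k => fcoef (P + P)%:R^-1 k * eu (k%:~R * (j%:R / (P + P)%:R))) P.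
Proof.
move=> P0 jN; set N := (P + P)%N.
have N0 : (0 < N)%N by rewrite addn_gt0 P0.
have NR : 0 < N%:R :> R by rewrite ltr0n.
have Nn : N%:R != 0 :> R by rewrite gt_eqF.
have h0 : 0 < N%:R^-1 :> R by rewrite invr_gt0.
have [K1 K10 hK1] := gau0.
pose w (i : nat) : int := i%:Z - P%:Z.
pose t (n : int) : C := gau (N%:R^-1 * n%:~R)%:c * (if (N %| `|j%:Z - n|)%N then 1 else 0).
have zdg : zdom (fun n : int => gau (N%:R^-1 * n%:~R)%:c) (fun k => K1 * expR (- N%:R^-1) ^+ k).
  have := grid_zdom h0 (ltW K10) (hK1 0).
  have -> : (fun n : int => gau (N%:R^-1 * n%:~R)%:c * eu (- (0%:~R * (N%:R^-1 * n%:~R)))) =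
    (fun n : int => gau (N%:R^-1 * n%:~R)%:c); last by [].
  by apply/funext => n; rewrite mul0r oppr0 eu0 mulr1.
have zdt : zdom t (fun k => K1 * expR (- N%:R^-1) ^+ k).
  move: zdg => [d1 d2 d3]; split=> // n; rewrite (le_trans _ (d1 n))// nrmM.
  by rewrite ler_piMr ?nrm_ge0//; case: ifP; rewrite ?nrm1 ?nrm0.
transitivity (zs t).
  symmetry.
  rewrite (@zcv_split _ t N (fun s => if s == j then zs (fun n : int => gau (n%:~R + j%:R / N%:R)%:c) else 0)
    _ N0 (zsP (zdom_summable zdt))).
    rewrite big_mkord (bigD1 (Ordinal jN))//= eqxx big1 ?addr0// => i hi.
    case: eqP => // e; move: hi; rewrite -val_eqE/= e eqxx//.
  move=> s sN; case: eqP => [->|sj].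
    have -> : (fun l : int => t (l * N%:Z + j%:Z)) = (fun n : int => gau (n%:~R + j%:R / N%:R)%:c).
      apply/funext => l; rewrite /t.
      have -> : j%:Z - (l * N%:Z + j%:Z) = - (l * N%:Z) by ring.
      rewrite abszN abszM dvdn_mull// mulr1; congr (gau _%:c).
      by rewrite intrD intrM -[N%:Z%:~R]/(N%:R) -[j%:Z%:~R]/(j%:R); field.
    apply: zsP.
    have [K K0 hK] := gau_expdom A0 (nrm_ge0 (j%:R / N%:R)%:c).
    have [e _ _] := hK _ (lexx _).
    have := grid_summable ltr01 (ltW K0) e.
    have -> // : (fun n : int => gau ((1 * n%:~R)%:c + (j%:R / N%:R)%:c)) = (fun n : int => gau (n%:~R + j%:R / N%:R)%:c).
    by apply/funext => n; rewrite mul1r -rmorphD.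
  have -> : (fun l : int => t (l * N%:Z + s%:Z)) = (fun=> 0).
    apply/funext => l; rewrite /t; case: ifP => [|_]; last by rewrite mulr0.
    move=> hd; exfalso; apply: sj.
    have : (N %| `|j%:Z - s%:Z|)%N.
      have [q hq] : exists q : int, j%:Z - (l * N%:Z + s%:Z) = q * N%:Z.
        by exists (intdiv.divz (j%:Z - (l * N%:Z + s%:Z)) N%:Z); rewrite intdiv.divzK// intdiv.dvdzE.
      have -> : j%:Z - s%:Z = (q + l) * N%:Z by rewrite mulrDl -hq; ring.
      by rewrite abszM dvdn_mull.
    move=> /dvdn_leq hle.
    have [->//|ne] := eqVneq s j.
    have : (0 < `|j%:Z - s%:Z|)%N by lia.
    by move=> /hle; lia.
  exact: zcv0.
rewrite wsumE.
have E (i : nat) : fcoef N%:R^-1 (w i) * eu ((w i)%:~R * (j%:R / N%:R)) =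
   N%:R^-1%:c * zs (fun n : int => gau (N%:R^-1 * n%:~R)%:c * eu ((w i)%:~R * ((j%:Z - n)%:~R / N%:R))).
  rewrite /fcoef /grid -mulrA; congr (_ * _).
  rewrite mulrC -zsZ; last exact: (grid_summable h0 (ltW K10) (hK1 (w i))).
  apply: eq_zs => n; rewrite mulrCA; congr (_ * _); rewrite -euD; congr eu.
  by rewrite rmorphB /=; ring.
rewrite (eq_bigr _ (fun i _ => E i)) -mulr_sumr.
have zE (i : nat) : zcv (fun n : int => gau (N%:R^-1 * n%:~R)%:c * eu ((w i)%:~R * ((j%:Z - n)%:~R / N%:R)))
   (zs (fun n : int => gau (N%:R^-1 * n%:~R)%:c * eu ((w i)%:~R * ((j%:Z - n)%:~R / N%:R)))).
  apply: zsP; apply: (@zdom_summable _ _ (fun k => K1 * expR (- N%:R^-1) ^+ k)).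
  by move: zdg => [d1 d2 d3]; split => // n; rewrite nrmM nrm_eu mulr1 d1.
rewrite -(zcv_zs (zcv_sum (index_iota 0 (P + P)) zE)) -zsZ; last first.
  by eexists; exact: (zcv_sum (index_iota 0 (P + P)) zE).
apply: eq_zs => n.
rewrite -mulr_sumr mulrCA; congr (_ * _).
have -> : \sum_(0 <= i < P + P) eu ((w i)%:~R * ((j%:Z - n)%:~R / N%:R)) =
  eu (- (P%:R * ((j%:Z - n)%:~R / N%:R))) * \sum_(0 <= i < N) eu (i%:R * ((j%:Z - n)%:~R / N%:R)) :> C.
  rewrite mulr_sumr; apply: eq_bigr => i _; rewrite -euD; congr eu.
  by rewrite /w rmorphB /=; ring.
rewrite (eu_orth R (j%:Z - n) N0); case: ifP => hd; last by rewrite !mulr0.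
have [q hq] : exists q : int, j%:Z - n = q * N%:Z.
  by exists (intdiv.divz (j%:Z - n) N%:Z); rewrite intdiv.divzK// intdiv.dvdzE.
have -> : (j%:Z - n)%:~R / N%:R = q%:~R :> R by rewrite hq rmorphM /= -[N%:Z%:~R]/(N%:R) mulfK.
have -> : - (P%:R * q%:~R) = (- (P%:Z * q))%:~R :> R by rewrite rmorphN rmorphM.
by rewrite eu_int mul1r -(rmorph_nat (real_complex R)) -rmorphM mulVf.
Qed.

Lemma dgau_le (k : int) : nrm (dgau k) <= expR (- (pi ^+ 2 * Re A^-1)) ^+ `|k|%N.
Proof.
rewrite nrm_cexp -expRM_natl ler_expR ReN Re_realM mulrN lerN2.
have r0 := Re_inv_gt0 A0.
rewrite mulrCA -mulrA ler_pM2l ?exprn_gt0 ?pi_gt0// ler_pM2r//.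
rewrite -[k%:~R ^+ 2]real_normK ?num_real// -intr_norm -natr_absz.
by rewrite -natrX ler_nat; case: `|k|%N => // n; rewrite leq_pmulr.
Qed.

Lemma dgau_rate : 0 <= expR (- (pi ^+ 2 * Re A^-1)) < 1.
Proof.
by rewrite expR_ge0 expR_lt1 oppr_lt0 mulr_gt0 ?Re_inv_gt0// exprn_gt0// pi_gt0.
Qed.

Lemma dgau_zdom (f : int -> C) (M : R) : (forall k, nrm (f k) <= M) ->
  zdom (fun k => dgau k * f k) (fun n => M * expR (- (pi ^+ 2 * Re A^-1)) ^+ n).
Proof.
move=> hf; have M0 : 0 <= M by rewrite (le_trans (nrm_ge0 _) (hf 0)).
have /andP[r0 r1] := dgau_rate.
split=> [k|k|].
- by rewrite nrmM mulrC ler_pM ?nrm_ge0// dgau_le.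
- by rewrite mulr_ge0// exprn_ge0.
- by apply: geometric_sums_bounded => //; rewrite r0.
Qed.

Theorem poisson (N0 j : nat) : (j < N0)%N ->
  zs (fun n : int => gau (n%:~R + j%:R / N0%:R)%:c) =
  kap A * zs (fun k => dgau k * eu (k%:~R * (j%:R / N0%:R))).
Proof.
move=> jN; have N00 : (0 < N0)%N by case: N0 jN.
have N0R : 0 < N0%:R :> R by rewrite ltr0n.
pose P i := (N0 * 2 ^ i)%N.
have P0 i : (0 < P i)%N by rewrite muln_gt0 N00 expn_gt0.
have jP i : (j * (2 ^ i.+1) < P i + P i)%N.
  by rewrite addnn -mul2n /P mulnCA -expnS ltn_pmul2r// expn_gt0.
have bE i : (j * (2 ^ i.+1))%:R / (P i + P i)%:R = j%:R / N0%:R :> R.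
  rewrite addnn -mul2n /P mulnCA -expnS !natrM -mulf_div mulfV ?mulr1//.
  by rewrite pnatr_eq0 -lt0n expn_gt0.
pose b : R := j%:R / N0%:R.
have L i : zs (fun n : int => gau (n%:~R + b)%:c) =
   wsum (fun k => fcoef (P i + P i)%:R^-1 k * eu (k%:~R * b)) (P i).
  by have := finite_poisson (P0 i) (jP i); rewrite bE.
have hE i : (P i + P i)%:R^-1 = (2 * N0%:R)^-1 * 2 ^- i :> R.
  by rewrite addnn -mul2n /P !natrM natrX mulrA invfM.
have [K K0 hK] := fcoef_decay.
have hrange i : 0 < ((P i + P i)%:R^-1 : R) <= 1.
  by rewrite invr_gt0 ltr0n addn_gt0 P0/= invf_le1 ?ltr0n ?addn_gt0 ?P0// ler1n addn_gt0 P0.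
have small i (k : int) : (`|k| <= P i)%N -> `|k%:~R * (P i + P i)%:R^-1| <= 1 / 2 :> R.
  move=> hk; rewrite normrM (ger0_norm (x := _^-1)) ?invr_ge0// -intr_norm -natr_absz.
  have p0 : 0 < (P i)%:R :> R by rewrite ltr0n.
  rewrite natrD ler_pdivrMr ?addr_gt0//.
  have : (`|k|%N)%:R <= (P i)%:R :> R by rewrite ler_nat.
  lra.
have bound i (k : int) n : (`|k| <= P i)%N -> (n <= `|k|)%N ->
    nrm (fcoef (P i + P i)%:R^-1 k * eu (k%:~R * b)) <= 4 * K / n.+1%:R ^+ 2.
  move=> hk nk; rewrite nrmM nrm_eu mulr1.
  have [k1 k2] := hK _ k (hrange i) (small i k hk).
  rewrite ler_pdivlMr ?exprn_gt0 ?ltr0n//.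
  case: n nk => [|n] nk; first by rewrite expr1n mulr1; lra.
  have : (n.+2%:R : R) ^+ 2 <= 4 * k%:~R ^+ 2.
    rewrite -[k%:~R ^+ 2]real_normK ?num_real// -intr_norm -natr_absz -!natrX -natrM ler_nat.
    nia.
  move=> /(ler_wpM2l (nrm_ge0 (fcoef (P i + P i)%:R^-1 k))); lra.
pose u i k := fcoef (P i + P i)%:R^-1 k%:Z * eu (k%:~R * b) +
   fcoef (P i + P i)%:R^-1 (- k.+1%:Z) * eu ((- k.+1%:Z)%:~R * b).
have hu i k : (k < P i)%N -> nrm (u i k) <= (8 * K) / k.+1%:R ^+ 2.
  move=> kP; rewrite (le_trans (nrmD _ _))//.
  have -> : 8 * K / k.+1%:R ^+ 2 = 4 * K / k.+1%:R ^+ 2 + 4 * K / k.+1%:R ^+ 2 by ring.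
  rewrite lerD//; apply: bound; rewrite ?abszN//=; exact: ltnW.
have K8 : 0 <= 8 * K by rewrite mulr_ge0// ltW.
have c0 : 0 < (2 * N0%:R)^-1 :> R by rewrite invr_gt0 mulr_gt0.
have lf (k : int) : tends (fun i => fcoef (P i + P i)%:R^-1 k * eu (k%:~R * b))
   (kap A * (dgau k * eu (k%:~R * b))).
  have := tendsM (tendsZ (dgau k) (kapP A0 (dual_shift k) c0)) (tends_cst (eu (k%:~R * b))).
  rewrite (_ : dgau k * kap A * eu (k%:~R * b) = kap A * (dgau k * eu (k%:~R * b))); last by ring.
  apply: tends_ext => i; rewrite -hE fcoefE//.
  by have /andP[] := hrange i.
have lu k : tends (u ^~ k) (kap A * (dgau k%:Z * eu (k%:~R * b)) +
   kap A * (dgau (- k.+1%:Z) * eu ((- k.+1%:Z)%:~R * b))).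
  exact: tendsD.
have zd := @dgau_zdom (fun k => eu (k%:~R * b)) 1 (fun k => eq_leq_R (nrm_eu _)).
have := zsP (zdom_summable zd).
move=> /(zcvZ (kap A)) hL.
apply: (tends_unique (u := fun i => \sum_(0 <= k < P i) u i k)).
  by apply: tends_ext (tends_cst _) => i; exact: L.
apply: (tannery hu (invsq_sums_bounded K8) _ lu _ hL).
  by move=> n; rewrite divr_ge0// exprn_ge0.
by move=> n; rewrite (leq_trans (ltnW (ltn_expl n (isT : 1 < 2)%N)))// leq_pmull.
Qed.

End FixedA.

Lemma kap_pi : kap (pi%:c : C) = 1.
Proof.
have pi0 : 0 < Re (pi%:c : C) by exact: pi_gt0.
have pn : pi%:c != 0 :> C by rewrite -nrm_gt0 nrm_real gtr0_norm ?pi_gt0.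
have := poisson pi0 (isT : 0 < 1)%N.
have e : (fun n : int => gau (pi%:c : C) (n%:~R + 0%:R / 1%:R)%:c) =
   (fun k => dgau (pi%:c) k * eu (k%:~R * (0%:R / 1%:R))).
  apply/funext => n; rewrite mul0r mulr0 eu0 mulr1 addr0 /gau /dgau; congr (cexp (- _)).
  by move: pn; generalize (pi : R) => p pn'; rewrite !(rmorphM, rmorphXn) /=; field.
rewrite e; set Z := zs _ => h.
suff Z0 : Z != 0.
  by apply: (mulIf Z0); rewrite -h mul1r.
have zd := @dgau_zdom _ pi0 (fun k => eu (k%:~R * (0%:R / 1%:R))) 1 (fun k => eq_leq_R (nrm_eu _)).
have hZ := zsP (zdom_summable zd); rewrite -/Z in hZ.
have R0 (k : int) : 0 <= Re (dgau (pi%:c : C) k * eu (k%:~R * (0%:R / 1%:R))).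
  rewrite mul0r mulr0 eu0 mulr1 /dgau.
  have -> : - ((pi ^+ 2 * k%:~R ^+ 2)%:c / pi%:c) = (- (pi * k%:~R ^+ 2))%:c :> C.
    by move: pn; generalize (pi : R) => p pn'; rewrite !(rmorphN, rmorphM, rmorphXn) /=; field.
  by rewrite cexp_real expR_ge0.
have : 1 <= Re Z.
  apply: (@tends_Re_ge _ (fun n => wsum (fun k : int => dgau (pi%:c : C) k * eu (k%:~R * (0%:R / 1%:R))) n.+1)).
    by apply: (tends_comp (f := S)) hZ => n; exact: leqnSn.
  move=> n; rewrite Re_sum big_nat_recl// ReD.
  have -> : dgau (pi%:c : C) 0 * eu (0%:~R * (0%:R / 1%:R)) = 1.
    by rewrite mul0r eu0 /dgau expr0n mulr0 mul0r oppr0 cexp0 mulr1.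
  by rewrite -addrA lerDl addr_ge0// sumr_ge0// => i _; rewrite ReD addr_ge0.
by move=> h1; apply/eqP => zz; move: h1; rewrite zz /= ler10.
Qed.

End PoissonGaussian.

End PoissonSummation.
Import PoissonSummation.

(** * The Euler product and the pentagonal number theorem *)

Module EulerFunction.

Section EulerProduct.
Variable R : realType.
Local Notation C := (R[i]%C).
Implicit Types (q z : C).

Definition eulp q N : C := \prod_(0 <= k < N) (1 - q ^+ k.+1).
Definition eul q : C := xget 0 [set l | tends (eulp q) l].

Lemma eulpS q N : eulp q N.+1 = eulp q N * (1 - q ^+ N.+1).
Proof. by rewrite /eulp big_nat_recr. Qed.

Lemma eulp_bounds (r : R) : 0 <= r < 1 -> exists d M, [/\ 0 < d, 0 < M &
  forall q N, nrm q <= r -> d <= nrm (eulp q N) <= M].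
Proof.
move=> /andP[r0 r1].
have r10 : 0 < 1 - r by rewrite subr_gt0.
exists (expR (- ((1 - r)^-1 * (1 - r)^-1))), (expR (1 - r)^-1).
split; rewrite ?expR_gt0// => q N hq.
have h1 k : 1 - r ^+ k.+1 <= nrm (1 - q ^+ k.+1) <= 1 + r ^+ k.+1.
  have hk : nrm (q ^+ k.+1) <= r ^+ k.+1 by rewrite nrmX lerXn2r ?nnegrE ?nrm_ge0.
  apply/andP; split.
    by have := ler_nrm_dist 1 (q ^+ k.+1); rewrite nrm1; lra.
  by have := nrmB 1 (q ^+ k.+1); rewrite nrm1; lra.
have rk k : 0 <= r ^+ k.+1 <= r ^+ k.
  by rewrite exprn_ge0//= exprS ler_piMl ?exprn_ge0// ltW.
have rk1 k : r ^+ k.+1 <= r by rewrite exprS ler_piMr// exprn_ile1// ltW.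
have gs : \sum_(0 <= k < N) r ^+ k.+1 <= (1 - r)^-1.
  rewrite (le_trans _ (geometric_sum_le N _)) ?r0 ?r1//.
  by apply: ler_sum => k _; have /andP[] := rk k.
rewrite nrm_prod; apply/andP; split.
  have -> : - ((1 - r)^-1 * (1 - r)^-1) = (1 - r)^-1 * - (1 - r)^-1 by ring.
  apply: (le_trans (y := expR (\sum_(0 <= k < N) - ((1 - r)^-1 * r ^+ k.+1)))).
    rewrite ler_expR sumrN -mulr_sumr mulrN lerN2 ler_wpM2l// invr_ge0 ltW//.
  rewrite expR_sum; apply: ler_prod => k _; rewrite expR_ge0/=.
  have /andP[h _] := h1 k; apply: le_trans h.
  have /andP[p0 _] := rk k; have p1 := rk1 k; set x := r ^+ k.+1 in p0 p1 *.
  have x1 : 0 < 1 - x by lra.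
  have e : 1 + x / (1 - x) <= expR (x / (1 - x)) by exact: expR_ge1Dx.
  have e1 : expR (- ((1 - r)^-1 * x)) <= expR (- (x / (1 - x))).
    rewrite ler_expR lerN2 mulrC ler_wpM2r// lef_pV2 ?posrE//; lra.
  apply: (le_trans e1); rewrite expRN -[leRHS]invrK lef_pV2 ?posrE ?expR_gt0 ?invr_gt0//.
  have xE : (1 - x)^-1 = 1 + x / (1 - x) by field; exact: lt0r_neq0.
  by rewrite [leLHS]xE.
apply: (le_trans (y := expR (\sum_(0 <= k < N) r ^+ k.+1))); last by rewrite ler_expR.
rewrite expR_sum; apply: ler_prod => k _; rewrite nrm_ge0/=.
have /andP[_ h] := h1 k; rewrite (le_trans h)//; exact: expR_ge1Dx.
Qed.

Lemma eul_cvg q : nrm q < 1 -> tends (eulp q) (eul q).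
Proof.
move=> q1.
suff [l hl] : exists l, tends (eulp q) l.
  by rewrite /eul; case: xgetP => [y ->//|/(_ l)/(_ hl)].
have q01 : 0 <= nrm q < 1 by rewrite nrm_ge0.
have [d [M [d0 M0 hM]]] := eulp_bounds q01.
pose u k := eulp q k.+1 - eulp q k.
have hu k : nrm (u k) <= M * nrm q ^+ k.
  rewrite /u eulpS; have -> : eulp q k * (1 - q ^+ k.+1) - eulp q k = - (eulp q k * q ^+ k.+1) by ring.
  rewrite nrmN nrmM nrmX; have /andP[_ h] := hM q k (lexx _).
  rewrite ler_pM ?nrm_ge0 ?exprn_ge0 ?nrm_ge0//.
  by rewrite exprS ler_piMl ?exprn_ge0 ?nrm_ge0// ltW.
have [l hl] := abs_series hu (geometric_sums_bounded q01 (ltW M0)).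
exists (1 + l); have := tendsD (tends_cst 1) hl; apply: tends_ext => n.
elim: n => [|n IH]; first by rewrite /eulp !big_nil addr0.
by rewrite big_nat_recr//= addrA IH /u; ring.
Qed.

Lemma eulp_neq0 q N : nrm q < 1 -> eulp q N != 0.
Proof.
move=> q1; have q01 : 0 <= nrm q < 1 by rewrite nrm_ge0.
have [d [M [d0 M0 hM]]] := eulp_bounds q01.
by rewrite -nrm_gt0 (lt_le_trans d0)//; have /andP[] := hM q N (lexx _).
Qed.

Lemma eul_neq0 q : nrm q < 1 -> eul q != 0.
Proof.
move=> q1; have q01 : 0 <= nrm q < 1 by rewrite nrm_ge0.
have [d [M [d0 M0 hM]]] := eulp_bounds q01.
apply/eqP => e.
have [N hN] := eul_cvg q1 (e := d / 2) ltac:(by rewrite divr_gt0).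
have := hN N (leqnn _); rewrite e subr0; have /andP[h _] := hM q N (lexx _).
lra.
Qed.

(** Gaussian binomial coefficients. *)
Definition qbin q n k : C := eulp q n / (eulp q k * eulp q (n - k)).

Lemma qbin0 q n : nrm q < 1 -> qbin q n 0 = 1.
Proof. by move=> q1; rewrite /qbin subn0 {2}/eulp big_nil mul1r mulfV// eulp_neq0. Qed.
Lemma qbinn q n : nrm q < 1 -> qbin q n n = 1.
Proof. by move=> q1; rewrite /qbin subnn {3}/eulp big_nil mulr1 mulfV// eulp_neq0. Qed.
Lemma qbinS q n k : nrm q < 1 -> (k < n)%N ->
  qbin q n.+1 k.+1 = qbin q n k.+1 + q ^+ (n - k) * qbin q n k.
Proof.
move=> q1 kn; rewrite /qbin subSS.
have e : (n - k)%N = (n - k.+1).+1 by rewrite subnSK.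
rewrite {1 2}e !eulpS -{1}e.
have := eulp_neq0 k q1; have := eulp_neq0 (n - k.+1) q1.
set a := eulp q k; set b := eulp q (n - k.+1); set c := eulp q n => b0 a0.
have k0 : 1 - q ^+ k.+1 != 0.
  by have := eulp_neq0 k.+1 q1; rewrite eulpS mulf_eq0 negb_or => /andP[].
have l0 : 1 - q ^+ (n - k) != 0.
  by have := eulp_neq0 (n - k) q1; rewrite e eulpS mulf_eq0 negb_or => /andP[].
have en : q ^+ n.+1 = q ^+ k.+1 * q ^+ (n - k) by rewrite -exprD; congr (q ^+ _); lia.
rewrite en e eulpS -e -/b; field.
by rewrite a0 b0 k0 l0.
Qed.

Lemma qbinomial q x n : nrm q < 1 ->
  \prod_(0 <= i < n) (1 + x * q ^+ i) = \sum_(0 <= k < n.+1) q ^+ 'C(k, 2) * qbin q n k * x ^+ k.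
Proof.
move=> q1; elim: n => [|n IH].
  by rewrite big_nil big_nat1 qbin0// !expr0 !mulr1.
rewrite big_nat_recr//= IH mulrDr mulr1 mulr_suml.
rewrite [X in _ = X]big_nat_recl// [in X in _ = _ + X]big_nat_recr//=.
rewrite [X in X + _ = _]big_nat_recl// [X in _ + X = _]big_nat_recr//=.
rewrite !qbin0// !qbinn// !expr0.
have -> : \sum_(0 <= i < n) q ^+ 'C(i.+1, 2) * qbin q n.+1 i.+1 * x ^+ i.+1 =
   \sum_(0 <= i < n) q ^+ 'C(i.+1, 2) * qbin q n i.+1 * x ^+ i.+1 +
   \sum_(0 <= i < n) q ^+ 'C(i, 2) * qbin q n i * x ^+ i * (x * q ^+ n).
  rewrite -big_split/=; apply: eq_big_nat => i /andP[_ hi].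
  rewrite qbinS// binS bin1 !exprD.
  have -> : q ^+ n = q ^+ i * q ^+ (n - i) by rewrite -exprD subnKC// ltnW.
  rewrite exprS; ring.
by rewrite binS bin1 !exprD exprS; ring.
Qed.

(** Triangular numbers indexed by all integers, j (j + 1) / 2. *)
Definition tri (j : int) : nat := match j with Posz k => 'C(k.+1, 2) | Negz k => 'C(k.+1, 2) end.

Lemma tri2 (j : int) : ((tri j) * 2)%:Z = j * (j + 1).
Proof.
case: j => k /=; rewrite bin2 /= muln2; have : (k.+1 * k)./2.*2 = (k.+1 * k)%N.
- by rewrite even_halfK// oddM /= andNb.
- by move=> ->; rewrite PoszM; lia.
- by rewrite even_halfK// oddM /= andNb.
- by move=> ->; rewrite NegzE PoszM; nia.
Qed.

Lemma bin2_tri (i N : nat) : (0 < N)%N -> ('C(i, 2) + 'C(N, 2) = tri (i%:Z - N%:Z) + N.-1 * i)%N.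
Proof.
move=> N0; have t := tri2 (i%:Z - N%:Z).
have hb n : ('C(n, 2) * 2 = n * n.-1)%N.
  by rewrite bin2 muln2 even_halfK//; case: n => //= n; rewrite oddM /= andNb.
have hi := hb i; have hN := hb N; move: t hi hN.
move: (tri _) 'C(i, 2) 'C(N, 2) => T a b t hi hN.
have {}t : (T%:Z * 2 = i%:Z * i%:Z - 2 * i%:Z * N%:Z + N%:Z * N%:Z + i%:Z - N%:Z)
  by rewrite -[X in _ * X]/(2%:Z) -PoszM t; ring.
have {}hi : a%:Z * 2 = i%:Z * i%:Z - i%:Z by case: i hi {t} => [|i] /= hi; [lia | have := congr1 Posz hi; rewrite !PoszM; lia].
have {}hN : b%:Z * 2 = N%:Z * N%:Z - N%:Z by case: N hN {t N0} => [|i'] /= hN; [lia | have := congr1 Posz hN; rewrite !PoszM; lia].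
have e : (N.-1 * i)%:Z = N%:Z * i%:Z - i%:Z by case: (N) N0 => // n _; rewrite PoszM /=; lia.
  suff : (a + b)%:Z * 2 = (T + N.-1 * i)%:Z * 2 by lia.
  rewrite !PoszD e !mulrDl hi hN t; ring.
Qed.

Lemma jtp_finite q z N : nrm q < 1 -> q != 0 -> z != 0 -> (0 < N)%N ->
  \prod_(1 <= i < N) (1 + z * q ^+ i) * \prod_(0 <= i < N) (1 + q ^+ i / z) =
  wsum (fun j : int => qbin q (N + N).-1 (absz (j + N%:Z)) * q ^+ tri j * z ^ j) N.
Proof.
move=> q1 q0 z0 N0.
pose x := z / q ^+ N.-1.
have := qbinomial x (N + N).-1 q1.
have E1 : \prod_(0 <= i < (N + N).-1) (1 + x * q ^+ i) =
  (z ^+ N / q ^+ 'C(N, 2)) * (\prod_(1 <= i < N) (1 + z * q ^+ i) * \prod_(0 <= i < N) (1 + q ^+ i / z)).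
  have NN : (N <= (N + N).-1)%N by lia.
  rewrite (big_cat_nat (leq0n _) NN)/=.
  have -> : \prod_(N <= i < (N + N).-1) (1 + x * q ^+ i) = \prod_(1 <= i < N) (1 + z * q ^+ i).
    rewrite -{1}[N]add0n big_addn.
    have -> : ((N + N).-1 - N)%N = N.-1 by lia.
    rewrite [RHS]big_add1; apply: eq_big_nat => i hi; congr (1 + _).
    rewrite /x; have -> : (i + N = N.-1 + i.+1)%N by lia.
    by rewrite exprD mulrA divfK// expf_neq0.
  rewrite mulrC mulrCA; congr (_ * _).
  have -> : z ^+ N / q ^+ 'C(N, 2) = \prod_(0 <= i < N) (z / q ^+ i).
    elim: N {N0 x NN} => [|N IH]; first by rewrite big_nil !expr0 divr1.
    by rewrite big_nat_recr//= -IH exprSr binS bin1 exprD invfM mulrACA.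
  rewrite -big_split/= big_nat_rev/=; apply: eq_big_nat => i /andP[_ hi].
  rewrite add0n /x mulrDr mulr1 addrC; congr (_ + _).
  have qn : q ^+ N.-1 = q ^+ (N - i.+1) * q ^+ i by rewrite -exprD; congr (q ^+ _); lia.
    rewrite qn; have := expf_neq0 (N - i.+1) q0; have := expf_neq0 i q0.
    move: (q ^+ (N - i.+1)) (q ^+ i) => a b b0 a0; by field; rewrite a0 b0.
  by field; rewrite z0 expf_neq0.
rewrite E1 => /esym.
have zN : z ^+ N / q ^+ 'C(N, 2) != 0 by rewrite mulf_neq0// ?invr_eq0 expf_neq0.
have -> : (N + N).-1.+1 = (N + N)%N by lia.
have -> : \sum_(0 <= k < N + N) q ^+ 'C(k, 2) * qbin q (N + N).-1 k * x ^+ k =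
   (z ^+ N / q ^+ 'C(N, 2)) * wsum (fun j : int => qbin q (N + N).-1 (absz (j + N%:Z)) * q ^+ tri j * z ^ j) N.
  rewrite wsumE mulr_sumr; apply: eq_bigr => i _.
  rewrite subrK absz_nat expfzDr// -exprnP.
  have -> : z ^ (- N%:Z) = (z ^+ N)^-1 by rewrite -exprnN.
  have := bin2_tri i N0 => /(congr1 (GRing.exp q)); rewrite !exprD exprM => h.
  have qN := expf_neq0 'C(N, 2) q0; have qi := expf_neq0 N.-1 q0; have zz := expf_neq0 N z0.
  have -> : q ^+ 'C(i, 2) = q ^+ tri (i%:Z - N%:Z) * q ^+ N.-1 ^+ i / q ^+ 'C(N, 2) by rewrite -h mulfK.
  rewrite /x expr_div_n; field; by rewrite qN zz expf_neq0.
by move=> /(mulfI zN).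
Qed.

Lemma tends_comp_inf (f : nat -> nat) (u : nat -> C) l :
  (forall m, exists N0, forall N, (N0 <= N)%N -> (m <= f N)%N) -> tends u l ->
  tends (fun n => u (f n)) l.
Proof.
move=> hf h e e0; have [n0 H] := h e e0; have [N1 H1] := hf n0; exists N1 => n hn.
by apply: H; exact: H1.
Qed.

Lemma quadratic_exp_bounded (r y : R) : 0 <= r < 1 -> 0 <= y ->
  exists2 K, 0 <= K & forall k, r ^+ 'C(k.+1, 2) * y ^+ k <= K * (1 / 2) ^+ k.
Proof.
move=> /andP[r0 r1] y0.
pose a k := r ^+ 'C(k.+1, 2) * (2 * y) ^+ k.
have a0 k : 0 <= a k by rewrite mulr_ge0 ?exprn_ge0// mulr_ge0.
have [n0 hn0] : exists n0, forall n, (n0 <= n)%N -> r ^+ n.+1 * (2 * y) <= 1.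
  have e0 : 0 < (2 * y + 1)^-1 by rewrite invr_gt0 ltr_wpDl// mulr_ge0.
  have r01 : 0 <= r < 1 by rewrite r0.
  have [N hN] := sums_bounded_to0 (fun n => mulr_ge0 ler01 (exprn_ge0 n r0)) (geometric_sums_bounded r01 ler01) e0.
  exists N => n hn; have := hN n.+1 (leqW hn); rewrite mul1r => h.
  have y1 : 0 <= 2 * y by rewrite mulr_ge0.
  rewrite (le_trans (ler_wpM2r y1 h))// mulrC ler_pdivrMr ?ltr_wpDl// mul1r lerDl//.
have aS k : a k.+1 = a k * (r ^+ k.+1 * (2 * y)).
  by rewrite /a binS bin1 exprD [(2 * y) ^+ k.+1]exprSr mulrACA.
exists (\sum_(0 <= i < n0.+1) a i); first by rewrite sumr_ge0.
move=> k; suff H : a k <= \sum_(0 <= i < n0.+1) a i.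
  have -> : r ^+ 'C(k.+1, 2) * y ^+ k = a k * (1 / 2) ^+ k.
    rewrite /a exprMn expr_div_n expr1n mul1r -mulrA; congr (_ * _).
    by rewrite mulrAC mulfV ?mul1r// expf_neq0 ?pnatr_eq0.
  by apply: ler_wpM2r => //; apply: exprn_ge0; lra.
elim: k => [|k IH]; first by rewrite big_nat_recl//= lerDl sumr_ge0.
have [hk|hk] := leqP n0 k.
  by rewrite aS (le_trans _ IH)// ler_piMr// hn0.
have := sums_nneg_mono a0 (m := n0.+1) (n := k.+2).
rewrite ltnS hk => /(_ isT); apply: le_trans.
by rewrite big_nat_recr//= lerDr sumr_ge0.
Qed.

Definition theta q z : C := zs (fun j : int => q ^+ tri j * z ^ j).

Lemma theta_zdom q z : nrm q < 1 -> z != 0 ->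
  exists b, zdom (fun j : int => q ^+ tri j * z ^ j) b.
Proof.
move=> q1 z0; have q01 : 0 <= nrm q < 1 by rewrite nrm_ge0.
have y0 := nrm_ge0 z; have y1 := nrm_ge0 z^-1.
have [K K0 hK] := quadratic_exp_bounded q01 y0.
have [K' K'0 hK'] := quadratic_exp_bounded q01 y1.
have half : 0 <= (1 / 2 : R) < 1 by lra.
exists (fun k => (K + 2 * nrm z^-1 * K') * (1 / 2) ^+ k).
have KK : 0 <= 2 * nrm z^-1 * K' by rewrite !mulr_ge0.
split.
- case=> k /=.
    by rewrite nrmM nrmX -exprnP nrmX (le_trans (hK k))// ler_wpM2r ?exprn_ge0 ?divr_ge0// lerDl.
  have -> : z ^ Negz k = z^-1 * z^-1 ^+ k by rewrite NegzE -exprnN -exprVn exprS.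
  rewrite nrmM nrmM !nrmX mulrCA (le_trans (ler_wpM2l y1 (hK' k)))//.
  rewrite exprS; have : 0 <= (1 / 2 : R) ^+ k by rewrite exprn_ge0 ?divr_ge0.
  set p := _ ^+ k => p0; have := mulr_ge0 K0 p0; have := mulr_ge0 (mulr_ge0 y1 K'0) p0; lra.
- by move=> n; rewrite mulr_ge0 ?addr_ge0// exprn_ge0 ?divr_ge0.
- by apply: geometric_sums_bounded => //; rewrite addr_ge0.
Qed.

(** Jacobi's triple product, as the limit of the finite identity. *)
Theorem jtp q z : nrm q < 1 -> q != 0 -> z != 0 ->
  tends (fun N => \prod_(1 <= i < N) (1 + z * q ^+ i) * \prod_(0 <= i < N) (1 + q ^+ i / z))
    (theta q z / eul q).
Proof.
move=> q1 q0 z0.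
have q01 : 0 <= nrm q < 1 by rewrite nrm_ge0.
have [d [M [d0 M0 hM]]] := eulp_bounds q01.
have e0 := eul_neq0 q1.
have [b [hb b0 sb]] := theta_zdom q1 z0.
pose t (j : int) := q ^+ tri j * z ^ j.
pose u N k := qbin q (N + N).-1 (k + N) * t k%:Z + qbin q (N + N).-1 (N - k.+1) * t (- k.+1%:Z).
have hB n k : nrm (qbin q n k) <= M / d ^+ 2.
  have hd i : d <= nrm (eulp q i) by have /andP[] := hM q i (lexx _).
  have hM' i : nrm (eulp q i) <= M by have /andP[] := hM q i (lexx _).
  rewrite nrm_div; apply: ler_pM; rewrite ?nrm_ge0 ?invr_ge0 ?nrm_ge0//.
  rewrite lef_pV2 ?posrE ?exprn_gt0// nrmM ?mulr_gt0 ?(lt_le_trans d0)//.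
  by rewrite expr2 ler_pM// ltW.
have Md : 0 <= M / d ^+ 2 by rewrite divr_ge0 ?exprn_ge0 ?ltW.
have hu N k : (k < N)%N -> nrm (u N k) <= M / d ^+ 2 * (b k + b k.+1).
  move=> _; rewrite (le_trans (nrmD _ _))// mulrDr lerD// nrmM ler_pM ?nrm_ge0// ?hB//.
    exact: (hb k).
  by have := hb (- k.+1%:Z); rewrite abszN.
have sb2 : sums_bounded (fun k => M / d ^+ 2 * (b k + b k.+1)).
  have [B hB'] := sb; exists (M / d ^+ 2 * (B + B)) => n.
  rewrite -mulr_sumr ler_wpM2l// big_split/= lerD//.
  by have := hB' n.+1; rewrite big_nat_recl//=; apply: le_trans; rewrite lerDr.
have inf1 : forall m, exists N0, forall N, (N0 <= N)%N -> (m <= (N + N).-1)%N.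
  by move=> m; exists m.+1 => N hN; lia.
have inf2 (k : nat) : forall m, exists N0, forall N, (N0 <= N)%N -> (m <= k + N)%N.
  by move=> m; exists m => N hN; lia.
have inf3 (k : nat) : forall m, exists N0, forall N, (N0 <= N)%N -> (m <= N - k.+1)%N.
  by move=> m; exists (m + k.+1)%N => N hN; lia.
have ee0 : eul q * eul q != 0 by rewrite mulf_neq0.
have eE : (eul q)^-1 = eul q / (eul q * eul q) by field.
have c1 := tends_comp_inf (f := fun N => (N + N).-1) inf1 (eul_cvg q1).
have c2 k := tends_comp_inf (f := fun N => (k + N)%N) (inf2 k) (eul_cvg q1).
have c3 k := tends_comp_inf (f := fun N => (N - k.+1)%N) (inf3 k) (eul_cvg q1).
have lim1 k : tends (fun N => qbin q (N + N).-1 (k + N)) (eul q)^-1.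
  rewrite eE; apply: (tends_ext_near (N := k.+1)) (tendsM c1 (tendsV ee0 (tendsM (c2 k) (c3 k)))).
  by move=> N hN; rewrite /qbin; congr (_ / (_ * eulp q _)); lia.
have lim2 k : tends (fun N => qbin q (N + N).-1 (N - k.+1)) (eul q)^-1.
  rewrite eE; apply: (tends_ext_near (N := k.+1)) (tendsM c1 (tendsV ee0 (tendsM (c3 k) (c2 k)))).
  by move=> N hN; rewrite /qbin; congr (_ / (_ * eulp q _)); lia.
have lu k : tends (u ^~ k) ((eul q)^-1 * t k%:Z + (eul q)^-1 * t (- k.+1%:Z)).
  by apply: tendsD; apply: tendsM; rewrite //; exact: tends_cst.
have hL : zcv t (theta q z) by apply: zsP; apply: zdom_summable; split; eauto.
have H := tannery hu sb2 (fun n => mulr_ge0 Md (addr_ge0 (b0 n) (b0 n.+1))) lu (fun n => leqnn n) (zcvZ (eul q)^-1 hL).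
rewrite [theta q z / _]mulrC; apply: (tends_ext_near (N := 1%N) _ H) => N hN.
rewrite jtp_finite// /wsum; apply: eq_big_nat => k /andP[_ kN]; rewrite /u /t.
rewrite !mulrA; congr (qbin q _ _ * _ * _ + qbin q _ _ * _ * _); lia.
Qed.

End EulerProduct.
Global Opaque eul.

End EulerFunction.
Import EulerFunction.

(** * Theta products and the cube of the Euler function *)

Module JacobiIdentities.

Section ThetaProducts.
Variable R : realType.
Local Notation C := (R[i]%C).
Implicit Types (q z : C).

Lemma nrmX_lt1 q n : nrm q < 1 -> (0 < n)%N -> nrm (q ^+ n) < 1.
Proof. by move=> q1 n0; rewrite nrmX exprn_ilt1 ?nrm_ge0// -lt0n. Qed.

Lemma theta_prod q z (P : nat -> C) l : nrm q < 1 -> q != 0 -> z != 0 ->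
  (forall N, (0 < N)%N -> \prod_(1 <= i < N) (1 + z * q ^+ i) * \prod_(0 <= i < N) (1 + q ^+ i / z) = P N) ->
  tends P l -> theta q z = l * eul q.
Proof.
move=> q1 q0 z0 hP hl.
have h := jtp q1 q0 z0.
have : tends (fun N => \prod_(1 <= i < N) (1 + z * q ^+ i) * \prod_(0 <= i < N) (1 + q ^+ i / z)) l.
  by apply: (tends_ext_near (N := 1%N) _ hl) => N hN; rewrite hP.
by move=> /(tends_unique h) <-; rewrite divfK// eul_neq0.
Qed.

Theorem euler_pentagonal q : nrm q < 1 -> q != 0 -> theta (q ^+ 3) (- q^-1) = eul q.
Proof.
move=> q1 q0.
have q31 : nrm (q ^+ 3) < 1 by exact: nrmX_lt1.
have q30 : q ^+ 3 != 0 by rewrite expf_neq0.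
have z0 : - q^-1 != 0 by rewrite oppr_eq0 invr_eq0.
have H N : \prod_(1 <= i < N.+1) (1 + - q^-1 * q ^+ 3 ^+ i) * \prod_(0 <= i < N.+1) (1 + q ^+ 3 ^+ i / - q^-1) =
    eulp q (3 * N).+1 / eulp (q ^+ 3) N.
  have e0 := eulp_neq0 _ q31.
  elim: N => [|N IH].
    rewrite big_geq// big_nat1 muln0 /eulp big_nat1 big_nil divr1 mul1r expr0 expr1.
    by field.
  rewrite big_nat_recr//= [X in _ * X]big_nat_recr//= mulrACA IH mulnS !addSn add0n !eulpS.
  have := e0 N; have := e0 N.+1; rewrite eulpS; set d := eulp _ N => dd d0.
  have d1 : 1 - q ^+ 3 ^+ N.+1 != 0 by move: dd; rewrite mulf_eq0 negb_or => /andP[].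
  have -> : - q^-1 * q ^+ 3 ^+ N.+1 = - q ^+ (3 * N).+2.
    by rewrite -exprM mulnS -[(3 + 3 * N)%N]/((3 * N).+2.+1) [in LHS]exprS; field.
  have -> : q ^+ 3 ^+ N.+1 / - q^-1 = - q ^+ (3 * N).+4.
    by rewrite -exprM mulnS -[(3 + 3 * N)%N]/((3 * N).+2.+1) [in RHS]exprS; field.
  have e3 : q ^+ 3 ^+ N.+1 = q ^+ (3 * N).+3 by rewrite -exprM mulnS.
  by rewrite e3 in d1 *; field; rewrite d0 d1.
rewrite (@theta_prod _ _ (fun N => eulp q (3 * N.-1).+1 / eulp (q ^+ 3) N.-1) (eul q / eul (q ^+ 3)))//.
- by rewrite divfK// eul_neq0.
- by case=> // N _; rewrite H.
apply: tendsS; rewrite /=.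
apply: tendsM; first by apply: (tends_comp (f := fun n => (3 * n).+1)) (eul_cvg q1) => n; lia.
by apply: tendsV (eul_cvg q31); exact: eul_neq0.
Qed.

Definition oddp q N : C := \prod_(0 <= i < N) (1 - q ^+ (i + i).+1).

Lemma oddpS q N : oddp q N.+1 = oddp q N * (1 - q ^+ (N + N).+1).
Proof. by rewrite /oddp big_nat_recr. Qed.

Lemma oddp_eulp q N : oddp q N * eulp (q ^+ 2) N = eulp q (N + N).
Proof.
elim: N => [|N IH]; first by rewrite /oddp /eulp !big_nil mulr1.
rewrite addnS addSn !eulpS oddpS mulrACA IH -exprM.
by rewrite mul2n -addnn addnS addSn mulrA.
Qed.

Lemma oddp_cvg q : nrm q < 1 -> tends (oddp q) (eul q / eul (q ^+ 2)).
Proof.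
move=> q1; have q21 : nrm (q ^+ 2) < 1 by exact: nrmX_lt1.
have e0 := eulp_neq0 _ q21.
apply: (tends_ext (u := fun N => eulp q (N + N) / eulp (q ^+ 2) N)).
  by move=> N; rewrite -oddp_eulp mulfK.
apply: tendsM; first by apply: (tends_comp (f := fun n => (n + n)%N)) (eul_cvg q1) => n; lia.
by apply: tendsV (eul_cvg q21); exact: eul_neq0.
Qed.

Lemma oddpN q N : oddp (- q) N * oddp q N = oddp (q ^+ 2) N.
Proof.
rewrite /oddp -big_split; apply: eq_bigr => i _ /=.
rewrite exprNn -signr_odd /= oddD addbb expr1 -exprM mul2n -addnn exprD; ring.
Qed.

Lemma eulN q : nrm q < 1 -> eul (- q) = eul (q ^+ 2) ^+ 3 / (eul q * eul (q ^+ 4)).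
Proof.
move=> q1; have mq1 : nrm (- q) < 1 by rewrite nrmN.
have q21 : nrm (q ^+ 2) < 1 by exact: nrmX_lt1.
have q41 : nrm (q ^+ 4) < 1 by exact: nrmX_lt1.
have h1 := tendsM (oddp_cvg mq1) (oddp_cvg q1).
have h2 := oddp_cvg q21; rewrite -exprM in h2.
have : eul (- q) / eul ((- q) ^+ 2) * (eul q / eul (q ^+ 2)) = eul (q ^+ 2) / eul (q ^+ 4).
  by apply: tends_unique h1 _; apply: tends_ext h2 => N; rewrite oddpN.
rewrite (sqrrN q) => h; move: (eul_neq0 q1) (eul_neq0 q21) (eul_neq0 q41) h.
move: (eul q) (eul (q ^+ 2)) (eul (q ^+ 4)) (eul (- q)) => a b c d a0 b0 c0 h.
have -> : d = (d / b * (a / b)) * b ^+ 2 / a by field; rewrite b0 a0.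
by rewrite h; field; rewrite c0 a0.
Qed.

(** The theta functions of Jacobi, sum of q^(j^2) and sum of q^(2j^2+j) over the integers. *)
Definition phi q : C := theta (q ^+ 2) (q^-1).
Definition psi q : C := theta (q ^+ 4) (q^-1).

Lemma phi_eul q : nrm q < 1 -> q != 0 -> phi q = eul (- q) ^+ 2 / eul (q ^+ 2).
Proof.
move=> q1 q0; have mq1 : nrm (- q) < 1 by rewrite nrmN.
have q21 : nrm (q ^+ 2) < 1 by exact: nrmX_lt1.
have q20 : q ^+ 2 != 0 by rewrite expf_neq0.
have z0 : q^-1 != 0 by rewrite invr_eq0.
have odds n : (- q) ^+ (n + n).+1 = - q ^+ (n + n).+1.
  by rewrite exprNn -signr_odd /= oddD addbb expr1 mulN1r.
have H N : \prod_(1 <= i < N.+1) (1 + q^-1 * q ^+ 2 ^+ i) * \prod_(0 <= i < N.+1) (1 + q ^+ 2 ^+ i / q^-1) =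
    oddp (- q) N * oddp (- q) N.+1.
  congr (_ * _).
    rewrite big_add1 /oddp; apply: eq_bigr => i _; rewrite odds opprK; congr (1 + _).
    by rewrite -exprM mulnS mul2n -addnn -[(2 + (i + i))%N]/((i + i).+1.+1) [in LHS]exprS mulKf.
  rewrite /oddp; apply: eq_bigr => i _; rewrite odds opprK; congr (1 + _).
  by rewrite -exprM mul2n -addnn invrK exprSr.
rewrite /phi (@theta_prod _ _ (fun N => oddp (- q) N.-1 * oddp (- q) N) ((eul (- q) / eul (q ^+ 2)) ^+ 2))//.
- by move: (eul_neq0 q21); move: (eul (q ^+ 2)) (eul (- q)) => b d h; field.
- by case=> // N _; rewrite H.
have h := oddp_cvg mq1; rewrite (sqrrN q) in h.
by apply: tendsS; rewrite /= expr2; apply: tendsM => //; apply: (tends_comp (f := S)).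
Qed.

Lemma phiN q : nrm q < 1 -> q != 0 -> phi (- q) = eul q ^+ 2 / eul (q ^+ 2).
Proof.
move=> q1 q0; have mq1 : nrm (- q) < 1 by rewrite nrmN.
have mq0 : - q != 0 by rewrite oppr_eq0.
by rewrite (phi_eul mq1 mq0) (opprK q) (sqrrN q).
Qed.

Lemma psi_eul q : nrm q < 1 -> q != 0 -> psi q = eul (q ^+ 2) ^+ 2 / eul q.
Proof.
move=> q1 q0; have mq1 : nrm (- q) < 1 by rewrite nrmN.
have q21 : nrm (q ^+ 2) < 1 by exact: nrmX_lt1.
have q41 : nrm (q ^+ 4) < 1 by exact: nrmX_lt1.
have q40 : q ^+ 4 != 0 by rewrite expf_neq0.
have z0 : q^-1 != 0 by rewrite invr_eq0.
have odds n : (- q) ^+ (n + n).+1 = - q ^+ (n + n).+1.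
  by rewrite exprNn -signr_odd /= oddD addbb expr1 mulN1r.
have H N : \prod_(1 <= i < N.+1) (1 + q^-1 * q ^+ 4 ^+ i) * \prod_(0 <= i < N.+1) (1 + q ^+ 4 ^+ i / q^-1) =
    oddp (- q) (N + N).+1.
  elim: N => [|N IH].
    by rewrite big_geq// big_nat1 /oddp big_nat1 mul1r expr0 invrK mul1r addn0 expr1 opprK.
  rewrite big_nat_recr//= [X in _ * X]big_nat_recr//= mulrACA IH.
  rewrite addnS addSn !oddpS -mulrA !odds !opprK invrK -!exprM; congr (_ * (_ * _)); congr (1 + _).
    have -> : (4 * N.+1 = ((N + N).+1 + (N + N).+1).+1.+1)%N by lia.
    by rewrite [in LHS]exprS mulKf.
  by rewrite -exprSr; congr (_ ^+ _); lia.
rewrite /psi (@theta_prod _ _ (fun N => oddp (- q) (N.-1 + N.-1).+1) (eul (- q) / eul (q ^+ 2)))//.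
- rewrite (eulN q1); move: (eul_neq0 q1) (eul_neq0 q21) (eul_neq0 q41).
  by move: (eul q) (eul (q ^+ 2)) (eul (q ^+ 4)) => a b c a0 b0 c0; field; rewrite a0 b0 c0.
- by case=> // N _; rewrite H.
have h := oddp_cvg mq1; rewrite (sqrrN q) in h.
by apply: tendsS; apply: (tends_comp (f := fun N => (N + N).+1) _ h) => N; lia.
Qed.

Lemma qbin_sym q n k : (k <= n)%N -> qbin q n (n - k) = qbin q n k.
Proof. by move=> kn; rewrite /qbin subKn//; congr (_ / _); exact: mulrC. Qed.

Lemma jacobi_finite q N : nrm q < 1 -> q != 0 -> (0 < N)%N ->
  eulp q N.-1 ^+ 2 = \sum_(0 <= k < N) qbin q (N + N).-1 (k + N) * (q ^+ 'C(k.+1, 2) * ((-1) ^+ k * (k + k).+1%:R)).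
Proof.
move=> q1 q0 N0.
pose w n : C := 1 + n.+1%:R^-1.
have invt : tends (fun n => n.+1%:R^-1 : C) 0.
  apply: (@tends_squeeze _ _ _ 1) => n; rewrite subr0 nrmV nrm_nat mul1r//.
have wt : tends w 1 by have := tendsD (tends_cst 1) invt; rewrite addr0.
have n0 n : n.+1%:R != 0 :> C by rewrite pnatr_eq0.
have w0 n : w n != 0.
  apply/eqP => /(congr1 (fun x => n.+1%:R * x)); rewrite /w mulr0 mulrDr mulr1 mulfV// natr1.
  by move=> /eqP; rewrite (negPf (n0 n.+1)).
have w1 n : 1 - (w n)^-1 != 0.
  apply/eqP => /(congr1 (fun x => w n * x)); rewrite mulrBr mulr1 mulfV// mulr0 /w addrAC subrr add0r.
  by move=> /eqP; rewrite invr_eq0 (negPf (n0 n)).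
have key n : \prod_(1 <= i < N) ((1 - w n * q ^+ i) * (1 - q ^+ i / w n)) =
  \sum_(0 <= k < N) qbin q (N + N).-1 (k + N) * (q ^+ 'C(k.+1, 2) * ((-1) ^+ k * ((w n)^-1 ^+ k * \sum_(i < (k + k).+1) w n ^+ i))).
  have z0 : - w n != 0 by rewrite oppr_eq0.
  have := jtp_finite q1 q0 z0 N0.
  have -> : \prod_(0 <= i < N) (1 + q ^+ i / - w n) = (1 - (w n)^-1) * \prod_(1 <= i < N) (1 - q ^+ i / w n).
    rewrite big_ltn// expr0 invrN mulrN mul1r; congr (_ * _).
    by apply: eq_bigr => i _; rewrite mulrN.
  have -> : \prod_(1 <= i < N) (1 + - w n * q ^+ i) = \prod_(1 <= i < N) (1 - w n * q ^+ i).
    by apply: eq_bigr => i _; rewrite mulNr.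
  rewrite mulrCA -big_split/= => h.
  apply: (mulfI (w1 n)); rewrite h /wsum mulr_sumr; apply: eq_big_nat => k /andP[_ kN].
  have -> : absz (k%:Z + N%:Z) = (k + N)%N by [].
  have -> : absz (- k.+1%:Z + N%:Z) = ((N + N).-1 - (k + N))%N by lia.
  rewrite qbin_sym; last by lia.
  rewrite /= -exprnP.
  have -> : (- w n) ^ (- k.+1%:Z) = (- w n)^-1 ^+ k.+1 by rewrite -exprnN exprVn.
  set B := qbin _ _ _; set Q := q ^+ _.
  have w0n := w0 n; have w1n : w n - 1 != 0 by rewrite /w addrC addKr invr_eq0.
  set v := w n in w0n w1n *.
  have geo : \sum_(i < (k + k).+1) v ^+ i = (v ^+ (k + k).+1 - 1) / (v - 1).
    by rewrite subrX1 mulrC mulKf.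
  have vk := expf_neq0 k w0n.
  have e1 : (- v) ^+ k = (-1) ^+ k * v ^+ k by rewrite -exprMn mulN1r.
  have e2 : (- v)^-1 ^+ k.+1 = - (-1) ^+ k * ((v ^+ k)^-1 * v^-1).
    by rewrite invrN [LHS]exprNn exprVn exprS mulN1r [v ^+ k.+1]exprS invfM [v^-1 * _]mulrC.
  have e3 : v ^+ (k + k).+1 = v ^+ k * v ^+ k * v by rewrite exprSr exprD.
  rewrite geo e1 e2 e3 exprVn; move: (v ^+ k) vk ((-1) ^+ k) B Q => V vk S B Q.
  by field; rewrite w0n w1n vk.
have L1 : tends (fun n => \prod_(1 <= i < N) ((1 - w n * q ^+ i) * (1 - q ^+ i / w n)))
   (\prod_(1 <= i < N) ((1 - 1 * q ^+ i) * (1 - q ^+ i / 1))).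
  apply: tends_prod => i _; apply: tendsM; apply: tendsB; try exact: tends_cst.
    by apply: tendsM => //; exact: tends_cst.
  by apply: tendsM; [exact: tends_cst|apply: tendsV; rewrite ?oner_eq0].
have L2 : tends (fun n => \sum_(0 <= k < N) qbin q (N + N).-1 (k + N) * (q ^+ 'C(k.+1, 2) * ((-1) ^+ k * ((w n)^-1 ^+ k * \sum_(i < (k + k).+1) w n ^+ i))))
   (\sum_(0 <= k < N) qbin q (N + N).-1 (k + N) * (q ^+ 'C(k.+1, 2) * ((-1) ^+ k * (1^-1 ^+ k * \sum_(i < (k + k).+1) 1 ^+ i)))).
  apply: tends_sum => k _; do 3 apply: tendsZ.
  apply: tendsM; first by apply: tendsX; apply: tendsV; rewrite ?oner_eq0.
  by apply: tends_sum => i _; apply: tendsX.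
have := tends_unique L1 (tends_ext (fun n => esym (key n)) L2).
have -> : \prod_(1 <= i < N) ((1 - 1 * q ^+ i) * (1 - q ^+ i / 1)) = eulp q N.-1 ^+ 2.
  rewrite big_split/= expr2 /eulp; congr (_ * _); rewrite big_add1; apply: eq_bigr => i _.
    by rewrite mul1r.
  by rewrite divr1.
move=> ->; apply: eq_bigr => k _; rewrite invr1 expr1n mul1r; congr (_ * (_ * (_ * _))).
rewrite (eq_bigr (fun=> 1)); last by move=> i _; rewrite expr1n.
by rewrite sumr_const card_ord.
Qed.

Theorem jacobi_cube q : nrm q < 1 -> q != 0 ->
  tends (fun n => \sum_(0 <= k < n) q ^+ 'C(k.+1, 2) * ((-1) ^+ k * (k + k).+1%:R)) (eul q ^+ 3).
Proof.
move=> q1 q0; have q01 : 0 <= nrm q < 1 by rewrite nrm_ge0.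
have [d [M [d0 M0 hM]]] := eulp_bounds q01.
have e0 := eul_neq0 q1.
have [K K0 hK] := quadratic_exp_bounded q01 (ler0n R 3).
have hl k : nrm (q ^+ 'C(k.+1, 2) * ((-1) ^+ k * (k + k).+1%:R)) <= K * (1 / 2) ^+ k.
  rewrite 2!nrmM nrmX nrmX nrmN nrm1 expr1n mul1r nrm_nat (le_trans _ (hK k))//.
  rewrite ler_wpM2l ?exprn_ge0 ?nrm_ge0// -natrX ler_nat.
  by elim: k => // k IH; rewrite expnS; lia.
have half : 0 <= (1 / 2 : R) < 1 by lra.
have [L hL] := abs_series hl (geometric_sums_bounded half K0).
have hB n k : nrm (qbin q n k) <= M / d ^+ 2.
  have hd i : d <= nrm (eulp q i) by have /andP[] := hM q i (lexx _).
  have hM' i : nrm (eulp q i) <= M by have /andP[] := hM q i (lexx _).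
  rewrite nrm_div; apply: ler_pM; rewrite ?nrm_ge0 ?invr_ge0 ?nrm_ge0//.
  rewrite lef_pV2 ?posrE ?exprn_gt0// nrmM ?mulr_gt0 ?(lt_le_trans d0)//.
  by rewrite expr2 ler_pM// ltW.
have Md : 0 <= M / d ^+ 2 by rewrite divr_ge0 ?exprn_ge0 ?ltW.
have hp k : 0 <= M / d ^+ 2 * (K * (1 / 2) ^+ k) by rewrite mulr_ge0// mulr_ge0// exprn_ge0// divr_ge0.
have sb : sums_bounded (fun k => M / d ^+ 2 * (K * (1 / 2) ^+ k)).
  have [B hB'] := geometric_sums_bounded half K0; exists (M / d ^+ 2 * B) => n.
  by rewrite -mulr_sumr ler_wpM2l.
pose u N k := qbin q (N + N).-1 (k + N) * (q ^+ 'C(k.+1, 2) * ((-1) ^+ k * (k + k).+1%:R)).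
have hu N k : (k < N)%N -> nrm (u N k) <= M / d ^+ 2 * (K * (1 / 2) ^+ k).
  by move=> _; rewrite nrmM ler_pM ?nrm_ge0.
have ee0 : eul q * eul q != 0 by rewrite mulf_neq0.
have c1 : tends (fun N => eulp q (N + N).-1) (eul q).
  by apply: (tends_comp_inf (f := fun N => (N + N).-1) _ (eul_cvg q1)) => m; exists m.+1 => N hN; lia.
have c2 (k : nat) : tends (fun N => eulp q (k + N)) (eul q).
  by apply: (tends_comp_inf (f := fun N => (k + N)%N) _ (eul_cvg q1)) => m; exists m => N hN; lia.
have c3 (k : nat) : tends (fun N => eulp q (N - k.+1)) (eul q).
  by apply: (tends_comp_inf (f := fun N => (N - k.+1)%N) _ (eul_cvg q1)) => m; exists (m + k.+1)%N => N hN; lia.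
have eE : (eul q)^-1 = eul q / (eul q * eul q) by field.
have lim1 k : tends (fun N => qbin q (N + N).-1 (k + N)) (eul q)^-1.
  rewrite eE; apply: (tends_ext_near (N := k.+1)) (tendsM c1 (tendsV ee0 (tendsM (c2 k) (c3 k)))).
  by move=> N hN; rewrite /qbin; congr (_ / (_ * eulp q _)); lia.
have lu k : tends (u ^~ k) ((eul q)^-1 * (q ^+ 'C(k.+1, 2) * ((-1) ^+ k * (k + k).+1%:R))).
  by apply: tendsM (lim1 k) (tends_cst _).
have hL2 : tends (fun n => \sum_(0 <= k < n) (eul q)^-1 * (q ^+ 'C(k.+1, 2) * ((-1) ^+ k * (k + k).+1%:R))) ((eul q)^-1 * L).
  by apply: tends_ext (tendsZ (eul q)^-1 hL) => n; rewrite mulr_sumr.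
have H := tannery hu sb hp lu (fun n => leqnn n) hL2.
have c4 : tends (fun N => eulp q N.-1 ^+ 2) (eul q ^+ 2).
  apply: tendsX; apply: (tends_comp_inf (f := fun N => N.-1) _ (eul_cvg q1)) => m; exists m.+1 => N hN; lia.
have : eul q ^+ 2 = (eul q)^-1 * L.
  apply: tends_unique c4 _; apply: (tends_ext_near (N := 1%N) _ H) => N hN.
  by rewrite jacobi_finite.
move=> h; have -> : eul q ^+ 3 = L; last by [].
by rewrite exprS h mulrA mulfV// mul1r.
Qed.

End ThetaProducts.

End JacobiIdentities.
Import JacobiIdentities.

(** * The Euler function near a root of unity *)

Module CuspExpansion.

Local Opaque cexp kap.

Section Cusps.
Variable R : realType.
Local Notation C := (R[i]%C).
Implicit Types (q z Z : C).

Lemma cexp_int z (n : int) : cexp z ^ n = cexp (n%:~R * z).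
Proof.
case: n => n; first by rewrite -exprnP cexpXR.
by rewrite NegzE -exprnN cexpXR -cexpN rmorphN mulNr.
Qed.

Lemma eu_cexp (x : R) : eu x = cexp ((0 +i* (2 * pi))%C * x%:c).
Proof. rewrite /eu; congr cexp; apply: eqC; rewrite ?ReM ?ImM /=; ring. Qed.

(** The root of unity carried by the pentagonal term of index s at the cusp h/t. *)
Definition pent_phase (t h : nat) (s : int) : R :=
  s%:~R / 2 + h%:R * (3 * s%:~R ^+ 2 + s%:~R) / (2 * t%:R).

Lemma pent_term (t h : nat) Z (j : int) : (0 < t)%N ->
  let q := eu (h%:R / t%:R) * cexp (- Z) in
  (q ^+ 3) ^+ tri j * (- q^-1) ^ j =
   eu (pent_phase t h j) * (cexp (Z / 24) * cexp (- ((3 / 2)%:c * (j%:~R + 1 / 6)%:c ^+ 2 * Z))).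
Proof.
move=> t0 /=; set q := eu (h%:R / t%:R) * cexp (- Z).
pose I : C := (0 +i* (2 * pi))%C.
pose W := I * (h%:R / t%:R)%:c - Z.
have qE : q = cexp W by rewrite /q eu_cexp -cexpD.
have m1 : -1 = cexp (I * (1 / 2)%:c) by rewrite -(eu_half R) eu_cexp.
have -> : - q^-1 = cexp (I * (1 / 2)%:c - W) by rewrite -mulN1r m1 qE -cexpN -cexpD.
rewrite cexp_int -exprM qE cexpXR eu_cexp -!cexpD -/I; congr cexp.
have tr : (3 * tri j)%:R = (3 * (j%:~R ^+ 2 + j%:~R) / 2)%:c :> C.
  have e : (tri j)%:R * 2 = j%:~R * (j%:~R + 1) :> R.
    by have := congr1 (fun n : int => n%:~R : R) (tri2 j); rewrite PoszM !intrM intrD.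
  have -> : 3 * (j%:~R ^+ 2 + j%:~R) / 2 = (3 * tri j)%:R :> R.
    by rewrite natrM; have -> : (tri j)%:R = j%:~R * (j%:~R + 1) / 2 :> R; [rewrite -e mulfK ?pnatr_eq0|field].
  by rewrite rmorph_nat.
rewrite tr -(rmorph_int (real_complex R)) /pent_phase /W.
have tn : t%:R != 0 :> R by rewrite pnatr_eq0 -lt0n.
move: (j%:~R : R) (h%:R : R) (t%:R : R) tn => x y w wn.
have -> : (x / 2 + y * (3 * x ^+ 2 + x) / (2 * w))%:c = (x / 2)%:c + ((3 * x ^+ 2 + x) / 2)%:c * (y / w)%:c :> C.
  by rewrite -rmorphM -rmorphD; congr (_%:c); field.
have -> : (3 * (x ^+ 2 + x) / 2)%:c = ((3 * x ^+ 2 + x) / 2)%:c + x%:c :> C.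
  by rewrite -rmorphD; congr (_%:c); field.
have e1 : ((3 * x ^+ 2 + x) / 2)%:c = (3 / 2)%:c * (x + 1 / 6)%:c ^+ 2 - (1 / 24)%:c :> C.
  by rewrite -rmorphXn -rmorphM -rmorphB; congr (_%:c); field.
have -> : Z / 24 = (1 / 24)%:c * Z by rewrite mulrC; congr (_ * _); rewrite rmorphM rmorph1 mul1r fmorphV rmorph_nat.
have e2 : (x / 2)%:c = x%:c * (1 / 2)%:c :> C by rewrite -rmorphM; congr (_%:c); field.
rewrite e2.
move: ((3 * x ^+ 2 + x) / 2)%:c ((3 / 2)%:c * (x + 1 / 6)%:c ^+ 2) ((1 / 24)%:c) e1 => a b c ->.
ring.
Qed.

Lemma pent_phase_period (t h : nat) (l : int) (s : nat) : (0 < t)%N ->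
  eu (pent_phase t h (l * (2 * t)%N%:Z + s%:Z)) = eu (pent_phase t h s%:Z) :> C.
Proof.
move=> t0; have tn : t%:R != 0 :> R by rewrite pnatr_eq0 -lt0n.
rewrite -(eu_addZ (pent_phase t h s%:Z) (l * t%:Z + h%:Z * (6 * t%:Z * l ^+ 2 + 6 * l * s%:Z + l))).
have nz n : (n%:Z)%:~R = n%:R :> R by [].
congr eu; rewrite /pent_phase !(intrD, intrM, rmorphXn, nz) natrM /=; by field.
Qed.

(** Gauss sums attached to the cusp h/t; gamma 0 vanishes and the two terms of index 1
    and -1 give the leading coefficient. *)
Definition gam (t h : nat) (k : int) : C :=
  \sum_(0 <= s < 2 * t) eu (pent_phase t h s%:Z) * eu (k%:~R * ((6 * s + 1)%:R / (12 * t)%:R)).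

Definition Gam t h : C := gam t h 1 + gam t h (-1).

Theorem eul_cusp (t h : nat) Z : (0 < t)%N -> 0 < Re Z ->
  eul (eu (h%:R / t%:R) * cexp (- Z)) =
  cexp (Z / 24) * kap ((6 * t%:R ^+ 2)%:c * Z) *
  zs (fun k => dgau ((6 * t%:R ^+ 2)%:c * Z) k * gam t h k).
Proof.
move=> t0 Z0; have tn : t%:R != 0 :> R by rewrite pnatr_eq0 -lt0n.
have tp : 0 < t%:R :> R by rewrite ltr0n.
set q := eu (h%:R / t%:R) * cexp (- Z); pose A : C := (6 * t%:R ^+ 2)%:c * Z.
have A0 : 0 < Re A by rewrite Re_realM mulr_gt0// mulr_gt0// exprn_gt0.
have q1 : nrm q < 1 by rewrite nrmM nrm_eu mul1r nrm_cexp expR_lt1 ReN oppr_lt0.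
have q0 : q != 0 by apply: mulf_neq0; [exact: eu_neq0|exact: cexp_neq0].
rewrite -(euler_pentagonal q1 q0) /theta.
have q31 : nrm (q ^+ 3) < 1 by exact: nrmX_lt1.
have z0 : - q^-1 != 0 by rewrite oppr_eq0 invr_eq0.
have [b hb] := theta_zdom q31 z0.
have k0 : (0 < 2 * t)%N by rewrite muln_gt0.
have zd (s : nat) := @dgau_zdom _ A A0 (fun k => eu (k%:~R * ((6 * s + 1)%:R / (12 * t)%:R))) 1 (fun k => eq_leq_R (nrm_eu _)).
pose D (s : nat) := zs (fun k => dgau A k * eu (k%:~R * ((6 * s + 1)%:R / (12 * t)%:R))).
pose L (s : nat) := cexp (Z / 24) * eu (pent_phase t h s%:Z) * (kap A * D s).
rewrite (@zcv_split _ _ (2 * t) L _ k0 (zsP (zdom_summable hb))); last first.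
  move=> s s2t.
  have jl : (6 * s + 1 < 12 * t)%N by lia.
  rewrite /L -(poisson A0 jl).
  have E : (fun j : int => (q ^+ 3) ^+ tri (j * (2 * t)%N%:Z + s%:Z) * (- q^-1) ^ (j * (2 * t)%N%:Z + s%:Z)) =
    (fun j : int => cexp (Z / 24) * eu (pent_phase t h s%:Z) * gau A (j%:~R + (6 * s + 1)%:R / (12 * t)%:R)%:c).
    apply/funext => j; rewrite pent_term// pent_phase_period// mulrCA mulrA; congr (_ * _).
    rewrite /gau; congr (cexp (- _)); rewrite /A [RHS]mulrAC; congr (_ * _).
    rewrite -!rmorphXn -!rmorphM; apply: (congr1 (real_complex R)).
    have nz n : (n%:Z)%:~R = n%:R :> R by [].
    by rewrite !(intrD, intrM, nz) natrD !natrM; field.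
  rewrite E; apply: zcvZ; apply: zsP.
  have [K K0 hK] := gau_expdom A0 (nrm_ge0 ((6 * s + 1)%:R / (12 * t)%:R)%:c).
  have [e _ _] := hK _ (lexx _).
  have := grid_summable ltr01 (ltW K0) e.
  have -> // : (fun n : int => gau A ((1 * n%:~R)%:c + ((6 * s + 1)%:R / (12 * t)%:R)%:c)) =
     (fun n : int => gau A (n%:~R + (6 * s + 1)%:R / (12 * t)%:R)%:c).
  by apply/funext => n; rewrite mul1r -rmorphD.
rewrite -/A.
have hz s : zcv (fun k => eu (pent_phase t h s%:Z) * (dgau A k * eu (k%:~R * ((6 * s + 1)%:R / (12 * t)%:R)))) (eu (pent_phase t h s%:Z) * D s).
  by apply: zcvZ; apply: zsP; exact: zdom_summable (zd s).
have := zcv_zs (zcv_sum (index_iota 0 (2 * t)) hz).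
have -> : (fun n : int => \sum_(0 <= i < 2 * t) eu (pent_phase t h i%:Z) * (dgau A n * eu (n%:~R * ((6 * i + 1)%:R / (12 * t)%:R)))) =
   (fun k => dgau A k * gam t h k).
  by apply/funext => k; rewrite /gam mulr_sumr; apply: eq_bigr => s _; ring.
move=> ->; rewrite mulr_sumr; apply: eq_bigr => s _; rewrite /L; ring.
Qed.

Lemma gam0 (t h : nat) : (0 < t)%N -> coprime h t -> gam t h 0 = 0.
Proof.
move=> t0 cop; have tn : t%:R != 0 :> R by rewrite pnatr_eq0 -lt0n.
rewrite /gam mul2n -addnn (big_cat_nat (leq0n _) (leq_addr t t))/=.
have sh (F : nat -> C) : \sum_(t <= i < t + t) F i = \sum_(0 <= i < t) F (i + t)%N.
  by rewrite -{1}[t]add0n big_addn addnK.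
rewrite sh -big_split/=; apply: big1_seq => s _.
rewrite !mul0r eu0 !mulr1.
suff -> : eu (pent_phase t h (s + t)%N%:Z) = - eu (pent_phase t h s%:Z) :> C by rewrite subrr.
have odd1 : odd (t + h * (6 * s + 3 * t + 1)).
  rewrite !(oddD, oddM) /=.
  have : ~~ (~~ odd t && ~~ odd h).
    apply/negP => /andP[ht hh]; have : (2 %| gcdn h t)%N by rewrite dvdn_gcd !dvdn2 ht hh.
    by rewrite (eqP cop).
  by case: (odd t) (odd h) => -[].
have [r hr] : exists r, (t + h * (6 * s + 3 * t + 1))%N = (r.*2.+1)%N.
  by exists ((t + h * (6 * s + 3 * t + 1))./2); rewrite -[LHS]odd_double_half odd1.
have -> : pent_phase t h (s + t)%N%:Z = pent_phase t h s%:Z + 1 / 2 + (r%:Z)%:~R.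
  have nz n : (n%:Z)%:~R = n%:R :> R by [].
  rewrite /pent_phase !nz natrD.
  have e : t%:R + h%:R * (6 * s%:R + 3 * t%:R + 1) = r%:R * 2 + 1 :> R.
    by have := congr1 (fun n => n%:R : R) hr; rewrite -muln2 -[(r * 2).+1]addn1 !(natrD, natrM).
  have -> : r%:R = (t%:R + h%:R * (6 * s%:R + 3 * t%:R + 1) - 1) / 2 :> R by rewrite e; field.
  by field.
by rewrite eu_addZ euD eu_half mulrN1.
Qed.

Lemma gam_le t h k : nrm (gam t h k) <= (2 * t)%:R.
Proof.
rewrite (le_trans (nrm_sum _ _ _))// (eq_bigr (fun=> 1)) => [|s _]; last by rewrite nrmM !nrm_eu mulr1.
by rewrite sumr_const_nat subn0.
Qed.

Lemma nrm_dgau (A : C) k : nrm (dgau A k) = expR (- (pi ^+ 2 * Re A^-1 * k%:~R ^+ 2)).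
Proof. by rewrite nrm_cexp ReN Re_realM; congr (expR (- _)); ring. Qed.

(** Leading term of the dual theta series at a cusp. *)
Lemma zs_leading (A : C) (f : int -> C) (M : R) : 0 < Re A -> 1 <= pi ^+ 2 * Re A^-1 ->
  (forall k, nrm (f k) <= M) -> f 0 = 0 ->
  exists2 e, nrm e <= 4 * M * expR (- (pi ^+ 2 * Re A^-1)) &
    zs (fun k => dgau A k * f k) = dgau A 1 * (f 1 + f (-1) + e).
Proof.
move=> A0 x1 hf f0; set x := pi ^+ 2 * Re A^-1 in x1 *.
have M0 : 0 <= M by rewrite (le_trans (nrm_ge0 _) (hf 0)).
pose small (k : int) := (absz k < 2)%N.
pose u k := dgau A k * f k.
pose v k := if small k then u k else 0.
pose w k := if small k then 0 else u k.
have uE : u = (fun k => v k + w k).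
  by apply/funext => k; rewrite /v /w; case: ifP; rewrite ?addr0 ?add0r.
have dm : dgau A (-1) = dgau A 1 by rewrite /dgau !rmorphN rmorph1 sqrrN.
have hv : zcv v (u 1 + u (-1)).
  apply: (tends_ext_near (N := 2) (u := fun=> u 1 + u (-1))); last exact: tends_cst.
  move=> n hn; rewrite /wsum big_ltn; last by lia.
  rewrite big_ltn; last by lia.
  rewrite big_nat big1 => [|k /andP[k2 _]]; last first.
    have e1 : small k%:Z = false by rewrite /small /= ltnNge k2.
    have e2 : small (- k.+1%:Z) = false by rewrite /small abszN /= ltnNge (leqW k2).
    by rewrite /v e1 e2 addr0.
  by rewrite /v /small /= /u f0 mulr0; ring.
pose r := expR (- x).
have r01 : 0 <= r < 1 by rewrite expR_ge0 expR_lt1 oppr_lt0 (lt_le_trans ltr01).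
have r2 : r <= 1 / 2.
  rewrite /r expRN -[leRHS]invrK lef_pV2 ?posrE ?expR_gt0//; last by lra.
  have := expR_ge1Dx x; lra.
have hw k : nrm (w k) <= M * r ^+ 2 * r ^+ `|k|%N.
  rewrite /w; case: ifP => hk.
    by rewrite nrm0 mulr_ge0 ?exprn_ge0 ?expR_ge0// mulr_ge0 ?exprn_ge0 ?expR_ge0.
  rewrite /u nrmM mulrC -mulrA; apply: ler_pM; rewrite ?nrm_ge0// nrm_dgau -/x -exprD /r -expRM_natl ler_expR.
  rewrite mulrN lerN2 mulrC ler_wpM2l ?(le_trans ler01)//.
  rewrite -[k%:~R ^+ 2]real_normK ?num_real// -intr_norm -natr_absz -natrX ler_nat.
  move: hk; rewrite /small => /negbT; rewrite -leqNgt; move: (absz k) => n; nia.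
have b0 n : 0 <= M * r ^+ 2 * r ^+ n by rewrite mulr_ge0 ?exprn_ge0 ?expR_ge0// mulr_ge0 ?exprn_ge0 ?expR_ge0.
have bB n : \sum_(0 <= k < n) M * r ^+ 2 * r ^+ k <= M * r ^+ 2 * 2.
  rewrite -mulr_sumr ler_wpM2l//; first by have := b0 0%N; rewrite expr0 mulr1.
  rewrite (le_trans (geometric_sum_le n r01))//.
  rewrite -[leRHS]invrK lef_pV2 ?posrE; lra.
have zw : zsummable w by apply: (@zdom_summable _ _ (fun n => M * r ^+ 2 * r ^+ n)); split => //; exists (M * r ^+ 2 * 2).
have nw := zdom_le hw b0 bB.
exists (zs w / dgau A 1).
  rewrite nrm_div nrm_dgau -/x expr1n mulr1 -/r ler_pdivrMr ?expR_gt0// (le_trans nw)//.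
  by rewrite expr2; lra.
have dn : dgau A 1 != 0 by exact: cexp_neq0.
rewrite -/u uE; have zv : zsummable v by exists (u 1 + u (-1)).
rewrite (zsD zv zw) (zcv_zs hv) /u dm.
by move: (dgau A 1) dn (zs w) (f 1) (f (-1)) => d dn a b c; field.
Qed.

Corollary eul_cusp_leading (t h : nat) : (0 < t)%N -> coprime h t -> forall Z, 0 < Re Z ->
  1 <= pi ^+ 2 / (6 * t%:R ^+ 2) * Re Z^-1 ->
  exists2 e, nrm e <= 8 * t%:R * expR (- (pi ^+ 2 / (6 * t%:R ^+ 2) * Re Z^-1)) &
   eul (eu (h%:R / t%:R) * cexp (- Z)) =
  cexp (Z / 24) * kap ((6 * t%:R ^+ 2)%:c * Z) * (cexp (- ((pi ^+ 2 / (6 * t%:R ^+ 2))%:c / Z)) * (Gam t h + e)).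
Proof.
move=> t0 cop Z Z0 x1; have tp : 0 < t%:R :> R by rewrite ltr0n.
have w0 : 0 < 6 * t%:R ^+ 2 :> R by rewrite mulr_gt0// exprn_gt0.
set w : R := 6 * t%:R ^+ 2 in w0 x1 *; pose A : C := w%:c * Z.
have A0 : 0 < Re A by rewrite Re_realM mulr_gt0.
have wc : w%:c != 0 :> C by rewrite -nrm_gt0 nrm_real gtr0_norm.
have AV : A^-1 = w^-1%:c * Z^-1 by rewrite invfM fmorphV.
have xE : pi ^+ 2 * Re A^-1 = pi ^+ 2 / w * Re Z^-1 by rewrite AV Re_realM mulrA.
have := @zs_leading A (gam t h) (2 * t)%:R A0; rewrite xE => /(_ x1 (gam_le t h) (gam0 t0 cop)) [e he hE].
exists e; first by rewrite (le_trans he)// natrM; lra.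
rewrite (eul_cusp h t0 Z0) -/w -/A hE; congr (_ * (_ * _)).
rewrite /dgau; congr (cexp (- _)).
by rewrite expr1n mulr1 AV mulrA -rmorphM.
Qed.

End Cusps.

End CuspExpansion.
Import CuspExpansion.

(** * Leading term of the Euler function at the cusps *)

Module CuspGrowth.

Local Opaque cexp kap eu.

Section EulerBounds.
Variable R : realType.
Local Notation C := (R[i]%C).
Implicit Types (q u z Z : C).

Lemma eul_le q : nrm q < 1 -> q != 0 -> nrm (eul q) <= 2 / (1 - nrm q).
Proof.
move=> q1 q0; rewrite -(euler_pentagonal q1 q0) /theta.
have nq0 : 0 < nrm q by rewrite nrm_gt0.
have q01 : 0 <= nrm q < 1 by rewrite nrm_ge0.
apply: (@zdom_le _ _ (fun k => nrm q ^+ k)) => [j|k|n].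
- have le1 a b : (b <= a)%N -> nrm q ^+ a <= nrm q ^+ b by move=> h; rewrite ler_wiXn2l// ltW.
  case: j => k.
    rewrite -[(- q^-1) ^ _]/((- q^-1) ^+ k) nrmM !nrmX nrmN nrmV exprVn -exprM ler_pdivrMr ?exprn_gt0// -exprD /=.
    by apply: le1; rewrite bin2 /=; have := leq_addr 0 k; rewrite -divn2; nia.
  rewrite NegzE -exprnN -exprVn invrN invrK nrmM !nrmX nrmN -exprM -exprD /=.
  by apply: le1; rewrite leq_addl.
- by rewrite exprn_ge0// nrm_ge0.
- exact: geometric_sum_le.
Qed.

Lemma expR_chord (y : R) : 0 <= y <= 1 -> (1 - y) * expR (2 * y) <= 1 + y.
Proof.
move=> /andP[y0 y1].
pose f (x : R) := 1 + x - (1 - x) * expR (2 * x).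
have df (x : R) : is_derive x (1 : R) f (1 - expR (2 * x) * (1 - 2 * x)).
  rewrite /f; apply: is_derive_eq.
  rewrite /GRing.scale /= ?mulr1 ?mulr0 ?add0r ?sub0r.
  by ring.
have cf : {within `[0, y], continuous f}.
  apply: derivable_within_continuous => x _.
  by have [] := df x.
have [c cy] := MVT_segment y0 (fun x _ => df x) cf.
rewrite /f mulr0 expR0 !addr0 !subr0 mulr1 subrr subr0 => h.
suff : 0 <= 1 + y - (1 - y) * expR (2 * y) by lra.
rewrite h mulr_ge0// subr_ge0.
have k := expR_ge1Dx (- (2 * c)); have := ler_wpM2l (expR_ge0 (2 * c)) k.
by rewrite -expRD subrr expR0; lra.
Qed.

Lemma one_sub_lower z : nrm z < 1 -> (1 - nrm z) * expR (nrm z - Re z) <= nrm (1 - z).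
Proof.
move=> z1; have z0 := nrm_ge0 z.
have hR : `|Re z| <= nrm z by exact: Re_le_nrm.
move: hR; rewrite ler_norml => /andP[hR1 hR2].
rewrite -(ler_pXn2r (n := 2)) ?nnegrE ?nrm_ge0 ?mulr_ge0 ?expR_ge0 ?subr_ge0 ?(ltW z1)//.
rewrite exprMn -expRM_natl.
have -> : nrm (1 - z) ^+ 2 = (1 - nrm z) ^+ 2 + 2 * (nrm z - Re z).
  rewrite nrm_sqr !(ReD, ImD, ReN, ImN) /=.
  have := nrm_sqr z; rewrite expr2 => e.
  have -> : (1 - nrm z) ^+ 2 = 1 - 2 * nrm z + nrm z * nrm z by ring.
  by rewrite e; ring.
set r := nrm z in z0 z1 hR1 hR2 *; set y := (r - Re z) / 2.
have y0 : 0 <= y by rewrite /y; lra.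
have yr : y <= r by rewrite /y; lra.
have -> : r - Re z = 2 * y by rewrite /y; field.
have E1 : 1 <= expR (2 * (2 * y)) by rewrite -[leLHS]expR0 ler_expR; lra.
have y1 : 0 <= y <= 1 by lra.
have k := expR_chord y1.
have k2 : ((1 - y) * expR (2 * y)) ^+ 2 <= (1 + y) ^+ 2.
  by rewrite ler_pXn2r// nnegrE ?mulr_ge0 ?expR_ge0//; lra.
move: k2; rewrite exprMn -expRM_natl; set E := expR (2 * (2 * y)) in E1 * => k2.
have : (1 - r) ^+ 2 * (E - 1) <= (1 - y) ^+ 2 * (E - 1).
  by rewrite ler_wpM2r ?subr_ge0// ler_pXn2r// ?nnegrE; lra.
lra.
Qed.

Lemma eul_lower u : nrm u < 1 -> u != 0 ->
  nrm (eul (nrm u)%:c) * expR ((1 - nrm u)^-1 - 2 / nrm (1 - u)) <= expR 2 * nrm (eul u).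
Proof.
move=> u1 u0; set r := nrm u in u1 *.
have r0 : 0 <= r by exact: nrm_ge0.
have r01 : 0 <= r < 1 by rewrite r0.
have nr : nrm (r%:c : C) = r by rewrite nrm_real ger0_norm.
have rc1 : nrm (r%:c : C) < 1 by rewrite nr.
have r10 : 0 < 1 - r by rewrite subr_gt0.
have d0 : 1 - u != 0 by rewrite subr_eq0; apply/eqP => e; move: u1; rewrite /r -e nrm1 ltxx.
have dp : 0 < nrm (1 - u) by rewrite nrm_gt0.
set E := expR _.
have fin N : nrm (eulp r%:c N) * expR (\sum_(0 <= k < N) (r ^+ k.+1 - Re (u ^+ k.+1))) <= nrm (eulp u N).
  rewrite !nrm_prod expR_sum -big_split/=; apply: ler_prod => k _.
  rewrite mulr_ge0 ?nrm_ge0 ?expR_ge0//=.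
  have uk : nrm (u ^+ k.+1) < 1 by exact: nrmX_lt1.
  have := one_sub_lower uk; rewrite nrmX -/r.
  have -> // : nrm (1 - r%:c ^+ k.+1 : C) = 1 - r ^+ k.+1.
  rewrite -rmorphXn -(rmorph1 (real_complex R)) -rmorphB nrm_real ger0_norm//.
  by rewrite subr_ge0 exprn_ile1 ?r0 ?(ltW u1).
have ge n : 0 <= 1 * r ^+ n by rewrite mul1r exprn_ge0.
have hN1 := sums_bounded_to0 ge (geometric_sums_bounded r01 ler01) r10.
case: hN1 => N0 hN0.
have sumE : forall n, (N0 <= n)%N -> (1 - r)^-1 - 2 / nrm (1 - u) - 2 <= \sum_(0 <= k < n) (r ^+ k.+1 - Re (u ^+ k.+1)).
  move=> n hN; rewrite sumrB -Re_sum.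
  have g1 : \sum_(0 <= k < n) r ^+ k.+1 = (1 - r ^+ n) * r / (1 - r).
    rewrite (eq_bigr (fun k => r * r ^+ k)) => [|k _]; last by rewrite exprS.
    rewrite -mulr_sumr big_mkord; have := subrX1 r n; rewrite -opprB -[r - 1]opprB mulNr => /oppr_inj ->.
    by field; exact: lt0r_neq0.
  have g2 : \sum_(0 <= k < n) u ^+ k.+1 = (1 - u ^+ n) * u / (1 - u).
    rewrite (eq_bigr (fun k => u * u ^+ k)) => [|k _]; last by rewrite exprS.
    rewrite -mulr_sumr big_mkord; have := subrX1 u n; rewrite -opprB -[u - 1]opprB mulNr => /oppr_inj ->.
    by field.
  have g3 : Re (\sum_(0 <= k < n) u ^+ k.+1) <= 2 / nrm (1 - u).
    rewrite (le_trans (ler_norm _))// (le_trans (Re_le_nrm _))// g2 nrm_div ler_wpM2r ?invr_ge0 ?(ltW dp)//.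
    rewrite nrmM -/r; have h1 := nrmB 1 (u ^+ n); rewrite nrm1 nrmX -/r in h1.
    have h2 : r ^+ n <= 1 by rewrite exprn_ile1// ltW.
    have : nrm (1 - u ^+ n) * r <= 2 * 1 by apply: ler_pM; rewrite ?nrm_ge0 ?(ltW u1)//; lra.
    by rewrite mulr1.
  have h4 := hN0 n hN; rewrite mul1r in h4.
  rewrite g1.
  have g5 : (1 - r ^+ n) * r / (1 - r) = (1 - r)^-1 - 1 - r ^+ n * r / (1 - r) by field; exact: lt0r_neq0.
  have g6 : r ^+ n * r / (1 - r) <= 1.
    by rewrite ler_pdivrMr// mul1r (le_trans _ h4)// ler_piMr ?exprn_ge0 ?(ltW u1).
  rewrite g5; lra.
have q0 := eul_neq0 u1; have q1 : 0 < nrm (eul u) by rewrite nrm_gt0.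
have t1 : tends (fun n => eulp r%:c (n + N0) * E%:c / eulp u (n + N0)) (eul r%:c * E%:c / eul u).
  have sh m : (m <= m + N0)%N by rewrite leq_addr.
  apply: tendsM; last by apply: tendsV q0 _; exact: (tends_comp (f := fun n => (n + N0)%N) sh (eul_cvg u1)).
  apply: tendsM (tends_cst _); exact: (tends_comp (f := fun n => (n + N0)%N) sh (eul_cvg rc1)).
have := tends_nrm (b := expR 2) t1.
rewrite nrm_div nrmM nrm_real (ger0_norm (expR_ge0 _)) ler_pdivrMr//; apply.
move=> n; have ep : 0 < nrm (eulp u (n + N0)) by rewrite nrm_gt0 eulp_neq0.
rewrite nrm_div nrmM nrm_real (ger0_norm (expR_ge0 _)) ler_pdivrMr//.
have := fin (n + N0)%N; move=> /(ler_wpM2l (expR_ge0 2)); apply: le_trans.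
rewrite mulrCA ler_wpM2l ?nrm_ge0// -expRD ler_expR.
by have := sumE (n + N0)%N (leq_addl _ _); lra.
Qed.

Lemma Gam1E : Gam R 1 0 = (4 * cos (pi / 6))%:c.
Proof.
have e (x : R) : eu x + eu (- x) = (2 * cos (2 * pi * x))%:c :> C.
  by rewrite !euE mulrN cosN sinN; apply: eqC; rewrite /=; ring.
have g k : gam R 1 0 k = eu (k%:~R / 12) - eu (k%:~R * (7 / 12)).
  rewrite /gam (_ : (2 * 1 = 2)%N)// (_ : (12 * 1 = 12)%N)// unlock/= addr0.
  have p0 : eu (pent_phase R 1 0 0) = 1 :> C by rewrite /pent_phase mul0r mul0r mul0r addr0 eu0.
  have p1 : eu (pent_phase R 1 0 1) = -1 :> C by rewrite /pent_phase mul0r mul0r addr0 eu_half.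
  rewrite (_ : (6 * 0 + 1 = 1)%N)// (_ : (6 * 1 + 1 = 7)%N)//.
  by rewrite p0 p1 mul1r mulN1r mul1r.
rewrite /Gam !g.
have -> : (-1)%:~R = -1 :> R by [].
have -> : 1%:~R = 1 :> R by [].
rewrite !mulN1r !mul1r addrACA -opprD !e.
have -> : 2 * pi * (12^-1) = pi / 6 :> R by field.
have -> : 2 * pi * (7 / 12) = pi / 6 + pi :> R by field.
by rewrite cosDpi mulrN rmorphN opprK -rmorphD; congr (_%:c); ring.
Qed.

Lemma Gam1_gt0 : 0 < 4 * cos (pi / 6 : R).
Proof.
rewrite mulr_gt0// cos_gt0_pihalf//; have := @pi_gt0 R; lra.
Qed.

Lemma small_exp (K x : R) : 0 < K -> expR (- x) <= K \/ x < K^-1.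
Proof.
move=> K0; have [h|h] := leP K^-1 x; [left|by right].
rewrite expRN -[leRHS]invrK lef_pV2 ?posrE ?expR_gt0 ?invr_gt0// (le_trans h)//.
have := expR_ge1Dx x; lra.
Qed.

Lemma eul_real_lower : exists c Y0 : R, [/\ 0 < c, 0 < Y0 & forall Y, 0 < Y <= Y0 ->
  c * expR (- (pi ^+ 2 / 6 / Y)) <= nrm (eul (expR (- Y))%:c)].
Proof.
have p0 := @pi_gt0 R; have p2 := @pi_ge2 R.
have K0 := Gam1_gt0; set K := 4 * cos (pi / 6) in K0.
pose Y0 : R := Num.min (1 / 6) (K / 32).
have Y00 : 0 < Y0 by rewrite lt_min; apply/andP; split; lra.
exists (K / 2), Y0; split => //; first by rewrite divr_gt0.
move=> Y /andP[Y1]; rewrite le_min => /andP[Y2 Y3].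
have ReZ : 0 < Re (Y%:c : C) by [].
have iY : (Y%:c : C)^-1 = Y^-1%:c by rewrite fmorphV.
have x1 : 1 <= pi ^+ 2 / (6 * 1%:R ^+ 2) * Re (Y%:c : C)^-1.
  rewrite iY /= expr1n mulr1 -mulrA -invfM ler_pdivlMr ?mulr_gt0//.
  by have : 2 * 2 <= pi ^+ 2 :> R; [rewrite expr2 ler_pM//|lra].
have [e he] := eul_cusp_leading (isT : 0 < 1)%N (coprimen1 0) ReZ x1.
rewrite divr1 eu0 mul1r -rmorphN cexp_real => ->.
move: he; rewrite iY /= expr1n !mulr1 => he.
have he2 : nrm e <= K / 2.
  rewrite (le_trans he)//.
  have K16 : 0 < K / 16 by rewrite divr_gt0.
  have [h16|hx] := small_exp (pi ^+ 2 / 6 * Y^-1) K16; first by lra.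
  exfalso; move: hx; apply/negP; rewrite -leNgt invf_div.
  have a1 : 16 / K <= 1 / (2 * Y).
    rewrite ler_pdivrMr// mulrC mulrA ler_pdivlMr ?mulr_gt0//; lra.
  rewrite (le_trans a1)// invfM mulrA ler_wpM2r ?invr_ge0 ?(ltW Y1)//.
  by have : 2 * 2 <= pi ^+ 2 :> R; [rewrite expr2 ler_pM//|lra].
have G1 : K / 2 <= nrm (Gam R 1 0 + e).
  have := ler_nrm_dist (Gam R 1 0) (- e); rewrite opprK nrmN Gam1E nrm_real gtr0_norm// -/K; lra.
rewrite !nrmM !nrm_cexp.
have -> : Re (Y%:c / 24) = Y / 24.
  have -> : Y%:c / 24 = (Y / 24)%:c :> C by rewrite rmorphM fmorphV rmorph_nat.
  by [].
have -> : Re (- ((pi ^+ 2 / 6)%:c * Y^-1%:c)) = - (pi ^+ 2 / 6 / Y) by rewrite ReN Re_realM.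
have kE : nrm (kap (6%:c * Y%:c : C)) = (Num.sqrt (6 * Y / pi))^-1.
  have l0 : 0 < Num.sqrt (6 * Y / pi) by rewrite sqrtr_gt0 divr_gt0// mulr_gt0.
  have pr : 0 < Re (pi%:c : C) by [].
  have -> : 6%:c * Y%:c = (Num.sqrt (6 * Y / pi) ^+ 2)%:c * pi%:c :> C.
    by rewrite -!rmorphM; congr (_%:c); rewrite sqr_sqrtr ?divfK ?gt_eqF// divr_ge0 ?ltW// mulr_gt0.
  by rewrite (kap_scale pr l0) kap_pi mulr1 nrm_real gtr0_norm// invr_gt0.
rewrite kE.
have s1 : 1 <= (Num.sqrt (6 * Y / pi))^-1.
  rewrite invf_ge1 ?sqrtr_gt0 ?divr_gt0 ?mulr_gt0//.
  rewrite -[leRHS]sqrtr1 ler_sqrt// ler_pdivrMr//; lra.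
have e1 : 1 <= expR (Y / 24) by rewrite -[leLHS]expR0 ler_expR divr_ge0// ltW.
rewrite [_ * nrm _]mulrC mulrA [leRHS]mulrC.
set X := expR (- _).
have X0 : 0 <= X by exact: expR_ge0.
have : 1 <= expR (Y / 24) * (Num.sqrt (6 * Y / pi))^-1 by rewrite mulr_ege1.
set P := _ * _^-1 => P1.
have : K / 2 * X <= nrm (Gam R 1 0 + e) * X by rewrite ler_wpM2r.
have : nrm (Gam R 1 0 + e) * X <= nrm (Gam R 1 0 + e) * X * P by rewrite ler_peMr// mulr_ge0 ?nrm_ge0.
lra.
Qed.

Lemma pi_lt : pi < 13 / 4 :> R.
Proof.
have p2 := @pi_ge2 R.
have c4 : cos (13 / 8 : R) < 0.
  have dbl (x y : R) : 0 <= y -> - y <= cos x <= y -> cos (x *+ 2) <= 2 * y ^+ 2 - 1.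
    move=> y0 /andP[h1 h2]; rewrite cos_mulr2n -[_ *+ 2]mulr_natl.
    have : cos x ^+ 2 <= y ^+ 2 by rewrite -[cos x ^+ 2]real_normK ?num_real// ler_pXn2r ?nnegrE// ler_norml h1.
    lra.
  have lowc (x : R) : 1 - x ^+ 2 / 2 <= cos x by have := cos_quad x; lra.
  (* sine from below, by the mean value theorem, then 1 - cos by half angles *)
  pose x : R := 13 / 32.
  have hx : cos x <= 921 / 1000.
    pose z := x / 2.
    have z0 : 0 <= z by rewrite /z /x; lra.
    have [c cz h] := MVT_segment z0 (fun x _ => is_derive_sin x) (continuous_subspaceT (@continuous_sin R)).
    move: cz; rewrite in_itv/= => /andP[c0 cz].
    rewrite sin0 !subr0 in h.
    have lc : 1 - z ^+ 2 / 2 <= cos c.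
      by rewrite (le_trans _ (lowc c))// lerD2l lerN2 ler_pM2r ?invr_gt0// ler_pXn2r ?nnegrE.
    have ls : (1 - z ^+ 2 / 2) * z <= sin z by rewrite h ler_wpM2r.
    have l0 : 0 <= (1 - z ^+ 2 / 2) * z by rewrite /z /x; lra.
    have l2 : ((1 - z ^+ 2 / 2) * z) ^+ 2 <= sin z ^+ 2 by rewrite ler_pXn2r ?nnegrE// (le_trans l0).
    have := cos_one_sub x; rewrite -/z => e.
    move: l2; rewrite /z /x; lra.
  have hx0 : 0 <= cos x by rewrite (le_trans _ (lowc x))// /x; lra.
  have h2 : cos (x *+ 2) <= 697 / 1000.
    have := dbl x (921 / 1000) ltac:(lra) ltac:(lra); lra.
  have h20 : 0 <= cos (x *+ 2) by rewrite (le_trans _ (lowc _))// -mulr_natl /x; lra.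
  have h4 := dbl (x *+ 2) (697 / 1000) ltac:(lra) ltac:(lra).
  have -> : 13 / 8 = x *+ 2 *+ 2 :> R by rewrite -mulrnA -(mulr_natl x 4) /x; field.
  lra.
rewrite ltNge; apply/negP => h.
have : 0 <= cos (13 / 8 : R).
  by apply: cos_ge0_pihalf; apply/andP; split; lra.
lra.
Qed.

End EulerBounds.

End CuspGrowth.
Import CuspGrowth.

(** * Growth of the eta quotient along a circle *)

Module EtaGrowth.

Ltac pos := repeat first [ assumption | done | apply: expR_gt0 | apply: exprn_gt0 | apply: divr_gt0
  | apply: mulr_gt0 | apply: addr_gt0 ].
Ltac nonneg := repeat first [ assumption | done | by apply: ltW | apply: expR_ge0 | apply: nrm_ge0
  | apply: exprn_ge0 | apply: divr_ge0 | apply: mulr_ge0 | apply: addr_ge0 ].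

Section Growth.
Variable R : realType.
Local Notation C := (R[i]%C).
Implicit Types (q u z Z : C).

Lemma expR_pow_le (k : nat) (e : R) : 0 < e ->
  exists2 K, 0 < K & forall x, 0 <= x -> x ^+ k <= K * expR (e * x).
Proof.
move=> e0; case: k => [|k].
  by exists 1 => // x x0; rewrite expr0 mul1r -[leLHS]expR0 ler_expR mulr_ge0// ltW.
pose d : R := k.+1%:R; have d0 : 0 < d by [].
exists ((d / e) ^+ k.+1); first by rewrite exprn_gt0// divr_gt0.
move=> x x0; pose y := e * x / d.
have y0 : 0 <= y by apply: divr_ge0; [apply: mulr_ge0 => //|]; exact: ltW.
have dn : d != 0 by rewrite gt_eqF.
have en : e != 0 by rewrite gt_eqF.
have xE : x = d / e * y.
  by apply: (mulfI en); rewrite mulrA [e * (d / e)]mulrC divfK// /y [RHS]mulrC divfK.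
have eE : e * x = d * y by rewrite /y [RHS]mulrC divfK.
rewrite eE xE exprMn ler_pM2l ?exprn_gt0 ?divr_gt0// {1}/d expRM_natl.
rewrite ler_pXn2r// ?nnegrE ?expR_ge0//.
by have := expR_ge1Dx y; lra.
Qed.

Lemma pow_close (m : nat) (X : R) : 0 <= X -> exists2 K, 0 < K &
  forall x y : C, nrm x <= X -> nrm y <= X -> nrm (x ^+ m - y ^+ m) <= K * nrm (x - y).
Proof.
move=> X0; elim: m => [|m [K K0 IH]].
  by exists 1 => // x y _ _; rewrite !expr0 subrr nrm0 mul1r nrm_ge0.
have Xm : 0 <= X ^+ m by rewrite exprn_ge0.
have XK : 0 <= X * K by rewrite mulr_ge0// ltW.
exists (X * K + X ^+ m + 1) => [|x y hx hy]; first lra.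
have -> : x ^+ m.+1 - y ^+ m.+1 = x * (x ^+ m - y ^+ m) + (x - y) * y ^+ m by rewrite !exprS; ring.
rewrite (le_trans (nrmD _ _))// !nrmM nrmX.
have h1 : nrm x * nrm (x ^+ m - y ^+ m) <= X * (K * nrm (x - y)) by rewrite ler_pM ?nrm_ge0// IH.
have h2 : nrm (x - y) * nrm y ^+ m <= nrm (x - y) * X ^+ m.
  by rewrite ler_wpM2l ?nrm_ge0// lerXn2r ?nnegrE ?nrm_ge0.
have := nrm_ge0 (x - y); lra.
Qed.

Lemma uniform_consts (t : nat) (P : nat -> R -> R -> Prop) :
  (forall h K K' Y Y', P h K Y -> K <= K' -> Y' <= Y -> P h K' Y') ->
  (forall h, (h < t)%N -> exists K Y, [/\ 0 < K, 0 < Y & P h K Y]) ->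
  exists K Y, [/\ 0 < K, 0 < Y & forall h, (h < t)%N -> P h K Y].
Proof.
move=> mono; elim: t => [|t IH] H; first by exists 1, 1.
have [K [Y [K0 Y0 hP]]] := IH (fun h ht => H h (ltnW ht)).
have [K' [Y' [K0' Y0' hP']]] := H t (ltnSn t).
exists (Num.max K K'), (Num.min Y Y'); split; rewrite ?lt_max ?lt_min ?K0 ?Y0//.
move=> h; rewrite ltnS leq_eqVlt => /orP[/eqP->|ht].
  by apply: mono hP' _ _; rewrite ?le_max ?ge_min lexx orbT.
by apply: mono (hP h ht) _ _; rewrite ?le_max ?ge_min lexx.
Qed.

Lemma Re_inv Z : Re Z^-1 = Re Z / (Re Z ^+ 2 + Im Z ^+ 2).
Proof. by case: Z. Qed.

Lemma Re_inv_bounds Z (B : R) : 0 < Re Z -> `|Im Z| <= B * Re Z ->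
  (Re Z * (1 + B ^+ 2))^-1 <= Re Z^-1 <= (Re Z)^-1.
Proof.
move=> Y0 hI; rewrite Re_inv; set Y := Re Z in Y0 hI *; set f := Im Z in hI *.
have f2 : f ^+ 2 <= B ^+ 2 * Y ^+ 2.
  rewrite -[f ^+ 2]real_normK ?num_real// -exprMn ler_pXn2r ?nnegrE//.
  exact: le_trans (normr_ge0 _) hI.
have y2 : 0 < Y ^+ 2 by rewrite exprn_gt0.
have f0 := sqr_ge0 f; have B0 := sqr_ge0 B.
have d0 : 0 < Y ^+ 2 + f ^+ 2 by lra.
have e0 : 0 < Y * (1 + B ^+ 2) by rewrite mulr_gt0//; lra.
apply/andP; split.
  rewrite ler_pdivlMr// mulrC ler_pdivrMr//.
  have -> : Y * (Y * (1 + B ^+ 2)) = Y ^+ 2 + B ^+ 2 * Y ^+ 2 by ring.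
  lra.
rewrite ler_pdivrMr// mulrDr expr2 mulKf ?gt_eqF//.
by rewrite lerDl mulr_ge0 ?invr_ge0 // ltW.
Qed.

Lemma nrm_one_sub_cexp_sqr Z : nrm (1 - cexp (- Z)) ^+ 2 =
  (1 - expR (- Re Z)) ^+ 2 + 2 * expR (- Re Z) * (1 - cos (Im Z)).
Proof.
rewrite nrm_sqr !(ReD, ImD, ReN, ImN) /= !(ReN, ImN) cosN sinN.
have := cos2Dsin2 (Im Z); move: (cos _) (sin _) (expR _) => c s r h.
have -> : (0 - r * - s) ^+ 2 = r ^+ 2 * s ^+ 2 by ring.
have -> : s ^+ 2 = 1 - c ^+ 2 by lra.
ring.
Qed.

End Growth.

Local Opaque cexp kap eu.

Section Arcs.
Variable R : realType.
Local Notation C := (R[i]%C).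
Implicit Types (q u z Z : C).

(** The value 2 sqrt 3 of Gam at the cusp 0 of the denominator. *)
Definition Gam1 : R := 4 * cos (pi / 6).

Definition eta_quot (t m : nat) q : C := (eul q / eul (q ^+ t)) ^+ m.

Lemma Gam1_pos : 0 < Gam1. Proof. exact: Gam1_gt0. Qed.
Lemma Gam_one : Gam R 1 0 = Gam1%:c. Proof. exact: Gam1E. Qed.
Global Opaque Gam1.

Definition gap (t : nat) : R := pi ^+ 2 / (6 * t%:R ^+ 2).

Lemma gap_gt0 t : (0 < t)%N -> 0 < gap t.
Proof. by move=> t0; rewrite divr_gt0 ?exprn_gt0 ?pi_gt0// mulr_gt0// exprn_gt0 ?ltr0n. Qed.

Lemma cusp_ratio (t t' h : nat) (B : R) : (0 < t')%N -> (t' <= t)%N -> coprime h t' ->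
  exists K Y0, [/\ 0 < K, 0 < Y0 & forall Z, 0 < Re Z <= Y0 -> `|Im Z| <= B * Re Z ->
   exists2 e, nrm e <= K * expR (- (gap t * Re Z^-1)) &
    eul (eu (h%:R / t'%:R) * cexp (- Z)) / eul (cexp (- (t%:R%:c * Z))) =
    cexp (- (((t%:R - 1) / 24)%:c * Z)) * (Num.sqrt t%:R / t'%:R)%:c *
    cexp ((pi ^+ 2 / 6 * (t%:R^-1 - (t'%:R ^+ 2)^-1))%:c / Z) * (Gam R t' h / Gam1%:c + e)].
Proof.
move=> t'0 t't cop; have t0 : (0 < t)%N by exact: leq_trans t't.
have tp : 0 < t%:R :> R by rewrite ltr0n.
have tp' : 0 < t'%:R :> R by rewrite ltr0n.
have tt : t'%:R <= t%:R :> R by rewrite ler_nat.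
have t1 : 1 <= t'%:R :> R by rewrite ler1n.
have p0 := @pi_gt0 R.
have K0 : 0 < Gam1 := Gam1_pos.
have g0 := gap_gt0 t0; set g := gap t in g0 *.
have B2 := sqr_ge0 B.
pose V : R := 1 + 16 / Gam1.
have V0 : 0 < 16 / Gam1 by rewrite divr_gt0.
have V1 : 0 < V by rewrite /V; lra.
pose Y0 : R := g / (1 + B ^+ 2) / V.
have b0 : 0 < 1 + B ^+ 2 by lra.
pose G := Gam R t' h.
have nG := nrm_ge0 G.
have KK : 0 < (8 * t%:R * Gam1 + 8 * nrm G) * (2 / Gam1 ^+ 2).
  apply: mulr_gt0; last by pos.
  have : 0 < 8 * t%:R * Gam1 by pos.
  lra.
exists ((8 * t%:R * Gam1 + 8 * nrm G) * (2 / Gam1 ^+ 2)), Y0; split => //.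
  by rewrite /Y0; pos.
move=> Z /andP[Z0 ZY] hI; have /andP[w1 w2] := Re_inv_bounds Z0 hI.
set w := Re Z^-1 in w1 w2 *.
have gw : V <= g * w.
  apply: le_trans (ler_wpM2l (ltW g0) w1).
  have e0 : 0 < Re Z * (1 + B ^+ 2) by pos.
  rewrite ler_pdivlMr//; move: ZY; rewrite /Y0 ler_pdivlMr// ler_pdivlMr//.
  by have -> : Re Z * V * (1 + B ^+ 2) = V * (Re Z * (1 + B ^+ 2)) by ring.
have w0 : 0 < w by rewrite (lt_le_trans _ w1)// invr_gt0 mulr_gt0.
have gt' : g <= pi ^+ 2 / (6 * t'%:R ^+ 2).
  rewrite /g /gap ler_pM2l ?exprn_gt0// lef_pV2 ?posrE ?mulr_gt0 ?exprn_gt0//.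
  by rewrite ler_pM2l// ler_pXn2r ?nnegrE ?(ltW tp) ?(ltW tp').
have gt1 : g <= pi ^+ 2 / (6 * 1%:R ^+ 2) * t%:R^-1.
  rewrite /g /gap -mulrA ler_pM2l ?exprn_gt0// expr1n mulr1 -invfM lef_pV2 ?posrE ?mulr_gt0 ?exprn_gt0//.
  rewrite ler_pM2l// expr2 ler_peMr ?(ltW tp)//; lra.
have V2 : 1 <= V by rewrite /V; lra.
have c1 : 1 <= pi ^+ 2 / (6 * t'%:R ^+ 2) * w.
  by rewrite (le_trans V2)// (le_trans gw)// ler_wpM2r// ltW.
have [e1 he1 E1] := eul_cusp_leading t'0 cop Z0 c1.
have Zt0 : 0 < Re (t%:R%:c * Z) by rewrite Re_realM mulr_gt0.
have wt : Re (t%:R%:c * Z)^-1 = t%:R^-1 * w by rewrite invfM -fmorphV Re_realM.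
have c2 : 1 <= pi ^+ 2 / (6 * 1%:R ^+ 2) * Re (t%:R%:c * Z)^-1.
  by rewrite wt mulrA (le_trans V2)// (le_trans gw)// ler_wpM2r// ltW.
have [e2 he2 E2] := eul_cusp_leading (isT : 0 < 1)%N (coprimen1 0) Zt0 c2.
rewrite Gam_one mul0r eu0 mul1r in E2.
rewrite wt mulrA in he2.
set x := expR (- (g * w)).
have x0 : 0 <= x := expR_ge0 _.
have he1x : nrm e1 <= 8 * t%:R * x.
  rewrite (le_trans he1)// ler_pM ?mulr_ge0 ?expR_ge0 ?(ltW tp')// ?ler_pM2l// ler_expR lerN2.
  by rewrite ler_wpM2r// ltW.
have he2x : nrm e2 <= 8 * x.
  rewrite (le_trans he2)// mulr1 ler_pM2l// ler_expR lerN2.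
  by rewrite ler_wpM2r// ltW.
have xs : x <= Gam1 / 16.
  have G16 : 0 < Gam1 / 16 by rewrite divr_gt0.
  have [//|] := small_exp (g * w) G16.
  by rewrite invf_div; move: gw; rewrite /V; lra.
have d1 : Gam1 / 2 <= nrm (Gam1%:c + e2).
  have := ler_nrm_dist (Gam1%:c) (- e2); rewrite opprK nrmN nrm_real gtr0_norm//; lra.
have d0 : Gam1%:c + e2 != 0 by rewrite -nrm_gt0 (lt_le_trans _ d1)// divr_gt0.
have G10 : Gam1%:c != 0 :> C by rewrite -nrm_gt0 nrm_real gtr0_norm.
set E := (G + e1) / (Gam1%:c + e2) - G / Gam1%:c.
exists E.
  have -> : E = (e1 * Gam1%:c - G * e2) / (Gam1%:c * (Gam1%:c + e2)).
    by rewrite /E; move: G10 d0; move: (Gam1%:c) => k k0 d0; field; rewrite d0 k0.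
  rewrite nrm_div nrmM nrm_real gtr0_norm// ler_pdivrMr; last by rewrite mulr_gt0// (lt_le_trans _ d1)// divr_gt0.
  rewrite (le_trans (nrmB _ _))// !nrmM nrm_real gtr0_norm//.
  have n1 : nrm e1 * Gam1 <= 8 * t%:R * x * Gam1 by rewrite ler_wpM2r// ltW.
  have n2 : nrm G * nrm e2 <= nrm G * (8 * x) by rewrite ler_wpM2l.
  have n3 : (8 * t%:R * Gam1 + 8 * nrm G) * (2 / Gam1 ^+ 2) * x * (Gam1 * (Gam1 / 2)) <=
     (8 * t%:R * Gam1 + 8 * nrm G) * (2 / Gam1 ^+ 2) * x * (Gam1 * nrm (Gam1%:c + e2)).
    apply: ler_wpM2l; first by nonneg.
    by apply: ler_wpM2l => //; exact: ltW.
  apply: le_trans n3.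
  have -> : (8 * t%:R * Gam1 + 8 * nrm G) * (2 / Gam1 ^+ 2) * x * (Gam1 * (Gam1 / 2)) =
    8 * t%:R * x * Gam1 + nrm G * (8 * x) by field; rewrite gt_eqF.
  lra.
have -> : G / Gam1%:c + E = (G + e1) / (Gam1%:c + e2) by rewrite /E addrC subrK.
have s0 : 0 < Num.sqrt t%:R :> R by rewrite sqrtr_gt0.
pose l : R := t'%:R / Num.sqrt t%:R.
have l0 : 0 < l by rewrite divr_gt0.
set A := (6 * 1%:R ^+ 2)%:c * (t%:R%:c * Z) in E2.
have A0 : 0 < Re A by rewrite /A Re_realM expr1n mulr1 mulr_gt0.
have kE : kap ((6 * t'%:R ^+ 2)%:c * Z) = (Num.sqrt t%:R / t'%:R)%:c * kap A.
  have -> : (6 * t'%:R ^+ 2)%:c * Z = (l ^+ 2)%:c * A.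
    rewrite /A !mulrA -!rmorphM; congr (_ * _); apply: (congr1 (real_complex R)).
    by rewrite /l expr_div_n sqr_sqrtr ?(ltW tp)//; field; rewrite gt_eqF.
  by rewrite (kap_scale A0 l0) /l invf_div.
have uE : nrm (cexp (- (t%:R%:c * Z))) < 1.
  by rewrite nrm_cexp ReN -[ltRHS]expR0 ltr_expR oppr_lt0.
have u0 := eul_neq0 uE.
have k0 : kap A != 0.
  by apply: contraNneq u0 => k0; rewrite E2 k0 mulr0 mul0r.
rewrite E1 E2 kE.
have -> : cexp (- (((t%:R - 1) / 24)%:c * Z)) = cexp (Z / 24) / cexp (t%:R%:c * Z / 24).
  rewrite -cexpN -cexpD; congr cexp.
  rewrite !rmorphM rmorphB fmorphV !rmorph_nat rmorph1.
  by field.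
have -> : cexp ((pi ^+ 2 / 6 * (t%:R^-1 - (t'%:R ^+ 2)^-1))%:c / Z) =
  cexp (- ((pi ^+ 2 / (6 * t'%:R ^+ 2))%:c / Z)) / cexp (- ((pi ^+ 2 / (6 * 1%:R ^+ 2))%:c / (t%:R%:c * Z))).
  rewrite -cexpN -cexpD; congr cexp.
  have -> : pi ^+ 2 / 6 * (t%:R^-1 - (t'%:R ^+ 2)^-1) =
    - (pi ^+ 2 / (6 * t'%:R ^+ 2)) + pi ^+ 2 / (6 * 1%:R ^+ 2) * t%:R^-1 :> R.
    by rewrite expr1n mulr1; move: (pi : R) (t%:R : R) (t'%:R : R) tp tp' => p x1 x2 y1 y2; field; rewrite !gt_eqF.
  move: (pi ^+ 2 / (6 * t'%:R ^+ 2) : R) (pi ^+ 2 / (6 * 1%:R ^+ 2) : R) => a b.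
  have -> : (- a + b * t%:R^-1)%:c = - a%:c + b%:c / t%:R%:c :> C.
    by rewrite -fmorphV -rmorphM -rmorphN -rmorphD.
  rewrite opprK invfM; move: (a%:c) (b%:c) (t%:R%:c : C)^-1 Z^-1 => a' b' c' z'.
  by ring.
have x1 := cexp_neq0 (t%:R%:c * Z / 24).
have x2 := cexp_neq0 (- ((pi ^+ 2 / (6 * 1%:R ^+ 2))%:c / (t%:R%:c * Z))).
have aux (a1 a2 k d b1 b2 r g1 : C) : a1 != 0 -> a2 != 0 -> k != 0 -> d != 0 ->
    b1 * (r * k) * (b2 * g1) / (a1 * k * (a2 * d)) = b1 / a1 * r * (b2 / a2) * (g1 / d).
  by move=> z1 z2 z3 z4; field; rewrite z1 z2 z3 z4.
exact: aux.
Qed.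

End Arcs.

End EtaGrowth.
Import EtaGrowth.

(** * Major and minor arcs *)

Module CircleMethod.

Local Opaque cexp kap eu.

Section Circle.
Variable R : realType.
Local Notation C := (R[i]%C).
Implicit Types (q u z Z : C).

(** Growth rate, shift and constant of the leading term. *)
Definition rate (t m : nat) : R := m%:R * (pi ^+ 2 / 6 * (t%:R^-1 - (t%:R ^+ 2)^-1)).
Definition shift (t m : nat) : R := m%:R * ((t%:R - 1) / 24).
Definition lead (t m : nat) : R := (Num.sqrt t%:R / t%:R / Gam1 R) ^+ m.
Definition main_term (t m h : nat) Z : C :=
  (lead t m)%:c * Gam R t h ^+ m * (cexp (- ((shift t m)%:c * Z)) * cexp ((rate t m)%:c / Z)).

Lemma rate_gap t m : (0 < t)%N -> rate t m = m%:R * (t%:R - 1) * gap R t.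
Proof.
move=> t0; have : t%:R != 0 :> R by rewrite pnatr_eq0 -lt0n.
by rewrite /rate /gap; move: (pi : R) (t%:R : R) (m%:R : R) => p x y x0; field.
Qed.

Lemma rate_ge_gap t m : (1 < t)%N -> (0 < m)%N -> gap R t <= rate t m.
Proof.
move=> t1 m0; have t0 : (0 < t)%N := ltnW t1.
have g0 := gap_gt0 R t0; rewrite (rate_gap _ t0).
have a : 1 <= m%:R :> R by rewrite ler1n.
have b : 1 <= t%:R - 1 :> R by have : 2 <= t%:R :> R; [rewrite ler_nat|lra].
have : 1 * 1 <= m%:R * (t%:R - 1) :> R by apply: ler_pM.
rewrite mulr1 => h; rewrite ler_peMl// ltW//.
Qed.

Lemma cuspX (t t' h : nat) Z : (0 < t')%N -> (t' %| t)%N ->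
  (eu (h%:R / t'%:R) * cexp (- Z)) ^+ t = cexp (- (t%:R%:c * Z)).
Proof.
move=> t'0 /dvdnP[k ->]; rewrite exprMn euX cexpXR.
have -> : (k * t')%:R * (h%:R / t'%:R) = (k * h)%:R :> R.
  by rewrite !natrM; field; rewrite pnatr_eq0 -lt0n.
by rewrite eu_nat mul1r rmorph_nat mulrN.
Qed.

Lemma cusp_lt1 (t h : nat) Z : 0 < Re Z -> nrm (eu (h%:R / t%:R) * cexp (- Z)) < 1.
Proof. by move=> Z0; rewrite nrmM nrm_eu mul1r nrm_cexp ReN -[ltRHS]expR0 ltr_expR oppr_lt0. Qed.

Lemma exp_rate_le (b c w Y : R) : b <= c -> 0 <= c -> 0 < w -> w <= Y^-1 -> expR (b * w) <= expR (c / Y).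
Proof.
move=> bc c0 w0 wY; rewrite ler_expR (le_trans (ler_wpM2r (ltW w0) bc))//.
by rewrite ler_wpM2l.
Qed.

(** Poisson summation turns the pentagonal series at the cusp h/t into a theta
    series in exp(- 1 / Z), of which only the leading terms survive; the
    denominator is expanded at the cusp 0. *)
Lemma major_coprime (t m h : nat) (B : R) : (1 < t)%N -> (0 < m)%N -> coprime h t ->
  exists K Y0, [/\ 0 < K, 0 < Y0 & forall Z, 0 < Re Z <= Y0 -> `|Im Z| <= B * Re Z ->
   nrm (eta_quot t m (eu (h%:R / t%:R) * cexp (- Z)) - main_term t m h Z)
   <= K * expR ((rate t m - gap R t) / Re Z)].
Proof.
move=> t1 m0 cop; have t0 : (0 < t)%N := ltnW t1.
have tp : 0 < t%:R :> R by rewrite ltr0n.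
have t1' : 1 <= t%:R :> R by rewrite ler1n.
have [K1 [Y0 [K10 Y00 H]]] := cusp_ratio B t0 (leqnn t) cop.
have g0 := gap_gt0 R t0; have rg := rate_ge_gap t1 m0.
have G1 := Gam1_pos R.
pose X : R := nrm (Gam R t h) / Gam1 R + K1.
have X0 : 0 <= X by rewrite /X; nonneg.
have [K2 K20 hK2] := pow_close m X0.
pose s : R := Num.sqrt t%:R / t%:R.
have s0 : 0 < s by rewrite /s divr_gt0 ?sqrtr_gt0.
exists (s ^+ m * (K2 * K1)), Y0; split => //; first by pos.
move=> Z hZ hI; have [Z0 _] := andP hZ; have [e he E] := H Z hZ hI.
have /andP[w1 w2] := Re_inv_bounds Z0 hI; set w := Re Z^-1 in w1 w2 he.
have B2 := sqr_ge0 B.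
have w0 : 0 < w by rewrite (lt_le_trans _ w1)// invr_gt0 mulr_gt0//; lra.
rewrite /eta_quot (cuspX _ _ t0 (dvdnn t)) E.
set g := Gam R t h / (Gam1 R)%:c in E *.
set b : R := pi ^+ 2 / 6 * (t%:R^-1 - (t%:R ^+ 2)^-1) in E *.
set v : R := (t%:R - 1) / 24 in E *.
rewrite !exprMn !cexpXR -rmorphXn.
have -> : main_term t m h Z = cexp (m%:R * - (v%:c * Z)) * (s ^+ m)%:c * cexp (m%:R * (b%:c / Z)) * g ^+ m.
  rewrite /main_term /lead /shift /rate -/b -/v -/s /g !expr_div_n rmorphM fmorphV !rmorphXn /=.
  have -> : - ((m%:R * v)%:c * Z) = m%:R * - (v%:c * Z) by rewrite rmorphM rmorph_nat; ring.
  have -> : (m%:R * b)%:c / Z = m%:R * (b%:c / Z) by rewrite rmorphM rmorph_nat mulrA.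
  by move: (cexp _) (cexp _) (_ ^+ m) (_ ^+ m) (_^-1) => *; ring.
rewrite -mulrBr !nrmM nrm_real !nrm_cexp ger0_norm ?exprn_ge0 ?(ltW s0)//.
have nm (x : C) : Re (m%:R * x) = m%:R * Re x by rewrite -(rmorph_nat (real_complex R)) Re_realM.
rewrite !nm ReN !Re_realM -/w.
have e1 : expR (m%:R * - (v * Re Z)) <= 1.
  rewrite -[leRHS]expR0 ler_expR mulrN oppr_le0 mulr_ge0// mulr_ge0 ?(ltW Z0)// /v; lra.
have x1 : expR (- (gap R t * w)) <= 1.
  by rewrite -[leRHS]expR0 ler_expR oppr_le0 mulr_ge0// ltW.
have ng : nrm g = nrm (Gam R t h) / Gam1 R by rewrite /g nrm_div nrm_real gtr0_norm.
have eK : nrm e <= K1 by rewrite (le_trans he)// ler_piMr// ltW.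
have k : nrm ((g + e) ^+ m - g ^+ m) <= K2 * nrm e.
  have := hK2 (g + e) g; rewrite [g + e - g]addrAC subrr add0r; apply.
    by rewrite (le_trans (nrmD _ _))// ng lerD.
  by rewrite ng /X lerDl ltW.
have f1 : expR (m%:R * (b * w)) * expR (- (gap R t * w)) <= expR ((rate t m - gap R t) / Re Z).
  rewrite -expRD mulrA -/(rate t m) -mulrBl; apply: exp_rate_le => //.
  by rewrite subr_ge0.
set P := expR (m%:R * - _) in e1 *; set Q := expR (m%:R * (b * w)) in f1 *.
set x := expR (- (gap R t * w)) in f1 he x1 *.
have P0 : 0 <= P := expR_ge0 _. have Q0 : 0 <= Q := expR_ge0 _. have sm : 0 <= s ^+ m by rewrite exprn_ge0// ltW.
have k2 : nrm ((g + e) ^+ m - g ^+ m) <= K2 * (K1 * x) by rewrite (le_trans k)// ler_pM2l.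
have k3 : Q * nrm ((g + e) ^+ m - g ^+ m) <= K2 * K1 * (Q * x).
  rewrite (le_trans (ler_wpM2l Q0 k2))//; apply: eq_leq_R; ring.
have k4 : K2 * K1 * (Q * x) <= K2 * K1 * expR ((rate t m - gap R t) / Re Z).
  by rewrite ler_wpM2l// mulr_ge0// ltW.
have nd0 := nrm_ge0 ((g + e) ^+ m - g ^+ m).
move: (nrm ((g + e) ^+ m - g ^+ m)) nd0 k3 => D D0 k3.
have k5 : s ^+ m * (Q * D) <= s ^+ m * (K2 * K1 * expR ((rate t m - gap R t) / Re Z)).
  by rewrite ler_wpM2l// (le_trans k3).
have k6 : P * (s ^+ m * (Q * D)) <= 1 * (s ^+ m * (Q * D)).
  by rewrite ler_wpM2r// mulr_ge0// mulr_ge0.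
have -> : P * s ^+ m * Q * D = P * (s ^+ m * (Q * D)) by ring.
apply: (le_trans k6); rewrite mul1r; apply: (le_trans k5); by rewrite /s exprMn !mulrA.
Qed.

Lemma major_noncoprime (t m h : nat) (B : R) : (1 < t)%N -> (0 < m)%N -> (h < t)%N -> ~~ coprime h t ->
  exists K Y0, [/\ 0 < K, 0 < Y0 & forall Z, 0 < Re Z <= Y0 -> `|Im Z| <= B * Re Z ->
   nrm (eta_quot t m (eu (h%:R / t%:R) * cexp (- Z))) <= K * expR ((rate t m - gap R t) / Re Z)].
Proof.
move=> t1 m0 ht ncop; have t0 : (0 < t)%N := ltnW t1.
have tp : 0 < t%:R :> R by rewrite ltr0n.
have t1' : 1 <= t%:R :> R by rewrite ler1n.
have m1 : 1 <= m%:R :> R by rewrite ler1n.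
pose d := gcdn h t; pose h' := (h %/ d)%N; pose t' := (t %/ d)%N.
have d0 : (0 < d)%N by rewrite gcdn_gt0 t0 orbT.
have d2 : (1 < d)%N by rewrite ltn_neqAle eq_sym ncop.
have tE : t = (t' * d)%N by rewrite divnK// dvdn_gcdr.
have hE : h = (h' * d)%N by rewrite divnK// dvdn_gcdl.
have dE : gcdn h t = d by [].
clearbody t' h' d.
have t'0 : (0 < t')%N by move: t0; rewrite {1}tE muln_gt0 => /andP[].
have t't : (t' <= t)%N by rewrite tE leq_pmulr.
have tp' : 0 < t'%:R :> R by rewrite ltr0n.
have cop : coprime h' t'.
  have := muln_gcdl h' t' d; rewrite -hE -tE dE => /eqP.
  by rewrite -{2}[d]mul1n eqn_pmul2r.
have [K1 [Y0 [K10 Y00 H]]] := cusp_ratio B t'0 t't cop.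
have g0 := gap_gt0 R t0; have rg := rate_ge_gap t1 m0.
have G1 := Gam1_pos R.
pose X : R := nrm (Gam R t' h') / Gam1 R + K1.
have X0 : 0 < X by rewrite /X addrC ltr_wpDr//; nonneg.
pose s : R := Num.sqrt t%:R / t'%:R.
have s0 : 0 < s by rewrite /s divr_gt0 ?sqrtr_gt0.
exists (s ^+ m * X ^+ m), Y0; split => //; first by pos.
move=> Z hZ hI; have [Z0 _] := andP hZ; have [e he E] := H Z hZ hI.
have /andP[w1 w2] := Re_inv_bounds Z0 hI; set w := Re Z^-1 in w1 w2 he.
have B2 := sqr_ge0 B.
have w0 : 0 < w by rewrite (lt_le_trans _ w1)// invr_gt0 mulr_gt0//; lra.
have -> : h%:R / t%:R = h'%:R / t'%:R :> R.
  by rewrite {1}hE {1}tE !natrM; field; rewrite !pnatr_eq0 -!lt0n d0 t'0.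
have dv : (t' %| t)%N by rewrite tE dvdn_mulr.
rewrite /eta_quot (cuspX _ _ t'0 dv) E.
set g := Gam R t' h' / (Gam1 R)%:c in E *.
set b : R := pi ^+ 2 / 6 * (t%:R^-1 - (t'%:R ^+ 2)^-1) in E *.
set v : R := (t%:R - 1) / 24 in E *.
rewrite !exprMn !nrmM !nrmX !nrm_cexp ReN !Re_realM -/w nrm_real -/s gtr0_norm//.
have e1 : expR (- (v * Re Z)) ^+ m <= 1.
  rewrite exprn_ile1 ?expR_ge0// -[leRHS]expR0 ler_expR oppr_le0 mulr_ge0 ?(ltW Z0)// /v; lra.
have x1 : expR (- (gap R t * w)) <= 1.
  by rewrite -[leRHS]expR0 ler_expR oppr_le0 mulr_ge0// ltW.
have ng : nrm g = nrm (Gam R t' h') / Gam1 R by rewrite /g nrm_div nrm_real gtr0_norm.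
have eK : nrm e <= K1 by rewrite (le_trans he)// ler_piMr// ltW.
have k : nrm (g + e) ^+ m <= X ^+ m.
  by rewrite lerXn2r ?nnegrE ?nrm_ge0 ?(ltW X0)// (le_trans (nrmD _ _))// ng lerD.
have f1 : expR (b * w) ^+ m <= expR ((rate t m - gap R t) / Re Z).
  rewrite -expRM_natl mulrA; apply: exp_rate_le => //; last by rewrite subr_ge0.
  have b3 : b <= pi ^+ 2 / 6 * (t%:R^-1 - (t%:R ^+ 2)^-1) - gap R t.
    have -> : pi ^+ 2 / 6 * (t%:R^-1 - (t%:R ^+ 2)^-1) - gap R t = pi ^+ 2 / 6 * (t%:R^-1 - 2 / t%:R ^+ 2).
      by rewrite /gap; move: (pi : R) (t%:R : R) tp => p y y0; field; rewrite gt_eqF.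
    have pp : 0 <= pi ^+ 2 / 6 :> R by rewrite divr_ge0 ?sqr_ge0.
    rewrite /b ler_wpM2l// lerD2l lerN2 ler_pdivrMr ?exprn_gt0// mulrC ler_pdivlMr ?exprn_gt0//.
    have t2 : 2 * t'%:R <= t%:R :> R.
      by rewrite tE natrM mulrC ler_pM2l// ler_nat.
    have : (2 * t'%:R) ^+ 2 <= t%:R ^+ 2 :> R by rewrite ler_pXn2r ?nnegrE ?(ltW tp)// mulr_ge0// ltW.
    rewrite exprMn; have := sqr_ge0 (t'%:R : R); lra.
  have := ler_wpM2l (le_trans ler01 m1) b3; rewrite mulrBr -/(rate t m) => b4.
  apply: le_trans b4 _; rewrite lerD2l lerN2 ler_peMl// ltW//.
have sm : 0 <= s ^+ m by rewrite exprn_ge0// ltW.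
apply: le_trans (_ : 1 * s ^+ m * expR ((rate t m - gap R t) / Re Z) * X ^+ m <= _); last first.
  by rewrite mul1r mulrAC /s exprMn.
apply: ler_pM => //; try by nonneg.
apply: ler_pM => //; try by nonneg.
by apply: ler_wpM2r.
Qed.

Lemma minor_arc (t m : nat) : (1 < t)%N -> (0 < m)%N ->
  exists B d K Y0, [/\ 1 <= B, 0 < d, 0 < K, 0 < Y0 & forall h Z, 0 < Re Z <= Y0 ->
    B * Re Z <= `|Im Z| -> t%:R * `|Im Z| <= pi ->
    nrm (eta_quot t m (eu (h%:R / t%:R) * cexp (- Z))) <= K * expR ((rate t m - d) / Re Z)].
Proof.
move=> t1 m0; have t0 : (0 < t)%N := ltnW t1.
have tp : 0 < t%:R :> R by rewrite ltr0n.
have t1' : 2 <= t%:R :> R by rewrite ler_nat.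
have mp : 0 < m%:R :> R by rewrite ltr0n.
have p0 := @pi_gt0 R; have p4 := pi_lt R.
have [k k0 hk] := one_sub_cos_ge R.
have [c [Y1 [c0 Y10 hc]]] := eul_real_lower R.
pose k1 := Num.min k 1.
have k10 : 0 < k1 by rewrite lt_min k0/=.
pose B : R := 20 / k1.
have B0 : 0 < B by rewrite /B; pos.
have kB : 400 <= k * B ^+ 2.
  have a1 : k1 <= k by rewrite ge_min lexx.
  have a2 : k1 <= 1 by rewrite ge_min lexx orbT.
  apply: le_trans (_ : k1 * B ^+ 2 <= _); last by rewrite ler_wpM2r ?sqr_ge0.
  have -> : k1 * B ^+ 2 = 400 / k1 by rewrite /B; field; rewrite gt_eqF.
  by rewrite ler_pdivlMr// ler_piMr.
have B1 : 1 <= B.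
  have : k1 <= 1 by rewrite ge_min lexx orbT.
  by rewrite /B ler_pdivlMr//; lra.
clearbody B.
pose d : R := m%:R / t%:R * (9 / 10 - pi ^+ 2 / 6 / t%:R).
have d0 : 0 < d.
  rewrite /d; apply: mulr_gt0; first by pos.
  rewrite subr_gt0 ltr_pdivrMr// ltr_pdivrMr//.
  have : pi ^+ 2 <= (13 / 4) ^+ 2 :> R by apply: lerXn2r; rewrite ?nnegrE; lra.
  lra.
have d2 : 0 < d / 2 by pos.
have [K1 K10 hK1] := expR_pow_le m d2.
pose Y0 : R := Num.min (Num.min 1 Y1) (1 / 2) / t%:R.
have Y00 : 0 < Y0 by rewrite /Y0 divr_gt0// !lt_min Y10 ltr01 /=; lra.
exists B, (d / 2), ((4 * expR 2 / c) ^+ m * K1), Y0; split => //.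
  by apply: mulr_gt0 => //; apply: exprn_gt0; apply: divr_gt0 => //; apply: mulr_gt0 => //; exact: expR_gt0.
move=> h Z /andP[Z0 ZY] hB hp.
move: ZY; rewrite /Y0 ler_pdivlMr// !le_min => /andP[/andP[ZY1 ZYY] ZYh].
set Y := Re Z in Z0 hB ZY1 ZYY ZYh *; set f := Im Z in hB hp *.
have tY : 0 < Y * t%:R by pos.
have Yle : Y <= Y * t%:R by rewrite ler_peMr ?(ltW Z0)//; lra.
rewrite /eta_quot (cuspX _ _ t0 (dvdnn t)).
set q := eu _ * _; set u := cexp _.
have q1 : nrm q < 1 by exact: cusp_lt1.
have q0 : q != 0 by rewrite -nrm_gt0 nrmM nrm_eu mul1r nrm_cexp expR_gt0.
have nq : nrm q = expR (- Y) by rewrite nrmM nrm_eu mul1r nrm_cexp ReN.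
have nu : nrm u = expR (- (Y * t%:R)) by rewrite nrm_cexp ReN Re_realM mulrC.
have u1 : nrm u < 1 by rewrite nu -[ltRHS]expR0 ltr_expR oppr_lt0.
have u0 : u != 0 by rewrite -nrm_gt0 nu expR_gt0.
have oneE (x : R) : 0 < x -> x <= 1 -> x / 2 <= 1 - expR (- x) <= x.
  move=> x0 x1; apply/andP; split; last by have := expR_ge1Dx (- x); lra.
  have e1 : expR (- x) <= (1 + x)^-1.
    by rewrite expRN lef_pV2 ?posrE ?expR_gt0//; [exact: expR_ge1Dx|lra].
  have e2 : (1 + x)^-1 <= 1 - x / 2.
    rewrite -[leLHS]mul1r ler_pdivrMr; last lra.
    have -> : (1 - x / 2) * (1 + x) = 1 + x * (1 - x) / 2 by field.
    by rewrite lerDl divr_ge0 ?mulr_ge0 ?(ltW x0) ?subr_ge0.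
  lra.
have num : nrm (eul q) <= 4 / Y.
  rewrite (le_trans (eul_le q1 q0))// nq.
  have /andP[a1 _] := oneE Y Z0 (le_trans Yle ZY1).
  have a2 : 0 < Y / 2 by pos.
  have -> : 4 / Y = 2 / (Y / 2) by field; rewrite gt_eqF.
  by rewrite ler_pM2l// lef_pV2 ?posrE// (lt_le_trans a2).
have n1u : 20 * (Y * t%:R) <= nrm (1 - u).
  rewrite -(ler_pXn2r (n := 2)) ?nnegrE ?nrm_ge0//; last by nonneg.
  rewrite /u nrm_one_sub_cexp_sqr Re_realM Im_realM -/Y -/f [t%:R * Y]mulrC.
  have tf : `|t%:R * f| <= pi by rewrite normrM (gtr0_norm tp).
  have := hk _ tf; have := expR_ge1Dx (- (Y * t%:R)); have := sqr_ge0 (1 - expR (- (Y * t%:R))).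
  set E := expR _; set cc := cos _ => s1 s2 s3.
  have E2 : 1 / 2 <= E by lra.
  have f2 : (B * Y) ^+ 2 <= f ^+ 2.
    rewrite -[leRHS]real_normK ?num_real// ler_pXn2r ?nnegrE//; by nonneg.
  have s4 : k * (t%:R * (B * Y)) ^+ 2 <= 1 - cc.
    apply: le_trans s3; rewrite ler_pM2l// !exprMn; rewrite exprMn in f2.
    by rewrite ler_wpM2l ?sqr_ge0.
  have s5 : 400 * (t%:R * Y) ^+ 2 <= 1 - cc.
    apply: le_trans s4.
    have -> : k * (t%:R * (B * Y)) ^+ 2 = k * B ^+ 2 * (t%:R * Y) ^+ 2 by ring.
    by rewrite ler_wpM2r ?sqr_ge0.
  have s6 : 0 <= (2 * E - 1) * (1 - cc).
    apply: mulr_ge0; first lra.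
    by apply: le_trans s5; apply: mulr_ge0 => //; exact: sqr_ge0.
  have -> : (20 * (Y * t%:R)) ^+ 2 = 400 * (t%:R * Y) ^+ 2 by ring.
  lra.
have den : c * expR (- (pi ^+ 2 / 6 / (Y * t%:R))) * expR (9 / 10 / (Y * t%:R)) <= expR 2 * nrm (eul u).
  apply: le_trans (eul_lower u1 u0).
  apply: ler_pM; [by nonneg|by nonneg| |].
    by rewrite nu; apply: hc; rewrite tY.
  rewrite ler_expR nu.
  have /andP[a1 a2] := oneE _ tY ZY1.
  have a3 : (Y * t%:R)^-1 <= (1 - expR (- (Y * t%:R)))^-1.
    by rewrite lef_pV2 ?posrE// (lt_le_trans _ a1)//; pos.
  have a4 : 2 / nrm (1 - u) <= 1 / 10 / (Y * t%:R).
    have -> : 1 / 10 / (Y * t%:R) = 2 / (20 * (Y * t%:R)) by field; rewrite !gt_eqF.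
    by rewrite ler_pM2l// lef_pV2 ?posrE//; [rewrite (lt_le_trans _ n1u)//; pos|pos].
  have -> : 9 / 10 / (Y * t%:R) = (Y * t%:R)^-1 - 1 / 10 / (Y * t%:R) by field; rewrite !gt_eqF.
  lra.
have eu0' : 0 < nrm (eul u) by rewrite nrm_gt0 eul_neq0.
have D : nrm (eul u)^-1 <= expR 2 / c * expR ((pi ^+ 2 / 6 - 9 / 10) / (Y * t%:R)).
  rewrite nrmV -[leLHS]mul1r ler_pdivrMr//.
  rewrite -(ler_pM2r c0) mul1r.
  set x := expR (_ / _); have x0 : 0 < x := expR_gt0 _.
  have -> : expR 2 / c * x * nrm (eul u) * c = x * (expR 2 * nrm (eul u)) by field; rewrite gt_eqF.
  apply: le_trans (ler_wpM2l (ltW x0) den).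
  rewrite -mulrA mulrCA -expRD /x -expRD.
  have -> : (pi ^+ 2 / 6 - 9 / 10) / (Y * t%:R) + (- (pi ^+ 2 / 6 / (Y * t%:R)) + 9 / 10 / (Y * t%:R)) = 0.
    by move: (_^-1) (pi ^+ 2 / 6) => a b; ring.
  by rewrite expR0 mulr1.
rewrite nrmX nrmM.
have T1 : nrm (eul q) * nrm (eul u)^-1 <= 4 / Y * (expR 2 / c * expR ((pi ^+ 2 / 6 - 9 / 10) / (Y * t%:R))).
  by apply: ler_pM; rewrite ?nrm_ge0.
have T2 : (nrm (eul q) * nrm (eul u)^-1) ^+ m <= (4 / Y * (expR 2 / c * expR ((pi ^+ 2 / 6 - 9 / 10) / (Y * t%:R)))) ^+ m.
  have r0 : 0 <= nrm (eul q) * nrm (eul u)^-1 by apply: mulr_ge0; exact: nrm_ge0.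
  by apply: lerXn2r; rewrite ?nnegrE // (le_trans r0 T1).
apply: (le_trans T2).
have -> : 4 / Y * (expR 2 / c * expR ((pi ^+ 2 / 6 - 9 / 10) / (Y * t%:R))) =
  4 * expR 2 / c * (Y^-1 * expR ((pi ^+ 2 / 6 - 9 / 10) / (Y * t%:R))) by ring.
rewrite exprMn -[leRHS]mulrA; apply: ler_wpM2l.
  by apply: exprn_ge0; apply: divr_ge0; [apply: mulr_ge0 => //; exact: expR_ge0|exact: ltW].
rewrite exprMn -expRM_natl.
have iY : 0 <= Y^-1 by rewrite invr_ge0 ltW.
have K2 := hK1 _ iY.
set x := expR (m%:R * _).
apply: le_trans (ler_wpM2r (expR_ge0 _) K2) _.
rewrite -(mulrA K1) ler_pM2l// -expRD ler_expR /rate /d; apply: eq_leq_R.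
by move: (pi : R) (t%:R : R) (m%:R : R) tp => p y z y0; field; rewrite !gt_eqF.
Qed.

(** Uniform comparison with the leading term on every arc. *)
Theorem arcs (t m : nat) : (1 < t)%N -> (0 < m)%N ->
  exists B d K Y0, [/\ 1 <= B, 0 < d <= rate t m, 0 < K, 0 < Y0 & forall h, (h < t)%N -> forall Z,
    0 < Re Z <= Y0 -> t%:R * `|Im Z| <= pi ->
    nrm (eta_quot t m (eu (h%:R / t%:R) * cexp (- Z)) -
      (if coprime h t && (`|Im Z| <= B * Re Z) then main_term t m h Z else 0))
    <= K * expR ((rate t m - d) / Re Z)].
Proof.
move=> t1 m0; have t0 : (0 < t)%N := ltnW t1.
have [B [d1 [K1 [Y1 [B0 d10 K10 Y10 H1]]]]] := minor_arc t1 m0.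
have g0 := gap_gt0 R t0; have rg := rate_ge_gap t1 m0.
pose d := Num.min d1 (gap R t).
have mono K K' Y (d' : R) : 0 < K -> K <= K' -> 0 < Y -> d <= d' ->
    K * expR ((rate t m - d') / Y) <= K' * expR ((rate t m - d) / Y).
  move=> K0 KK Y0 dd; apply: ler_pM; [exact: ltW|exact: expR_ge0|done|].
  by rewrite ler_expR ler_pM2r ?invr_gt0// lerD2l lerN2.
pose P (h : nat) (K Y : R) := forall Z, 0 < Re Z <= Y -> `|Im Z| <= B * Re Z ->
   nrm (eta_quot t m (eu (h%:R / t%:R) * cexp (- Z)) - (if coprime h t then main_term t m h Z else 0))
   <= K * expR ((rate t m - gap R t) / Re Z).
have [K2 [Y2 [K20 Y20 H2]]] : exists K Y, [/\ 0 < K, 0 < Y & forall h, (h < t)%N -> P h K Y].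
  apply: uniform_consts => [h K K' Y Y' hP KK YY Z /andP[Z1 Z2] hI|h ht].
    apply: le_trans (hP Z _ hI) _; first by rewrite Z1 (le_trans Z2).
    by apply: ler_wpM2r => //; exact: expR_ge0.
  rewrite /P; case: (boolP (coprime h t)) => cop; first exact: major_coprime.
  have [K [Y [K0 Y0 H]]] := major_noncoprime B t1 m0 ht cop.
  by exists K, Y; split => // Z hZ hI; rewrite subr0; exact: H.
exists B, d, (Num.max K1 K2), (Num.min Y1 Y2); split => //.
- by rewrite lt_min d10 g0 ge_min rg orbT.
- by rewrite lt_max K10.
- by rewrite lt_min Y10.
move=> h ht Z /andP[Z0]; rewrite le_min => /andP[ZY1 ZY2] hp.
have [hI|hI] := leP `|Im Z| (B * Re Z).
  rewrite andbT; apply: le_trans (H2 h ht Z _ hI) _; first by rewrite Z0.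
  by apply: mono; rewrite ?le_max ?ge_min ?lexx ?orbT.
rewrite andbF subr0; apply: le_trans (H1 h Z _ (ltW hI) hp) _; first by rewrite Z0.
by apply: mono; rewrite ?le_max ?ge_min ?lexx.
Qed.

End Circle.

End CircleMethod.
Import CircleMethod.

(** * Coefficients as averages over a circle *)

Module CoefficientAverages.

Local Opaque cexp kap eu.

Section CircleAverages.

Variable R : realType.
Local Notation C := (R[i]%C).

(** The origin is left out, so that q^-1 makes sense throughout. *)
Definition power_series (a : nat -> C) (G : C -> C) : Prop :=
  forall q, 0 < nrm q < 1 -> tends (fun N => \sum_(0 <= l < N) a l * q ^+ l) (G q).

Variables (c : nat -> C) (F : C -> C).
Hypothesis hc : power_series c F.

Lemma coef_abs_summable (r : R) : 0 < r < 1 ->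
  sums_bounded (fun l => nrm (c l) * r ^+ l).
Proof.
move=> /andP[r0 r1]; pose r' : R := (1 + r) / 2.
have r'0 : 0 < r' by rewrite /r'; lra.
have r'1 : r' < 1 by rewrite /r'; lra.
have nr : nrm (r'%:c : C) = r' by rewrite nrm_real gtr0_norm.
have r'1c : 0 < nrm (r'%:c : C) < 1 by rewrite nr r'0.
have [B hB] := tends_bound (hc r'1c).
have B0 : 0 <= B := le_trans (nrm_ge0 _) (hB 0%N).
have hl l : nrm (c l) * r' ^+ l <= 2 * B.
  have -> : nrm (c l) * r' ^+ l = nrm (c l * (r'%:c : C) ^+ l) by rewrite nrmM nrmX nr.
  have := nrmB (\sum_(0 <= l < l.+1) c l * (r'%:c : C) ^+ l) (\sum_(0 <= l < l) c l * (r'%:c : C) ^+ l).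
  rewrite {1}big_nat_recr//= addrAC subrr add0r; have := hB l; have := hB l.+1; lra.
pose x : R := r / r'.
have x0 : 0 <= x by rewrite divr_ge0// ltW.
have x1 : 0 <= x < 1 by rewrite x0 ltr_pdivrMr// mul1r /r'; lra.
have [D hD] := geometric_sums_bounded x1 (mulr_ge0 (ler0n R 2) B0).
exists D => n; apply: le_trans (hD n); apply: ler_sum => l _.
have -> : r ^+ l = r' ^+ l * x ^+ l by rewrite -exprMn /x mulrC divfK// gt_eqF.
by rewrite mulrA ler_wpM2r// exprn_ge0.
Qed.

(** Orthogonality on equally spaced points of a circle, whatever the offset. *)
Lemma coef_extract (Y : R) (n : nat) (e : R) : 0 < Y -> 0 < e -> exists N0, forall N, (N0 <= N)%N -> forall s,
  let q k := eu (k%:R / N%:R - s) * (expR (- Y))%:c in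
  nrm (c n - N%:R^-1 * \sum_(0 <= k < N) F (q k) / q k ^+ n) <= e.
Proof.
move=> Y0 e0; set r := expR (- Y); have r0 : 0 < r := expR_gt0 _.
have r1 : r < 1 by rewrite -[ltRHS]expR0 ltr_expR oppr_lt0.
have r01 : 0 < r < 1 by rewrite r0.
have rn0 : 0 < r ^+ n by rewrite exprn_gt0.
have er : 0 < e * r ^+ n by rewrite mulr_gt0.
pose b l := nrm (c l) * r ^+ l.
have b0 l : 0 <= b l by rewrite /b mulr_ge0 ?nrm_ge0 ?exprn_ge0 // ltW.
have [N1 hN1] := sums_tail b0 (coef_abs_summable r01) er.
exists (maxn N1 n.+1) => N; rewrite geq_max => /andP[NN1 nN] s /=.
pose q (k : nat) : C := eu (k%:R / N%:R - s) * r%:c.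
change (nrm (c n - N%:R^-1 * \sum_(0 <= k < N) F (q k) / q k ^+ n) <= e).
have N0 : (0 < N)%N by exact: leq_ltn_trans nN.
have Nn : N%:R != 0 :> C by rewrite pnatr_eq0 -lt0n.
have nq k : nrm (q k) = r by rewrite /q nrmM nrm_eu mul1r nrm_real gtr0_norm.
have q1 k : 0 < nrm (q k) < 1 by rewrite nq r0.
have rc0 : r%:c != 0 :> C by rewrite -nrm_gt0 nrm_real gtr0_norm.
have q0 k : q k != 0 by rewrite -nrm_gt0 nq.
pose S L := N%:R^-1 * \sum_(0 <= k < N) (\sum_(0 <= l < L) c l * q k ^+ l) / q k ^+ n.
have tS : tends S (N%:R^-1 * \sum_(0 <= k < N) F (q k) / q k ^+ n).
  apply: tendsZ; apply: tends_sum => k _; apply: tendsM (tends_cst _); exact: hc.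
pose d l : C := if (N %| absz (l%:Z - n%:Z))%N then 1 else 0.
pose T l : C := c l * r%:c ^+ l / r%:c ^+ n * eu (- ((l%:Z - n%:Z)%:~R * s)) * d l.
have SE L : S L = \sum_(0 <= l < L) T l.
  rewrite /S (eq_bigr (fun k => \sum_(0 <= l < L) c l * q k ^+ l / q k ^+ n)) => [|k _]; last by rewrite mulr_suml.
  rewrite exchange_big mulr_sumr; apply: eq_bigr => l _.
  have qk k : c l * q k ^+ l / q k ^+ n = c l * r%:c ^+ l / r%:c ^+ n * eu (- ((l%:Z - n%:Z)%:~R * s)) *
     eu (k%:R * ((l%:Z - n%:Z)%:~R / N%:R)).
    rewrite /q !exprMn !euX invfM -euN.
    have -> : eu (- ((l%:Z - n%:Z)%:~R * s)) = eu (l%:R * - s) * eu (- (n%:R * - s)) :> C.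
      by rewrite -euD intrB /=; congr eu; rewrite -!pmulrn; ring.
    have -> : eu (k%:R * ((l%:Z - n%:Z)%:~R / N%:R)) = eu (l%:R * (k%:R / N%:R)) * eu (- (n%:R * (k%:R / N%:R))) :> C.
      by rewrite -euD intrB /=; congr eu; rewrite -!pmulrn; ring.
    have -> : eu (l%:R * (k%:R / N%:R - s)) = eu (l%:R * (k%:R / N%:R)) * eu (l%:R * - s) :> C by rewrite -euD -mulrDr.
    have -> : eu (- (n%:R * (k%:R / N%:R - s))) = eu (- (n%:R * (k%:R / N%:R))) * eu (- (n%:R * - s)) :> C.
      by rewrite -euD -opprD -mulrDr.
    move: (eu _ : C) (eu _ : C) (eu _ : C) (eu _ : C) (c l) (r%:c ^+ l : C) ((r%:c ^+ n)^-1 : C) => x1 x2 x3 x4 x5 x6 x7; ring.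
  rewrite (eq_bigr _ (fun k _ => qk k)) -mulr_sumr (eu_orth _ _ N0) /T /d mulrCA; congr (_ * _).
  by case: ifP => _; rewrite ?mulVf ?mulr0.
have small L : (N <= L)%N -> nrm (c n - S L) <= e.
  move=> NL; rewrite SE (big_cat_nat (leq0n N) NL)/=.
  have -> : \sum_(0 <= l < N) T l = c n.
    rewrite (eq_big_nat _ _ (F2 := fun l => if l == n then c n else 0)) => [|l /andP[_ lN]].
      by rewrite -big_mkcond big_nat1_eq /= nN.
    rewrite /T /d; have [->|ln] := eqVneq l n.
      by rewrite subrr /= dvdn0 mul0r oppr0 eu0 !mulr1 mulfK// expf_neq0.
    case: ifP => [dv|_]; last by rewrite mulr0.
    exfalso; move: ln; apply/negP; rewrite negbK; apply/eqP.
    have sm : (absz (l%:Z - n%:Z) < N)%N by lia.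
    have : absz (l%:Z - n%:Z) = 0%N by apply/eqP; rewrite -leqn0 leqNgt; apply/negP => /dvdn_leq /(_ dv); lia.
    lia.
  rewrite opprD addrA subrr add0r nrmN (le_trans (nrm_sum _ _ _))//.
  have : \sum_(N <= l < L) b l <= e * r ^+ n.
    apply: le_trans (hN1 L).
    rewrite [leRHS](big_cat_nat NN1 NL)/= lerDr sumr_ge0//.
  rewrite -ler_pdivrMr//; apply: le_trans.
  rewrite mulr_suml; apply: ler_sum => l _.
  rewrite /T !nrmM nrm_eu mulr1 nrmV !nrmX nrm_real gtr0_norm//.
  rewrite -[leRHS]mulr1 ler_wpM2l//.
    by rewrite mulr_ge0 ?invr_ge0 ?(ltW rn0)// b0.
  by rewrite /d; case: ifP => _; rewrite ?nrm1 ?nrm0.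
have sh m : (m <= m + N)%N by rewrite leq_addr.
have := tends_nrm (b := e) (tendsB (tends_cst (c n)) (tends_comp (f := fun m => (m + N)%N) sh tS)).
by apply => m; apply: small; rewrite leq_addl.
Qed.

End CircleAverages.

Section Saddle.
Variable R : realType.
Local Notation C := (R[i]%C).
Implicit Types (Z : C).

(** Sample points Y + i phi, placed symmetrically about the real axis. *)
Definition angle (t M j : nat) : R := pi * ((2 * M)%:R - 1 - (2 * j)%:R) / (2 * t * M)%:R.
Definition point (t M : nat) (Y : R) (j : nat) : C := (Y +i* angle t M j)%C.
Definition saddle_exp (p a : R) Z : C := cexp (p%:c * Z) * cexp (a%:c / Z).
Definition saddle_sum (t M : nat) (B Y p a : R) : C :=
  (2 * t * M)%:R^-1 * \sum_(0 <= j < 2 * M)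
    (if `|angle t M j| <= B * Y then saddle_exp p a (point t M Y j) else 0).

Lemma angle_rev t M j : (j < 2 * M)%N -> angle t M (2 * M - j.+1) = - angle t M j.
Proof.
move=> jM; rewrite /angle -mulNr -mulrN; congr (_ * _ / _).
by rewrite mulnBr natrB ?leq_mul2l// -[j.+1]addn1 mulnDr natrD !natrM; ring.
Qed.

Lemma angle_le t M j : (0 < t)%N -> (j < 2 * M)%N -> t%:R * `|angle t M j| <= pi.
Proof.
move=> t0 jM; have M0 : (0 < M)%N by lia.
have tp : 0 < t%:R :> R by rewrite ltr0n.
have Mp : 0 < M%:R :> R by rewrite ltr0n.
have p0 := @pi_gt0 R.
rewrite /angle !normrM normfV (gtr0_norm p0) (gtr0_norm (_ : 0 < (2 * t * M)%:R)); last by rewrite ltr0n !muln_gt0 t0.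
have h : `|(2 * M)%:R - 1 - (2 * j)%:R| <= (2 * M)%:R :> R.
  rewrite ler_norml; apply/andP; split.
    have : (2 * j)%:R + 1 <= 2 * (2 * M)%:R :> R by rewrite natr1 -natrM ler_nat; lia.
    lra.
  have : 0 <= (2 * j)%:R :> R by []. lra.
rewrite mulrA ler_pdivrMr; last by rewrite ltr0n !muln_gt0 t0.
have -> : (2 * t * M)%:R = t%:R * (2 * M)%:R :> R by rewrite -natrM; congr _%:R; ring.
by rewrite mulrCA ler_pM2l// mulrC [leRHS]mulrC ler_pM2r.
Qed.

Lemma saddle_exp_conj p a Z : saddle_exp p a (Z^*%C) = ((saddle_exp p a Z)^*)%C.
Proof.
rewrite /saddle_exp [RHS]rmorphM /= !cexp_conj; congr (cexp _ * cexp _).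
- by case: Z => x y; apply: eqC; rewrite /=; ring.
- by rewrite [RHS]rmorphM fmorphV /=; congr (_ * _); apply: eqC; rewrite /= ?oppr0.
Qed.

(** The symmetric sample makes the saddle sum real. *)
Lemma saddle_sum_real t M B Y p a : Im (saddle_sum t M B Y p a) = 0.
Proof.
set J := saddle_sum _ _ _ _ _ _.
suff e : J^*%C = J by have := congr1 (@Im R) e; case: J {e} => x y /=; lra.
rewrite /J /saddle_sum [LHS]rmorphM fmorphV rmorph_nat rmorph_sum; congr (_ * _).
rewrite [RHS]big_nat_rev /= add0n; apply: eq_big_nat => j /andP[_ jM].
rewrite angle_rev// normrN; case: ifP => _; last by rewrite rmorph0.
by rewrite -saddle_exp_conj; congr saddle_exp; rewrite /point angle_rev.
Qed.

Lemma Re_saddle_exp (p a Y s X : R) : 0 < Y -> p * Y = X -> a / Y = X ->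
  Re (saddle_exp p a (Y +i* (s * Y))%C) =
  expR (2 * X - X * (s ^+ 2 / (1 + s ^+ 2))) * cos (X * (s ^+ 3 / (1 + s ^+ 2))).
Proof.
move=> Y0 pY aY.
have s1 : 0 < 1 + s ^+ 2 by have := sqr_ge0 s; lra.
have aE : a = X * Y by rewrite -aY divfK// gt_eqF.
rewrite /saddle_exp -cexpD.
set w := _ + _.
have rw : Re w = 2 * X - X * (s ^+ 2 / (1 + s ^+ 2)).
  rewrite /w ReD !Re_realM /= pY aE; field.
  by rewrite -{1}[Y ^+ 2]mul1r exprMn -mulrDl !gt_eqF ?mulr_gt0 ?exprn_gt0.
have iw : Im w = X * (s ^+ 3 / (1 + s ^+ 2)).
  rewrite /w ImD !Im_realM /= mulrCA pY aE; field.
  by rewrite -{1}[Y ^+ 2]mul1r exprMn -mulrDl !gt_eqF ?mulr_gt0 ?exprn_gt0.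
by rewrite -rw -iw.
Qed.

Lemma saddle_exp_lower (p a Y s X V : R) : 1 <= V -> X = V ^+ 8 -> 0 < Y -> p * Y = X -> a / Y = X ->
  - (expR (2 * X) * expR (- (V ^+ 2 / 2))) <= Re (saddle_exp p a (Y +i* (s * Y))%C) /\
  (V ^+ 4 * `|s| <= 1 -> expR (2 * X) * (expR (-1) / 2) <= Re (saddle_exp p a (Y +i* (s * Y))%C)).
Proof.
move=> V1 XE Y0 pY aY; rewrite (Re_saddle_exp _ Y0 pY aY).
have V0 : 0 < V by lra.
have s2 := sqr_ge0 s.
have s1 : 0 < 1 + s ^+ 2 by lra.
have X0 : 0 < X by rewrite XE exprn_gt0.
set sg := s ^+ 2 / (1 + s ^+ 2).
have sg0 : 0 <= sg by rewrite divr_ge0 // ltW.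
have sgs : sg <= s ^+ 2 by rewrite ler_pdivrMr// ler_peMr//; lra.
set ph := X * (s ^+ 3 / (1 + s ^+ 2)).
have co : V ^+ 3 * `|s| <= 1 -> 1 / 2 <= cos ph.
  move=> hs; have ph1 : `|ph| <= 1.
    rewrite /ph normrM normf_div normrX (gtr0_norm X0) (gtr0_norm s1) mulrA ler_pdivrMr// mul1r XE.
    have h9 : V ^+ 9 * `|s| ^+ 3 <= 1.
      have -> : V ^+ 9 * `|s| ^+ 3 = (V ^+ 3 * `|s|) ^+ 3 by rewrite exprMn -exprM.
      by rewrite exprn_ile1// mulr_ge0// exprn_ge0// ltW.
    apply: le_trans (_ : V ^+ 9 * `|s| ^+ 3 <= _); last lra.
    by rewrite ler_wpM2r ?exprn_ge0// ler_weXn2l.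
  have := cos_quad ph; have : ph ^+ 2 <= 1 by rewrite -real_normK ?num_real// exprn_ile1.
  lra.
split.
  have [hs|hs] := leP (V ^+ 3 * `|s|) 1.
    apply: le_trans (_ : 0 <= _).
      by rewrite oppr_le0 mulr_ge0 ?expR_ge0.
    apply: mulr_ge0; first exact: expR_ge0.
    by have := co hs; lra.
  have sl : V ^+ 2 / 2 <= X * sg.
    have hs2 : 1 <= V ^+ 6 * s ^+ 2.
      have -> : V ^+ 6 * s ^+ 2 = (V ^+ 3 * `|s|) ^+ 2 by rewrite exprMn -exprM real_normK ?num_real.
      by rewrite exprn_ege1// ltW.
    rewrite /sg mulrA ler_pdivlMr// XE.
    have e1 : V ^+ 2 * 1 <= V ^+ 2 * (V ^+ 6 * s ^+ 2) by rewrite ler_wpM2l// sqr_ge0.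
    have e2 : V ^+ 2 * s ^+ 2 <= V ^+ 8 * s ^+ 2 by rewrite ler_wpM2r// ler_weXn2l.
    have e3 : V ^+ 2 * (V ^+ 6 * s ^+ 2) = V ^+ 8 * s ^+ 2 by rewrite mulrA -exprD.
    lra.
  rewrite lerNl -mulrN; apply: le_trans (_ : expR (2 * X - X * sg) * 1 <= _).
    by apply: ler_wpM2l; [exact: expR_ge0|rewrite lerNl cos_geN1].
  by rewrite mulr1 -expRD ler_expR; lra.
move=> hs4.
have hs3 : V ^+ 3 * `|s| <= 1.
  by apply: le_trans hs4; rewrite ler_wpM2r// ler_weXn2l.
have h8 : X * s ^+ 2 <= 1.
  have -> : X * s ^+ 2 = (V ^+ 4 * `|s|) ^+ 2 by rewrite exprMn -exprM real_normK ?num_real// XE.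
  by rewrite exprn_ile1// mulr_ge0// exprn_ge0// ltW.
have h8' : X * sg <= 1 by apply: le_trans h8; rewrite ler_pM2l.
apply: le_trans (_ : expR (2 * X) * expR (-1) * (1 / 2) <= _).
  by rewrite mulrA mul1r.
apply: ler_pM; [by rewrite mulr_ge0 ?expR_ge0|lra| |exact: co].
by rewrite -expRD ler_expR; lra.
Qed.

Lemma saddle_sum_lower (t : nat) (B a V Y p : R) : (0 < t)%N -> 0 < a -> 1 <= B -> 1 <= V -> 0 < Y -> t%:R * Y <= 1 ->
  p * Y = V ^+ 8 -> a / Y = V ^+ 8 ->
  exists M0, forall M, (M0 <= M)%N -> (0 < M)%N ->
   expR (2 * V ^+ 8) * (a * expR (-1) / (8 * pi) / V ^+ 12 - expR (- (V ^+ 2 / 2))) <= Re (saddle_sum t M B Y p a).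
Proof.
move=> t0 a0 B1 V1 Y0 tY pY aY.
have V0 : 0 < V by lra.
have p0 := @pi_gt0 R; have p2 := @pi_ge2 R.
have tp : 0 < t%:R :> R by rewrite ltr0n.
have t1 : 1 <= t%:R :> R by rewrite ler1n.
pose Q1 : R := Y * t%:R / pi / V ^+ 4.
have V4 : 0 < V ^+ 4 by rewrite exprn_gt0.
have Q10 : 0 < Q1 by rewrite /Q1 !divr_gt0// mulr_gt0.
have Q11 : Q1 <= 1.
  rewrite /Q1 ler_pdivrMr// mul1r ler_pdivrMr//.
  have : 1 <= V ^+ 4 by rewrite exprn_ege1.
  have h : 1 * 2 <= V ^+ 4 * pi -> Y * t%:R <= V ^+ 4 * pi by lra.
  by move=> h4; apply: h; apply: ler_pM.
exists (Num.trunc (2 / Q1)).+1 => M hM M0.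
have Mp : 0 < M%:R :> R by rewrite ltr0n.
pose Q := Q1 * M%:R.
have Q2 : 2 <= Q.
  rewrite /Q -ler_pdivrMl// mulrC.
  have := truncnS_gt (2 / Q1); move/ltW/le_trans; apply; by rewrite ler_nat.
have Q0 : 0 <= Q by lra.
pose k := Num.trunc Q.
have /andP[k1 k2] := truncn_itv Q0; rewrite -/k in k1 k2.
have kQ : Q / 2 <= k%:R by move: k2; rewrite -natr1; lra.
have kM : (k <= M)%N.
  rewrite -(ler_nat R) (le_trans k1)// /Q ler_piMl// ltW.
set E := expR (2 * V ^+ 8); set f := expR (- (V ^+ 2 / 2)).
have E0 : 0 < E := expR_gt0 _. have f0 : 0 < f := expR_gt0 _.
have Np : 0 < (2 * t * M)%:R :> R by rewrite ltr0n !muln_gt0 t0.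
rewrite /saddle_sum -(rmorph_nat (real_complex R)) -fmorphV Re_realM [leRHS]mulrC ler_pdivlMr// Re_sum.
have term j : (j < 2 * M)%N -> (if (M <= j < M + k)%N then E * (expR (-1) / 2) else 0) - E * f <=
   Re (if `|angle t M j| <= B * Y then saddle_exp p a (point t M Y j) else 0).
  move=> jM.
  have sE : angle t M j = angle t M j / Y * Y by rewrite divfK// gt_eqF.
  have [l1 l2] := @saddle_exp_lower p a Y (angle t M j / Y) (V ^+ 8) V V1 erefl Y0 pY aY.
  rewrite -sE -/(point t M Y j) in l1 l2.
  case: ifP => hj; last first.
    rewrite sub0r; case: ifP => _ //.
    by rewrite oppr_le0 mulr_ge0 // ltW.
  have an : V ^+ 4 * `|angle t M j / Y| <= 1.
    have aj : `|angle t M j| <= pi * (2 * k)%:R / (2 * t * M)%:R.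
      rewrite /angle !normrM normfV (gtr0_norm p0) (gtr0_norm Np) ler_pM2r ?invr_gt0// ler_pM2l//.
      case/andP: hj => hj1 hj2.
      have e1 : (2 * M)%:R <= (2 * j)%:R :> R by rewrite ler_nat leq_mul2l hj1 orbT.
      have e2 : (2 * j)%:R + 1 <= (2 * M)%:R + (2 * k)%:R :> R by rewrite natr1 -natrD ler_nat; clear -hj2; lia.
      have e3 : 0 <= (2 * k)%:R :> R by [].
      have e4 : 1 <= (2 * k)%:R :> R by rewrite ler1n; clear -hj1 hj2; lia.
      rewrite ler_norml; apply/andP; split; lra.
    have e5 : pi * (2 * k)%:R / (2 * t * M)%:R <= Y / V ^+ 4.
      have -> : pi * (2 * k)%:R / (2 * t * M)%:R = pi / (t%:R * M%:R) * k%:R :> R.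
        by rewrite !natrM; move: (pi : R) (t%:R : R) (M%:R : R) (k%:R : R) tp Mp => x y z v y0 z0; field; rewrite !gt_eqF.
      apply: le_trans (ler_wpM2l _ k1) _; first by rewrite divr_ge0 ?mulr_ge0 // ltW.
      apply: eq_leq_R; rewrite /Q /Q1.
      by move: (pi : R) (t%:R : R) (M%:R : R) (V ^+ 4) p0 tp Mp V4 => x y z v x0 y0 z0 v0; field; rewrite !gt_eqF.
    rewrite normrM normfV (gtr0_norm Y0) mulrA ler_pdivrMr// mul1r -ler_pdivlMl// mulrC.
    exact: le_trans e5.
  have -> : `|angle t M j| <= B * Y.
    have V41 : 1 <= V ^+ 4 by rewrite exprn_ege1.
    have e6 : `|angle t M j / Y| <= 1.
      by apply: le_trans an; rewrite ler_peMl.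
    move: e6; rewrite normrM normfV (gtr0_norm Y0) ler_pdivrMr// mul1r => /le_trans; apply.
    by rewrite ler_peMl// ltW.
  apply: le_trans (l2 an); rewrite lerBlDr lerDl; apply: mulr_ge0; exact: ltW.
have : \sum_(0 <= j < 2 * M) ((if (M <= j < M + k)%N then E * (expR (-1) / 2) else 0) - E * f) <=
   \sum_(0 <= j < 2 * M) Re (if `|angle t M j| <= B * Y then saddle_exp p a (point t M Y j) else 0).
  by apply: ler_sum_nat => j /andP[_ jM]; exact: term.
apply: le_trans.
rewrite sumrB sumr_const_nat subn0 -big_mkcond/=.
have -> : \sum_(0 <= i < 2 * M | (M <= i < M + k)%N) (E * (expR (-1) / 2)) = k%:R * (E * (expR (-1) / 2)).
  have k2M : (M + k <= 2 * M)%N by rewrite mul2n -addnn leq_add2l.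
  have -> : k%:R * (E * (expR (-1) / 2)) = \sum_(M <= i < M + k) (E * (expR (-1) / 2)).
    by rewrite sumr_const_nat addKn mulr_natl.
  by rewrite (big_nat_widenl M 0)// (big_nat_widen 0 (M + k) (2 * M))//.
rewrite -[_ *+ _]mulr_natl.
have V12 : V ^+ 12 = V ^+ 8 * V ^+ 4 by rewrite -exprD.
have aE : a = V ^+ 8 * Y by rewrite -aY divfK// gt_eqF.
have x1 : E * (a * expR (-1) / (8 * pi) / V ^+ 12) * (2 * t * M)%:R = Q / 2 * (E * (expR (-1) / 2)).
  rewrite V12 aE /Q /Q1 !natrM.
  have V8 : 0 < V ^+ 8 by rewrite exprn_gt0.
  move: (pi : R) (t%:R : R) (M%:R : R) (V ^+ 4) (V ^+ 8) (expR (-1)) p0 tp Mp V4 V8 => x y z v v' w x0 y0 z0 v0 v'0.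
  by field; rewrite !gt_eqF.
have x2 : (2 * M)%:R * (E * f) <= E * f * (2 * t * M)%:R.
  rewrite mulrC; apply: ler_wpM2l; first by rewrite mulr_ge0// ltW.
  by rewrite ler_nat leq_mul2r leq_pmulr ?orbT.
have x3 : Q / 2 * (E * (expR (-1) / 2)) <= k%:R * (E * (expR (-1) / 2)).
  by rewrite ler_wpM2r// mulr_ge0 ?(ltW E0)// divr_ge0 ?expR_ge0.
rewrite mulrBr mulrBl; lra.
Qed.

End Saddle.

End CoefficientAverages.
Import CoefficientAverages.

(** * Transfer of nonvanishing between primitive roots of unity *)

Module CyclotomicValues.

From mathcomp Require Import all_field.

Section CyclotomicTransfer.

Lemma root_Cyclotomic (F : fieldType) n (z : F) : n.-primitive_root z ->
  root (map_poly intr 'Phi_n) z.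
Proof.
move=> pz; have n0 := prim_order_gt0 pz.
have : root (map_poly intr ('X^n - 1 : {poly int})) z.
  by rewrite rmorphB rmorph1 /= map_polyXn /root !hornerE prim_expr_order// subrr.
rewrite -(prod_Cyclotomic n0) rmorph_prod /root horner_prod prodf_seq_eq0 => /hasP[d]; rewrite -dvdn_divisors// => dn /= hd.
have [<-//|dn'] := eqVneq d n; exfalso.
have d0 : (0 < d)%N by exact: dvdn_gt0 dn.
have : root (map_poly intr ('X^d - 1 : {poly int})) z.
  rewrite -(prod_Cyclotomic d0) rmorph_prod /root horner_prod (big_rem d) /=.
    by rewrite (eqP hd) mul0r.
  by rewrite -dvdn_divisors.
rewrite rmorphB rmorph1 /= map_polyXn /root !hornerE subr_eq0 => /eqP zd.
move/negP: dn'; apply; rewrite eqn_dvd dn.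
by rewrite (prim_order_dvd pz); apply/eqP.
Qed.

(** An integer polynomial killed by one primitive root of unity, in any field
    of characteristic zero, is a multiple of the cyclotomic polynomial. *)
Lemma dvd_Cyclotomic (F : numFieldType) n (z : F) (G : {poly int}) :
  n.-primitive_root z -> root (map_poly intr G) z -> exists H, G = 'Phi_n * H.
Proof.
move=> pz rG; have n0 := prim_order_gt0 pz.
have [x px] := C_prim_root_exists n0.
pose Q (p : {poly int}) : {poly rat} := map_poly intr p.
have toF (p : {poly int}) : map_poly intr p = map_poly ratr (Q p) :> {poly F}.
  by rewrite -map_poly_comp; apply: eq_map_poly => k /=; rewrite ratr_int.
have toC (p : {poly int}) : map_poly intr p = map_poly ratr (Q p) :> {poly algC}.
  by rewrite -map_poly_comp; apply: eq_map_poly => k /=; rewrite ratr_int.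
have ncop : ~~ coprimep (Q G) (Q 'Phi_n).
  rewrite -(coprimep_map (ratr : {rmorphism rat -> F})) -!toF.
  apply/negP => /coprimep_root /(_ rG).
  by have := root_Cyclotomic pz; rewrite /root => ->.
have [y ry] : exists y : algC, root (map_poly intr G) y && root (map_poly intr 'Phi_n) y.
  rewrite -(coprimep_map (ratr : {rmorphism rat -> algC})) -!toC in ncop.
  have sz : size (gcdp (map_poly intr G) (map_poly intr 'Phi_n : {poly algC})) != 1%N by [].
  have [y] := closed_rootP _ sz; rewrite root_gcd; by exists y.
case/andP: ry => ryG ryP.
have py : n.-primitive_root y.
  by move: ryP; rewrite (Cintr_Cyclotomic px) root_cyclotomic.
have [p [Ep _ hp]] := minCpolyP y.
have pE : p = Q 'Phi_n.
  apply: (map_poly_inj (ratr : {rmorphism rat -> algC})).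
  by rewrite -Ep (minCpoly_cyclotomic py) -(Cintr_Cyclotomic py) toC.
have : p %| Q G by rewrite -hp -toC.
rewrite pE => /dvdpP_rat_int[p1 [a a0 Ea] [r Er]].
have lc : a * (lead_coef p1)%:~R = 1.
  have := congr1 lead_coef Ea; rewrite lead_coefZ !lead_coef_map_inj ?rmorph0//; try exact: intr_inj.
  by rewrite (monicP (Cyclotomic_monic n)).
have E1 : p1 = lead_coef p1 *: 'Phi_n.
  apply: (map_inj_poly (intr_inj : injective (intr : int -> rat))) => //.
  rewrite map_polyZ /= -/(Q p1) -/(Q 'Phi_n) Ea scalerA mulrC lc scale1r //.
exists (lead_coef p1 *: r); rewrite -scalerAr scalerAl -E1 -Er //.
Qed.

(** Modular certificate for a nonzero cyclotomic integer. *)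
Lemma cyclotomic_value_neq0 (F : numFieldType) n (z : F) (G : {poly int}) (p g : int) :
  n.-primitive_root z ->
  (p %| g ^+ n - 1)%Z -> (forall d, (0 < d < n)%N -> coprimez p (g ^+ d - 1)) ->
  ~~ (p %| G.[g])%Z -> (map_poly intr G).[z] != 0.
Proof.
move=> pz pn cop nd; apply/negP => /(dvd_Cyclotomic pz)[H GE].
have n0 := prim_order_gt0 pz.
move/negP: nd; apply; rewrite GE hornerM dvdz_mulr//.
move: pn; have := congr1 (fun P : {poly int} => P.[g]) (prod_Cyclotomic n0).
rewrite /= !hornerE horner_prod => <-.
rewrite (big_rem n) ?dvdn_divisors//= -?dvdn_divisors//.
rewrite Gauss_dvdzl//.
rewrite big_seq; apply: (big_ind (fun v => coprimez p v)) => [||d].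
- by rewrite /coprimez gcdz1.
- by move=> a b ha hb; rewrite coprimezMr ha hb.
rewrite mem_rem_uniq ?divisors_uniq// inE => /andP[dn]; rewrite -dvdn_divisors// => dd.
have d0 : (0 < d)%N by exact: dvdn_gt0 dd.
have dlt : (0 < d < n)%N by rewrite d0 ltn_neqAle dn dvdn_leq.
have := cop d dlt; have := congr1 (fun P : {poly int} => P.[g]) (prod_Cyclotomic d0).
rewrite /= !hornerE horner_prod => <-.
by rewrite (big_rem d) ?coprimezMr/= -?dvdn_divisors// => /andP[].
Qed.

End CyclotomicTransfer.

End CyclotomicValues.
Import CyclotomicValues.

(** * The sums over the dominant cusps *)

Module CuspSums.

From Stdlib Require Import ZArith.
From mathcomp Require Import ssrZ ring lra zify.
Delimit Scope nat_scope with N.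
Delimit Scope int_scope with Z.
Delimit Scope Z_scope with ZZ.
Local Opaque cexp kap eu.

Section CuspValue.

(** The exponential sum at the cusps, as a polynomial expression in a primitive
    12t-th root of unity g. *)
Definition expo (t h s : nat) : nat := (6 * t * s + 6 * h * s * (3 * s + 1))%N.
Definition gam_val (A : comNzRingType) (t h : nat) (g : A) : A :=
  \sum_(0 <= s < 2 * t) (g ^+ (expo t h s + (6 * s + 1)) + g ^+ (expo t h s + (12 * t).-1 * (6 * s + 1))).
Definition cusp_val (A : comNzRingType) (t m r : nat) (g : A) : A :=
  \sum_(0 <= h < t) (if coprime h t then gam_val t h g ^+ m * g ^+ ((12 * t).-1 * 12 * h * r) else 0).

Lemma gam_val_morph (A B : comNzRingType) (f : {rmorphism A -> B}) t h g :
  f (gam_val t h g) = gam_val t h (f g).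
Proof. by rewrite rmorph_sum; apply: eq_bigr => s _; rewrite rmorphD !rmorphXn. Qed.

Lemma cusp_val_morph (A B : comNzRingType) (f : {rmorphism A -> B}) t m r g :
  f (cusp_val t m r g) = cusp_val t m r (f g).
Proof.
rewrite rmorph_sum; apply: eq_bigr => h _; case: ifP => _; last by rewrite rmorph0.
by rewrite rmorphM !rmorphXn gam_val_morph.
Qed.

Variable R : realType.
Local Notation C := (R[i]%C).

Definition cusp_sum (t m r : nat) : C :=
  \sum_(0 <= h < t) (if coprime h t then Gam R t h ^+ m * eu (- ((r * h)%:R / t%:R)) else 0).

Lemma eu_eq1 (n k : nat) : (0 < n)%N -> eu (k%:R / n%:R) = 1 :> C -> (n %| k)%N.
Proof.
move=> n0 e; have := eu_orth R k%:Z n0.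
rewrite (eq_bigr (fun=> 1)) => [|j _]; last by rewrite -euX e expr1n.
rewrite sumr_const_nat subn0 absz_nat; case: ifP => // _ /eqP.
by rewrite pnatr_eq0 gtn_eqF.
Qed.

Lemma eu_primitive n : (0 < n)%N -> n.-primitive_root (eu (n%:R^-1) : C).
Proof.
move=> n0; apply/andP; split => //; apply/forallP => i; apply/eqP.
have nn : n%:R != 0 :> R by rewrite pnatr_eq0 -lt0n.
rewrite unity_rootE euX; apply/eqP/eqP => [h|->]; last by rewrite mulfV// eu1.
have /dvdn_leq := eu_eq1 n0 h; move=> /(_ isT) le; apply/eqP; rewrite eqn_leq le andbT.
exact: ltn_ord.
Qed.

Lemma cusp_sum_val t m r : (0 < t)%N -> cusp_sum t m r = cusp_val t m r (eu ((12 * t)%:R^-1) : C).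
Proof.
move=> t0; have tn : t%:R != 0 :> R by rewrite pnatr_eq0 -lt0n.
set z := eu _; have n0 : (0 < 12 * t)%N by rewrite muln_gt0.
have zi k : z ^+ ((12 * t).-1 * k) = eu (- (k%:R / (12 * t)%:R)).
  rewrite exprM /z euX -subn1 natrB// mulrBl mulfV ?mul1r; last by rewrite pnatr_eq0 -lt0n.
  by rewrite euD eu1 mul1r euX mulrN.
have zk k : z ^+ k = eu (k%:R / (12 * t)%:R) by rewrite /z euX.
have ph h s : eu (pent_phase R t h s%:Z) = z ^+ expo t h s.
  rewrite zk; congr eu; rewrite /pent_phase /expo -!pmulrn !(natrD, natrM).
  by move: (h%:R : R) (s%:R : R) (t%:R : R) tn => x y v v0; field.
rewrite /cusp_sum /cusp_val; apply: eq_bigr => h _; case: ifP => // _.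
congr (_ ^+ m * _).
  rewrite /Gam /gam -big_split /gam_val; apply: eq_bigr => s _ /=.
  by rewrite !ph (exprD z (expo t h s) (6 * s + 1)) (exprD z (expo t h s) ((12 * t).-1 * (6 * s + 1))) zi (zk (6 * s + 1)%N) mulr1z mul1r mulrNz mulr1z mulN1r.
rewrite -!mulnA zi; congr (eu (- _)).
by rewrite !natrM; move: (h%:R : R) (r%:R : R) (t%:R : R) tn => x y v v0; field.
Qed.

Lemma cusp_sum_Re t m r : (0 < t)%N ->
  cusp_val t m r (eu ((12 * t)%:R^-1) : C) + cusp_val t m r ((eu ((12 * t)%:R^-1) : C) ^+ (12 * t).-1) != 0 ->
  Re (cusp_sum t m r) != 0.
Proof.
move=> t0; set z := eu _; have n0 : (0 < 12 * t)%N by rewrite muln_gt0.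
have zc : z ^+ (12 * t).-1 = z^*%C.
  rewrite /z eu_conj euX -subn1 natrB// mulrBl mulfV ?mul1r; last by rewrite pnatr_eq0 -lt0n.
  by rewrite euD eu1 mul1r.
have cj : cusp_val t m r (z^*%C) = (cusp_val t m r z)^*%C.
  exact: (esym (cusp_val_morph (conjc : {rmorphism C -> C}) t m r z)).
rewrite zc cj -cusp_sum_val//; apply: contraNneq; case: (cusp_sum _ _ _) => x y /= ->.
by apply/eqP; apply: eqC; rewrite /= ?addr0 ?subrr.
Qed.

End CuspValue.

Section ModularCheck.
Local Open Scope Z_scope.

Section Congruence.
Local Open Scope ring_scope.
Variables (A : comNzRingType) (p : A).
Definition cg (x y : A) : Prop := exists k : A, x = y + k * p.

Lemma cg_refl x : cg x x. Proof. by exists 0; rewrite mul0r addr0. Qed.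
Lemma cg_sym x y : cg x y -> cg y x. Proof. by move=> [k ->]; exists (- k); ring. Qed.
Lemma cgD x x' y y' : cg x x' -> cg y y' -> cg (x + y) (x' + y').
Proof. by move=> [k ->] [l ->]; exists (k + l); ring. Qed.
Lemma cgM x x' y y' : cg x x' -> cg y y' -> cg (x * y) (x' * y').
Proof. by move=> [k ->] [l ->]; exists (k * y' + x' * l + k * l * p); ring. Qed.
Lemma cgX x x' n : cg x x' -> cg (x ^+ n) (x' ^+ n).
Proof. by move=> h; elim: n => [|n IH]; [exact: cg_refl|rewrite !exprS; exact: cgM]. Qed.
Lemma cg_trans y x z : cg x y -> cg y z -> cg x z.
Proof. by move=> [k ->] [l ->]; exists (l + k); ring. Qed.
Lemma cg_sum (r : seq nat) (F G : nat -> A) : (forall i, cg (F i) (G i)) ->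
  cg (\sum_(i <- r) F i) (\sum_(i <- r) G i).
Proof. by move=> h; elim/big_ind2: _ => *; [exact: cg_refl|exact: cgD|exact: h]. Qed.
Lemma cg_addp x : cg (x + (p - 1)) (x - 1). Proof. by exists 1; ring. Qed.
End Congruence.

Lemma cg_mod (p x : Z) : p <> 0 -> cg p (x mod p) x.
Proof. by move=> p0; exists (- (x / p)); rewrite Z.mod_eq// /GRing.add /GRing.mul /=; lia. Qed.

Definition power_table (p g : Z) (n : nat) : seq Z := traject (fun x => (g * x) mod p) 1 n.
Definition lookup (tb : seq Z) (n e : Z) : Z := nth 0 tb (Z.to_nat (e mod n)).

Definition expoZ (t h s : Z) : Z := 6 * t * s + 6 * h * s * (3 * s + 1).
Definition gam_fast (p : Z) (tb : seq Z) (t h : nat) : Z :=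
  let n := 12 * Z.of_nat t in let tz := Z.of_nat t in let hz := Z.of_nat h in
  foldr (fun s acc => let sz := Z.of_nat s in let e := expoZ tz hz sz in
    (lookup tb n (e + (6 * sz + 1)) + lookup tb n (e + (n - 1) * (6 * sz + 1)) + acc) mod p)
    0 (iota 0 (2 * t)).
Fixpoint pow_fast (p x : Z) (m : nat) : Z := if m is m'.+1 then (x * pow_fast p x m') mod p else 1.
Definition cusp_fast (p : Z) (tb gl : seq Z) (t m r : nat) : Z :=
  let n := 12 * Z.of_nat t in
  foldr (fun h acc => if coprime h t then
     (pow_fast p (nth 0 gl h) m * lookup tb n ((n - 1) * 12 * Z.of_nat h * Z.of_nat r) + acc) mod p else acc)
    0 (iota 0 t).

Section Correct.
Variables (p g : Z) (t : nat).
Hypothesis p0 : p <> 0.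
Hypothesis t0 : (0 < t)%N.
Let n := (12 * t)%N.
Hypothesis gn : cg p (g ^+ n)%R 1%R.

Lemma n_gt0 : (0 < n)%N. Proof. by rewrite muln_gt0. Qed.

Lemma power_table_nth i : (i < n)%N -> cg p (nth 0 (power_table p g n) i) (g ^+ i)%R.
Proof.
move=> iN; rewrite /power_table (set_nth_default 1) ?size_traject// nth_traject//; elim: i {iN} => [|i IH]; first exact: cg_refl.
rewrite iterS exprS; apply: cg_trans (cg_mod _ p0) _.
by apply: cgM => //; exact: cg_refl.
Qed.

Lemma lookup_cg (e : nat) : cg p (lookup (power_table p g n) (12 * Z.of_nat t) (Z.of_nat e)) (g ^+ e)%R.
Proof.
rewrite /lookup.
have -> : Z.to_nat (Z.of_nat e mod (12 * Z.of_nat t)) = modn e n.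
  have -> : 12 * Z.of_nat t = Z.of_nat n by rewrite /n; lia.
  have k0 := n_gt0; have de := divn_eq e n; have := ltn_mod e n; rewrite k0.
  move: (divn e n) (modn e n) de; move: n k0 => k k0 q r de rk.
  rewrite -(@Z.mod_unique_pos _ _ (Z.of_nat q) (Z.of_nat r)) ?Nat2Z.id//; [lia|by rewrite de; lia].
apply: (@cg_trans _ p (g ^+ (modn e n))%R).
  by apply: power_table_nth; rewrite ltn_mod; exact: n_gt0.
rewrite {2}(divn_eq e n) exprD mulnC exprM.
rewrite -[X in cg p X _]mul1r; apply: cgM; last exact: cg_refl.
have := cgX (divn e n) gn; rewrite expr1n; exact: cg_sym.
Qed.

Lemma gam_fast_cg h : cg p (gam_fast p (power_table p g n) t h) (gam_val t h g).
Proof.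
rewrite /gam_fast /gam_val /index_iota subn0.
elim: (iota 0 (2 * t)) => [|s l IH]; first by rewrite big_nil; exact: cg_refl.
rewrite big_cons /=; apply: (cg_trans (cg_mod _ p0)); apply: cgD IH; apply: cgD.
  have -> : expoZ (Z.of_nat t) (Z.of_nat h) (Z.of_nat s) + (6 * Z.of_nat s + 1) =
    Z.of_nat (expo t h s + (6 * s + 1)) by rewrite /expoZ /expo; lia.
  exact: lookup_cg.
have -> : expoZ (Z.of_nat t) (Z.of_nat h) (Z.of_nat s) + (12 * Z.of_nat t - 1) * (6 * Z.of_nat s + 1) =
    Z.of_nat (expo t h s + (12 * t).-1 * (6 * s + 1)).
  have : Z.of_nat (12 * t).-1 = 12 * Z.of_nat t - 1 by lia.
  by rewrite /expoZ /expo; move: (12 * t).-1 => k kE; rewrite -kE; lia.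
exact: lookup_cg.
Qed.

Lemma pow_fast_cg x m : cg p (pow_fast p x m) (x ^+ m)%R.
Proof.
elim: m => [|m IH] /=; first exact: cg_refl.
rewrite exprS; apply: (cg_trans (cg_mod _ p0)); apply: cgM IH; exact: cg_refl.
Qed.

Lemma cusp_fast_cg m r :
  cg p (cusp_fast p (power_table p g n) [seq gam_fast p (power_table p g n) t h | h <- iota 0 t] t m r)
    (cusp_val t m r g).
Proof.
rewrite /cusp_fast /cusp_val /index_iota subn0.
have : all (fun h => h < t)%N (iota 0 t) by apply/allP => h; rewrite mem_iota.
elim: {-2}(iota 0 t) => [|h l IH] /=; first by rewrite big_nil => _; exact: cg_refl.
move=> /andP[ht hl]; rewrite big_cons; case: ifP => _; last by rewrite add0r; exact: IH.
apply: (cg_trans (cg_mod _ p0)); apply: cgD (IH hl); apply: cgM.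
  rewrite (nth_map 0%N) ?size_iota// nth_iota// add0n.
  apply: (cg_trans (pow_fast_cg _ _)); apply: cgX; exact: gam_fast_cg.
have -> : (12 * Z.of_nat t - 1) * 12 * Z.of_nat h * Z.of_nat r = Z.of_nat ((12 * t).-1 * 12 * h * r).
  have : Z.of_nat (12 * t).-1 = 12 * Z.of_nat t - 1 by lia.
  by move: (12 * t).-1 => k kE; rewrite -kE; lia.
exact: lookup_cg.
Qed.

End Correct.

(** Residue classes on which the leading term vanishes. *)
Definition zeros (t m : nat) : seq nat :=
  match m, t with
  | 1%N, 5%N | 1%N, 7%N | 1%N, 10%N | 1%N, 11%N | 1%N, 13%N | 1%N, 14%N | 1%N, 15%N | 1%N, 17%N
  | 1%N, 19%N | 1%N, 20%N | 1%N, 21%N | 1%N, 22%N | 1%N, 23%N =>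
    [seq r <- iota 0 t | all (fun k => k * (3 * k + 1) %/ 2 != r %[mod t]) (iota 0 (2 * t))]
  | 1%N, 25%N => 1%N :: [seq r <- iota 0 t | all (fun k => k * (3 * k + 1) %/ 2 != r %[mod t]) (iota 0 (2 * t))]
  | 3%N, 3%N | 3%N, 5%N | 3%N, 6%N | 3%N, 7%N =>
    [seq r <- iota 0 t | all (fun k => k * (k + 1) %/ 2 != r %[mod t]) (iota 0 (2 * t))]
  | 3%N, 9%N => 1%N :: [seq r <- iota 0 t | all (fun k => k * (k + 1) %/ 2 != r %[mod t]) (iota 0 (2 * t))]
  | 9%N, 3%N => [:: 0%N]
  | 4%N, 4%N => [:: 0%N; 2%N]
  | 8%N, 4%N => [:: 1%N; 3%N]
  | 5%N, 5%N => [:: 0%N]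
  | 2%N, 8%N => [:: 0%N; 2%N; 4%N; 6%N]
  | _, _ => [::]
  end%N.

Definition check (x : nat * nat * nat) : bool :=
  let: (t, pn, gn) := x in
  let n := (12 * t)%N in let p := Z.of_nat pn in let g := Z.of_nat gn in
  let tb := power_table p g n in
  let g' := nth 0 tb n.-1 in
  let tb' := power_table p g' n in
  let gl := [seq gam_fast p tb t h | h <- iota 0 t] in
  let gl' := [seq gam_fast p tb' t h | h <- iota 0 t] in
  [&& (1 < pn)%N, ((g * g') mod p == 1)%ZZ,
   all (fun d => coprime pn (Z.to_nat ((nth 0 tb d + (p - 1)) mod p))) (iota 1 n.-1) &
   all (fun m => let zs := zeros t m in all (fun r => (r \in zs) ||
     ((cusp_fast p tb gl t m r + cusp_fast p tb' gl' t m r) mod p != 0)%ZZ) (iota 0 t)) (iota 1 (24 %/ t.-1))].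

Definition certificates : seq (nat * nat * nat) :=
  [:: (2, 241, 2); (3, 397, 41); (4, 241, 11); (5, 241, 9); (6, 433, 2); (7, 337, 9); (8, 577, 11); (9, 433, 12); (10, 241, 3); (11, 397, 15); (12, 433, 42); (13, 313, 2); (14, 337, 3); (15, 541, 8); (16, 577, 14); (17, 409, 2); (18, 433, 6); (19, 229, 6); (20, 241, 7); (21, 757, 8); (22, 1321, 7); (23, 277, 5); (24, 577, 17); (25, 601, 10)]%N.

Lemma certificates_ok : all check certificates.
Proof. by vm_compute. Qed.

Variable R : realType.
Local Notation C := (R[i]%C).
Local Open Scope ring_scope.

Lemma check_sound t p g m r : (1 < t)%N -> check (t, p, g) -> (0 < m)%N -> (m <= 24 %/ t.-1)%N -> (r < t)%N ->
  r \notin zeros t m -> Re (cusp_sum R t m r) != 0.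
Proof.
move=> t1 /and4P[p1 h1 h2 h3] m0 mt rt rz.
have t0 : (0 < t)%N by exact: ltnW.
set n := (12 * t)%N in h1 h2 h3; have n0 : (0 < n)%N by rewrite muln_gt0.
set pz := Z.of_nat p in h1 h2 h3; set gz := Z.of_nat g in h1 h2 h3.
have p0 : pz <> 0%R by rewrite /pz; move: p1; clear => h /=; case: p h.
have tbn i : (i < n)%N -> cg pz (nth Z0 (power_table pz gz n) i) (gz ^+ i).
  exact: power_table_nth.
set g' := nth _ _ n.-1 in h1 h3.
have g'E : cg pz g' (gz ^+ n.-1) by apply: tbn; rewrite prednK.
have gn : cg pz (gz ^+ n) 1.
  have : cg pz (gz * g') (gz ^+ n).
    by rewrite -(prednK n0) exprS; apply: cgM => //; exact: cg_refl.
  have := cg_mod (gz * g')%R p0; rewrite (eqP h1) => k l.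
  exact: cg_sym (cg_trans k l).
have g'n : cg pz (g' ^+ n) 1.
  apply: (cg_trans (cgX n g'E)); rewrite -exprM mulnC exprM.
  by have := cgX n.-1 gn; rewrite expr1n.
apply: cusp_sum_Re => //.
pose G : {poly int} := cusp_val t m r 'X + cusp_val t m r ('X ^+ n.-1).
have ev (A : comNzRingType) (f : {rmorphism int -> A}) (x : A) :
    (map_poly f G).[x] = cusp_val t m r x + cusp_val t m r (x ^+ n.-1).
  rewrite /G rmorphD !(cusp_val_morph (map_poly f : {rmorphism {poly int} -> {poly A}})) rmorphXn /= map_polyX hornerD.
  rewrite -!/(horner_eval x _) !(cusp_val_morph (horner_eval x : {rmorphism {poly A} -> A})).
  by rewrite rmorphXn /= /horner_eval hornerX.
rewrite -(ev C intr).
have pz1 := eu_primitive R n0.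
apply: (cyclotomic_value_neq0 (p := int_of_Z pz) (g := int_of_Z gz) pz1).
- have [k kE] := gn; rewrite -rmorphXn kE rmorphD rmorphM rmorph1 addrAC subrr add0r.
  exact: dvdz_mull.
- move=> d /andP[d0 dn].
  have := allP h2 d; rewrite mem_iota d0 add1n prednK// => /(_ dn).
  set y := (_ mod _)%ZZ => cop.
  have y0 : (0 <= y)%ZZ by apply: (proj1 (Z.mod_pos_bound _ _ _)); rewrite /pz; lia.
  have [k kE] : cg pz y (gz ^+ d - 1).
    apply: (cg_trans (cg_mod _ p0)); apply: (cg_trans _ (cg_addp pz _)).
    by apply: cgD; [exact: tbn|exact: cg_refl].
  have yE : int_of_Z y = (Z.to_nat y)%:Z by clear -y0; lia.
  have : coprimez p (Z.to_nat y) by [].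
  rewrite -yE kE rmorphD rmorphM rmorphB rmorph1 rmorphXn /coprimez (addrC (_ - _)).
  have pE : int_of_Z pz = p%:Z by rewrite /pz; clear; lia.
  by rewrite /= pE gcdzMDl.
- have -> : G.[int_of_Z gz] = int_of_Z (cusp_val t m r gz + cusp_val t m r (gz ^+ n.-1)).
    rewrite rmorphD !(cusp_val_morph (int_of_Z : {rmorphism Z -> int})) rmorphXn.
    by rewrite -(ev int (idfun : {rmorphism int -> int})) map_poly_id.
  apply/negP => /dvdzP[k kE].
  have {}kE : cg pz (cusp_val t m r gz + cusp_val t m r (gz ^+ n.-1)) 0.
    exists (Z_of_int k); rewrite add0r; apply: (can_inj int_of_ZK).
    by rewrite kE rmorphM /= Z_of_intK.
  have mi : m \in iota 1 (24 %/ t.-1) by rewrite mem_iota m0 add1n ltnS.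
  have ri : r \in iota 0 t by rewrite mem_iota.
  have := allP (allP h3 m mi) r ri; rewrite (negPf rz) /=.
  set v := (_ + _)%ZZ => /negP; apply; apply/eqP.
  have [l lE] : cg pz v 0.
    apply: cg_trans kE; apply: cgD; first exact: cusp_fast_cg.
    apply: cg_trans (cusp_fast_cg p0 t0 g'n m r) _.
    apply: cg_sum => h; case: ifP => _; last exact: cg_refl.
    apply: cgM; last by apply: cgX.
    by apply: cgX; apply: cg_sum => s; apply: cgD; apply: cgX.
  by rewrite lE add0r; exact: Z_mod_mult.
Qed.

(** A nonzero value at an element of exact order 12 t modulo p excludes the
    value 0 at a primitive root of unity in characteristic 0. *)
Theorem cusp_sum_neq0 t m r : (1 < t)%N -> (0 < m)%N -> (m * (t - 1) <= 24)%N -> (r < t)%N ->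
  r \notin zeros t m -> Re (cusp_sum R t m r) != 0.
Proof.
move=> t1 m0 mt rt rz.
have tp : (0 < t.-1)%N by case: t t1 {mt rt rz} => [|[]].
have mt' : (m <= 24 %/ t.-1)%N by rewrite leq_divRL// -subn1.
have t25 : (t <= 25)%N by nia.
have [x /andP[/eqP xt hx]] : exists x, (x.1.1 == t) && check x.
  have ex : has (fun x => x.1.1 == t) certificates.
    have : t \in iota 2 24 by rewrite mem_iota t1.
    have /allP : all (fun t => has (fun x => x.1.1 == t) certificates) (iota 2 24) by [].
    exact.
  have [x xc xt] := hasP ex; exists x; rewrite xt; exact: (allP certificates_ok).
case: x xt hx => [[t' p] g] /= -> hx; exact: check_sound hx m0 mt' rt rz.
Qed.

(** Summing the leading constants over the classes congruent modulo a proper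
    divisor of t kills every cusp. *)
Lemma cusp_sum_classes t m r g : (0 < t)%N -> (g %| t)%N -> (g < t)%N ->
  \sum_(0 <= j < t %/ g) cusp_sum R t m (r + j * g) = 0.
Proof.
move=> t0 gt glt; have g0 : (0 < g)%N by exact: dvdn_gt0 gt.
set N := (t %/ g)%N; have tE : t = (N * g)%N by rewrite divnK.
have N0 : (0 < N)%N by rewrite divn_gt0// ltnW.
clearbody N; have N1 : (1 < N)%N by move: glt; rewrite tE -{1}[g]mul1n ltn_pmul2r.
rewrite /cusp_sum exchange_big /=; apply: big1_seq => h _.
case: (boolP (coprime h t)) => [cop|_]; last by rewrite big1.
have e j : Gam R t h ^+ m * eu (- (((r + j * g) * h)%:R / t%:R)) =
   Gam R t h ^+ m * eu (- ((r * h)%:R / t%:R)) * eu (j%:R * ((- h%:Z)%:~R / N%:R)).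
  rewrite -mulrA -euD; congr (_ * eu _).
  rewrite rmorphN /= -pmulrn !(natrM, natrD) {2}tE natrM.
  have : N%:R != 0 :> R by rewrite pnatr_eq0 -lt0n.
  have : g%:R != 0 :> R by rewrite pnatr_eq0 -lt0n.
  rewrite {1}tE natrM.
  by move: (N%:R : R) (g%:R : R) (h%:R : R) (r%:R : R) (j%:R : R) => *; field; apply/andP.
rewrite (eq_bigr _ (fun j _ => e j)) -mulr_sumr (eu_orth _ _ N0) abszN absz_nat.
case: ifP => [dv|_]; last by rewrite mulr0.
exfalso; move: cop; rewrite /coprime => /eqP cop.
have : (N %| gcdn h t)%N by rewrite dvdn_gcd dv tE dvdn_mulr.
by rewrite cop dvdn1 => /eqP N1'; rewrite N1' in N1.
Qed.

End ModularCheck.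

End CuspSums.
Import CuspSums.

(** * Signs of the coefficients in a residue class *)

Module SignAsymptotics.

Local Opaque cexp kap eu.

Section Asymptotics.
Variable R : realType.
Local Notation C := (R[i]%C).

Lemma exp_small (g e : R) : 0 < g -> 0 < e -> exists2 V0, 1 <= V0 & forall V, V0 <= V -> expR (- (g * V)) <= e / V ^+ 12.
Proof.
move=> g0 e0; have [K K0 hK] := expR_pow_le 13 g0.
exists (Num.max 1 (K / e)); first by rewrite le_max lexx.
move=> V; rewrite ge_max => /andP[V1 VK]; have V0 : 0 < V by lra.
have V12 : 0 < V ^+ 12 by rewrite exprn_gt0.
rewrite ler_pdivlMr// expRN mulrC ler_pdivrMr ?expR_gt0//.
rewrite ler_pdivrMr// in VK.
have h := hK V (ltW V0); rewrite exprS in h.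
rewrite -(ler_pM2l K0).
have : K * V ^+ 12 <= V * e * V ^+ 12 by rewrite ler_pM2r.
have : V * e * V ^+ 12 <= K * expR (g * V) * e by rewrite mulrAC ler_pM2r.
rewrite [K * (e * _)]mulrCA [e * _]mulrC; lra.
Qed.

Lemma sg_near (x y : R) : `|x - y| < `|y| -> Num.sg x = Num.sg y.
Proof.
have [y0|y0|->] := ltrgt0P y.
- by rewrite ltr_norml => /andP[a b]; rewrite !gtr0_sg//; lra.
- by rewrite ltr_norml => /andP[a b]; rewrite !ltr0_sg//; lra.
- by rewrite ltNge normr_ge0.
Qed.

Lemma cusp_sum_mod t m n r : (0 < t)%N -> n = r %[mod t] -> cusp_sum R t m n = cusp_sum R t m r.
Proof.
move=> t0; have tn : t%:R != 0 :> R by rewrite pnatr_eq0 -lt0n.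
have red k : cusp_sum R t m k = cusp_sum R t m (k %% t).
  apply: eq_bigr => h _; case: ifP => // _; congr (_ * _).
  rewrite {1}(divn_eq k t) -(eu_addZ (- (((k %% t) * h)%:R / t%:R)) (- ((k %/ t) * h)%N%:Z)); congr eu.
  rewrite rmorphN /= -pmulrn !(natrM, natrD).
  by move: tn; move: (t%:R : R) (h%:R : R) ((k %/ t)%:R : R) ((k %% t)%:R : R) => *; field.
by rewrite red => ->; rewrite -red.
Qed.

Lemma circle_main (t m n M : nat) (B d K Y0 Y : R) : (1 < t)%N -> (0 < M)%N ->
  (forall h, (h < t)%N -> forall Z, 0 < Re Z <= Y0 -> t%:R * `|Im Z| <= pi ->
    nrm (eta_quot t m (eu (h%:R / t%:R) * cexp (- Z)) -
      (if coprime h t && (`|Im Z| <= B * Re Z) then main_term t m h Z else 0))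
    <= K * expR ((rate R t m - d) / Re Z)) -> 0 < Y <= Y0 ->
  let N := (t * (2 * M))%N in
  let q k := eu (k%:R / N%:R - ((2 * M)%:R - 1) / (2 * N%:R)) * (expR (- Y))%:c in
  is_true (nrm (N%:R^-1 * \sum_(0 <= k < N) eta_quot t m (q k) / q k ^+ n -
    (lead R t m)%:c * cusp_sum R t m n * saddle_sum t M B Y (n%:R - shift R t m) (rate R t m))
  <= K * expR ((rate R t m - d) / Y + n%:R * Y)).
Proof.
move=> t1 M0 H /andP[Yp YY0] N q; have t0 : (0 < t)%N := ltnW t1.
have tp : 0 < t%:R :> R by rewrite ltr0n.
have Mp : 0 < M%:R :> R by rewrite ltr0n.
have N0 : (0 < N)%N by rewrite !muln_gt0 t0.
have Np : 0 < N%:R :> R by rewrite ltr0n.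
pose Q h j : C := eu (h%:R / t%:R) * cexp (- point t M Y j).
have qE h j : q (h * (2 * M) + j)%N = Q h j.
  rewrite /q /Q -cexp_real rmorphN.
  have -> : cexp (- point t M Y j) = eu (- angle R t M j / (2 * pi)) * cexp (- Y%:c).
    rewrite eu_cexp -cexpD; congr cexp; rewrite /point; move: (angle R t M j) => x.
    have := @pi_gt0 R; move: (pi : R) => p pp; have p0 : p != 0 by rewrite gt_eqF.
    apply: eqC; rewrite ?ReD ?ImD ?ReM ?ImM /=; first by ring.
    by rewrite mul0r add0r subr0 mulrC divfK// mulf_neq0// pnatr_eq0.
  rewrite mulrA -euD; congr (eu _ * _); rewrite /angle /N !(natrM, natrD).
  have := @pi_gt0 R; move: tp Mp; move: (pi : R) (t%:R : R) (M%:R : R) (h%:R : R) (j%:R : R) => x y z v w y0 z0 x0.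
  by field; rewrite !gt_eqF.
have nQ h j : nrm (Q h j) = expR (- Y) by rewrite /Q nrmM nrm_eu mul1r nrm_cexp ReN.
pose G h j : C := if coprime h t && (`|angle R t M j| <= B * Y) then main_term t m h (point t M Y j) else 0.
have sumE (f : C -> C) : \sum_(0 <= k < N) f (q k) = \sum_(0 <= j < 2 * M) \sum_(0 <= h < t) f (Q h j).
  by rewrite /N big_nat_mul; apply: eq_bigr => j _; apply: eq_bigr => h _; rewrite qE.
rewrite (sumE (fun z => eta_quot t m z / z ^+ n)).
pose x h : C := if coprime h t then Gam R t h ^+ m * eu (- ((n * h)%:R / t%:R)) else 0.
pose y j : C := if `|angle R t M j| <= B * Y then saddle_exp (n%:R - shift R t m) (rate R t m) (point t M Y j) else 0.
have GE h j : G h j / Q h j ^+ n = (lead R t m)%:c * x h * y j.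
  rewrite /G /x /y; case: (coprime h t) => /=; last by rewrite mul0r mulr0 mul0r.
  case: ifP => _ /=; last by rewrite mul0r mulr0.
  rewrite /main_term /saddle_exp /Q; set Z := point _ _ _ _.
  rewrite exprMn euX cexpXR invfM -euN -cexpN.
  have -> : n%:R * (h%:R / t%:R) = (n * h)%:R / t%:R :> R by rewrite natrM mulrA.
  have -> : cexp ((n%:R - shift R t m)%:c * Z) = cexp (- ((shift R t m)%:c * Z)) * cexp (- (n%:R * - Z)).
    by rewrite -cexpD; congr cexp; rewrite rmorphB rmorph_nat; ring.
  by move: (cexp _) (cexp _) (cexp _) (eu _) (_ ^+ m) (_%:c) => *; ring.
have mainE : (lead R t m)%:c * cusp_sum R t m n * saddle_sum t M B Y (n%:R - shift R t m) (rate R t m) =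
   N%:R^-1 * \sum_(0 <= j < 2 * M) \sum_(0 <= h < t) G h j / Q h j ^+ n.
  rewrite (eq_bigr (fun j => (lead R t m)%:c * cusp_sum R t m n * y j)) => [|j _]; last first.
    by rewrite (eq_bigr _ (fun h _ => GE h j)) -mulr_suml -mulr_sumr.
  rewrite -mulr_sumr /saddle_sum.
  have -> : (2 * t * M)%N = N by rewrite /N; ring.
  by rewrite mulrCA.
rewrite mainE -mulrBr nrmM nrmV nrm_nat -sumrB mulrC ler_pdivrMr//.
rewrite (le_trans (nrm_sum _ _ _))//.
have term j : (0 <= j < 2 * M)%N -> nrm (\sum_(0 <= h < t) eta_quot t m (Q h j) / Q h j ^+ n - \sum_(0 <= h < t) G h j / Q h j ^+ n)
   <= t%:R * (K * expR ((rate R t m - d) / Y + n%:R * Y)).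
  move=> /andP[_ jM]; rewrite -sumrB (le_trans (nrm_sum _ _ _))//.
  rewrite mulr_natl -[X in _ *+ X]subn0 -sumr_const_nat; apply: ler_sum_nat => h /andP[_ ht].
  rewrite -mulrBl nrmM nrmV nrmX nQ -expRM_natl -expRN mulrN opprK expRD mulrA.
  apply: ler_wpM2r; first exact: expR_ge0.
  have := H h ht (point t M Y j); rewrite /= Yp YY0 => /(_ isT); apply.
  exact: angle_le.
rewrite (le_trans (ler_sum_nat term))// sumr_const_nat subn0 -[_ *+ (2 * M)]mulr_natl.
apply: eq_leq_R; rewrite /N !natrM; move: (expR _) => w; ring.
Qed.

Lemma root16 (x : R) : 0 <= x -> exists2 V, 0 <= V & V ^+ 16 = x.
Proof.
move=> x0; exists (Num.sqrt (Num.sqrt (Num.sqrt (Num.sqrt x)))); first exact: sqrtr_ge0.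
by rewrite -[16%N]/(2 * 2 * 2 * 2)%N !exprM !sqr_sqrtr ?sqrtr_ge0.
Qed.

(** Every cusp h/t, with h prime to t, contributes the same saddle integral,
    positive up to a smaller error, times its term in the cusp sum. *)
Theorem sign_main (t m : nat) (c : nat -> int) (r : nat) : (1 < t)%N -> (0 < m)%N ->
  power_series (fun l => (c l)%:~R : C) (eta_quot t m) ->
  Re (cusp_sum R t m r) != 0 ->
  exists n0, forall n, (n0 <= n)%N -> n = r %[mod t] -> Num.sg ((c n)%:~R : R) = Num.sg (Re (cusp_sum R t m r)).
Proof.
move=> t1 m0 hc A0; have t0 : (0 < t)%N := ltnW t1.
have tp : 0 < t%:R :> R by rewrite ltr0n.
have t1' : 1 <= t%:R :> R by rewrite ler1n.
have p0 := @pi_gt0 R.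
have [B [d [K [Y0 [B1 /andP[d0 da] K0 Y00 H]]]]] := arcs R t1 m0.
set D := `|Re (cusp_sum R t m r)|; have D0 : 0 < D by rewrite normr_gt0.
set a := rate R t m in da H *; have a0 : 0 < a by exact: lt_le_trans d0 da.
set v := shift R t m.
have v0 : 0 <= v by rewrite /v /shift mulr_ge0// divr_ge0// subr_ge0.
set L := lead R t m; have L0 : 0 < L.
  by rewrite /L /lead exprn_gt0// divr_gt0 ?Gam1_pos// divr_gt0// sqrtr_gt0.
pose c1 : R := a * expR (-1) / (8 * pi).
have c10 : 0 < c1 by rewrite /c1; pos.
have [V1 V11 hV1] := exp_small (ltac:(lra) : 0 < 1 / 2 :> R) (ltac:(pos) : 0 < c1 / 2).
have da0 : 0 < d / a by pos.
pose e2 : R := L * D * c1 / 8 / (K * expR v).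
have e20 : 0 < e2 by rewrite /e2; pos.
have [V2 V21 hV2] := exp_small da0 e20.
pose Y1 : R := Num.min (Num.min Y0 (t%:R)^-1) 1.
have Y10 : 0 < Y1 by rewrite !lt_min Y00 ltr01 invr_gt0 tp.
pose Vm : R := Num.max (Num.max V1 V2) (a / Y1).
have Vm1 : 1 <= Vm by rewrite !le_max V11.
exists (Num.truncn (v + Vm ^+ 16 / a)).+1 => n hn nr.
have nv : Vm ^+ 16 <= a * (n%:R - v).
  rewrite mulrC -ler_pdivrMr// lerBrDl.
  apply: le_trans (ltW (truncnS_gt _)) _; by rewrite ler_nat.
have Vm0 : 0 <= Vm by lra.
have [V V0 VE] : exists2 V, 0 <= V & V ^+ 16 = a * (n%:R - v).
  by apply: root16; apply: le_trans nv; rewrite exprn_ge0.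
have VV : Vm <= V by rewrite -(ler_pXn2r (n := 16)) ?nnegrE// VE.
have V1' : 1 <= V by exact: le_trans VV.
have Vp : 0 < V by lra.
have V8 : 0 < V ^+ 8 by rewrite exprn_gt0.
pose Y := a / V ^+ 8; have Yp : 0 < Y by rewrite /Y; pos.
have YV : V ^+ 8 = a / Y by rewrite /Y invf_div mulrC divfK// gt_eqF.
have aV : a / Y1 <= V by apply: le_trans VV; rewrite /Vm le_max lexx orbT.
have YY1 : Y <= Y1.
  have : a / Y1 <= V ^+ 8 by rewrite (le_trans aV)// -[leLHS]expr1 ler_weXn2l.
  by rewrite /Y ler_pdivrMr// mulrC -ler_pdivrMr.
have [YY0 tY Y11] : [/\ Y <= Y0, t%:R * Y <= 1 & Y <= 1].
  move: YY1; rewrite !le_min => /andP[/andP[q1 q2] q3]; split => //.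
  by rewrite mulrC -ler_pdivlMr// mul1r.
have pY : (n%:R - v) * Y = V ^+ 8.
  have -> : n%:R - v = V ^+ 16 / a by rewrite VE [a * _]mulrC mulfK// gt_eqF.
  rewrite /Y (_ : V ^+ 16 = V ^+ 8 * V ^+ 8) -?exprD//.
  by field; rewrite !gt_eqF.
have [M0 hM0] := saddle_sum_lower t0 a0 B1 V1' Yp tY pY (esym YV).
set E := expR (2 * V ^+ 8) in hM0; have E0 : 0 < E := expR_gt0 _.
have V12 : 0 < V ^+ 12 by rewrite exprn_gt0.
pose e := E * (L * D * c1 / 8 / V ^+ 12).
have e0 : 0 < e by rewrite /e; pos.
have [N0 hN0] := coef_extract hc n Yp e0.
pose M := (maxn M0 N0).+1.
have M00 : (M0 <= M)%N by rewrite leqW// leq_maxl.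
have N00 : (N0 <= t * (2 * M))%N.
  apply: (@leq_trans M); first by rewrite leqW// leq_maxr.
  by rewrite mulnA leq_pmull// muln_gt0 t0.
have J1 := hM0 M M00 isT.
have C1 := hN0 _ N00 (((2 * M)%:R - 1) / (2 * (t * (2 * M))%:R)).
have Yb : 0 < Y <= Y0 by rewrite Yp.
have C2 := @circle_main t m n M B d K Y0 Y t1 isT H Yb.
rewrite /= in C1 C2.
set S := \sum_(0 <= k < t * (2 * M)) _ in C1 C2.
set J := saddle_sum _ _ _ _ _ _ in J1 C2.
have JE : J = (Re J)%:c by apply: eqC; rewrite //= /J saddle_sum_real.
have J2 : E * (c1 / 2 / V ^+ 12) <= Re J.
  apply: le_trans J1; rewrite ler_pM2l//.
  have := hV1 V (le_trans _ VV); rewrite !le_max lexx => /(_ isT).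
  have : expR (- (V ^+ 2 / 2)) <= expR (- (1 / 2 * V)).
    by rewrite ler_expR lerN2; have : V <= V ^+ 2; [rewrite expr2 ler_peMr|lra].
  rewrite -/c1; move: (V ^+ 12) => w; have -> : c1 / 2 / w = c1 / w / 2 by rewrite mulrAC.
  lra.
have X2 : K * expR ((a - d) / Y + n%:R * Y) <= e.
  have -> : (a - d) / Y + n%:R * Y = 2 * V ^+ 8 - d / a * V ^+ 8 + v * Y.
    have -> : n%:R * Y = V ^+ 8 + v * Y by rewrite -pY; ring.
    have -> : (a - d) / Y = V ^+ 8 - d / a * V ^+ 8 by rewrite YV; field; rewrite !gt_eqF.
    by ring.
  have x1 : expR (2 * V ^+ 8 - d / a * V ^+ 8 + v * Y) <= E * expR (- (d / a * V)) * expR v.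
    rewrite /E -!expRD ler_expR.
    have : d / a * V <= d / a * V ^+ 8 by rewrite ler_pM2l// -[leLHS]expr1 ler_weXn2l.
    have : v * Y <= v * 1 by rewrite ler_wpM2l.
    lra.
  have x2 : expR (- (d / a * V)) <= e2 / V ^+ 12.
    by apply: hV2; apply: le_trans VV; rewrite !le_max lexx orbT.
  have x3 : E * expR (- (d / a * V)) * expR v <= E * (e2 / V ^+ 12) * expR v.
    by rewrite ler_pM2r ?expR_gt0// ler_pM2l.
  have x4 : K * (E * (e2 / V ^+ 12) * expR v) = e.
    rewrite /e /e2; have ev := expR_gt0 v; move: (expR v) ev => w w0.
    by field; rewrite !gt_eqF.
  by rewrite -x4 ler_pM2l// (le_trans x1).
have tot : nrm ((c n)%:~R - L%:c * cusp_sum R t m n * J) <= e + e.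
  have -> : (c n)%:~R - L%:c * cusp_sum R t m n * J =
     ((c n)%:~R - (t * (2 * M))%:R^-1 * S) + ((t * (2 * M))%:R^-1 * S - L%:c * cusp_sum R t m n * J) by ring.
  by rewrite (le_trans (nrmD _ _))// lerD// (le_trans C2).
rewrite (cusp_sum_mod _ t0 nr) in tot.
have Jp : 0 < Re J by apply: lt_le_trans J2; apply: mulr_gt0 => //; apply: divr_gt0 => //; exact: divr_gt0.
have sgE : Num.sg (L * Re J * Re (cusp_sum R t m r)) = Num.sg (Re (cusp_sum R t m r)).
  by rewrite !sgrM (gtr0_sg L0) (gtr0_sg Jp) !mul1r.
rewrite -sgE; apply: sg_near.
have nE : `|L * Re J * Re (cusp_sum R t m r)| = L * Re J * D.
  by rewrite !normrM (gtr0_norm L0) (gtr0_norm Jp).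
rewrite nE.
apply: le_lt_trans (_ : e + e < _).
  apply: le_trans tot; apply: le_trans (Re_le_nrm _).
  have ReE : Re (L%:c * cusp_sum R t m r * J) = L * Re J * Re (cusp_sum R t m r).
    by rewrite {1}JE mulrAC -rmorphM Re_realM.
  have nE' : Re ((c n)%:~R : C) = (c n)%:~R by rewrite -(rmorph_int (real_complex R)).
  by rewrite ReD ReN ReE nE'.
apply: lt_le_trans (_ : L * (E * (c1 / 2 / V ^+ 12)) * D <= _); last first.
  by rewrite ler_pM2r// ler_pM2l.
have -> : L * (E * (c1 / 2 / V ^+ 12)) * D = e + e + (e + e) by rewrite /e; field; rewrite gt_eqF.
by rewrite ltrDl addr_gt0.
Qed.

End Asymptotics.

End SignAsymptotics.
Import SignAsymptotics.

(** * Power series and their sections *)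

Module CoefficientSections.

Local Opaque cexp eu.

Section PowerSeries.
Variable R : realType.
Local Notation C := (R[i]%C).
Implicit Types (a b : nat -> C) (F G H : C -> C) (q z : C).

Lemma nrm_lt1_neq0 q : 0 < nrm q < 1 -> q != 0. Proof. by rewrite nrm_gt0 => /andP[]. Qed.

Lemma psB a b F G : power_series a F -> power_series b G -> power_series (fun n => a n - b n) (fun q => F q - G q).
Proof.
move=> ha hb q hq; apply: tends_ext (tendsB (ha q hq) (hb q hq)) => N.
by rewrite -sumrB; apply: eq_bigr => l _; rewrite mulrBl.
Qed.

(** Coefficients are averages over circles, hence determined by the values. *)
Lemma ps_coef0 a F : power_series a F -> (forall q, 0 < nrm q < 1 -> F q = 0) -> forall n, a n = 0.
Proof.
move=> ha F0 n; apply/eqP; rewrite -nrm_eq0 eq_le nrm_ge0 andbT.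
apply/ler_addgt0Pr => e e0; rewrite add0r.
have [N0 h] := coef_extract ha n (ltr01 : 0 < 1 :> R) e0.
have := h N0 (leqnn _) 0; rewrite /= big1 ?mulr0 ?subr0// => k _.
rewrite F0 ?mul0r// nrmM nrm_eu mul1r nrm_real gtr0_norm ?expR_gt0//=.
by rewrite -[ltRHS]expR0 ltr_expR oppr_lt0.
Qed.

Lemma ps_unique a b F G : power_series a F -> power_series b G ->
  (forall q, 0 < nrm q < 1 -> F q = G q) -> forall n, a n = b n.
Proof.
move=> ha hb e n; apply/eqP; rewrite -subr_eq0; apply/eqP.
by apply: (ps_coef0 (psB ha hb)) => q hq; rewrite e// subrr.
Qed.

(** Part of F on the exponents congruent to r modulo t. *)
Definition proj (t r : nat) F q : C :=
  t%:R^-1 * \sum_(0 <= h < t) eu (- ((r * h)%:R / t%:R)) * F (eu (h%:R / t%:R) * q).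

Lemma rot_disc (t h : nat) q : 0 < nrm q < 1 -> 0 < nrm (eu (h%:R / t%:R) * q) < 1.
Proof. by rewrite nrmM nrm_eu mul1r. Qed.

Lemma rotX (t h : nat) q : (0 < t)%N -> (eu (h%:R / t%:R) * q) ^+ t = q ^+ t.
Proof.
move=> t0; rewrite exprMn euX [_%:R * _]mulrC divfK ?eu_nat ?mul1r//.
by rewrite pnatr_eq0 -lt0n.
Qed.

Lemma proj_ext t r F G q : 0 < nrm q < 1 -> (forall z, 0 < nrm z < 1 -> F z = G z) -> proj t r F q = proj t r G q.
Proof. by move=> hq h; congr (_ * _); apply: eq_bigr => k _; rewrite h// rot_disc. Qed.

Lemma projM t r F G q : (0 < t)%N -> proj t r (fun z => F z * G (z ^+ t)) q = proj t r F q * G (q ^+ t).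
Proof.
move=> t0; rewrite /proj -mulrA mulr_suml; congr (_ * _); apply: eq_bigr => h _.
by rewrite rotX// mulrA.
Qed.

Lemma projZ t r F k q : proj t r (fun z => k * F z) q = k * proj t r F q.
Proof.
by rewrite /proj [RHS]mulrCA; congr (_ * _); rewrite mulr_sumr; apply: eq_bigr => h _; rewrite mulrCA.
Qed.

Lemma projD t r F G q : proj t r (fun z => F z + G z) q = proj t r F q + proj t r G q.
Proof.
by rewrite /proj -mulrDr -big_split; congr (_ * _); apply: eq_bigr => h _; exact: mulrDr.
Qed.

Lemma proj_sum t r (s : seq nat) (F : nat -> C -> C) q :
  proj t r (fun z => \sum_(k <- s) F k z) q = \sum_(k <- s) proj t r (F k) q.
Proof.
elim: s => [|k s IH].
  by rewrite big_nil /proj big1 ?mulr0// => h _; rewrite big_nil mulr0.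
by rewrite big_cons -IH -projD; congr (proj _ _ _ _); apply/funext => z; rewrite big_cons.
Qed.

Lemma projX t r e q : (0 < t)%N ->
  proj t r (fun z => z ^+ e) q = if (e == r %[mod t])%N then q ^+ e else 0.
Proof.
move=> t0; have tn : t%:R != 0 :> C by rewrite pnatr_eq0 -lt0n.
rewrite /proj (eq_bigr (fun h => q ^+ e * eu (h%:R * ((e%:Z - r%:Z)%:~R / t%:R)))) => [|h _]; last first.
  rewrite /= exprMn euX [LHS]mulrA -[in LHS]euD [LHS]mulrC; congr (_ * eu _).
  by rewrite intrB -!pmulrn natrM; ring.
rewrite -mulr_sumr (eu_orth _ _ t0) mulrCA.
have -> : (t %| absz (e%:Z - r%:Z))%N = (e == r %[mod t])%N.
  by have := eqz_mod_dvd t e r; rewrite !modz_nat eqz_nat => ->.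
by case: ifP => _; [rewrite mulVf// mulr1|rewrite mulr0 mulr0].
Qed.

Lemma proj_tends t r (S : nat -> C -> C) F q : 0 < nrm q < 1 ->
  (forall z, 0 < nrm z < 1 -> tends (S ^~ z) (F z)) -> tends (fun n => proj t r (S n) q) (proj t r F q).
Proof.
move=> hq hS; apply: tendsZ; apply: tends_sum => h _; apply: tendsZ; apply: hS; exact: rot_disc.
Qed.

Lemma ps_proj t r a F : (0 < t)%N -> power_series a F ->
  power_series (fun n => if (n == r %[mod t])%N then a n else 0) (proj t r F).
Proof.
move=> t0 ha q hq.
have := proj_tends t r hq ha; apply: tends_ext => N.
rewrite proj_sum; apply: eq_bigr => l _; rewrite projZ projX//.
by case: ifP => _; rewrite ?mulr0 ?mul0r.
Qed.

Lemma root_exists (k : nat) z : (0 < k)%N -> 0 < nrm z < 1 -> exists2 q, 0 < nrm q < 1 & q ^+ k = z.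
Proof.
move=> k0 /andP[z0 z1].
have [q qE] : exists q, q ^+ k = z by exists (k.-root z); rewrite rootCK.
have nq : nrm q ^+ k = nrm z by rewrite -nrmX qE.
exists q => //; apply/andP; split.
  by rewrite nrm_gt0; apply: contraTneq z0 => q0; rewrite -qE q0 expr0n gtn_eqF// nrm0 ltxx.
by move: z1; rewrite -nq expr_lt1// nrm_ge0.
Qed.

(** The subsequence n |-> a (k n + r), read off from the part of class r. *)
Lemma ps_section k r a F H : (r < k)%N -> power_series a F ->
  (forall q, 0 < nrm q < 1 -> proj k r F q = q ^+ r * H (q ^+ k)) -> power_series (fun n => a (k * n + r)%N) H.
Proof.
move=> rk ha h z hz; have k0 : (0 < k)%N by exact: leq_ltn_trans rk.
have [q hq qE] := root_exists k0 hz.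
have q0 := nrm_lt1_neq0 hq.
have qr0 : q ^+ r != 0 by rewrite expf_neq0.
have hp := ps_proj r k0 ha hq; rewrite h// qE in hp.
have sh n : (n <= n * k)%N by rewrite leq_pmulr.
have := tendsZ (q ^+ r)^-1 (tends_comp (f := fun n => (n * k)%N) sh hp).
rewrite mulKf//; apply: tends_ext => N.
rewrite mulr_sumr big_nat_mul (bigD1_seq r) ?iota_uniq ?mem_index_iota//= [X in _ + X]big1_seq ?addr0.
  apply: eq_bigr => l _.
  have -> : (l * k + r == r %[mod k])%N by rewrite modnMDl.
  by rewrite mulnC mulrCA -qE -exprM exprD [q ^+ (k * l) * _]mulrC mulKf.
move=> s /andP[sr]; rewrite mem_index_iota => /andP[_ sk]; apply: big1 => l _.
have -> : (l * k + s == r %[mod k])%N = false by rewrite modnMDl !modn_small// (negPf sr).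
by rewrite mul0r mulr0.
Qed.

End PowerSeries.

Section Expansions.
Variable R : realType.
Local Notation C := (R[i]%C).
Implicit Types (q z : C).

(** Generalized pentagonal numbers, of non-negative and of negative index. *)
Definition pent0 (k : nat) : nat := (3 * 'C(k, 2) + 2 * k)%N.
Definition pent1 (k : nat) : nat := (3 * 'C(k, 2) + 4 * k + 1)%N.

Lemma bin2_double k : ('C(k, 2) * 2 = k * k.-1)%N.
Proof. by rewrite bin2 muln2 even_halfK//; case: k => //= k; rewrite oddM /= andNb. Qed.

Lemma pent0_double k : (pent0 k * 2 = k * (3 * k + 1))%N.
Proof. by have := bin2_double k; rewrite /pent0; case: k => [|k] /=; lia. Qed.

Lemma pent1_double k : (pent1 k * 2 = (k + 1) * (3 * k + 2))%N.
Proof. by have := bin2_double k; rewrite /pent1; case: k => [|k] /=; lia. Qed.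

Lemma eul_pent q : 0 < nrm q < 1 ->
  tends (fun n => \sum_(0 <= k < n) (-1) ^+ k * (q ^+ pent0 k - q ^+ pent1 k)) (eul q).
Proof.
move=> hq; have [_ q1] := andP hq; have q0 := nrm_lt1_neq0 hq.
have q31 : nrm (q ^+ 3) < 1 by exact: nrmX_lt1.
have q30 : q ^+ 3 != 0 by rewrite expf_neq0.
have z0 : - q^-1 != 0 by rewrite oppr_eq0 invr_neq0.
rewrite -(euler_pentagonal q1 q0) /theta.
have [b zd] := theta_zdom q31 z0.
have := zsP (zdom_summable zd); apply: tends_ext => n; apply: eq_bigr => k _.
have b2 := bin2_double k; have b3 := bin2_double k.+1.
have -> : (q ^+ 3) ^+ tri k%:Z * (- q^-1) ^ k%:Z = (-1) ^+ k * q ^+ pent0 k.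
  rewrite -exprnP (exprNn q^-1) -exprM mulrCA; congr (_ * _).
  have -> : (3 * tri k%:Z = pent0 k + k)%N by rewrite /pent0 /=; case: k b2 b3 => [|k] /=; lia.
  by rewrite exprD exprVn mulfK// expf_neq0.
have -> : (q ^+ 3) ^+ tri (- k.+1%:Z) * (- q^-1) ^ (- k.+1%:Z) = (-1) ^+ k.+1 * q ^+ pent1 k.
  rewrite -exprnN -exprVn invrN invrK (exprNn q) -exprM mulrCA -exprD; congr (_ * q ^+ _).
  by rewrite /pent1 /=; case: k b2 b3 => [|k] /=; lia.
by rewrite exprS mulN1r mulNr -mulrBr.
Qed.

Lemma pent_period t k : (0 < t)%N -> (pent0 (k + 2 * t) = pent0 k %[mod t])%N /\ (pent1 (k + 2 * t) = pent1 k %[mod t])%N.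
Proof.
move=> t0.
have e : ('C(k + 2 * t, 2) = 'C(k, 2) + (2 * k + 2 * t - 1) * t)%N.
  have := bin2_double k; have := bin2_double (k + 2 * t).
  by case: k => [|k] /=; [case: t t0 => // t _ /=|]; nia.
rewrite /pent0 /pent1 e; split.
  have -> : (3 * ('C(k, 2) + (2 * k + 2 * t - 1) * t) + 2 * (k + 2 * t) = (3 * (2 * k + 2 * t - 1) + 4) * t + (3 * 'C(k, 2) + 2 * k))%N by ring.
  by rewrite modnMDl.
have -> : (3 * ('C(k, 2) + (2 * k + 2 * t - 1) * t) + 4 * (k + 2 * t) + 1 = (3 * (2 * k + 2 * t - 1) + 8) * t + (3 * 'C(k, 2) + 4 * k + 1))%N by ring.
by rewrite modnMDl.
Qed.

Lemma tri_period t k : (0 < t)%N -> ('C((k + 2 * t).+1, 2) = 'C(k.+1, 2) %[mod t])%N.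
Proof.
move=> t0.
have -> : ('C((k + 2 * t).+1, 2) = (2 * k + 2 * t + 1) * t + 'C(k.+1, 2))%N.
  have := bin2_double k.+1; have := bin2_double (k + 2 * t).+1; rewrite /=; nia.
by rewrite modnMDl.
Qed.

Lemma periodic_avoid (f : nat -> nat) (t p r : nat) : (0 < p)%N -> (forall k, f (k + p)%N = f k %[mod t]) ->
  all (fun k => (f k != r %[mod t])%N) (iota 0 p) -> forall k, (f k != r %[mod t])%N.
Proof.
move=> p0 hp h k; elim/ltn_ind: k => k IH; have [kp|kp] := ltnP k p.
  by apply: (allP h); rewrite mem_iota.
by rewrite -(subnK kp) hp IH// ltn_subrL p0 (leq_trans p0 kp).
Qed.

Lemma proj_eul0 t r q : (0 < t)%N -> 0 < nrm q < 1 ->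
  all (fun k => (pent0 k != r %[mod t])%N && (pent1 k != r %[mod t])%N) (iota 0 (2 * t)) -> proj t r (@eul R) q = 0.
Proof.
move=> t0 hq; have p0 : (0 < 2 * t)%N by rewrite muln_gt0.
move=> h; have h0 : all (fun k => (pent0 k != r %[mod t])%N) (iota 0 (2 * t)) by apply: sub_all h => k /andP[].
have h1 : all (fun k => (pent1 k != r %[mod t])%N) (iota 0 (2 * t)) by apply: sub_all h => k /andP[].
apply: (tends_unique (proj_tends t r hq (@eul_pent))).
apply: tends_ext (tends_cst 0) => n; rewrite proj_sum big1// => k _.
rewrite projZ (_ : (fun z : C => z ^+ pent0 k - z ^+ pent1 k) = (fun z => z ^+ pent0 k + -1 * z ^+ pent1 k)); last by apply/funext => z; rewrite mulN1r.
rewrite projD projZ !projX//.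
rewrite (negPf (periodic_avoid p0 (fun j => (pent_period j t0).1) h0 k)).
by rewrite (negPf (periodic_avoid p0 (fun j => (pent_period j t0).2) h1 k)) mulr0 addr0 mulr0.
Qed.

Lemma eul_cube q : 0 < nrm q < 1 ->
  tends (fun n => \sum_(0 <= k < n) ((-1) ^+ k * (k + k).+1%:R) * q ^+ 'C(k.+1, 2)) (eul q ^+ 3).
Proof.
move=> hq; have [_ q1] := andP hq; have q0 := nrm_lt1_neq0 hq.
by apply: tends_ext (jacobi_cube q1 q0) => n; apply: eq_bigr => k _; rewrite mulrC.
Qed.

Lemma proj_cube0 t r q : (0 < t)%N -> 0 < nrm q < 1 ->
  all (fun k => ('C(k.+1, 2) != r %[mod t])%N) (iota 0 (2 * t)) -> proj t r (fun z => eul z ^+ 3) q = 0 :> C.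
Proof.
move=> t0 hq h; have p0 : (0 < 2 * t)%N by rewrite muln_gt0.
apply: (tends_unique (proj_tends t r hq (@eul_cube))).
apply: tends_ext (tends_cst 0) => n; rewrite proj_sum big1// => k _.
by rewrite projZ projX// (negPf (periodic_avoid p0 (fun j => tri_period j t0) h k)) mulr0.
Qed.

(** The pentagonal numbers congruent to 1 modulo 25 are those of index 5 l. *)
Lemma proj_eul_25 q : 0 < nrm q < 1 -> proj 25 1 (@eul R) q = - q * eul (q ^+ 25).
Proof.
move=> hq; have [qq q1] := andP hq.
have hq25 : 0 < nrm (q ^+ 25) < 1 by rewrite nrm_gt0 expf_neq0 ?nrmX_lt1// nrm_lt1_neq0.
have sh n : (n <= n * 5)%N by rewrite leq_pmulr.
apply: (tends_unique (tends_comp (f := fun n => (n * 5)%N) sh (proj_tends 25 1 hq (@eul_pent)))).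
apply: tends_ext (tendsZ (- q) (eul_pent hq25)) => n.
rewrite proj_sum mulr_sumr big_nat_mul exchange_big /=; apply: eq_bigr => l _.
have pr k : proj 25 1 (fun z : C => (-1) ^+ k * (z ^+ pent0 k - z ^+ pent1 k)) q =
   (-1) ^+ k * ((if (pent0 k == 1 %[mod 25])%N then q ^+ pent0 k else 0) - (if (pent1 k == 1 %[mod 25])%N then q ^+ pent1 k else 0)).
  rewrite projZ (_ : (fun z : C => z ^+ pent0 k - z ^+ pent1 k) = (fun z => z ^+ pent0 k + -1 * z ^+ pent1 k)); last by apply/funext => z; rewrite mulN1r.
  by rewrite projD projZ !projX// mulN1r.
have f0 := pent0_double l; have f1 := pent1_double l.
have a0 s : (s < 4)%N -> (pent0 (l * 5 + s) == 1 %[mod 25])%N = false.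
  by have := pent0_double (l * 5 + s); case: s => [|[|[|[|//]]]]; lia.
have a1 s : (0 < s < 5)%N -> (pent1 (l * 5 + s) == 1 %[mod 25])%N = false.
  by have := pent1_double (l * 5 + s); case: s => [|[|[|[|[|//]]]]]; lia.
have g0 : pent1 (l * 5 + 0) = (25 * pent0 l + 1)%N by have := pent1_double (l * 5 + 0); lia.
have g1 : pent0 (l * 5 + 4) = (25 * pent1 l + 1)%N by have := pent0_double (l * 5 + 4); lia.
have m1 (e : nat) : (25 * e + 1 == 1 %[mod 25])%N by lia.
rewrite unlock /= addr0 !pr (a0 0%N)// (a0 1%N)// (a0 2%N)// (a0 3%N)// (a1 1%N)// (a1 2%N)// (a1 3%N)// (a1 4%N)// g0 g1 !m1 !subrr !mulr0 !add0r subr0.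
have sg s : (-1) ^+ (l * 5 + s) = (-1) ^+ l * (-1) ^+ s :> C.
  by rewrite exprD mulnC exprM -[X in X ^+ l * _]signr_odd expr1.
rewrite !sg expr0 -[(-1) ^+ 4]signr_odd expr0 !mulr1 (exprD q (25 * pent0 l) 1) (exprD q (25 * pent1 l) 1) expr1 (exprM q 25 (pent0 l)) (exprM q 25 (pent1 l)).
by move: ((-1) ^+ l : C) ((q ^+ 25) ^+ pent0 l) ((q ^+ 25) ^+ pent1 l) => x y z; ring.
Qed.

(** The triangular numbers congruent to 1 modulo 9 are those of index 3 l + 1. *)
Lemma proj_cube_9 q : 0 < nrm q < 1 -> proj 9 1 (fun z => eul z ^+ 3) q = - 3%:R * q * eul (q ^+ 9) ^+ 3 :> C.
Proof.
move=> hq; have [qq q1] := andP hq.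
have hq9 : 0 < nrm (q ^+ 9) < 1 by rewrite nrm_gt0 expf_neq0 ?nrmX_lt1// nrm_lt1_neq0.
have sh n : (n <= n * 3)%N by rewrite leq_pmulr.
apply: (tends_unique (tends_comp (f := fun n => (n * 3)%N) sh (proj_tends 9 1 hq (@eul_cube)))).
apply: tends_ext (tendsZ (- 3%:R * q) (eul_cube hq9)) => n.
rewrite proj_sum mulr_sumr big_nat_mul exchange_big /=; apply: eq_bigr => l _.
have b k := bin2_double k.+1.
have f := b l.
have a s : (s != 1)%N -> (s < 3)%N -> ('C((l * 3 + s).+1, 2) == 1 %[mod 9])%N = false.
  by have := b (l * 3 + s)%N; case: s => [|[|[|//]]] //=; lia.
have g : 'C((l * 3 + 1).+1, 2) = (9 * 'C(l.+1, 2) + 1)%N by have := b (l * 3 + 1)%N; rewrite /= in f *; lia.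
have m1 (e : nat) : (9 * e + 1 == 1 %[mod 9])%N by lia.
rewrite unlock /= addr0 !projZ !projX// (a 0%N)// (a 2%N)// g m1 !mulr0 add0r addr0.
have -> : (-1) ^+ (l * 3 + 1) = - (-1) ^+ l :> C.
  by rewrite exprD mulnC exprM -[X in X ^+ l * _]signr_odd !expr1 mulrN1.
have -> : (l * 3 + 1 + (l * 3 + 1)).+1%:R = 3%:R * (l + l).+1%:R :> C.
  by rewrite -natrM; congr _%:R; lia.
rewrite (exprD q (9 * 'C(l.+1, 2)) 1) expr1 (exprM q 9).
by move: ((-1) ^+ l : C) ((q ^+ 9) ^+ _) ((l + l).+1%:R : C) => x y z; ring.
Qed.
End Expansions.

End CoefficientSections.
Import CoefficientSections.

(** * The quotients with (t, m) = (3, 9) and (5, 5) *)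

Module SectionIdentities.

From mathcomp Require Import all_field.
Local Opaque cexp eu.

Section Rotations.
Variable R : realType.
Local Notation C := (R[i]%C).
Implicit Types (q z x : C).

Lemma prod_unity (n : nat) (w x : C) : n.-primitive_root w -> \prod_(0 <= i < n) (1 - w ^+ i * x) = 1 - x ^+ n.
Proof.
move=> pw; have n0 := prim_order_gt0 pw.
have [->|x0] := eqVneq x 0.
  by rewrite expr0n gtn_eqF// subr0 big1// => i _; rewrite mulr0 subr0.
have := congr1 (fun P : {poly C} => P.[x^-1]) (factor_Xn_sub_1 pw).
rewrite /= horner_prod !hornerE => h.
have -> : 1 - x ^+ n = x ^+ n * (x^-1 ^+ n - 1) by rewrite mulrBr exprVn mulfV ?expf_neq0// mulr1.
rewrite -h -[x ^+ n](_ : \prod_(0 <= i < n) x = _); last by rewrite prodr_const_nat subn0.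
rewrite -big_split; apply: eq_bigr => i _ /=.
by rewrite !hornerE mulrBr mulfV// mulrC.
Qed.

Lemma big_multiples (p M : nat) (F : nat -> C) : (0 < p)%N ->
  \prod_(0 <= k < M * p) (if (p %| k.+1)%N then F k.+1 else 1) = \prod_(0 <= l < M) F (l.+1 * p)%N.
Proof.
case: p => // p _; elim: M => [|M IH]; first by rewrite mul0n !big_nil.
rewrite [RHS]big_nat_recr//= -IH mulSn addnC (big_cat_nat (leq0n _) (leq_addr _ _))/=; congr (_ * _).
rewrite -{1}[(M * p.+1)%N]add0n big_addn addKn big_nat_recr//= [X in X * _]big1_seq ?mul1r.
  have -> : (p + M * p.+1).+1 = (M.+1 * p.+1)%N by rewrite mulSn; lia.
  by rewrite dvdn_mull ?dvdnn// mulSn addnC.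
move=> s; rewrite mem_index_iota => /andP[_ sp].
by rewrite -addSn dvdn_addl ?dvdn_mull ?dvdnn// gtnNdvd// ltnS.
Qed.

(** The product of the Euler function over the rotations of prime order. *)
Lemma prod_eul_rot (p : nat) q : prime p -> 0 < nrm q < 1 ->
  \prod_(0 <= h < p) eul (eu (h%:R / p%:R) * q) = eul (q ^+ p) ^+ p.+1 / eul (q ^+ (p * p)).
Proof.
move=> pp hq; have p0 := prime_gt0 pp; have [_ q1] := andP hq.
have qp1 : nrm (q ^+ p) < 1 by exact: nrmX_lt1.
have qpp1 : nrm (q ^+ (p * p)) < 1 by rewrite nrmX_lt1// muln_gt0 p0.
have pw : p.-primitive_root (eu (p%:R^-1) : C) by exact: eu_primitive.
have fac h k : (eu (h%:R / p%:R) * q) ^+ k = (eu (p%:R^-1) ^+ k) ^+ h * q ^+ k.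
  by rewrite exprMn !euX; congr (eu _ * _); ring.
have cf k : \prod_(0 <= h < p) (1 - (eu (h%:R / p%:R) * q) ^+ k.+1) =
   if (p %| k.+1)%N then (1 - q ^+ k.+1) ^+ p else 1 - q ^+ k.+1 ^+ p.
  under eq_bigr do rewrite fac.
  case: ifP => dv.
    have -> : eu (p%:R^-1) ^+ k.+1 = 1 :> C by apply/eqP; rewrite -(prim_order_dvd pw).
    by under eq_bigr do rewrite expr1n mul1r; rewrite prodr_const_nat subn0.
  by apply: prod_unity; rewrite prim_root_exp_coprime// coprime_sym prime_coprime// dv.
have fin M : (\prod_(0 <= h < p) eulp (eu (h%:R / p%:R) * q) (M * p)) * eulp (q ^+ (p * p)) M =
   eulp (q ^+ p) M ^+ p * eulp (q ^+ p) (M * p).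
  rewrite /eulp exchange_big /= (eq_bigr _ (fun k _ => cf k)).
  have e1 : \prod_(0 <= k < M) (1 - (q ^+ (p * p)) ^+ k.+1) =
     \prod_(0 <= k < M * p) (if (p %| k.+1)%N then 1 - q ^+ k.+1 ^+ p else 1).
    rewrite (big_multiples M (fun k => 1 - q ^+ k ^+ p) p0); apply: eq_bigr => l _.
    by rewrite -!exprM; congr (1 - q ^+ _); ring.
  have e2 : (\prod_(0 <= k < M) (1 - (q ^+ p) ^+ k.+1)) ^+ p =
     \prod_(0 <= k < M * p) (if (p %| k.+1)%N then (1 - q ^+ k.+1) ^+ p else 1).
    rewrite (big_multiples M (fun k => (1 - q ^+ k) ^+ p) p0) -prodrXl; apply: eq_bigr => l _.
    by rewrite -!exprM mulnC.
  rewrite e1 e2 -!big_split; apply: eq_bigr => k _ /=.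
  rewrite -!exprM [(p * k.+1)%N]mulnC; case: ifP => _; rewrite ?mulr1 ?mul1r//.
have sh n : (n <= n * p)%N by rewrite leq_pmulr.
have l1 : tends (fun M => \prod_(0 <= h < p) eulp (eu (h%:R / p%:R) * q) (M * p) * eulp (q ^+ (p * p)) M)
   (\prod_(0 <= h < p) eul (eu (h%:R / p%:R) * q) * eul (q ^+ (p * p))).
  apply: tendsM; last exact: eul_cvg.
  apply: tends_prod => h _; apply: (tends_comp (f := fun n => (n * p)%N) sh).
  by apply: eul_cvg; rewrite nrmM nrm_eu mul1r.
have l2 : tends (fun M => eulp (q ^+ p) M ^+ p * eulp (q ^+ p) (M * p)) (eul (q ^+ p) ^+ p * eul (q ^+ p)).
  apply: tendsM; first by apply: tendsX; exact: eul_cvg.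
  by apply: (tends_comp (f := fun n => (n * p)%N) sh); exact: eul_cvg.
rewrite exprSr -(tends_unique l1 (tends_ext (fun M => esym (fin M)) l2)).
by rewrite mulfK// eul_neq0.
Qed.

Lemma proj_eta t m r q (x : C) : (0 < t)%N -> 0 < nrm q < 1 -> proj t r (fun z => eul z ^+ m) q = x ->
  proj t r (eta_quot t m) q = x / eul (q ^+ t) ^+ m.
Proof.
move=> t0 hq <-.
have -> : proj t r (eta_quot t m) q = proj t r (fun z => eul z ^+ m * (fun w => (eul w)^-1 ^+ m) (z ^+ t)) q.
  by apply: proj_ext => // z hz; rewrite /eta_quot exprMn.
by rewrite (projM r (fun z => eul z ^+ m) (fun w => (eul w)^-1 ^+ m) q t0) exprVn.
Qed.

(** The terms of index 3 n for (3, 9) are the terms of index n for (3, 3). *)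
Lemma section_3_9 q : 0 < nrm q < 1 -> proj 3 0 (eta_quot 3 9) q = q ^+ 0 * @eta_quot R 3 3 (q ^+ 3).
Proof.
move=> hq; have [_ q1] := andP hq; rewrite expr0 mul1r.
have e3 : eul (q ^+ 3) != 0 by rewrite eul_neq0// nrmX_lt1.
have e9 : eul (q ^+ 9) != 0 by rewrite eul_neq0// nrmX_lt1.
rewrite (proj_eta (isT : 0 < 3)%N hq (erefl _)).
have z2 := proj_cube0 (isT : 0 < 3)%N hq (isT : all (fun k => ('C(k.+1, 2) != 2 %[mod 3])%N) (iota 0 (2 * 3))).
have := prod_eul_rot (isT : prime 3) hq.
rewrite /proj unlock /= in z2 *.
set a := eul (eu (0%:R / 3%:R) * q) in z2 *; set b := eul (eu (1%:R / 3%:R) * q) in z2 *; set c := eul (eu (2%:R / 3%:R) * q) in z2 *.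
clearbody a b c; rewrite mulr1 => pr.
have c1 : eu (- ((2 * 1)%:R / 3%:R)) ^+ 3 = 1 :> C.
  by rewrite euX -(eu_int R (-2)) ; congr eu; rewrite /=; field.
have c2 : eu (- ((2 * 2)%:R / 3%:R)) = eu (- ((2 * 1)%:R / 3%:R)) ^+ 2 :> C.
  by rewrite euX; congr eu; field.
have c0 : eu (- ((2 * 0)%:R / 3%:R)) = 1 :> C by rewrite muln0 mul0r oppr0 eu0.
rewrite c0 c2 in z2; move: c1 z2; set w := eu (- ((2 * 1)%:R / 3%:R)); clearbody w => c1 z2.
have s0 : a ^+ 3 + w * b ^+ 3 + w ^+ 2 * c ^+ 3 = 0.
  have n3 : (3%:R : C)^-1 != 0 by rewrite invr_eq0 pnatr_eq0.
  apply: (mulfI n3); rewrite mulr0 -[RHS]z2; congr (_ * _).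
  by rewrite addr0 mul1r addrA.
have key (x y v u : C) : x + u * y + u ^+ 2 * v = 0 -> u ^+ 3 = 1 -> x ^+ 3 + y ^+ 3 + v ^+ 3 = 3%:R * (x * y * v).
  move=> h1 h2; have xE : x = - (u * y) - u ^+ 2 * v by apply/eqP; rewrite -subr_eq0 -h1; apply/eqP; ring.
  have t1 : x ^+ 3 + u ^+ 3 * y ^+ 3 + (u ^+ 3) ^+ 2 * v ^+ 3 = 3%:R * (u ^+ 3 * (x * y * v)) by rewrite xE; ring.
  by move: t1; rewrite h2 expr1n !mul1r.
have {key}K := key _ _ _ _ s0 c1.
rewrite !mul0n mul0r oppr0 eu0 !mul1r addr0.
have -> : 3%:R^-1 * (a ^+ 9 + (b ^+ 9 + c ^+ 9)) = (a * (b * c)) ^+ 3.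
  have n3 : 3%:R != 0 :> C by rewrite pnatr_eq0.
  apply: (mulfI n3); rewrite mulVKf//.
  have -> : a ^+ 9 + (b ^+ 9 + c ^+ 9) = (a ^+ 3) ^+ 3 + (b ^+ 3) ^+ 3 + (c ^+ 3) ^+ 3 by ring.
  rewrite K; ring.
rewrite pr /eta_quot -!exprM.
by move: (eul (q ^+ 3)) (eul (q ^+ 9)) e3 e9 => x y x0 y0; field; rewrite x0 y0.
Qed.

Lemma sum5 (G : nat -> C) : \sum_(0 <= k < 5) G k = G 0%N + (G 1%N + (G 2%N + (G 3%N + (G 4%N + 0)))).
Proof. by rewrite unlock. Qed.
Lemma prod5 (G : nat -> C) : \prod_(0 <= k < 5) G k = G 0%N * (G 1%N * (G 2%N * (G 3%N * (G 4%N * 1)))).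
Proof. by rewrite unlock. Qed.
Lemma sum7 (G : nat -> C) : \sum_(0 <= k < 7) G k =
  G 0%N + (G 1%N + (G 2%N + (G 3%N + (G 4%N + (G 5%N + (G 6%N + 0)))))).
Proof. by rewrite unlock. Qed.
Lemma sum11 (G : nat -> C) : \sum_(0 <= k < 11) G k =
  G 0%N + (G 1%N + (G 2%N + (G 3%N + (G 4%N + (G 5%N + (G 6%N + (G 7%N + (G 8%N + (G 9%N + (G 10%N + 0)))))))))).
Proof. by rewrite unlock. Qed.

Lemma proj_total t (F : C -> C) z : (0 < t)%N -> \sum_(0 <= r < t) proj t r F z = F z.
Proof.
move=> t0; have tn : t%:R != 0 :> C by rewrite pnatr_eq0 -lt0n.
have e h : \sum_(0 <= r < t) eu (- ((r * h)%:R / t%:R)) * F (eu (h%:R / t%:R) * z) =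
   (if (t %| h)%N then t%:R else 0) * F (eu (h%:R / t%:R) * z).
  have := eu_orth R (- h%:Z) t0; rewrite abszN absz_nat => <-.
  rewrite -mulr_suml; congr (_ * _); apply: eq_bigr => r _.
  by congr eu; rewrite rmorphN /= -pmulrn natrM; ring.
rewrite /proj -mulr_sumr; apply: (mulfI tn); rewrite mulVKf//.
rewrite exchange_big /=; apply: etrans (eq_bigr _ (fun h _ => e h)) _.
rewrite big_ltn// dvdn0 mul0r eu0 mul1r [X in _ + X]big1_seq ?addr0//.
move=> h /andP[_]; rewrite mem_index_iota => /andP[h0 ht].
have -> : (t %| h)%N = false by rewrite gtnNdvd.
exact: mul0r.
Qed.

Lemma proj_rot t r h (F : C -> C) q : (0 < t)%N ->
  proj t r F (eu (h%:R / t%:R) * q) = eu (h%:R / t%:R) ^+ r * proj t r F q.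
Proof.
move=> t0; have tn : t%:R != 0 :> R by rewrite pnatr_eq0 -lt0n.
rewrite /proj mulrCA; congr (_ * _); rewrite mulr_sumr.
pose G (k : nat) := eu (h%:R / t%:R) ^+ r * (eu (- ((r * k)%:R / t%:R)) * F (eu (k%:R / t%:R) * q)).
have GE k : eu (- ((r * k)%:R / t%:R)) * F (eu (k%:R / t%:R) * (eu (h%:R / t%:R) * q)) = G (h + k)%N.
  rewrite /G mulrA euX -euD mulrA -euD; congr (eu _ * F (eu _ * _)).
    by rewrite !natrM natrD; field.
  by rewrite natrD; ring.
have Gp k : G (k + t)%N = G k.
  rewrite /G; congr (_ * (_ * F (_ * _))).
    rewrite -(eu_addZ (- ((r * k)%:R / t%:R)) (- r%:Z)); congr eu.
    by rewrite rmorphN /= -pmulrn !natrM natrD; field.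
  rewrite -(eu_addZ (k%:R / t%:R) 1); congr eu; rewrite natrD; by field.
rewrite (eq_bigr _ (fun k _ => GE k)).
have gen (n : nat) (G' : nat -> C) : (forall k, G' (k + t)%N = G' k) ->
    \sum_(0 <= k < t) G' (n + k)%N = \sum_(0 <= k < t) G' k.
  elim: n => [|n IH] Gp'; first by [].
  rewrite -(IH Gp'); case: t t0 {tn G GE Gp IH} Gp' => // u _ Gp'.
  rewrite big_nat_recr//= [RHS]big_nat_recl//= addrC; congr (_ + _).
    by rewrite addn0 addSnnS Gp'.
  by apply: eq_bigr => k _; rewrite addSnnS.
exact: (gen h G Gp).
Qed.

(** A root of z^2 + z = 1, whose conjugate is -1 - z. *)
Lemma golden : exists g : C, g ^+ 2 = 1 - g.
Proof.
exists ((2.-root 5%:R - 1) / 2%:R).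
have s : (2.-root (5%:R : C)) ^+ 2 = 5%:R by rewrite rootCK.
have -> : ((2.-root 5%:R - 1) / 2%:R) ^+ 2 = ((2.-root (5%:R : C)) ^+ 2 - 2.-root 5%:R * 2%:R + 1) / 4%:R by field.
by rewrite s; field.
Qed.

(** The terms of index 5 n for (5, 5) are the terms of index n for (5, 1): the
    three nonzero parts x0, x1, x2 of the Euler function modulo 5 satisfy
    x0 x2 = - x1^2, because the cube has no exponent congruent to 2 or 4. *)
Lemma section_5_5 q : 0 < nrm q < 1 -> proj 5 0 (eta_quot 5 5) q = q ^+ 0 * @eta_quot R 5 1 (q ^+ 5).
Proof.
move=> hq; have [_ q1] := andP hq; rewrite expr0 mul1r.
have e5 : eul (q ^+ 5) != 0 by rewrite eul_neq0// nrmX_lt1.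
have e25 : eul (q ^+ 25) != 0 by rewrite eul_neq0// nrmX_lt1.
rewrite (proj_eta (isT : 0 < 5)%N hq (erefl _)).
pose x0 := proj 5 0 (@eul R) q; pose x1 := proj 5 1 (@eul R) q; pose x2 := proj 5 2 (@eul R) q.
pose f z := x0 + x1 * z + x2 * z ^+ 2.
have x3 : proj 5 3 (@eul R) q = 0 by apply: proj_eul0.
have x4 : proj 5 4 (@eul R) q = 0 by apply: proj_eul0.
have ef (h : nat) : eul (eu (h%:R / 5%:R) * q) = f (eu (h%:R / 5%:R) * 1).
  have t := @proj_total 5 (@eul R) (eu (h%:R / 5%:R) * q) isT.
  have r k := @proj_rot 5 k h (@eul R) q isT.
  apply: etrans (esym t) _; apply: etrans (sum5 _) _.
  rewrite (r 0%N) (r 1%N) (r 2%N) (r 3%N) (r 4%N).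
  have aux (u a0 a1 a2 a3 a4 : C) : a3 = 0 -> a4 = 0 ->
      u ^+ 0 * a0 + (u ^+ 1 * a1 + (u ^+ 2 * a2 + (u ^+ 3 * a3 + (u ^+ 4 * a4 + 0)))) = a0 + a1 * (u * 1) + a2 * (u * 1) ^+ 2.
    by move=> -> ->; ring.
  exact: (aux _ _ _ _ _ _ x3 x4).
clearbody x0 x1 x2.
have pf r k : proj 5 r (fun z => eul z ^+ k) q = proj 5 r (fun z => f z ^+ k) 1.
  by congr (_ * _); apply: eq_bigr => h _; rewrite ef.
have mono (cs : seq C) r : proj 5 r (fun z => \sum_(0 <= k < size cs) cs`_k * z ^+ k) 1 =
    \sum_(0 <= k < size cs) cs`_k * (if (k == r %[mod 5])%N then 1 else 0).
  by rewrite proj_sum; apply: eq_bigr => k _; rewrite projZ projX// expr1n.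
have cube r : proj 5 r (fun z => f z ^+ 3) 1 = proj 5 r (fun z => \sum_(0 <= k < 7)
   [:: x0 ^+ 3; 3%:R * x0 ^+ 2 * x1; 3%:R * x0 * (x0 * x2 + x1 ^+ 2); x1 ^+ 3 + 6%:R * x0 * x1 * x2;
       3%:R * x2 * (x0 * x2 + x1 ^+ 2); 3%:R * x1 * x2 ^+ 2; x2 ^+ 3]`_k * z ^+ k) 1.
  congr (proj _ _ _ _); apply/funext => z; rewrite sum7 /= /f; ring.
have r2 : x0 * (x0 * x2 + x1 ^+ 2) = 0.
  have := proj_cube0 (isT : 0 < 5)%N hq (isT : all (fun k => ('C(k.+1, 2) != 2 %[mod 5])%N) (iota 0 (2 * 5))).
  rewrite pf cube (mono [:: _; _; _; _; _; _; _]) sum7 /= !mulr0 mulr1 !addr0 !add0r => /eqP.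
  by rewrite -mulrA mulf_eq0 pnatr_eq0 /= => /eqP.
have r4 : x2 * (x0 * x2 + x1 ^+ 2) = 0.
  have := proj_cube0 (isT : 0 < 5)%N hq (isT : all (fun k => ('C(k.+1, 2) != 4 %[mod 5])%N) (iota 0 (2 * 5))).
  rewrite pf cube (mono [:: _; _; _; _; _; _; _]) sum7 /= !mulr0 mulr1 !addr0 !add0r => /eqP.
  by rewrite -mulrA mulf_eq0 pnatr_eq0 /= => /eqP.
have five : proj 5 0 (fun z => f z ^+ 5) 1 =
   x0 ^+ 5 + (20%:R * x0 * x1 ^+ 3 * x2 + 30%:R * x0 ^+ 2 * x1 * x2 ^+ 2 + x1 ^+ 5) + x2 ^+ 5.
  have -> : proj 5 0 (fun z => f z ^+ 5) 1 = proj 5 0 (fun z => \sum_(0 <= k < 11)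
    [:: x0 ^+ 5; 5%:R * x0 ^+ 4 * x1; 5%:R * x0 ^+ 4 * x2 + 10%:R * x0 ^+ 3 * x1 ^+ 2;
       20%:R * x0 ^+ 3 * x1 * x2 + 10%:R * x0 ^+ 2 * x1 ^+ 3;
       10%:R * x0 ^+ 3 * x2 ^+ 2 + 30%:R * x0 ^+ 2 * x1 ^+ 2 * x2 + 5%:R * x0 * x1 ^+ 4;
       20%:R * x0 * x1 ^+ 3 * x2 + 30%:R * x0 ^+ 2 * x1 * x2 ^+ 2 + x1 ^+ 5;
       10%:R * x0 ^+ 2 * x2 ^+ 3 + 30%:R * x0 * x1 ^+ 2 * x2 ^+ 2 + 5%:R * x1 ^+ 4 * x2;
       20%:R * x0 * x1 * x2 ^+ 3 + 10%:R * x1 ^+ 3 * x2 ^+ 2;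
       5%:R * x0 * x2 ^+ 4 + 10%:R * x1 ^+ 2 * x2 ^+ 3; 5%:R * x1 * x2 ^+ 4; x2 ^+ 5]`_k * z ^+ k) 1.
    congr (proj _ _ _ _); apply/funext => z; rewrite sum11 /= /f; ring.
  rewrite (mono [:: _; _; _; _; _; _; _; _; _; _; _]) sum11 /= !mulr0 !mulr1 !addr0 !add0r; ring.
have pw : 5.-primitive_root (eu (5%:R^-1) : C) by exact: eu_primitive.
have prodf : \prod_(0 <= h < 5) eul (eu (h%:R / 5%:R) * q) = proj 5 0 (fun z => f z ^+ 5) 1.
  have wE (h : nat) : eu (h%:R / 5%:R) * 1 = eu (5%:R^-1) ^+ h :> C by rewrite mulr1 euX.
  rewrite five (eq_bigr (fun h => f (eu (5%:R^-1) ^+ h))) => [|h _]; last by rewrite ef wE.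
  have P1 := prod_unity 0 pw.
  have w5 := prim_expr_order pw.
  have [x00|x00] := eqVneq x0 0.
    have : x2 * x1 ^+ 2 = 0 by move: r4; rewrite x00 mul0r add0r.
    move=> /eqP; rewrite mulf_eq0 expf_eq0 /= => /orP[/eqP x20|/eqP x10].
      rewrite /f x00 x20 prod5 !(mul0r, mulr0, add0r, addr0) expr0 !mulr1.
      move: (eu _) w5 => w w5.
      have -> : x1 * (x1 * w ^+ 1 * (x1 * w ^+ 2 * (x1 * w ^+ 3 * (x1 * w ^+ 4)))) = x1 ^+ 5 * (w ^+ 5) ^+ 2 by ring.
      by rewrite w5; ring.
    move: (eu _) w5 => w w5.
    transitivity (x2 ^+ 5 * (w ^+ 5) ^+ 4); first by rewrite /f x00 x10 prod5; ring.
    by rewrite x00 x10 w5; ring.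
  have rel : x0 * x2 + x1 ^+ 2 = 0 by move: r2 => /eqP; rewrite mulf_eq0 (negPf x00) => /eqP.
  have [g gE] := golden.
  pose v := x1 / x0.
  have x1E : x1 = v * x0 by rewrite /v divfK.
  clearbody v.
  have x2E : x2 = - v ^+ 2 * x0.
    apply: (mulfI x00); apply/eqP; rewrite -subr_eq0 -rel x1E; apply/eqP; ring.
  have fE z : f z = x0 * ((1 - z * (g * v)) * (1 - z * ((-1 - g) * v))).
    rewrite /f x1E x2E.
    have -> : (1 - z * (g * v)) * (1 - z * ((-1 - g) * v)) = 1 + z * v - (g + g ^+ 2) * (z ^+ 2 * v ^+ 2) by ring.
    by rewrite gE; ring.
  rewrite (eq_bigr _ (fun h _ => fE _)) big_split /= prodr_const_nat subn0 big_split /= !prod_unity//.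
  have g5 : g ^+ 5 = 5%:R * g - 3%:R.
    have -> : g ^+ 5 = g ^+ 2 * g ^+ 2 * g by ring.
    rewrite gE; have -> : (1 - g) * (1 - g) * g = g - 2%:R * g ^+ 2 + g ^+ 2 * g by ring.
    rewrite gE; have -> : g - 2%:R * (1 - g) + (1 - g) * g = 4%:R * g - 2%:R - g ^+ 2 by ring.
    by rewrite gE; ring.
  have g5' : (-1 - g) ^+ 5 = - 5%:R * g - 8%:R.
    have g2' : (-1 - g) ^+ 2 = 2%:R + g.
      have -> : (-1 - g) ^+ 2 = 1 + 2%:R * g + g ^+ 2 by ring.
      by rewrite gE; ring.
    have -> : (-1 - g) ^+ 5 = (-1 - g) ^+ 2 * (-1 - g) ^+ 2 * (-1 - g) by ring.
    rewrite g2'; have -> : (2%:R + g) * (2%:R + g) * (-1 - g) = - 4%:R - 8%:R * g - 5%:R * g ^+ 2 - g ^+ 2 * g by ring.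
    rewrite gE; have -> : - 4%:R - 8%:R * g - 5%:R * (1 - g) - (1 - g) * g = - 9%:R - 4%:R * g + g ^+ 2 by ring.
    by rewrite gE; ring.
  rewrite !exprMn g5 g5' x1E x2E.
  have -> : x0 ^+ 5 * ((1 - (5%:R * g - 3%:R) * v ^+ 5) * (1 - (- 5%:R * g - 8%:R) * v ^+ 5)) =
     x0 ^+ 5 * (1 + 11%:R * v ^+ 5 + (24%:R - 25%:R * (g + g ^+ 2)) * v ^+ 10) by ring.
  by rewrite gE; ring.
rewrite pf -prodf (prod_eul_rot (isT : prime 5) hq) /eta_quot -!exprM.
by move: (eul (q ^+ 5)) (eul (q ^+ 25)) e5 e25 => x y y0 z0; field; rewrite y0 z0.
Qed.

End Rotations.

End SectionIdentities.
Import SectionIdentities.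

(** * Theta functions *)

Module ThetaFunctions.

Local Opaque cexp eu.

Section ThetaIdentities.
Variable R : realType.
Local Notation C := (R[i]%C).
Implicit Types (q z X : C).

Lemma disc_pow q k : (0 < k)%N -> 0 < nrm q < 1 -> 0 < nrm (q ^+ k) < 1.
Proof. by move=> k0 hq; rewrite nrm_gt0 expf_neq0 ?nrmX_lt1 ?(nrm_lt1_neq0 hq)//; case/andP: hq. Qed.

Lemma theta_cv q z : 0 < nrm q < 1 -> z != 0 -> zcv (fun j => q ^+ tri j * z ^ j) (theta q z).
Proof. by move=> /andP[_ q1] z0; have [b zd] := theta_zdom q1 z0; apply: zsP; exact: zdom_summable zd. Qed.

(** Exponents of the squares and of the two families of triangular numbers. *)
Definition tria (j : int) : nat := absz (j * (2 * j + 1)).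

Lemma trinz (j : int) : (tri j)%:Z * 2 = j * (j + 1). Proof. by rewrite -tri2 PoszM. Qed.
Lemma triaz (j : int) : (tria j)%:Z = j * (2 * j + 1).
Proof. by rewrite /tria gez0_abs//; nia. Qed.

Lemma sqz (j : int) : (absz (j * j))%:Z = j * j.
Proof. by rewrite gez0_abs// -expr2 sqr_ge0. Qed.
Lemma psi0z (j : int) : (absz (j * (4 * j + 1)))%:Z = j * (4 * j + 1).
Proof. by rewrite gez0_abs//; nia. Qed.
Lemma psi1z (j : int) : (absz (4 * j * j + 5 * j + 1))%:Z = 4 * j * j + 5 * j + 1.
Proof.
have -> : 4 * j * j + 5 * j + 1 = (4 * j + 1) * (j + 1) by ring.
apply: gez0_abs; have [h|h] : 0 <= j \/ j <= -1 by lia.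
  by apply: mulr_ge0; lia.
by rewrite -mulrNN; apply: mulr_ge0; lia.
Qed.

Lemma zcv_ext (u v : int -> C) l : u =1 v -> zcv u l -> zcv v l.
Proof. by move=> /funext ->. Qed.

Lemma zcv_refl (u : int -> C) l : zcv u l -> zcv (fun j => u (- j - 1)) l.
Proof.
apply: tends_ext => M; apply: eq_bigr => k _; rewrite addrC; congr (u _ + u _); lia.
Qed.

Lemma exp_mono q (a : nat) (b : int) (e : nat) : q != 0 -> a%:Z + b = e%:Z -> q ^+ a * q ^ b = q ^+ e.
Proof. by move=> q0 h; rewrite -[q ^+ a]/(q ^ a%:Z) -expfzDr// h. Qed.

Lemma phi_cv q : 0 < nrm q < 1 -> zcv (fun j => q ^+ absz (j * j)) (phi q).
Proof.
move=> hq; have q0 := nrm_lt1_neq0 hq.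
have := theta_cv (disc_pow (isT : 0 < 2)%N hq) (invr_neq0 q0); apply: zcv_ext => j.
rewrite -exprM exprz_inv; apply: exp_mono => //; have := trinz j; rewrite sqz PoszM; lia.
Qed.

Lemma psi_cv q : 0 < nrm q < 1 -> zcv (fun j => q ^+ tria j) (psi q).
Proof.
move=> hq; have q0 := nrm_lt1_neq0 hq.
have := theta_cv (disc_pow (isT : 0 < 4)%N hq) (invr_neq0 q0); apply: zcv_ext => j.
rewrite -exprM exprz_inv; apply: exp_mono => //; have := trinz j; rewrite triaz PoszM; lia.
Qed.

Lemma tri_cv q : 0 < nrm q < 1 -> zcv (fun j => q ^+ tri j) (2%:R * psi q).
Proof.
move=> hq; have l1 := theta_cv hq (oner_neq0 C).
have l2 : zcv (fun j => q ^+ tri j) (theta q 1) by apply: zcv_ext l1 => j; rewrite exp1rz mulr1.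
have hs s : (s < 2)%N -> zcv (fun j => q ^+ tri (j * 2%:Z + s%:Z)) (psi q).
  move=> h; have [->|->] : s = 0%N \/ s = 1%N by clear -h; lia.
    by apply: zcv_ext (psi_cv hq) => j; congr (q ^+ _); have := trinz (j * 2%:Z + 0%:Z); have := triaz j; lia.
  apply: zcv_ext (zcv_refl (psi_cv hq)) => j; congr (q ^+ _).
  by have := trinz (j * 2%:Z + 1%:Z); have := triaz (- j - 1); lia.
have := @zcv_split R _ 2 _ _ isT l2 hs; rewrite sumr_const_nat subn0 mulr_natl => <-.
exact: l2.
Qed.

Lemma phi_split q : 0 < nrm q < 1 -> phi q = phi (q ^+ 4) + 2%:R * q * psi (q ^+ 8).
Proof.
move=> hq.
pose L s := if s == 0%N then phi (q ^+ 4) else q * (2%:R * psi (q ^+ 8)).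
have hs s : (s < 2)%N -> zcv (fun j => q ^+ absz ((j * 2%:Z + s%:Z) * (j * 2%:Z + s%:Z))) (L s).
  move=> h; have [->|->] : s = 0%N \/ s = 1%N by clear -h; lia.
    by apply: zcv_ext (phi_cv (disc_pow (isT : 0 < 4)%N hq)) => j; rewrite -exprM; congr (q ^+ _); have := sqz j; have := sqz (j * 2%:Z + 0%:Z); lia.
  apply: zcv_ext (zcvZ q (tri_cv (disc_pow (isT : 0 < 8)%N hq))) => j.
  by rewrite -exprM -exprS; congr (q ^+ _); have := trinz j; have := sqz (j * 2%:Z + 1%:Z); lia.
rewrite (@zcv_split R _ 2 _ _ isT (phi_cv hq) hs) big_nat_recr//= big_nat1 /L /=.
by rewrite mulrCA mulrA.
Qed.

(** The even and odd parts of psi. *)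
Definition psi0 X : C := zs (fun i => X ^+ absz (i * (4 * i + 1))).
Definition psi1 X : C := zs (fun i => X ^+ absz (4 * i * i + 5 * i + 1)).

Lemma linear_exp_cv q (e : int -> nat) : 0 < nrm q < 1 -> (forall j : int, (absz j <= (e j).+1)%N) ->
  zcv (fun j => q ^+ e j) (zs (fun j => q ^+ e j)).
Proof.
move=> hq he; have [q0 q1] := andP hq; apply: zsP.
have qn : nrm q != 0 by rewrite gt_eqF.
have r01 : 0 <= nrm q < 1 by rewrite ltW.
apply: (@zdom_summable _ _ (fun k => (nrm q)^-1 * nrm q ^+ k)); split => [j|k|].
- rewrite nrmX -[leLHS](mulKf qn) -exprS ler_wpM2l ?invr_ge0 ?(ltW q0)//.
  by rewrite ler_wiXn2l// ltW.
- by rewrite mulr_ge0 ?invr_ge0 ?exprn_ge0// ltW.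
- by apply: geometric_sums_bounded => //; rewrite invr_ge0 ltW.
Qed.

Lemma psi0_cv X : 0 < nrm X < 1 -> zcv (fun i => X ^+ absz (i * (4 * i + 1))) (psi0 X).
Proof. by move=> hX; apply: (linear_exp_cv (e := fun i => absz (i * (4 * i + 1)))) => // j; have := psi0z j; nia. Qed.
Lemma psi1_cv X : 0 < nrm X < 1 -> zcv (fun i => X ^+ absz (4 * i * i + 5 * i + 1)) (psi1 X).
Proof. by move=> hX; apply: (linear_exp_cv (e := fun i => absz (4 * i * i + 5 * i + 1))) => // j; have := psi1z j; nia. Qed.

Lemma psi_split q : 0 < nrm q < 1 -> psi q = psi0 (q ^+ 2) + q * psi1 (q ^+ 2).
Proof.
move=> hq; have hq2 := disc_pow (isT : 0 < 2)%N hq.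
pose L s := if s == 0%N then psi0 (q ^+ 2) else q * psi1 (q ^+ 2).
have hs s : (s < 2)%N -> zcv (fun j => q ^+ tria (j * 2%:Z + s%:Z)) (L s).
  move=> h; have [->|->] : s = 0%N \/ s = 1%N by clear -h; lia.
    by apply: zcv_ext (psi0_cv hq2) => j; rewrite -exprM; congr (q ^+ _); have := triaz (j * 2%:Z + 0%:Z); have := psi0z j; lia.
  apply: zcv_ext (zcvZ q (psi1_cv hq2)) => j.
  by rewrite -exprM -exprS; congr (q ^+ _); have := triaz (j * 2%:Z + 1%:Z); have := psi1z j; lia.
by rewrite (@zcv_split R _ 2 _ _ isT (psi_cv hq) hs) big_nat_recr//= big_nat1.
Qed.

Lemma eul_near1 q : 0 < nrm q < 1 -> nrm (eul q - 1) <= 3 * nrm q / (1 - nrm q).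
Proof.
move=> hq; have [q0 q1] := andP hq.
have r01 : 0 <= nrm q < 1 by rewrite ltW.
have l := tendsB (eul_pent hq) (tends_cst 1).
have sh n : (n <= n.+1)%N by [].
apply: (tends_nrm (tends_comp (f := fun n => n.+1) sh l)) => n.
rewrite big_ltn// (_ : pent0 0 = 0%N)// (_ : pent1 0 = 1%N)// !expr0 mul1r expr1.
set S := \sum_(1 <= k < n.+1) _.
have -> : 1 - q + S - 1 = S - q by ring.
rewrite (le_trans (nrmB _ _))//.
have hS : nrm S <= \sum_(1 <= k < n.+1) 2 * nrm q ^+ k.
  rewrite (le_trans (nrm_sum _ _ _))//; apply: ler_sum_nat => k /andP[k1 _].
  rewrite nrmM nrmX nrmN nrm1 expr1n mul1r (le_trans (nrmB _ _))// !nrmX.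
  have le e : (k <= e)%N -> nrm q ^+ e <= nrm q ^+ k by move=> h; rewrite ler_wiXn2l// ltW.
  have l0 : (k <= pent0 k)%N by rewrite /pent0; lia.
  have l1 : (k <= pent1 k)%N by rewrite /pent1; lia.
  by rewrite mulr_natl mulr2n lerD// le.
have e : \sum_(1 <= k < n.+1) 2 * nrm q ^+ k <= 2 * nrm q / (1 - nrm q).
  rewrite big_add1 /= (eq_bigr (fun k => 2 * nrm q * nrm q ^+ k)) => [|k _]; last by rewrite exprS mulrA.
  by rewrite -mulr_sumr ler_wpM2l ?geometric_sum_le// mulr_ge0// ltW.
have e2 : nrm q <= nrm q / (1 - nrm q).
  by rewrite ler_pdivlMr ?subr_gt0//; have := mulr_ge0 (ltW q0) (ltW q0); lra.
move: e2 e hS; rewrite -!mulrA; move: (nrm q / (1 - nrm q)) (\sum_(1 <= k < n.+1) _) => x y; lra.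
Qed.

Lemma iter_sq_tends q (F : C -> C) : 0 < nrm q < 1 -> (exists K : R, forall z, 0 < nrm z < 1 / 2 -> nrm (F z) <= K * nrm z) ->
  tends (fun k => F (q ^+ (2 ^ k))) 0.
Proof.
move=> hq [K hK] e e0; have [q0 q1] := andP hq.
have r01 : 0 <= nrm q < 1 by rewrite ltW.
have K0 : 0 < `|K| + 1 by rewrite ltr_wpDl.
have m0 : 0 < Num.min (e / (`|K| + 1)) (1 / 4) by rewrite lt_min divr_gt0//=; lra.
have ge n : 0 <= 1 * nrm q ^+ n by rewrite mul1r exprn_ge0// ltW.
have h1 := sums_bounded_to0 ge (geometric_sums_bounded r01 ler01) m0.
case: h1 => N hN; exists N => n hn; rewrite subr0.
have n2 : (N <= 2 ^ n)%N by rewrite (leq_trans hn)// ltnW// ltn_expl.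
have := hN _ n2; rewrite mul1r -nrmX le_min => /andP[l1 l2].
have z0 : 0 < nrm (q ^+ (2 ^ n)) by rewrite nrmX exprn_gt0.
have z1 : 0 < nrm (q ^+ (2 ^ n)) < 1 / 2 by rewrite z0 /=; lra.
rewrite (le_trans (hK _ z1))//.
rewrite ler_pdivlMr// mulrC in l1; apply: le_trans l1.
by rewrite ler_pM2r// (le_trans (ler_norm _))// lerDl.
Qed.

Lemma eul_iter q k : 0 < nrm q < 1 -> (0 < k)%N -> tends (fun n => eul ((q ^+ (2 ^ n)) ^+ k)) 1.
Proof.
move=> hq k0; apply/tends_sub0.
apply: (@iter_sq_tends q (fun z => eul (z ^+ k) - 1)) => //; exists 6 => z /andP[z0 z1].
have zk : nrm (z ^+ k) <= nrm z by rewrite nrmX -[leRHS]expr1 ler_wiXn2l ?ltW//; lra.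
have hz : 0 < nrm (z ^+ k) < 1 by rewrite nrmX exprn_gt0//= -nrmX; lra.
rewrite (le_trans (eul_near1 hz))// ler_pdivrMr; last by lra.
have : 0 <= (6 - 6 * nrm (z ^+ k) - 3) * nrm z by apply: mulr_ge0; lra.
lra.
Qed.

Local Opaque phi psi psi0 psi1 theta.

Lemma phi_quot q : 0 < nrm q < 1 -> phi q = eul (q ^+ 2) ^+ 5 / (eul q ^+ 2 * eul (q ^+ 4) ^+ 2).
Proof.
move=> hq; have [_ q1] := andP hq; rewrite (phi_eul q1 (nrm_lt1_neq0 hq)) (eulN q1).
have a0 := eul_neq0 q1; have b0 := eul_neq0 (nrmX_lt1 q1 (isT : 0 < 2)%N); have c0 := eul_neq0 (nrmX_lt1 q1 (isT : 0 < 4)%N).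
by move: (eul q) (eul (q ^+ 2)) (eul (q ^+ 4)) a0 b0 c0 => a b c a0 b0 c0; field; rewrite a0 b0 c0.
Qed.

Lemma psi_sq q : 0 < nrm q < 1 -> psi q ^+ 2 = phi q * psi (q ^+ 2).
Proof.
move=> hq; have [_ q1] := andP hq; have hq2 := disc_pow (isT : 0 < 2)%N hq; have [_ q21] := andP hq2.
rewrite (phi_quot hq) (psi_eul q1 (nrm_lt1_neq0 hq)) (psi_eul q21 (nrm_lt1_neq0 hq2)) -exprM.
have a0 := eul_neq0 q1; have b0 := eul_neq0 (nrmX_lt1 q1 (isT : 0 < 2)%N); have c0 := eul_neq0 (nrmX_lt1 q1 (isT : 0 < 4)%N).
by move: (eul q) (eul (q ^+ 2)) (eul (q ^+ (2 * 2))) a0 b0 c0 => a b c a0 b0 c0; field; rewrite a0 b0 c0.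
Qed.

End ThetaIdentities.

End ThetaFunctions.
Import ThetaFunctions.

(** * The square of the theta function *)

Module ThetaSquares.

Local Opaque cexp eu phi psi psi0 psi1 theta.

Section ThetaIdentities2.
Variable R : realType.
Local Notation C := (R[i]%C).
Implicit Types (q z X : C).

(** The defect of this identity changes sign under q |-> q^2 and vanishes at 0. *)
Theorem phi_sq q : 0 < nrm q < 1 -> phi q ^+ 2 = phi (q ^+ 2) ^+ 2 + 4%:R * q * psi (q ^+ 4) ^+ 2.
Proof.
move=> hq; pose E z := phi z ^+ 2 - phi (z ^+ 2) ^+ 2 - 4%:R * z * psi (z ^+ 4) ^+ 2.
suff : E q = 0 by move=> /eqP; rewrite /E -addrA -opprD subr_eq0 => /eqP.
have step z : 0 < nrm z < 1 -> E z = - E (z ^+ 2).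
  move=> hz; have hz4 := disc_pow (isT : 0 < 4)%N hz.
  have p2 := phi_split hz; have s4 := psi_sq hz4.
  have e8 : (z ^+ 4) ^+ 2 = z ^+ 8 by rewrite -exprM.
  rewrite e8 in s4.
  have e4 : (z ^+ 2) ^+ 2 = z ^+ 4 by rewrite -exprM.
  have e24 : (z ^+ 2) ^+ 4 = z ^+ 8 by rewrite -exprM.
  have E2 : E (z ^+ 2) = phi (z ^+ 2) ^+ 2 - phi (z ^+ 4) ^+ 2 - 4%:R * z ^+ 2 * psi (z ^+ 8) ^+ 2.
    exact: (f_equal2 (fun u v => phi (z ^+ 2) ^+ 2 - phi u ^+ 2 - 4%:R * z ^+ 2 * psi v ^+ 2) e4 e24).
  have aux (w p x a v y : C) : p = a + 2%:R * w * v -> y ^+ 2 = a * v ->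
      p ^+ 2 - x ^+ 2 - 4%:R * w * y ^+ 2 = - (x ^+ 2 - a ^+ 2 - 4%:R * w ^+ 2 * v ^+ 2).
    by move=> -> ->; ring.
  have := aux z (phi z) (phi (z ^+ 2)) (phi (z ^+ 4)) (psi (z ^+ 8)) (psi (z ^+ 4)) p2 s4.
  by move=> h; exact: (etrans h (congr1 (fun u => - u) (esym E2))).
have it n : E q = (-1) ^+ n * E (q ^+ (2 ^ n)).
  elim: n => [|n IH]; first by rewrite expr0 mul1r expr1.
  have e : q ^+ (2 ^ n.+1) = (q ^+ (2 ^ n)) ^+ 2 by rewrite -exprM expnSr.
  have hn : 0 < nrm (q ^+ (2 ^ n)) < 1 by apply: disc_pow; rewrite ?expn_gt0.
  by rewrite IH e (step _ hn) mulrN (exprS (-1 : C) n) mulN1r mulNr.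
have [_ q1] := andP hq.
have fl n : E (q ^+ (2 ^ n)) = let z := q ^+ (2 ^ n) in
   (eul (z ^+ 2) ^+ 5 / (eul (z ^+ 1) ^+ 2 * eul (z ^+ 4) ^+ 2)) ^+ 2
   - (eul (z ^+ 4) ^+ 5 / (eul (z ^+ 2) ^+ 2 * eul (z ^+ 8) ^+ 2)) ^+ 2 - 4%:R * z * (eul (z ^+ 8) ^+ 2 / eul (z ^+ 4)) ^+ 2.
  have hz : 0 < nrm (q ^+ (2 ^ n)) < 1 by apply: disc_pow; rewrite ?expn_gt0.
  move: (q ^+ (2 ^ n)) hz => z hz /=; have hz4 := disc_pow (isT : 0 < 4)%N hz; have [_ z41] := andP hz4.
  have f1 : phi z = eul (z ^+ 2) ^+ 5 / (eul (z ^+ 1) ^+ 2 * eul (z ^+ 4) ^+ 2) by rewrite (phi_quot hz) expr1.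
  have e4 : (z ^+ 2) ^+ 2 = z ^+ 4 by rewrite -exprM.
  have e8 : (z ^+ 2) ^+ 4 = z ^+ 8 by rewrite -exprM.
  have e8' : (z ^+ 4) ^+ 2 = z ^+ 8 by rewrite -exprM.
  have f2 := etrans (phi_quot (disc_pow (isT : 0 < 2)%N hz))
    (f_equal2 (fun u v => eul u ^+ 5 / (eul (z ^+ 2) ^+ 2 * eul v ^+ 2)) e4 e8).
  have f3 := etrans (psi_eul z41 (nrm_lt1_neq0 hz4)) (congr1 (fun u => eul u ^+ 2 / eul (z ^+ 4)) e8').
  exact: (f_equal3 (fun u v w => u ^+ 2 - v ^+ 2 - 4%:R * z * w ^+ 2) f1 f2 f3).
have z0 : tends (fun n => q ^+ (2 ^ n)) 0.
  by apply: (@iter_sq_tends R q id) => //; exists 1 => z _; rewrite mul1r.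
have l k (k0 : (0 < k)%N) := eul_iter hq k0.
have n1 : (1 : C) ^+ 2 * 1 ^+ 2 != 0 by rewrite !expr1n mulr1 oner_neq0.
have lim : tends (fun n => E (q ^+ (2 ^ n))) 0.
  have -> : 0 = (1 ^+ 5 / (1 ^+ 2 * 1 ^+ 2)) ^+ 2 - (1 ^+ 5 / (1 ^+ 2 * 1 ^+ 2)) ^+ 2 - 4%:R * 0 * (1 ^+ 2 / 1) ^+ 2 :> C.
    by rewrite subrr mulr0 mul0r subr0.
  apply: tends_ext (fun n => esym (fl n)) _ => /=.
  apply: tendsB; first apply: tendsB.
  - apply: tendsX; apply: tendsM; first by apply: tendsX; exact: l.
    by apply: tendsV n1 _; apply: tendsM; apply: tendsX; exact: l.
  - apply: tendsX; apply: tendsM; first by apply: tendsX; exact: l.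
    by apply: tendsV n1 _; apply: tendsM; apply: tendsX; exact: l.
  - apply: tendsM; first by apply: tendsZ.
    by apply: tendsX; apply: tendsM; [apply: tendsX; exact: l|apply: tendsV (oner_neq0 _) _; exact: l].
apply/eqP; rewrite -nrm_eq0 eq_le nrm_ge0 andbT; apply/ler_addgt0Pr => e e0; rewrite add0r.
have [N hN] := lim e e0; have := hN N (leqnn N); rewrite subr0 (it N) nrmM nrmX nrmN nrm1 expr1n mul1r //.
Qed.

End ThetaIdentities2.

End ThetaSquares.
Import ThetaSquares.

(** * Splittings for (t, m) = (4, 4) and (8, 2) *)

Module EtaSplittings.

Local Opaque cexp eu phi psi psi0 psi1 theta.

Section ThetaIdentities3.
Variable R : realType.
Local Notation C := (R[i]%C).
Implicit Types (q z X : C).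

Lemma phiN_quot q : 0 < nrm q < 1 -> phi (- q) = eul q ^+ 2 / eul (q ^+ 2).
Proof. by move=> hq; apply: phiN; [case/andP: hq|exact: nrm_lt1_neq0]. Qed.

Lemma eta_4_8_odd q : 0 < nrm q < 1 -> eta_quot 4 8 q - eta_quot 4 8 (- q) = - 16%:R * q :> C.
Proof.
move=> hq; have hN : 0 < nrm (- q) < 1 by rewrite nrmN.
have hq2 := disc_pow (isT : 0 < 2)%N hq; have [_ q21] := andP hq2; have hq4 := disc_pow (isT : 0 < 4)%N hq.
have E z (hz : 0 < nrm z < 1) : eta_quot 4 8 z = phi (- z) ^+ 4 * (eul (z ^+ 2) ^+ 4 / eul (z ^+ 4) ^+ 8).
  rewrite /eta_quot (phiN_quot hz); have b0 := eul_neq0 (proj2 (andP (disc_pow (isT : 0 < 2)%N hz))).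
  have c0 := eul_neq0 (proj2 (andP (disc_pow (isT : 0 < 4)%N hz))).
  by move: (eul z) (eul (z ^+ 2)) (eul (z ^+ 4)) b0 c0 => a b c b0 c0; field; rewrite b0 c0.
rewrite (E q hq) (E (- q) hN) opprK !sqrrN (_ : (- q) ^+ 4 = q ^+ 4); last by ring.
have p1 := phi_sq hq; have p2 := phi_sq hN; rewrite sqrrN (_ : (- q) ^+ 4 = q ^+ 4) in p2; last by ring.
have s2 := psi_sq hq2; rewrite -exprM (psi_eul q21 (nrm_lt1_neq0 hq2)) -exprM in s2.
have b0 := eul_neq0 (proj2 (andP hq2)); have c0 := eul_neq0 (proj2 (andP hq4)).
have aux (A B x y b c : C) : A ^+ 2 = x ^+ 2 + 4%:R * - q * y ^+ 2 -> B ^+ 2 = x ^+ 2 + 4%:R * q * y ^+ 2 ->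
    (c ^+ 2 / b) ^+ 2 = x * y -> b != 0 -> c != 0 ->
    A ^+ 4 * (b ^+ 4 / c ^+ 8) - B ^+ 4 * (b ^+ 4 / c ^+ 8) = - 16%:R * q.
  move=> hA hB s b0' c0'; have p4 (x' : C) : x' ^+ 4 = (x' ^+ 2) ^+ 2 by ring.
  rewrite (p4 A) (p4 B) hA hB.
  have -> : ((x ^+ 2 + 4%:R * - q * y ^+ 2) ^+ 2 * (b ^+ 4 / c ^+ 8) - (x ^+ 2 + 4%:R * q * y ^+ 2) ^+ 2 * (b ^+ 4 / c ^+ 8)) =
    - 16%:R * q * ((x * y) ^+ 2 * (b ^+ 4 / c ^+ 8)) by ring.
  by rewrite -s; field; rewrite b0' c0'.
exact: (aux _ _ _ _ _ _ p2 p1 s2 b0 c0).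
Qed.

(** The even classes modulo 4 for (4, 4), as theta products in z^4. *)
Lemma split_4_4 z : 0 < nrm z < 1 -> eta_quot 4 4 z =
  phi (z ^+ 8) * eul (z ^+ 4) / eul (z ^+ 8) ^+ 2 + z ^+ 2 * (2%:R * psi (z ^+ 16) * eul (z ^+ 4) / eul (z ^+ 8) ^+ 2)
  - z * (4%:R * psi (z ^+ 4) ^+ 2 * (eul (z ^+ 2) ^+ 2 / eul (z ^+ 4) ^+ 4)).
Proof.
move=> hz; have hN : 0 < nrm (- z) < 1 by rewrite nrmN.
have hz2 := disc_pow (isT : 0 < 2)%N hz.
have n0 k (k0 : (0 < k)%N) := eul_neq0 (proj2 (andP (disc_pow k0 hz))).
have p2 := phi_sq hN; rewrite sqrrN (_ : (- z) ^+ 4 = z ^+ 4) in p2; last by ring.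
have hq := etrans (phi_quot hz2) (f_equal2 (fun u v => eul u ^+ 5 / (eul (z ^+ 2) ^+ 2 * eul v ^+ 2)) (esym (exprM z 2 2)) (esym (exprM z 2 4))).
have sp := etrans (phi_split hz2) (f_equal2 (fun u v => phi u + 2%:R * z ^+ 2 * psi v) (esym (exprM z 2 4)) (esym (exprM z 2 8))).
have aux (A b c d f2 f8 p16 p4 P : C) : P = A ^+ 2 / b -> P ^+ 2 = f2 ^+ 2 + 4%:R * - z * p4 ^+ 2 ->
    f2 = c ^+ 5 / (b ^+ 2 * d ^+ 2) -> f2 = f8 + 2%:R * z ^+ 2 * p16 -> b != 0 -> c != 0 -> d != 0 ->
    (A / c) ^+ 4 = f8 * c / d ^+ 2 + z ^+ 2 * (2%:R * p16 * c / d ^+ 2) - z * (4%:R * p4 ^+ 2 * (b ^+ 2 / c ^+ 4)).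
  move=> hP h2 hf hs b0 c0 d0.
  have e1 : (A / c) ^+ 4 = P ^+ 2 * (b ^+ 2 / c ^+ 4) by rewrite hP; field; rewrite b0 c0.
  have e2 : f2 ^+ 2 * (b ^+ 2 / c ^+ 4) = f2 * (c / d ^+ 2).
    by rewrite expr2 -mulrA; congr (f2 * _); rewrite hf; field; rewrite b0 c0 d0.
  by rewrite e1 h2 mulrDl e2 hs; ring.
exact: (aux _ _ _ _ _ _ _ _ _ (phiN_quot hz) p2 hq sp (n0 2 isT) (n0 4 isT) (n0 8 isT)).
Qed.

(** The quotient W with positive coefficients behind the even classes for (8, 2). *)
Lemma split_8_2 z : 0 < nrm z < 1 -> let W := eul (- z ^+ 4) / eul ((z ^+ 4) ^+ 2) / eul ((z ^+ 4) ^+ 4) in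
  eta_quot 8 2 z = psi0 (z ^+ 4) * W - z ^+ 2 * (psi1 (z ^+ 4) * W) - z * (2%:R * psi (z ^+ 8) * (eul (z ^+ 2) / eul (z ^+ 8) ^+ 2)).
Proof.
move=> hz W; have hN : 0 < nrm (- z) < 1 by rewrite nrmN.
have hz2 := disc_pow (isT : 0 < 2)%N hz; have hM : 0 < nrm (- z ^+ 2) < 1 by rewrite nrmN.
have hz4 := disc_pow (isT : 0 < 4)%N hz.
have n0 k (k0 : (0 < k)%N) := eul_neq0 (proj2 (andP (disc_pow k0 hz))).
have N4 : (- z) ^+ 4 = z ^+ 4 by ring.
have N8 : (- z) ^+ 8 = z ^+ 8 by ring.
have M2 : (- z ^+ 2) ^+ 2 = z ^+ 4 by ring.
have [_ m1] := andP hM; have [_ z21] := andP hz2; have [_ z41] := andP hz4.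
have sp := etrans (phi_split hN) (f_equal2 (fun u v => phi u + 2%:R * - z * psi v) N4 N8).
have hq := etrans (phi_quot hz4) (f_equal2 (fun u v => eul u ^+ 5 / (eul (z ^+ 4) ^+ 2 * eul v ^+ 2)) (esym (exprM z 4 2)) (esym (exprM z 4 4))).
have hm := etrans (psi_eul m1 (nrm_lt1_neq0 hM)) (congr1 (fun u => eul u ^+ 2 / eul (- z ^+ 2)) M2).
have hn2 := etrans (eulN z21) (f_equal2 (fun u v => eul u ^+ 3 / (eul (z ^+ 2) * eul v)) (esym (exprM z 2 2)) (esym (exprM z 2 4))).
have hn4 := etrans (eulN z41) (f_equal2 (fun u v => eul u ^+ 3 / (eul (z ^+ 4) * eul v)) (esym (exprM z 4 2)) (esym (exprM z 4 4))).
have hps := etrans (psi_split hM) (congr1 (fun u => psi0 u + - z ^+ 2 * psi1 u) M2).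
have hW : W = eul (- z ^+ 4) / eul (z ^+ 8) / eul (z ^+ 16).
  exact: (f_equal2 (fun u v => eul (- z ^+ 4) / eul u / eul v) (esym (exprM z 4 2)) (esym (exprM z 4 4))).
have aux (A b c d g P p4 p8 w q0 q1 pM m2 m4 : C) : P = A ^+ 2 / b -> P = p4 + 2%:R * - z * p8 ->
    p4 = d ^+ 5 / (c ^+ 2 * g ^+ 2) -> pM = c ^+ 2 / m2 -> m2 = c ^+ 3 / (b * d) -> m4 = d ^+ 3 / (c * g) ->
    w = m4 / d / g -> pM = q0 + - z ^+ 2 * q1 -> b != 0 -> c != 0 -> d != 0 -> g != 0 ->
    (A / d) ^+ 2 = q0 * w - z ^+ 2 * (q1 * w) - z * (2%:R * p8 * (b / d ^+ 2)).
  move=> hP hP2 h4 hM' h2 h4' hw hs b0 c0 d0 g0.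
  have e1 : (A / d) ^+ 2 = P * (b / d ^+ 2) by rewrite hP; field; rewrite b0 d0.
  have e2 : p4 * (b / d ^+ 2) = pM * w by rewrite h4 hM' h2 hw h4'; field; rewrite b0 c0 d0 g0.
  by rewrite e1 hP2 mulrDl e2 hs; ring.
exact: (aux _ _ _ _ _ _ _ _ _ _ _ _ _ _ (phiN_quot hz) sp hq hm hn2 hn4 hW hps (n0 2 isT) (n0 4 isT) (n0 8 isT) (n0 16 isT)).
Qed.

End ThetaIdentities3.

End EtaSplittings.
Import EtaSplittings.

(** * Signs in the even residue classes for (4, 4) and (8, 2) *)

Module EvenSections.

Local Opaque cexp eu.

Section Positivity.
Variable R : realType.
Local Notation C := (R[i]%C).
Implicit Types (p : {poly R}) (F : C -> C) (a : nat -> C) (z : C).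

Definition radius : R := expR (-1).
Definition atC p z : C := (map_poly (real_complex R) p).[z].
Definition nonneg_poly p := forall k, 0 <= p`_k.

Lemma radius01 : 0 < radius < 1.
Proof. by rewrite expR_gt0 -[ltRHS]expR0 ltr_expR oppr_lt0 ltr01. Qed.

Lemma disc_radius : 0 < nrm (radius%:c : C) < 1.
Proof.
have r01 := radius01; have r0 : 0 < radius by case/andP: r01.
by rewrite (_ : nrm (radius%:c : C) = radius)// nrm_real gtr0_norm.
Qed.

(** The average extracting the coefficient k of a polynomial with nonnegative
    coefficients sees that coefficient and other nonnegative ones. *)
Lemma proj_poly_ge p k N : (0 < N)%N -> nonneg_poly p -> p`_k * radius ^+ k <= Re (proj N k (atC p) radius%:c).
Proof.
move=> N0 hp; have /andP[r0 r1] := radius01.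
pose T l := (if (l == k %[mod N])%N then p`_l * radius ^+ l else 0).
have T0 l : 0 <= T l by rewrite /T; case: ifP => // _; rewrite mulr_ge0 ?exprn_ge0// ltW.
have [n [kn pn]] : exists n, (k < n)%N /\ (size p <= n)%N by exists (k.+1 + size p)%N; rewrite leq_addr leq_addl.
have pE : atC p = (fun z => \sum_(0 <= l < n) (p`_l)%:c * z ^+ l).
  apply/funext => z; rewrite /atC (@horner_coef_wide _ n) ?size_map_poly// big_mkord.
  by apply: eq_bigr => i _; rewrite coef_map.
rewrite pE proj_sum Re_sum (eq_bigr T) => [|l _]; last first.
  rewrite projZ projX// Re_realM /T; case: ifP => _; last by rewrite mulr0.
  by rewrite -rmorphXn.
rewrite (bigD1_seq k) ?iota_uniq ?mem_index_iota//= {1}/T eqxx lerDl sumr_ge0//.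
Qed.

Lemma proj_limit_ge N k (S : nat -> C -> C) F (b : R) :
  (forall z, 0 < nrm z < 1 -> tends (S ^~ z) (F z)) ->
  (exists n0, forall n, (n0 <= n)%N -> b <= Re (proj N k (S n) radius%:c)) -> b <= Re (proj N k F radius%:c).
Proof.
move=> hS [n0 h]; have sh n : (n <= n + n0)%N by rewrite leq_addr.
apply: tends_Re_ge (tends_comp (f := fun n => (n + n0)%N) sh (proj_tends N k disc_radius hS)) _ => n.
by apply: h; rewrite leq_addl.
Qed.

Lemma atCD p q z : atC (p + q) z = atC p z + atC q z. Proof. by rewrite /atC rmorphD hornerD. Qed.
Lemma atCM p q z : atC (p * q) z = atC p z * atC q z. Proof. by rewrite /atC rmorphM hornerM. Qed.
Lemma atC1 z : atC 1 z = 1. Proof. by rewrite /atC rmorph1 hornerC. Qed.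
Lemma atCXn n z : atC 'X^n z = z ^+ n. Proof. by rewrite /atC map_polyXn hornerXn. Qed.
Lemma atC_sum m n (P : nat -> {poly R}) z : atC (\sum_(m <= i < n) P i) z = \sum_(m <= i < n) atC (P i) z.
Proof. by rewrite /atC rmorph_sum horner_sum. Qed.
Lemma atC_prod m n (P : nat -> {poly R}) z : atC (\prod_(m <= i < n) P i) z = \prod_(m <= i < n) atC (P i) z.
Proof. by rewrite /atC rmorph_prod horner_prod. Qed.

Lemma coef_ge a F k (b : R) : power_series a F ->
  (forall N, (0 < N)%N -> b * radius ^+ k <= Re (proj N k F radius%:c)) -> b <= Re (a k).
Proof.
move=> ha h; have /andP[r0 r1] := radius01; have rk : 0 < radius ^+ k by rewrite exprn_gt0.
apply/ler_addgt0Pr => e e0; have [N0 hN] := coef_extract ha k (ltr01 : 0 < 1 :> R) e0.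
have := hN N0.+1 (leqnSn _) 0; rewrite /= -/radius.
have -> : N0.+1%:R^-1 * \sum_(0 <= j < N0.+1) F (eu (j%:R / N0.+1%:R - 0) * radius%:c) / (eu (j%:R / N0.+1%:R - 0) * radius%:c) ^+ k =
   (radius ^- k)%:c * proj N0.+1 k F radius%:c.
  rewrite /proj [RHS]mulrCA; congr (_ * _); rewrite mulr_sumr; apply: eq_bigr => j _.
  rewrite subr0 exprMn euX invfM -euN fmorphV rmorphXn.
  have -> : k%:R * (j%:R / N0.+1%:R) = (k * j)%:R / N0.+1%:R :> R by rewrite natrM mulrA.
  have aux (x y z : C) : x * (y * z) = z * (y * x) by ring.
  exact: aux.
move=> hn; have := le_trans (Re_le_nrm _) hn; rewrite ReD ReN Re_realM ler_norml => /andP[h1 _].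
have := h N0.+1 isT; rewrite -ler_pdivlMr// mulrC => h2; lra.
Qed.

Lemma coefM_ge p q i j : nonneg_poly p -> nonneg_poly q -> p`_i * q`_j <= (p * q)`_(i + j).
Proof.
move=> hp hq; rewrite coefM; have hi : (i < (i + j).+1)%N by rewrite ltnS leq_addr.
rewrite (bigD1 (Ordinal hi)) //= addKn lerDl sumr_ge0// => l _; exact: mulr_ge0.
Qed.

Lemma nonnegM p q : nonneg_poly p -> nonneg_poly q -> nonneg_poly (p * q).
Proof. by move=> hp hq k; rewrite coefM sumr_ge0// => l _; exact: mulr_ge0. Qed.

Lemma nonneg_sum (s : seq nat) (e : nat -> nat) : nonneg_poly (\sum_(k <- s) 'X^(e k) : {poly R}).
Proof. by move=> k; rewrite coef_sum sumr_ge0// => l _; rewrite coefXn ler0n. Qed.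

Lemma nonneg_prod (s : seq nat) (P : nat -> {poly R}) : (forall k, nonneg_poly (P k)) -> (forall k, 1 <= (P k)`_0) ->
  nonneg_poly (\prod_(k <- s) P k) /\ 1 <= (\prod_(k <- s) P k)`_0.
Proof.
move=> h h0; elim: s => [|k s [IH IH0]].
  by rewrite big_nil; split => [k|]; rewrite coef1 ?ler0n.
rewrite big_cons; split; first exact: nonnegM.
apply: le_trans (coefM_ge 0 0 (h k) IH); rewrite mulr_ege1//.
Qed.

Definition odd_factor (i : nat) : {poly R} := 1 + 'X^((i + i).+1).
Definition geom_factor (d J k : nat) : {poly R} := \sum_(0 <= j < J.+1) 'X^(d * k.+1 * j).

Lemma prod3 (f : nat -> {poly R}) : \prod_(0 <= i < 3) f i = f 0%N * (f 1%N * f 2%N).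
Proof. by rewrite big_ltn // big_ltn // big_nat1. Qed.

Lemma odd_factor_nonneg i : nonneg_poly (odd_factor i).
Proof. by move=> k; rewrite coefD coef1 coefXn addr_ge0. Qed.
Lemma odd_factor0 i : 1 <= (odd_factor i)`_0.
Proof. by rewrite coefD coef1 coefXn lerDl. Qed.
Lemma odd_factor_top i : 1 <= (odd_factor i)`_((i + i).+1).
Proof. by rewrite coefD coef1 coefXn eqxx lerDr. Qed.
Lemma geom_nonneg d J k : nonneg_poly (geom_factor d J k). Proof. exact: nonneg_sum. Qed.
Lemma geom_ge d J k j : (j <= J)%N -> 1 <= (geom_factor d J k)`_(d * k.+1 * j).
Proof.
move=> jJ; rewrite coef_sum (bigD1_seq j) ?iota_uniq ?mem_index_iota//= coefXn eqxx lerDl sumr_ge0// => l _.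
by rewrite coefXn.
Qed.

(** Positivity of the coefficients of T (-X;X^2)/(X^d;X^d), at the exponents
    A + d j where A is a sum of distinct integers among 1, 3, 5. *)
Lemma product_coef_ge a F (T : C -> C) (TN : nat -> {poly R}) (d A j : nat) : (0 < d)%N -> power_series a F ->
  (forall z, 0 < nrm z < 1 -> F z = T z * (eul (- z) / eul (z ^+ 2)) / eul (z ^+ d)) ->
  (forall N, nonneg_poly (TN N)) -> (forall N, 1 <= (TN N.+1)`_0) ->
  (forall z, 0 < nrm z < 1 -> tends (fun N => atC (TN N) z) (T z)) ->
  A \in [:: 0; 1; 3; 6]%N -> 1 <= Re (a (A + d * j)%N).
Proof.
move=> d0 ha FE hT hT0 lT hA; apply: (coef_ge ha) => N N0; rewrite mul1r.
pose P K J : {poly R} := TN K * \prod_(0 <= i < K) odd_factor i * \prod_(0 <= k < K) geom_factor d J k.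
pose S K z : C := atC (TN K) z * oddp (- z) K / eulp (z ^+ d) K.
have lS z : 0 < nrm z < 1 -> tends (S ^~ z) (F z).
  move=> hz; have [_ z1] := andP hz; have m1 : nrm (- z) < 1 by rewrite nrmN.
  have zd : nrm (z ^+ d) < 1 by rewrite nrmX_lt1.
  rewrite FE//; apply: tendsM; last by apply: tendsV (eul_neq0 zd) _; exact: eul_cvg.
  by apply: tendsM; [exact: lT|rewrite -(sqrrN z); exact: oddp_cvg].
have lP K z : 0 < nrm z < 1 -> tends (fun J => atC (P K J) z) (S K z).
  move=> hz; have [_ z1] := andP hz.
  have gE J : atC (P K J) z = atC (TN K) z * oddp (- z) K * \prod_(0 <= k < K) (\sum_(0 <= l < J.+1) ((z ^+ d) ^+ k.+1) ^+ l).
    rewrite /P !atCM !atC_prod; congr (_ * _ * _).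
      apply: eq_bigr => i _; rewrite /odd_factor atCD atC1 atCXn.
      have o : odd (i + i).+1 by rewrite /= addnn odd_double.
      by rewrite exprNn -signr_odd o expr1 mulN1r opprK.
    apply: eq_bigr => k _; rewrite /geom_factor atC_sum; apply: eq_bigr => l _.
    by rewrite atCXn (exprM z (d * k.+1) l) (exprM z d k.+1).
  apply: tends_ext (fun J => esym (gE J)) _; apply: tendsZ.
  have -> : (eulp (z ^+ d) K)^-1 = \prod_(0 <= k < K) (1 - (z ^+ d) ^+ k.+1)^-1 by rewrite prodfV.
  apply: tends_prod => k _; set w := (z ^+ d) ^+ k.+1.
  have hw : 0 < nrm w < 1 by rewrite /w -exprM disc_pow// muln_gt0 d0.
  have [w0 w1] := andP hw.
  have d1 : 1 - w != 0 by rewrite subr_eq0 eq_sym; apply: contraTneq w1 => ->; rewrite nrm1 ltxx.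
  have ps J : \sum_(0 <= l < J.+1) w ^+ l = (1 - w ^+ J.+1) / (1 - w).
    by have := subrX1 w J.+1; rewrite big_mkord -opprB -[w - 1]opprB mulNr => /oppr_inj ->; rewrite mulrC mulKf.
  apply: tends_ext (fun J => esym (ps J)) _.
  have lim0 : tends (fun J => (1 - w ^+ J.+1) / (1 - w)) ((1 - 0) / (1 - w)).
    apply: tendsM; last exact: tends_cst.
    apply: tendsB; first exact: tends_cst.
    move=> e e0; have ge n : 0 <= 1 * nrm w ^+ n by rewrite mul1r exprn_ge0// ltW.
    have r01 : 0 <= nrm w < 1 by rewrite ltW.
    have h1 := sums_bounded_to0 ge (geometric_sums_bounded r01 ler01) e0.
    by case: h1 => M hM; exists M => n hn; rewrite subr0 nrmX -[leLHS]mul1r hM// leqW.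
  by move: lim0; rewrite subr0 mul1r.
have lower K J : (3 <= K)%N -> (j <= J)%N -> 1 <= (P K J)`_(A + d * j) /\ nonneg_poly (P K J).
  move=> K3 jJ; have go k := geom_ge d k (leq0n J); have g0 k : 1 <= (geom_factor d J k)`_0 by have := go k; rewrite muln0.
  have [o1 o2] := nonneg_prod (index_iota 0 K) odd_factor_nonneg odd_factor0.
  have [q1 q2] := nonneg_prod (index_iota 0 K) (geom_nonneg d J) g0.
  have tK : 1 <= (TN K)`_0 by case: K K3 {o1 o2 q1 q2}.
  have oA : 1 <= (\prod_(0 <= i < K) odd_factor i)`_A.
    rewrite (big_cat_nat (leq0n 3) K3)/=.
    have [r1 r2] := nonneg_prod (index_iota 3 K) odd_factor_nonneg odd_factor0.
    have n3 : nonneg_poly (\prod_(0 <= i < 3) odd_factor i) by have [] := nonneg_prod (index_iota 0 3) odd_factor_nonneg odd_factor0.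
    rewrite -[A]addn0; apply: le_trans (coefM_ge A 0 n3 r1); apply: mulr_ege1 => //.
    rewrite prod3.
    have n12 := nonnegM (odd_factor_nonneg 1) (odd_factor_nonneg 2).
    have c i k l : 1 <= (odd_factor 0)`_i -> 1 <= (odd_factor 1)`_k -> 1 <= (odd_factor 2)`_l ->
        1 <= (odd_factor 0 * (odd_factor 1 * odd_factor 2))`_(i + (k + l)).
      move=> h1 h2 h3; apply: le_trans (coefM_ge i (k + l) (odd_factor_nonneg 0) n12); apply: mulr_ege1 => //.
      by apply: le_trans (coefM_ge k l (odd_factor_nonneg 1) (odd_factor_nonneg 2)); apply: mulr_ege1.
    have t0 := odd_factor0; have t1 := odd_factor_top.
    move: hA; rewrite !inE => /or4P[] /eqP ->.
    - exact: (c 0 0 0)%N.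
    - exact: (c 1 0 0 (t1 0) (t0 1) (t0 2))%N.
    - exact: (c 0 3 0 (t0 0) (t1 1) (t0 2))%N.
    - exact: (c 1 0 5 (t1 0) (t0 1) (t1 2))%N.
  have gj : 1 <= (\prod_(0 <= k < K) geom_factor d J k)`_(d * j).
    rewrite big_ltn ?(leq_trans _ K3)//.
    have [r1 r2] := nonneg_prod (index_iota 1 K) (geom_nonneg d J) g0.
    rewrite -[(d * j)%N]addn0; apply: le_trans (coefM_ge (d * j) 0 (geom_nonneg d J 0) r1); apply: mulr_ege1 => //.
    by have := geom_ge d 0 jJ; rewrite muln1.
  have TO := nonnegM (hT K) o1.
  split; last exact: nonnegM.
  apply: le_trans (coefM_ge A (d * j) TO q1); apply: mulr_ege1 => //.
  rewrite -[A]add0n; apply: le_trans (coefM_ge 0 A (hT K) o1); exact: mulr_ege1.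
have /andP[r0 _] := radius01.
apply: (proj_limit_ge lS); exists 3%N => K K3.
apply: (proj_limit_ge (lP K)); exists j => J jJ.
have [l1 l2] := lower K J K3 jJ.
by apply: le_trans (proj_poly_ge _ N0 l2); rewrite ler_peMl// exprn_ge0// ltW.
Qed.

(** Partial sums of a theta-like series, as polynomials. *)
Definition theta_poly (e : int -> nat) N : {poly R} := \sum_(0 <= k < N) ('X^(e k%:Z) + 'X^(e (- k.+1%:Z))).

Lemma theta_poly_nonneg e N : nonneg_poly (theta_poly e N).
Proof. by move=> k; rewrite coef_sum sumr_ge0// => l _; rewrite coefD !coefXn addr_ge0. Qed.

Lemma theta_poly0 e N : (e (Posz 0) == 0)%N || (e (Negz 0) == 0)%N -> 1 <= (theta_poly e N.+1)`_0.
Proof.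
move=> h; rewrite coef_sum big_ltn // coefD !coefXn.
have s0 : 0 <= \sum_(1 <= i < N.+1) ('X^(e i%:Z) + 'X^(e (- i.+1%:Z)) : {poly R})`_0.
  by rewrite sumr_ge0// => l _; rewrite coefD !coefXn addr_ge0.
have a : 1 <= (0%N == e (Posz 0))%:R + (0%N == e (Negz 0))%:R :> R.
  move: h; rewrite (eq_sym (e (Posz 0))) (eq_sym (e (Negz 0))).
  by case: (0%N == e (Posz 0)) => /= [_|->]; rewrite ?lerDl ?ler0n// add0r.
exact: (ler_wpDr s0 a).
Qed.

Lemma theta_poly_tends e z l : zcv (fun i => z ^+ e i) l -> tends (fun N => atC (theta_poly e N) z) l.
Proof.
apply: tends_ext => N; rewrite /theta_poly atC_sum; apply: eq_bigr => k _.
by rewrite atCD !atCXn.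
Qed.

Lemma theta_coef_ge a F (T : C -> C) (e : int -> nat) (d A j : nat) : (0 < d)%N -> power_series a F ->
  (forall z, 0 < nrm z < 1 -> F z = T z * (eul (- z) / eul (z ^+ 2)) / eul (z ^+ d)) ->
  (e (Posz 0) == 0)%N || (e (Negz 0) == 0)%N -> (forall z, 0 < nrm z < 1 -> zcv (fun i => z ^+ e i) (T z)) ->
  A \in [:: 0; 1; 3; 6]%N -> 1 <= Re (a (A + d * j)%N).
Proof.
move=> d0 ha FE e0 hT hA; apply: (product_coef_ge j d0 ha FE (theta_poly_nonneg e)) => // [N|z hz].
  exact: theta_poly0.
exact/theta_poly_tends/hT.
Qed.

Lemma ps_twist a F : power_series a F -> power_series (fun n => (-1) ^+ n * a n) (fun z => F (- z)).
Proof.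
move=> h z hz; have hN : 0 < nrm (- z) < 1 by rewrite nrmN.
apply: tends_ext (h (- z) hN) => N; apply: eq_bigr => l _.
by rewrite (exprNn z) mulrCA mulrA.
Qed.

Lemma psZ k a F : power_series a F -> power_series (fun n => k * a n) (fun z => k * F z).
Proof.
move=> h z hz; apply: tends_ext (tendsZ k (h z hz)) => N.
by rewrite mulr_sumr; apply: eq_bigr => l _; rewrite mulrA.
Qed.

(** z K(z^2) contributes nothing to the even classes. *)
Lemma proj_even_odd t s (K : C -> C) z : (0 < t)%N -> proj (2 * t) (2 * s) (fun w => w * K (w ^+ 2)) z = 0.
Proof.
move=> t0; have tn : t%:R != 0 :> R by rewrite pnatr_eq0 -lt0n.
have tt : t%:R + t%:R != 0 :> R by rewrite -mulr2n mulrn_eq0.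
have dbl (f : nat -> C) : \sum_(0 <= h < t + t) f h = \sum_(0 <= h < t) (f h + f (h + t)%N).
  rewrite (big_cat_nat (leq0n _) (leq_addr t t)) big_split; congr (_ + _).
  by have := @big_addn C 0 +%R 0%N (t + t)%N t xpredT f; rewrite add0n addnK.
have -> : (2 * t = t + t)%N by rewrite mul2n addnn.
rewrite /proj dbl big1 ?mulr0// => h _ /=.
have e : eu ((h + t)%:R / (t + t)%:R) = - eu (h%:R / (t + t)%:R) :> C.
  have -> : (h + t)%:R / (t + t)%:R = h%:R / (t + t)%:R + 1 / 2 :> R.
    by rewrite !natrD; field; rewrite ?tt ?pnatr_eq0 ?tn.
  by rewrite euD (_ : eu (1 / 2) = -1 :> C) ?mulrN1//; exact: eu_half.
have e2 : eu (- ((2 * s * (h + t))%:R / (t + t)%:R)) = eu (- ((2 * s * h)%:R / (t + t)%:R)) :> C.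
  rewrite -(eu_addZ (- ((2 * s * h)%:R / (t + t)%:R)) (- s%:Z)); congr eu.
  by rewrite rmorphN /= -pmulrn !(natrM, natrD); field; rewrite ?tt ?pnatr_eq0 ?tn.
rewrite e e2 mulNr sqrrN mulNr mulrN; exact: subrr.
Qed.

Lemma proj_mono_fun t s r (H : C -> C) z : (0 < t)%N -> proj t r (fun w => w ^+ s * H (w ^+ t)) z =
  (if (s == r %[mod t])%N then z ^+ s else 0) * H (z ^+ t).
Proof. by move=> t0; rewrite (projM r (fun w => w ^+ s) H z t0) projX. Qed.

End Positivity.

Local Opaque phi psi psi0 psi1.

Section EvenClasses.
Variable R : realType.
Local Notation C := (R[i]%C).
Notation ps c t m := (power_series (fun l => (c l)%:~R : C) (eta_quot t m)).

Lemma Re_int (x : int) : Re (x%:~R : C) = x%:~R.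
Proof. by rewrite -(rmorph_int (real_complex R)). Qed.

Lemma twist_sg (x : int) n : 1 <= Re ((-1) ^+ n * x%:~R : C) -> Num.sg x = (-1) ^+ n.
Proof.
have eC : (-1) ^+ n = (-1) ^+ odd n :> C by rewrite signr_odd.
have eZ : (-1) ^+ n = (-1) ^+ odd n :> int by rewrite signr_odd.
rewrite eC eZ; case: (odd n); rewrite ?expr1 ?expr0 ?mulN1r ?mul1r ?ReN Re_int => h.
  have : 1 <= (- x)%:~R :> R by rewrite rmorphN. 
  by rewrite ler1z => h1; apply: ltr0_sg; lia.
by move: h; rewrite ler1z => h1; apply: gtr0_sg; lia.
Qed.

Lemma signs_4_4 c : ps c 4 4 -> forall n, Num.sg (c (4 * n)%N) = (-1) ^+ n /\ Num.sg (c (4 * n + 2)%N) = (-1) ^+ n.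
Proof.
move=> hc n.
pose H0 (X : C) := phi (X ^+ 2) * eul X / eul (X ^+ 2) ^+ 2.
pose H2 (X : C) := 2%:R * psi (X ^+ 4) * eul X / eul (X ^+ 2) ^+ 2.
pose K (y : C) := - (4%:R * psi (y ^+ 2) ^+ 2 * (eul y ^+ 2 / eul (y ^+ 2) ^+ 4)).
have sp z : 0 < nrm z < 1 -> eta_quot 4 4 z = z ^+ 0 * H0 (z ^+ 4) + z ^+ 2 * H2 (z ^+ 4) + z * K (z ^+ 2).
  by move=> hz; rewrite (split_4_4 hz) /H0 /H2 /K -!exprM mul1r mulrN.
have pj r z : (r \in [:: 0; 2])%N -> 0 < nrm z < 1 -> proj 4 r (eta_quot 4 4) z = z ^+ r * (if r == 0%N then H0 else H2) (z ^+ 4).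
  move=> hr hz; rewrite (proj_ext 4 r hz sp) !projD !proj_mono_fun//.
  have := @proj_even_odd R 2 r./2 K z isT.
  by move: hr; rewrite !inE => /orP[] /eqP -> /= ->; rewrite mul0r ?addr0 ?add0r.
have s0 := ps_section (isT : 0 < 4)%N hc (fun z => @pj 0%N z isT).
have s2 := ps_section (isT : 2 < 4)%N hc (fun z => @pj 2%N z isT).
have m1 (z : C) : eul z = eul (- - z) by rewrite opprK.
have hA : exists A j, A \in [:: 0; 1; 3; 6]%N /\ n = (A + 2 * j)%N.
  by exists (n %% 2)%N, (n %/ 2)%N; split; [have := ltn_pmod n (isT : 0 < 2)%N; case: (n %% 2)%N => [|[|]]|lia].
have [A [j [hA' nE]]] := hA.
have n2 : 2%:R != 0 :> C by rewrite pnatr_eq0.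
have aux (x y w : C) : x * y / w ^+ 2 = x * (y / w) / w by rewrite expr2 invfM !mulrA.
have aux2 (x y w : C) : 2%:R^-1 * (2%:R * x * y / w ^+ 2) = x * (y / w) / w.
  by rewrite -!mulrA mulKf// expr2 invfM.
have FE0 z : 0 < nrm z < 1 -> H0 (- z) = phi (z ^+ 2) * (eul (- z) / eul (z ^+ 2)) / eul (z ^+ 2).
  move=> _; rewrite /H0 sqrrN; exact: aux.
have hT0 (z : C) : 0 < nrm z < 1 -> zcv (fun i => z ^+ (2 * absz (i * i)%R)%N) (phi (z ^+ 2)).
  by move=> hz; apply: zcv_ext (phi_cv (disc_pow (isT : 0 < 2)%N hz)) => i; rewrite -exprM.
have r0 := theta_coef_ge (d := 2) (T := fun z : C => phi (z ^+ 2)) j isT (ps_twist s0) FE0 (e := fun i => (2 * absz (i * i)%R)%N) isT hT0 hA'.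
have {}r0 : 1 <= Re ((-1) ^+ n * (c (4 * n)%N)%:~R : C) by move: r0; rewrite -nE addn0.
have FE2 z : 0 < nrm z < 1 -> 2%:R^-1 * H2 (- z) = psi (z ^+ 4) * (eul (- z) / eul (z ^+ 2)) / eul (z ^+ 2).
  have n4 : (- z) ^+ 4 = z ^+ 4 by ring.
  move=> _; rewrite /H2 sqrrN n4; exact: aux2.
have hT2 (z : C) : 0 < nrm z < 1 -> zcv (fun i => z ^+ (4 * tria i)%N) (psi (z ^+ 4)).
  by move=> hz; apply: zcv_ext (psi_cv (disc_pow (isT : 0 < 4)%N hz)) => i; rewrite -exprM.
have r2 := theta_coef_ge (d := 2) (T := fun z : C => psi (z ^+ 4)) j isT (psZ 2%:R^-1 (ps_twist s2)) FE2 (e := fun i => (4 * tria i)%N) isT hT2 hA'.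
have {}r2 : 1 <= Re (2%:R^-1 * ((-1) ^+ n * (c (4 * n + 2)%N)%:~R) : C) by move: r2; rewrite -nE.
have {}r2 : 1 <= Re ((-1) ^+ n * (c (4 * n + 2)%N)%:~R : C).
  by move: r2; rewrite -(rmorph_nat (real_complex R)) -fmorphV Re_realM => h3; lra.
split; [exact: twist_sg r0|exact: twist_sg r2].
Qed.

Lemma signs_8_2 c : ps c 8 2 -> forall n, (3 <= n)%N -> Num.sg (c (4 * n)%N) = 1 /\ Num.sg (c (4 * n + 2)%N) = -1.
Proof.
move=> hc n n3.
pose W (X : C) := eul (- X) / eul (X ^+ 2) / eul (X ^+ 4).
pose H0 (X : C) := psi0 X * W X.
pose H2 (X : C) := - (psi1 X * W X).
pose K (y : C) := - (2%:R * psi (y ^+ 4) * (eul y / eul (y ^+ 4) ^+ 2)).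
have sp z : 0 < nrm z < 1 -> eta_quot 8 2 z = z ^+ 0 * H0 (z ^+ 4) + z ^+ 2 * H2 (z ^+ 4) + z * K (z ^+ 2).
  by move=> hz; rewrite (split_8_2 hz) /H0 /H2 /K /W -!exprM mul1r !mulrN.
have pj r z : (r \in [:: 0; 2])%N -> 0 < nrm z < 1 -> proj 4 r (eta_quot 8 2) z = z ^+ r * (if r == 0%N then H0 else H2) (z ^+ 4).
  move=> hr hz; rewrite (proj_ext 4 r hz sp) !projD !proj_mono_fun//.
  have := @proj_even_odd R 2 r./2 K z isT.
  by move: hr; rewrite !inE => /orP[] /eqP -> /= ->; rewrite mul0r ?addr0 ?add0r.
have s0 := ps_section (isT : 0 < 4)%N hc (fun z => @pj 0%N z isT).
have s2 := ps_section (isT : 2 < 4)%N hc (fun z => @pj 2%N z isT).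
have [A [j [hA nE]]] : exists A j, A \in [:: 0; 1; 3; 6]%N /\ n = (A + 4 * j)%N.
  have [e|[e|[e|e]]] : (n %% 4 = 0 \/ n %% 4 = 1 \/ n %% 4 = 3 \/ n %% 4 = 2)%N by lia.
  - by exists 0%N, (n %/ 4)%N; split => //; lia.
  - by exists 1%N, (n %/ 4)%N; split => //; lia.
  - by exists 3%N, (n %/ 4)%N; split => //; lia.
  - by exists 6%N, ((n - 6) %/ 4)%N; split => //; lia.
have aux (x u v w : C) : x * (u / v / w) = x * (u / v) / w by rewrite !mulrA.
have cut (T : C -> C) z : T z * W z = T z * (eul (- z) / eul (z ^+ 2)) / eul (z ^+ 4).
  rewrite /W; exact: aux.
have r0 := theta_coef_ge (d := 4) (T := @psi0 R) j isT s0 (fun z _ => cut (@psi0 R) z) (e := fun i => absz (i * (4 * i + 1))) isT (fun z hz => psi0_cv hz) hA.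
have cut2 z : 0 < nrm z < 1 -> -1 * H2 z = psi1 z * (eul (- z) / eul (z ^+ 2)) / eul (z ^+ 4).
  have aux3 (x u v w : C) : -1 * - (x * (u / v / w)) = x * (u / v) / w by rewrite mulN1r opprK !mulrA.
  move=> _; rewrite /H2 /W; exact: aux3.
have r2 := theta_coef_ge (d := 4) (T := @psi1 R) j isT (psZ (-1) s2) cut2 (e := fun i => absz (4 * i * i + 5 * i + 1)) isT (fun z hz => psi1_cv hz) hA.
have {}r0 : 1 <= Re (1 * (c (4 * n)%N)%:~R : C) by move: r0; rewrite -nE addn0 mul1r.
have {}r2 : 1 <= Re (-1 * (c (4 * n + 2)%N)%:~R : C) by move: r2; rewrite -nE.
split; first by have := @twist_sg (c (4 * n)%N) 0; rewrite !expr0 => h; exact: h r0.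
by have := @twist_sg (c (4 * n + 2)%N) 1; rewrite !expr1 => h; exact: h r2.
Qed.

End EvenClasses.

End EvenSections.
Import EvenSections.

(** * Least periods *)

Module SignPeriodTheory.

Local Opaque cexp eu.

Section SignPeriods.

Definition evper (a : nat -> int) T := exists N, forall n, (N <= n)%N -> Num.sg (a n) = Num.sg (a (n + T)%N).

Lemma evper_mul a T k : evper a T -> evper a (k * T).
Proof.
move=> [N h]; exists N => n hn; elim: k => [|k IH]; first by rewrite addn0.
rewrite IH (h (n + k * T)%N) ?(leq_trans hn) ?leq_addr//.
by congr (Num.sg (a _)); rewrite mulSn; lia.
Qed.

Lemma evper_dvd a T T' : (T %| T')%N -> evper a T -> evper a T'.
Proof. by move=> /dvdnP[k ->]; exact: evper_mul. Qed.

Lemma evper_gcd a T T' : (0 < T)%N -> evper a T -> evper a T' -> evper a (gcdn T T').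
Proof.
move=> T0 h h'; case: (egcdnP T' T0) => u v e _.
have [N hN] := evper_mul u h; have [N' hN'] := evper_mul v h'.
exists (maxn N N') => n; rewrite geq_max => /andP[n1 n2].
rewrite (hN n n1) e (hN' (n + gcdn T T')%N) ?(leq_trans n2) ?leq_addr//.
by congr (Num.sg (a _)); lia.
Qed.

Lemma sign_periodE a T : sign_period a T <-> (0 < T)%N /\ evper a T.
Proof.
split=> [[T0 [N _ h]]|[T0 [N h]]]; first by split => //; exists N => n hn; exact: h.
by split => //; exists N.
Qed.

(** To find the least period it is enough to exclude the proper divisors. *)
Lemma least_of_gcd a T : (0 < T)%N -> evper a T ->
  (forall g, (g %| T)%N -> (g < T)%N -> ~ evper a g) -> least_sign_period a T.
Proof.
move=> T0 h hg; split; first by apply/sign_periodE.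
move=> T' /sign_periodE[T'0 h']; rewrite leqNgt; apply/negP => lt.
apply: (hg (gcdn T T')) => //; first exact: dvdn_gcdl.
- by rewrite (leq_ltn_trans _ lt)// dvdn_leq// dvdn_gcdr.
- exact: evper_gcd.
Qed.

Lemma least_dvd a T T' : least_sign_period a T -> evper a T' -> (0 < T')%N -> (T <= T')%N.
Proof. by move=> [_ h] e T0; apply: h; apply/sign_periodE. Qed.

End SignPeriods.

Section Bridge.
Variable R : realType.
Local Notation C := (R[i]%C).
Implicit Types (q : C).

Lemma normc_nrm q : `|q| = (nrm q)%:c. Proof. by []. Qed.

Let K : numFieldType := R[i]%C.

Lemma tends_cvg (u : nat -> K) (l : K) : tends (u : nat -> C) (l : C) <-> u N @[N --> \oo] --> l.
Proof.
split=> [h|/cvgrPdist_le h e e0].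
  apply/cvgrPdist_le => e; rewrite ltcE => /andP[/eqP ie re].
  have [N hN] := h (Re e) re; exists N => // n hn /=.
  by rewrite distrC normc_nrm lecE ie /= eqxx hN.
have [|N _ hN] := h (e%:c : K); first by rewrite ltcE /= eqxx.
by exists N => n hn; have := hN n hn; rewrite /= distrC normc_nrm lecR.
Qed.

Lemma qpoch_eul q : nrm q < 1 -> qpoch q q = eul q.
Proof.
move=> q1; rewrite /qpoch; apply/cvg_lim; first exact: norm_hausdorff.
apply/tends_cvg; apply: tends_ext (eul_cvg q1) => N.
by apply: eq_bigr => k _; rewrite exprS.
Qed.

Lemma ps_of_coef t m (c : nat -> int) : (0 < t)%N -> is_coef C t m c ->
  power_series (fun l => (c l)%:~R : C) (eta_quot t m).
Proof.
move=> t0 hc q /andP[q0 q1].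
have q1' : `|q| < 1 by rewrite normc_nrm ltcR.
have := hc q q1'; rewrite !qpoch_eul ?nrmX_lt1// -expr_div_n => /tends_cvg.
by apply: tends_ext => N; rewrite seriesEnat.
Qed.

Lemma ps_monom (k : C) e : power_series (fun n => if n == e then k else 0) (fun q => k * q ^+ e).
Proof.
move=> q hq; apply: (@tends_ext_near _ e.+1 (fun=> k * q ^+ e)) (tends_cst _) => N hN.
rewrite (eq_bigr (fun l => if l == e then k * q ^+ e else 0)) => [|l _]; last by case: eqP => [->|]; rewrite ?mul0r.
by rewrite -big_mkcond big_nat1_eq /= hN.
Qed.

End Bridge.

Section LeastPeriods.
Variable R : realType.
Local Notation C := (R[i]%C).
Notation ps c t m := (power_series (fun l => (c l)%:~R : C) (eta_quot t m)).

Lemma intC_inj (x y : int) : x%:~R = y%:~R :> C -> x = y. Proof. exact: intr_inj. Qed.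

Lemma sg_int (x : int) : Num.sg (x%:~R : R) = (Num.sg x)%:~R.
Proof.
have [x0|x0|->] := ltrgt0P x; last by rewrite !sgr0.
- by rewrite !gtr0_sg ?ltr0z.
- by rewrite !ltr0_sg ?ltrz0.
Qed.

Lemma sg_transfer (x y : int) : Num.sg (x%:~R : R) = Num.sg (y%:~R : R) -> Num.sg x = Num.sg y.
Proof. by rewrite !sg_int => /intr_inj. Qed.

Section Case.
Variables (t m : nat) (c : nat -> int).
Hypotheses (t1 : (1 < t)%N) (m0 : (0 < m)%N) (htm : (m * (t - 1) <= 24)%N) (hc : ps c t m).

Definition vanishes r := exists N, forall n, (N <= n)%N -> n = r %[mod t] -> c n = 0.

Lemma class_sign r : (r %% t)%N \notin zeros t m ->
  exists N, forall n, (N <= n)%N -> n = r %[mod t] -> Num.sg ((c n)%:~R : R) = Num.sg (Re (cusp_sum R t m r)).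
Proof.
move=> hr; apply: sign_main => //.
rewrite -(cusp_sum_mod R m (n := (r %% t)%N)) ?modn_mod ?(ltnW t1)//.
by apply: cusp_sum_neq0 => //; rewrite ltn_mod ltnW.
Qed.

Lemma class_const r : (r %% t)%N \notin zeros t m \/ vanishes r ->
  exists N, forall n n', (N <= n)%N -> (N <= n')%N -> n = r %[mod t] -> n' = r %[mod t] -> Num.sg (c n) = Num.sg (c n').
Proof.
case=> [hr|[N h]].
  have [N h] := class_sign hr; exists N => n n' hn hn' e e'.
  by apply: sg_transfer; rewrite !h.
by exists N => n n' hn hn' e e'; rewrite !h.
Qed.

Lemma evper_of_classes (T : nat) (P : nat -> Prop) : (t %| T)%N ->
  (forall r, (r < t)%N -> r \notin zeros t m \/ vanishes r \/
     exists N, forall n, (N <= n)%N -> n = r %[mod t] -> Num.sg (c n) = Num.sg (c (n + T)%N)) -> evper c T.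
Proof.
move=> /dvdnP[k Tk] H; have t0 : (0 < t)%N := ltnW t1.
have K r : (r < t)%N -> exists N, forall n, (N <= n)%N -> n = r %[mod t] -> Num.sg (c n) = Num.sg (c (n + T)%N).
  move=> rt; have [h|[h|//]] := H r rt.
    have h' : (r %% t)%N \notin zeros t m by rewrite modn_small.
    have [N hN] := class_const (or_introl h').
      exists N => n hn e; apply: hN => //; first by rewrite (leq_trans hn)// leq_addr.
      by rewrite Tk addnC modnMDl.
  have [N hN] := class_const (or_intror h).
  exists N => n hn e; apply: hN => //; first by rewrite (leq_trans hn)// leq_addr.
  by rewrite Tk addnC modnMDl.
have U s : (s <= t)%N -> exists N, forall n, (N <= n)%N -> (n %% t < s)%N -> Num.sg (c n) = Num.sg (c (n + T)%N).
  elim: s => [|s IH] st; first by exists 0%N.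
  have [N hN] := IH (ltnW st); have [N' hN'] := K s st.
  exists (maxn N N') => n; rewrite geq_max => /andP[n1 n2]; rewrite ltnS leq_eqVlt => /orP[/eqP e|e].
    by apply: hN' => //; rewrite e modn_small.
  exact: hN.
have [N hN] := U t (leqnn t); exists N => n hn; apply: hN => //; by rewrite ltn_mod.
Qed.

(** A proper divisor g of t cannot be a period: the leading constants would all
    have the same sign on a class modulo g, while their sum is zero. *)
Lemma not_period g r0 : (g %| t)%N -> (g < t)%N -> (r0 %% t)%N \notin zeros t m ->
  (forall j, ((r0 + j * g) %% t)%N \notin zeros t m \/ vanishes (r0 + j * g)) -> ~ evper c g.
Proof.
move=> gt glt hr0 H hg; have t0 : (0 < t)%N := ltnW t1.
set s0 := Num.sg (Re (cusp_sum R t m r0)).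
have A0 : Re (cusp_sum R t m r0) != 0.
  rewrite -(cusp_sum_mod R m (n := (r0 %% t)%N)) ?modn_mod//.
  by apply: cusp_sum_neq0 => //; rewrite ltn_mod.
have [N0 h0] := class_sign hr0.
have all_j j : s0 = Num.sg (Re (cusp_sum R t m (r0 + j * g))).
  have [N1 h1] := evper_mul j hg.
  have big M : exists2 n, (M <= n)%N & n = r0 %[mod t].
    exists (M * t + r0)%N; last by rewrite modnMDl.
    by rewrite (leq_trans _ (leq_addr _ _))// leq_pmulr.
  have [h|[N2 h2]] := H j.
    have [N2 h2] := class_sign h.
    have [n nM nr] := big (maxn N0 (maxn N1 N2)); move: nM; rewrite !geq_max => /and3P[n0 n1 n2].
    rewrite -(h2 (n + j * g)%N) ?(leq_trans n2) ?leq_addr//; last by rewrite -modnDml nr modnDml.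
    by rewrite /s0 -(h0 n)// !sg_int h1.
  have [n nM nr] := big (maxn N0 (maxn N1 N2)); move: nM; rewrite !geq_max => /and3P[n0 n1 n2].
  exfalso; have := h0 n n0 nr; rewrite sg_int (h1 n n1) h2; last by rewrite -modnDml nr modnDml.
    by rewrite sgr0 => /esym/eqP; rewrite sgr_eq0 (negPf A0).
  by rewrite (leq_trans n2)// leq_addr.
have S0 := cusp_sum_classes R m r0 t0 gt glt.
have tg : (0 < t %/ g)%N by rewrite divn_gt0 ?(dvdn_gt0 t0 gt)// ltnW.
have pos j : 0 < s0 * Re (cusp_sum R t m (r0 + j * g)).
  by rewrite (all_j j) -normrEsg normr_gt0 -sgr_eq0 -(all_j j) sgr_eq0.
have : 0 < s0 * Re (\sum_(0 <= j < t %/ g) cusp_sum R t m (r0 + j * g)).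
  rewrite Re_sum mulr_sumr big_ltn// ltr_pwDl ?pos// sumr_ge0// => j _; exact: ltW.
by rewrite S0 mulr0 ltxx.
Qed.

Lemma least_generic : (forall r, (r < t)%N -> r \in zeros t m -> vanishes r) ->
  has (fun r => r \notin zeros t m) (iota 0 t) -> least_sign_period c t.
Proof.
move=> hz /hasP[r0]; rewrite mem_iota /= add0n => r0t r0z; have t0 : (0 < t)%N := ltnW t1.
have hv r : (r %% t)%N \notin zeros t m \/ vanishes r.
  case: (boolP ((r %% t)%N \in zeros t m)) => h; last by left.
  right; have [N hN] := hz _ (ltn_pmod r t0) h; exists N => n hn e; apply: hN => //.
  by rewrite modn_mod.
apply: least_of_gcd => // [|g gt glt].
  apply: (evper_of_classes (fun=> True) (dvdnn t)) => r rt.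
  by have [|] := hv r; rewrite modn_small//; [left|right; left].
apply: (@not_period g r0) => //; by rewrite modn_small.
Qed.

Lemma vanishes_proj r : (forall q, 0 < nrm q < 1 -> proj t r (eta_quot t m) q = 0 :> C) -> vanishes r.
Proof.
move=> h; exists 0%N => n _ e; have t0 : (0 < t)%N := ltnW t1.
have := ps_coef0 (ps_proj r t0 hc) h n; rewrite e eqxx.
by move=> z; apply: intC_inj.
Qed.

Lemma vanishes_monom r (k : C) : (forall q, 0 < nrm q < 1 -> proj t r (eta_quot t m) q = k * q :> C) -> vanishes r.
Proof.
move=> h; exists 2%N => n n2 e; have t0 : (0 < t)%N := ltnW t1.
have := ps_unique (ps_proj r t0 hc) (ps_monom k 1) (fun q hq => etrans (h q hq) (congr1 (fun x => k * x) (esym (expr1 q)))) n.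
rewrite e eqxx gtn_eqF// => z; exact: intC_inj.
Qed.

End Case.

Definition pent_free t r := all (fun k => (pent0 k != r %[mod t])%N && (pent1 k != r %[mod t])%N) (iota 0 (2 * t)).
Definition tri_free t r := all (fun k => ('C(k.+1, 2) != r %[mod t])%N) (iota 0 (2 * t)).

Lemma eulX_neq0 t m q : (0 < t)%N -> 0 < nrm q < 1 -> eul (q ^+ t) ^+ m != 0 :> C.
Proof. by move=> t0 /andP[_ q1]; rewrite expf_neq0// eul_neq0// nrmX_lt1. Qed.

Lemma zeros_pent : all (fun t => all (fun r => ((t == 25) && (r == 1)) || pent_free t r) (zeros t 1)) (iota 2 24).
Proof. by vm_compute. Qed.
Lemma zeros_tri : all (fun t => all (fun r => ((t == 9) && (r == 1)) || ((t == 8) && false) || tri_free t r) (zeros t 3)) (iota 2 8).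
Proof. by vm_compute. Qed.

Lemma zeros_vanish t m c r : (1 < t)%N -> (0 < m)%N -> (m * (t - 1) <= 24)%N -> ps c t m ->
  (t, m) \notin [:: (3, 9); (4, 4); (5, 5); (8, 2)]%N -> r \in zeros t m -> vanishes t c r.
Proof.
move=> t1 m0 htm hc ex rz.
have t0 := ltnW t1.
have [m1|m1] := eqVneq m 1%N.
  subst m; have ti : t \in iota 2 24 by rewrite mem_iota t1; lia.
  have := allP (allP zeros_pent t ti) r rz => /orP[/andP[/eqP tE /eqP rE]|pf].
    subst t r; apply: (vanishes_monom t1 hc (k := -1)) => q hq.
    have e25 := eulX_neq0 1 (isT : 0 < 25)%N hq.
    rewrite (proj_eta t0 hq (x := - q * eul (q ^+ 25))).
      by rewrite expr1 in e25 *; rewrite mulfK// mulN1r.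
    by rewrite -proj_eul_25.
  apply: (vanishes_proj t1 hc) => q hq; rewrite (proj_eta t0 hq (x := 0)) ?mul0r//.
  exact: (proj_eul0 t0 hq pf).
have [m3|m3] := eqVneq m 3%N.
  subst m; have ti : t \in iota 2 8 by rewrite mem_iota t1; lia.
  have := allP (allP zeros_tri t ti) r rz; rewrite andbF orbF => /orP[/andP[/eqP tE /eqP rE]|pf].
    subst t r; apply: (vanishes_monom t1 hc (k := - 3%:R)) => q hq.
    have e9 := eulX_neq0 3 (isT : 0 < 9)%N hq.
    by rewrite (proj_eta t0 hq (proj_cube_9 hq)) mulfK.
  apply: (vanishes_proj t1 hc) => q hq.
  by rewrite (proj_eta t0 hq (proj_cube0 t0 hq pf)) mul0r.
have [/andP[/eqP tE /eqP mE]|nm] := boolP ((t == 4) && (m == 8)).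
  subst t m; exists 2%N => n n2 nr.
  have hN : power_series (fun l => (-1) ^+ l * (c l)%:~R : C) (fun q => eta_quot 4 8 (- q)).
    move=> q hq; have hq' : 0 < nrm (- q) < 1 by rewrite nrmN.
    apply: tends_ext (hc (- q) hq') => N; apply: eq_bigr => l _.
    by rewrite (exprNn q) mulrCA mulrA.
  have := ps_unique (psB hc hN) (ps_monom (- 16%:R) 1) (fun q hq => etrans (eta_4_8_odd hq) (congr1 (fun x => - 16%:R * x) (esym (expr1 q)))) n.
  rewrite gtn_eqF//.
  have on : odd n by move: rz; rewrite !inE => /orP[/eqP rE|/eqP rE]; subst r; lia.
  rewrite -signr_odd on expr1 mulN1r opprK -mulr2n -mulr_natl => /eqP.
  by rewrite mulf_eq0 pnatr_eq0 /= => /eqP z; apply: intC_inj.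
exfalso; clear hc; move: ex rz nm m1 m3 htm m0; rewrite !inE !xpair_eqE.
move: m => [|[|[|[|[|[|[|[|[|[|m]]]]]]]]]] //; move: t {t1 t0} => [|[|[|[|[|[|[|[|[|t]]]]]]]]] //.
Qed.

Lemma least_plain t m c : (1 < t)%N -> (0 < m)%N -> (m * (t - 1) <= 24)%N -> ps c t m ->
  (t, m) \notin [:: (3, 9); (4, 4); (5, 5); (8, 2)]%N -> least_sign_period c t.
Proof.
move=> t1 m0 htm hc ex; apply: (least_generic t1 m0 htm hc) => [r _|]; first exact: zeros_vanish.
have ok : all (fun m => all (fun t => has (fun r => r \notin zeros t m) (iota 0 t)) (iota 2 24)) (iota 1 24) by vm_compute.
have mi : m \in iota 1 24 by rewrite mem_iota m0; nia.
have ti : t \in iota 2 24 by rewrite mem_iota t1; nia.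
exact: (allP (allP ok m mi) t ti).
Qed.

(** If the class of 0 reproduces the signs of a sequence of least period p, the
    period p is multiplied by p. *)
Lemma least_square p m c : prime p -> (1 < p)%N -> (0 < m)%N -> (m * (p - 1) <= 24)%N -> ps c p m ->
  zeros p m = [:: 0%N] -> least_sign_period (fun n => c (p * n + 0)%N) p -> least_sign_period c (p ^ 2)%N.
Proof.
move=> pp p1 m0 htm hc hz hl; have p0 := prime_gt0 pp.
have [/sign_periodE[_ [N hN]] _] := hl.
apply: least_of_gcd; first by rewrite expn_gt0 p0.
  apply: (evper_of_classes p1 m0 htm hc (fun=> True)); first by rewrite expnS dvdn_mulr.
  move=> r rp; rewrite hz !inE; have [->|r0] := eqVneq r 0%N; last by left.
  right; right; exists (p * N)%N => n hn; rewrite mod0n => /eqP; rewrite -/(p %| n)%N => /dvdnP[k kE].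
  have := hN k; rewrite !addn0 mulnDr mulnn kE mulnC => -> //.
  by rewrite -(leq_pmul2l p0) [(p * k)%N]mulnC -kE.
move=> g /(dvdn_pfactor g 2 pp)[e e2 ->] lt hg.
have e1 : (e <= 1)%N by move: lt; rewrite ltn_exp2l.
have {}hg : evper c p by apply: evper_dvd hg; rewrite -{2}[p]expn1 dvdn_exp2l.
have [M hM] := hg.
have h1 : evper (fun n => c (p * n + 0)%N) 1.
  exists M => n hn; rewrite !addn0 mulnDr muln1; apply: hM; rewrite (leq_trans hn)// leq_pmull//.
by have := least_dvd hl h1 isT; rewrite leqNgt p1.
Qed.

Lemma least_4_4 c : ps c 4 4 -> least_sign_period c 8.
Proof.
move=> hc; have t1 : (1 < 4)%N by []. have S := signs_4_4 hc.
apply: least_of_gcd => // [|g g8 glt hg].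
  apply: (evper_of_classes t1 (isT : 0 < 4)%N (isT : 4 * (4 - 1) <= 24)%N hc (fun=> True) (isT : 4 %| 8)%N).
  move=> r r4; case: (boolP (r \in zeros 4 4)) => [|h]; last by left.
  rewrite !inE => /orP[] /eqP ->; right; right; exists 0%N => n _ hn.
    have nE : n = (4 * (n %/ 4))%N by lia.
    have n8 : (n + 8 = 4 * (n %/ 4 + 2))%N by lia.
    by rewrite n8 {1}nE !(S _).1 exprD mulr1.
  have nE : n = (4 * (n %/ 4) + 2)%N by lia.
  have n8 : (n + 8 = 4 * (n %/ 4 + 2) + 2)%N by lia.
  by rewrite n8 {1}nE !(S _).2 exprD mulr1.
have g4 : (g %| 4)%N by move: g8 glt; move: g {hg} => [|[|[|[|[|[|[|[|g]]]]]]]].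
have [N hN] := evper_dvd g4 hg.
have h1 : (N <= 4 * N.*2)%N by lia.
have e4 : (4 * N.*2 + 4 = 4 * N.*2.+1)%N by lia.
by have := hN _ h1; rewrite e4 !(S _).1 exprS -signr_odd odd_double.
Qed.

Lemma least_8_2 c : ps c 8 2 -> least_sign_period c 8.
Proof.
move=> hc; have t1 : (1 < 8)%N by []. have S := signs_8_2 hc.
apply: least_of_gcd => // [|g g8 glt hg].
  apply: (evper_of_classes t1 (isT : 0 < 2)%N (isT : 2 * (8 - 1) <= 24)%N hc (fun=> True) (isT : 8 %| 8)%N).
  move=> r r8; case: (boolP (r \in zeros 8 2)) => [|h]; last by left.
  move=> hr; right; right; exists 14%N => n n14 hn.
  have [|] : (n %% 4 = 0)%N \/ (n %% 4 = 2)%N by move: hr; rewrite !inE => /or4P[] /eqP rE; subst r; lia.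
    move=> n4; have nE : n = (4 * (n %/ 4))%N by lia.
    have n8 : (n + 8 = 4 * (n %/ 4 + 2))%N by lia.
    by rewrite n8 {1}nE !(S _ _).1//; lia.
  move=> n4; have nE : n = (4 * (n %/ 4) + 2)%N by lia.
  have n8 : (n + 8 = 4 * (n %/ 4 + 2) + 2)%N by lia.
  by rewrite n8 {1}nE !(S _ _).2//; lia.
have g4 : (g %| 4)%N by move: g8 glt; move: g {hg} => [|[|[|[|[|[|[|[|g]]]]]]]].
have := @not_period 8 2 c t1 isT isT hc 4 1 isT isT isT; apply; last exact: evper_dvd g4 hg.
move=> j; left; have : ((1 + j * 4) %% 8 = 1)%N \/ ((1 + j * 4) %% 8 = 5)%N by lia.
by case=> ->.
Qed.

Lemma least_1 m c : ps c 1 m -> least_sign_period c 1.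
Proof.
move=> hc; split; last by move=> T' [].
apply/sign_periodE; split => //; exists 1%N => n n1.
have e (q : C) : 0 < nrm q < 1 -> eta_quot 1 m q = 1 * q ^+ 0.
  by move=> /andP[_ q1]; rewrite /eta_quot expr1 divff ?eul_neq0// expr1n mul1r.
have z k : (0 < k)%N -> c k = 0.
  by move=> k0; apply: intC_inj; rewrite (ps_unique hc (ps_monom 1 0) e k) gtn_eqF.
by rewrite !z ?addn1.
Qed.

Theorem least_all t m c : (0 < t)%N -> (0 < m)%N -> (m * (t - 1) <= 24)%N -> ps c t m ->
  least_sign_period c (if (t, m) == (3, 9)%N then 9%N else if (t, m) == (4, 4)%N then 8%N
     else if (t, m) == (5, 5)%N then 25%N else t).
Proof.
move=> t0 m0 htm hc; case: eqP => [[? ?]|n39].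
  subst t m; apply: (@least_square 3 9 c) => //.
  apply: (@least_plain 3 3) => //; exact: (ps_section (isT : 0 < 3)%N hc (@section_3_9 R)).
case: eqP => [[? ?]|n44]; first by subst t m; exact: least_4_4.
case: eqP => [[? ?]|n55].
  subst t m; apply: (@least_square 5 5 c) => //.
  apply: (@least_plain 5 1) => //; exact: (ps_section (isT : 0 < 5)%N hc (@section_5_5 R)).
have [t1|t1] := leqP t 1.
  have t1' : t = 1%N by lia. by subst t; exact: least_1 hc.
have [/eqP[? ?]|n82] := boolP ((t, m) == (8, 2)%N); first by subst t m; exact: least_8_2.
apply: (least_plain t1 m0 htm hc); rewrite !inE (negPf n82) orbF.
by apply/negP => /or3P[] /eqP.
Qed.

End LeastPeriods.

End SignPeriodTheory.
Import SignPeriodTheory.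

Theorem theorem1p5 (R : realType) (t m : nat) (c : nat -> int)
    (ht : (0 < t)%N) (hm : (0 < m)%N) (htm : (m * (t - 1) <= 24)%N)
    (hc : is_coef R[i]%C t m c) :
  UPS c /\
  least_sign_period c
    (if (t, m) == (3, 9)%N then 9%N
     else if (t, m) == (4, 4)%N then 8%N
     else if (t, m) == (5, 5)%N then 25%N
     else t).
Proof.
have L := least_all ht hm htm (ps_of_coef ht hc).
by split; [eexists; exact: L.1|exact: L].
Qed.
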